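(* Let $W$ be a henselian valuation ring with fraction field $L$, residue field $k$, value group $\Gamma_W$, and valuation $v\colon L^\times\to\Gamma_W$. Let $\ell$ be a prime, let $\nu\ge1$, and put $N:=\ell^\nu$. Assume that $N$ is invertible in $W$. Fix $a\ge 0$ and $q\in\mathbf Z$. Choose a $\mathbf Z/N$-basis $B$ of $\Gamma_W/N\Gamma_W$, fix a total order on $B$, and choose classes $w_b\in H^1(L,\mu_N)$, $b\in B$, whose restrictions to the inertia group $I$ correspond to $b$ under the isomorphism $H^1(I,\mu_N)\simeq\Gamma_W/N\Gamma_W$. For a finite subset $J\subseteq B$, let $w_J$ be the cup product of the $w_b$, $b\in J$, taken in the induced order, and put $w_\varnothing:=1$. Then $$\Theta\colon\bigoplus_{\substack{J\subseteq B\\|J|\le a}}H^{a-|J|}(k,\mu_N^{\otimes(q-|J|)})\longrightarrow H^a(L,\mu_N^{\otimes q}),\qquad(\alpha_J)_J\longmapsto\sum_J\operatorname{inf}(\alpha_J)\cup w_J$$ is an isomorphism. For $0\le r\le a$, define $$F_r^{\mathrm{HS}}H^a(L,\mu_N^{\otimes q}):=\operatorname{im}\Bigl(H^aR\Gamma\bigl(G_k,\tau^{\le r}R\Gamma(I,\mu_N^{\otimes q})\bigr)\longrightarrow H^a(L,\mu_N^{\otimes q})\Bigr),$$ where the map is induced by $\tau^{\le r}R\Gamma(I,\mu_N^{\otimes q})\to R\Gamma(I,\mu_N^{\otimes q})$ followed by the transitivity equivalence $R\Gamma(G_k,R\Gamma(I,\mu_N^{\otimes q}))\simeq R\Gamma(G_L,\mu_N^{\otimes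 q})$. Put $F_{-1}^{\mathrm{HS}}H^a(L,\mu_N^{\otimes q})=0$ and $\operatorname{gr}_r^{\mathrm{HS}}H^a(L,\mu_N^{\otimes q}):=F_r^{\mathrm{HS}}H^a(L,\mu_N^{\otimes q})/F_{r-1}^{\mathrm{HS}}H^a(L,\mu_N^{\otimes q})$ for $0\le r\le a$. Then, for every $0\le r\le a$, $\Theta$ restricts to an isomorphism $$\bigoplus_{\substack{J\subseteq B\\|J|\le r}}H^{a-|J|}(k,\mu_N^{\otimes(q-|J|)})\xrightarrow{\ \sim\ }F_r^{\mathrm{HS}}H^a(L,\mu_N^{\otimes q}).$$ Consequently, the image of this restriction is independent of the basis $B$, its ordering, and the chosen classes $w_b$. Moreover, $$\operatorname{gr}_r^{\mathrm{HS}}H^a(L,\mu_N^{\otimes q})\simeq\Lambda^r_{\mathbf Z/N}(\Gamma_W/N\Gamma_W)\otimes_{\mathbf Z/N}H^{a-r}(k,\mu_N^{\otimes(q-r)})\qquad(0\le r\le a).$$ The image under $\Theta$ of the summand indexed by $J=\varnothing$ is $F_0^{\mathrm{HS}}H^a(L,\mu_N^{\otimes q})$, and on this summand $\Theta$ is inflation. In particular, the inflation map $H^a(k,\mu_N^{\otimes q})\to H^a(L,\mu_N^{\otimes q})$ is injective.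
   Context: For a field $F$, $G_F$ is its absolute Galois group and $H^a(F,M)=H^a_{\mathrm{cont}}(G_F,M)$ is continuous cohomology with coefficients in a discrete torsion $G_F$-module $M$; $R\Gamma(G,-)$ denotes derived invariants on discrete modules of a profinite group $G$. For $N$ invertible in $F$: $\mu_N^{\otimes 0}=\mathbf Z/N$, $\mu_N^{\otimes q}$ is the usual tensor power for $q>0$, and $\mu_N^{\otimes q}=(\operatorname{Hom}_{\mathbf Z/N}(\mu_N,\mathbf Z/N))^{\otimes(-q)}$ for $q<0$. A valuation ring may be a field and have arbitrary rank; it is henselian if it is henselian as a local ring. Let $W^{\mathrm{sh}}$ be a strict henselization of $W$, $L^{\mathrm{ur}}=\operatorname{Frac}(W^{\mathrm{sh}})$ inside a separable closure $L^{\mathrm{sep}}$, and $I=\operatorname{Gal}(L^{\mathrm{sep}}/L^{\mathrm{ur}})$ the inertia group; there is an exact sequence $1\to I\to G_L\to G_k\to 1$, and $\operatorname{inf}$ denotes inflation along $G_L\to G_k$. The ring $W^{\mathrm{sh}}$ is a henselian valuation ring with value group $\Gamma_W$, its unit group is $N$-divisible and $\mu_N\subset L^{\mathrm{ur}}$. Hence the valuation identifies $(L^{\mathrm{ur}})^\times/((L^{\mathrm{ur}})^\times)^N$ with $\Gamma_W/N\Gamma_W$, and Kummer theory over $L^{\mathrm{ur}}$ gives the isomorphism $H^1(I,\mu_N)\simeq\Gamma_W/N\Gamma_W$ used in the claim. The module $\Gamma_W/N\Gamma_W$ is free over $\mathbf Z/N$. The filtration $F^{\mathrm{HS}}_\bullet$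 is equivalently the weight-$q$ summand of the abutment filtration of the multiplicative Hochschild--Serre spectral sequence for $1\to I\to G_L\to G_k\to 1$ with coefficients in the graded algebra $\bigoplus_{n\in\mathbf Z}\mu_N^{\otimes n}$. *)

(* Defs.v *)
From HB Require Import structures.
From mathcomp Require Import all_boot all_order all_algebra separable finmap.
From mathcomp Require Import boolp classical_sets functions cardinality fsbigop.
From mathcomp.multinomials Require Import freeg.

Set Implicit Arguments.
Unset Strict Implicit.
Unset Printing Implicit Defensive.

Import Order.TTheory GRing.Theory.

Local Open Scope ring_scope.
Local Open Scope quotient_scope.

Section Submodule.
Context (R : pzRingType) (V : lmodType R) (S : submodClosed V).

Record subm : Type := Subm { subm_val :> V; _ : subm_val \in S }.

HB.instance Definition _ := [isSub for subm_val].
HB.instance Definition _ := [Choice of subm by <:].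
HB.instance Definition _ := [SubChoice_isSubLmodule of subm by <:].

End Submodule.

Section QuotientModule.
Context (R : pzRingType) (V : lmodType R) (S : submodClosed V).

Definition zpred : {pred V} := [pred x | x \in S].

Fact zpred_closed : zmod_closed zpred.
Proof. exact: GRing.submod_closedB (submodClosedP S). Qed.
HB.instance Definition _ := GRing.isZmodClosed.Build V zpred zpred_closed.

Definition quotm : Type := Quotient.quot zpred.

HB.instance Definition _ := GRing.Zmodule.on quotm.

Definition qpi (x : V) : quotm := \pi_(Quotient.quot zpred) x.
Definition qrepr (u : quotm) : V := repr (u : Quotient.quot zpred).

Lemma qreprK : cancel qrepr qpi. Proof. exact: reprK. Qed.

Lemma qpiD : {morph qpi : x y / x + y}.
Proof. by move=> x y; rewrite /qpi raddfD. Qed.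

Lemma qpi_eq x y : (qpi x == qpi y) = (x - y \in S).
Proof. by rewrite /qpi -Quotient.idealrBE. Qed.

Definition qscale (c : R) (u : quotm) : quotm := qpi (c *: qrepr u).

Lemma qscaleE c x : qscale c (qpi x) = qpi (c *: x).
Proof.
apply/eqP; rewrite qpi_eq -scalerBr rpredZ // -qpi_eq.
by rewrite qreprK.
Qed.

Fact qscaleA a b u : qscale a (qscale b u) = qscale (a * b) u.
Proof. by rewrite -[u]qreprK !qscaleE scalerA. Qed.
Fact qscale1 : left_id 1 qscale.
Proof. by move=> u; rewrite -[u]qreprK qscaleE scale1r. Qed.
Fact qscaleDr : right_distributive qscale +%R.
Proof.
by move=> c u v; rewrite -[u]qreprK -[v]qreprK -qpiD !qscaleE scalerDr qpiD.
Qed.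
Fact qscaleDl u : {morph qscale^~ u : a b / a + b}.
Proof. by move=> a b; rewrite -[u]qreprK !qscaleE scalerDl qpiD. Qed.

HB.instance Definition _ := GRing.Zmodule_isLmodule.Build R quotm
  qscaleA qscale1 qscaleDr qscaleDl.

Fact qpi_linear : linear qpi.
Proof. by move=> c x y; rewrite qpiD -qscaleE. Qed.
HB.instance Definition _ := GRing.isLinear.Build R V quotm *:%R qpi qpi_linear.

End QuotientModule.

Arguments qpi {R V S}.
Arguments qrepr {R V S}.

Section Subquotient.
Context (R : pzRingType) (V : lmodType R) (A B : submodClosed V).

Definition subq_rel : {pred subm A} := [pred x | val x \in B].

Fact subq_rel_closed : subsemimod_closed subq_rel.
Proof.
apply: GRing.submod_closed_semi; split=> [|c x y]; first exact: rpred0.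
move=> Bx By; rewrite -[_ \in _]/(val (c *: x + y) \in B) linearP /=.
by apply: rpredD; [apply: rpredZ; exact: Bx|exact: By].
Qed.
HB.instance Definition _ :=
  GRing.isSubmodClosed.Build R (subm A) subq_rel subq_rel_closed.

(* [A / (A :&: B)], i.e. [A / B] when [B] is contained in [A]. *)
Definition subquot : lmodType R := quotm subq_rel.

(* The class of an element of [A]; junk value [0] outside [A]. *)
Definition scls (x : V) : subquot := qpi (insubd 0 x : subm A).
Definition srep (u : subquot) : V := val (qrepr u : subm A).

End Subquotient.

Section Span.
Context (R : pzRingType) (V : lmodType R) (P : set V).

Definition mspan : {pred V} := [pred x | `[< forall S : submodClosed V,
  (forall y, P y -> y \in S) -> x \in S >]].

Fact mspan_closed : subsemimod_closed mspan.
Proof.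
apply: GRing.submod_closed_semi; split=> [|c x y].
  by apply: asboolT => S _; exact: rpred0.
move=> /asboolW hx /asboolW hy; apply: asboolT => S PS.
by apply: rpredD; [apply/rpredZ/hx|apply: hy].
Qed.
HB.instance Definition _ := GRing.isSubmodClosed.Build R V mspan mspan_closed.

End Span.

Section DirectSum.
Context (R : pzRingType) (I : choiceType) (V : I -> lmodType R).

Definition dprod : Type := forall i, V i.

HB.instance Definition _ := Choice.on dprod.

Implicit Types f g h : dprod.

Fact dprod_addA : associative (fun f g => (fun i => f i + g i) : dprod).
Proof. by move=> f g h; apply: functional_extensionality_dep => i; rewrite addrA. Qed.
Fact dprod_addC : commutative (fun f g => (fun i => f i + g i) : dprod).
Proof. by move=> f g; apply: functional_extensionality_dep => i; rewrite addrC. Qed.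
Fact dprod_add0 :
  left_id ((fun i => 0) : dprod) (fun f g => (fun i => f i + g i) : dprod).
Proof. by move=> f; apply: functional_extensionality_dep => i; rewrite add0r. Qed.
Fact dprod_addN : left_inverse ((fun i => 0) : dprod)
  (fun f => (fun i => - f i) : dprod) (fun f g => (fun i => f i + g i) : dprod).
Proof. by move=> f; apply: functional_extensionality_dep => i; rewrite addNr. Qed.

HB.instance Definition _ :=
  GRing.isZmodule.Build dprod dprod_addA dprod_addC dprod_add0 dprod_addN.

Let scale (c : R) f : dprod := fun i => c *: f i.
Fact dprod_scaleA a b f : scale a (scale b f) = scale (a * b) f.
Proof. by apply: functional_extensionality_dep => i; rewrite /scale scalerA. Qed.
Fact dprod_scale1 : left_id 1 scale.
Proof. by move=> f; apply: functional_extensionality_dep => i; rewrite /scale scale1r. Qed.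
Fact dprod_scaleDr : right_distributive scale +%R.
Proof. by move=> c f g; apply: functional_extensionality_dep => i; rewrite /scale scalerDr. Qed.
Fact dprod_scaleDl f : {morph scale^~ f : a b / a + b}.
Proof. by move=> a b; apply: functional_extensionality_dep => i; rewrite /scale scalerDl. Qed.

HB.instance Definition _ := GRing.Zmodule_isLmodule.Build R dprod
  dprod_scaleA dprod_scale1 dprod_scaleDr dprod_scaleDl.

Definition finsupp_pred : {pred dprod} :=
  [pred f : dprod | `[< finite_set [set i | f i != 0] >]].

Fact finsupp_closed : subsemimod_closed finsupp_pred.
Proof.
apply: GRing.submod_closed_semi; split=> [|c f g].
  apply: asboolT; apply: (sub_finite_set _ (finite_set0 _)) => i /=.
  by rewrite eqxx.
move=> /asboolW hf /asboolW hg; apply: asboolT.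
have hfg := conj hf hg; rewrite -finite_setU in hfg.
apply: sub_finite_set hfg => i /= fg0.
apply: contrapT => /not_orP[/negP/negPn/eqP f0 /negP/negPn/eqP g0].
have E : (c *: f + g) i = c *: f i + g i by [].
by case/negP: fg0; rewrite E f0 g0 scaler0 addr0.
Qed.
HB.instance Definition _ :=
  GRing.isSubmodClosed.Build R dprod finsupp_pred finsupp_closed.

Definition dsum : lmodType R := subm finsupp_pred.
Definition dcoord (f : dsum) (i : I) : V i := (val f : dprod) i.

End DirectSum.

Section Tensor.
Context (R : comNzRingType) (M M' : lmodType R).

Definition tensor_rel : set {freeg (M * M')%type / R} :=
  [set D | (exists c x y z, D = << (c *: x + y, z) >> - c *: << (x, z) >> - << (y, z) >>)
        \/ (exists c x y z, D = << (z, c *: x + y) >> - c *: << (z, x) >> - << (z, y) >>)].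

Definition tensor : lmodType R := quotm (mspan tensor_rel).

Definition tens (x : M) (y : M') : tensor := qpi << (x, y) >>.

(* The linear map induced by [f] when [f] is bilinear. *)
Definition tens_lift (P : lmodType R) (f : M -> M' -> P) (t : tensor) : P :=
  fglift (fun u => f u.1 u.2) (qrepr t).

End Tensor.

Section TensorTheory.
Context (R : comNzRingType).

Lemma fglift_linear (K : choiceType) (P : lmodType R) (f : K -> P) :
  linear (fglift f).
Proof.
have fgD (x y : {freeg K / R}) : fglift f (x - y) = fglift f x - fglift f y.
  exact: lift_is_additive.
pose fa := GRing.isZmodMorphism.Build _ _ _ fgD.
pose F : {additive {freeg K / R} -> P} := HB.pack (fglift f) fa.
move=> c x y; rewrite -[fglift f (_ + _)]/(F (c *: x + y)) raddfD /=; congr (_ + _).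
rewrite -[c *: x]/(fgscale c x) /fgscale -[fglift f _]/(F _) raddf_sum /=.
rewrite -[in RHS](freeg_sumE x) -[fglift f (\sum_(z <- _) _)]/(F _) raddf_sum scaler_sumr.
by apply: eq_bigr => k _; rewrite /= !liftU scalerA.
Qed.

Context (M M' P : lmodType R).

Lemma tens_liftE (f : M -> M' -> P) :
  (forall x, linear (f x)) -> (forall y, linear (f^~ y)) ->
  forall D, tens_lift f (qpi D) = fglift (fun u => f u.1 u.2) D.
Proof.
move=> fr fl D; set F := fglift _.
have Flin : linear F by exact: fglift_linear.
pose fL := GRing.isLinear.Build _ _ _ _ _ Flin.
pose FL : {linear {freeg (M * M')%type / R} -> P} := HB.pack F fL.
pose K : {pred {freeg (M * M')%type / R}} := [pred D | FL D == 0].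
have Kc : subsemimod_closed K.
  apply: GRing.submod_closed_semi; split=> [|c x y]; rewrite /= ?inE ?linear0 //.
  by move=> /eqP x0 /eqP y0; rewrite linearP x0 y0 scaler0 addr0.
pose Km := GRing.isSubmodClosed.Build _ _ _ Kc.
pose KS : submodClosed {freeg (M * M')%type / R} := HB.pack K Km.
have Fv u : FL << u >> = f u.1 u.2 by rewrite /= /F liftU scale1r.
have /eqP := qreprK (qpi D : tensor M M'); rewrite qpi_eq inE.
move=> /(_ KS) KD; apply/eqP; rewrite -subr_eq0.
have -> : tens_lift f (qpi D) - F D = FL (qrepr (qpi D : tensor M M') - D).
  by rewrite linearB.
apply: KD => y; case=> [] [c [x1 [x2 [z ->]]]];
  rewrite -[_ \in _]/(FL _ == 0) !linearB linearZ !Fv /=.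
  by rewrite fl addrAC addrK subrr.
by rewrite fr addrAC addrK subrr.
Qed.

Lemma tens_liftM (f : M -> M' -> P) :
  (forall x, linear (f x)) -> (forall y, linear (f^~ y)) ->
  forall x y, tens_lift f (tens x y) = f x y.
Proof. by move=> fr fl x y; rewrite tens_liftE // liftU scale1r. Qed.

Lemma tens_lift_linear (f : M -> M' -> P) :
  (forall x, linear (f x)) -> (forall y, linear (f^~ y)) ->
  linear (tens_lift f).
Proof.
move=> fr fl c u v; rewrite -[u]qreprK -[v]qreprK -linearP !tens_liftE //.
exact: fglift_linear.
Qed.

Lemma tens_linearr (x : M) : linear (tens x : M' -> _).
Proof.
move=> c y z; apply/eqP; rewrite -linearP qpi_eq inE => S; apply.
by right; exists c, y, z, x; rewrite opprD addrA.
Qed.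

Lemma tens_linearl (y : M') : linear (fun x : M => tens x y).
Proof.
move=> c x z; apply/eqP; rewrite -linearP qpi_eq inE => S; apply.
by left; exists c, x, z, y; rewrite opprD addrA.
Qed.

End TensorTheory.

Section TensorMap.
Context (R : comNzRingType) (M M' P P' : lmodType R).

Definition tens_map (f : M -> P) (g : M' -> P') : tensor M M' -> tensor P P' :=
  tens_lift (fun x y => tens (f x) (g y)).

Lemma tens_map_linear f g : linear f -> linear g -> linear (tens_map f g).
Proof.
move=> fl gl; apply: tens_lift_linear => [x|y] c u v.
  by rewrite gl tens_linearr.
by rewrite fl tens_linearl.
Qed.

End TensorMap.

Section Dual.
Context (R : comNzRingType).

Definition dual_pred (M : lmodType R) : {pred M -> R^o} :=
  [pred f | `[< linear f >]].

Fact dual_closed M : subsemimod_closed (@dual_pred M).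
Proof.
apply: GRing.submod_closed_semi; split=> [|c f g].
  by apply: asboolT => c x y; rewrite scaler0 addr0.
move=> /asboolW hf /asboolW hg; apply: asboolT => d x y.
rewrite -[LHS]/(c *: f _ + g _) -[X in _ = _ *: X + _]/(c *: f _ + g _).
rewrite -[X in _ = _ + X]/(c *: f _ + g _) hf hg !scalerDr !scalerA mulrC.
by rewrite -!addrA; congr (_ + _); rewrite addrCA.
Qed.
HB.instance Definition _ (M : lmodType R) :=
  GRing.isSubmodClosed.Build R (M -> R^o) (@dual_pred M) (@dual_closed M).

Definition dual (M : lmodType R) : lmodType R := subm (@dual_pred M).
Definition dual_app M (phi : dual M) : M -> R^o := val phi.

(* The transpose of [g]; junk value [0] if [g] is not linear. *)
Definition dual_map (M M' : lmodType R) (g : M' -> M) (phi : dual M) : dual M' :=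
  insubd (0 : dual M') (dual_app phi \o g).

Lemma dual_map_linear (M M' : lmodType R) (g : M' -> M) : linear g -> linear (dual_map g).
Proof.
have dlin (N : lmodType R) (phi : dual N) : linear (dual_app phi).
  by have := valP phi; rewrite inE.
move=> gl.
have E (phi : dual M) : dual_app (dual_map g phi) = dual_app phi \o g.
  rewrite /dual_app /dual_map insubdK // inE => c x y /=.
  by rewrite gl dlin.
move=> c f h; apply: val_inj.
rewrite -[LHS]/(dual_app (dual_map g (c *: f + h))).
rewrite -[RHS]/(c *: dual_app (dual_map g f) + dual_app (dual_map g h)).
by rewrite !E.
Qed.

End Dual.

Section ExteriorPower.
Context (R : comNzRingType) (r : nat) (M : lmodType R).

Definition ffset (x : {ffun 'I_r -> M}) (i : 'I_r) (y : M) : {ffun 'I_r -> M} :=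
  [ffun j => if j == i then y else x j].

Definition extpow_rel : set {freeg {ffun 'I_r -> M} / R} :=
  [set D | (exists x i c y z, D = << ffset x i (c *: y + z) >>
                               - c *: << ffset x i y >> - << ffset x i z >>)
        \/ (exists (x : {ffun 'I_r -> M}) (i j : 'I_r), [/\ i != j, x i = x j & D = << x >>])].

Definition extpow : lmodType R := quotm (mspan extpow_rel).

End ExteriorPower.

Section TensorPower.
Context (R : comNzRingType).

Fixpoint tpow (n : nat) (M : lmodType R) : lmodType R :=
  if n is m.+1 then tensor (tpow m M) M else R^o.

Fixpoint tpow_map n (M M' : lmodType R) (f : M -> M') : tpow n M -> tpow n M' :=
  match n with
  | 0 => id
  | m.+1 => tens_map (@tpow_map m M M' f) f
  end.

Definition twist (q : int) (M : lmodType R) : lmodType R :=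
  match q with
  | Posz n => tpow n M
  | Negz n => tpow n.+1 (dual M)
  end.

(* Transport along [f], [g] being the inverse of [f]. *)
Definition twist_map q (M M' : lmodType R) (f : M -> M') (g : M' -> M) :
    twist q M -> twist q M' :=
  match q with
  | Posz n => @tpow_map n M M' f
  | Negz n => @tpow_map n.+1 (dual M) (dual M') (dual_map g)
  end.

Lemma tpow_map_linear n (M M' : lmodType R) (f : M -> M') : linear f -> linear (@tpow_map n M M' f).
Proof. by move=> fl; elim: n => [//|n IH]; apply: tens_map_linear. Qed.

Lemma twist_map_linear q (M M' : lmodType R) (f : M -> M') g :
  linear f -> linear g -> linear (@twist_map q M M' f g).
Proof.
move=> fl gl; case: q => n; first exact: tpow_map_linear.
exact/tpow_map_linear/dual_map_linear.
Qed.

Definition succz (q : int) : int :=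
  match q with Posz n => Posz n.+1 | Negz 0 => Posz 0 | Negz n.+1 => Negz n end.

Lemma succzE q : succz q = q + 1.
Proof.
case: q => [n|[|n]] //=; first by rewrite intS addrC.
by rewrite !NegzE [n.+2%:Z]intS opprD addrAC addNr add0r.
Qed.

Lemma iter_succz q n : iter n succz (q - n%:Z) = q.
Proof.
have E m p : iter m succz p = p + m%:Z.
  by elim: m => [|m IH] /=; rewrite ?addr0 // succzE IH intS [1 + _]addrC addrA.
by rewrite E subrK.
Qed.

Definition contract n (M : lmodType R) : tpow n.+1 (dual M) -> M -> tpow n (dual M) :=
  fun t x => tens_lift (fun s phi => dual_app phi x *: s) t.

Definition twist_succ q (M : lmodType R) : twist q M -> M -> twist (succz q) M :=
  match q with
  | Posz n => fun t x => tens t x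
  | Negz 0 => @contract 0 M
  | Negz n.+1 => @contract n.+1 M
  end.

(* The product of the graded algebra [\bigoplus_q M^{(x) q}]. *)
Fixpoint twist_mul q n (M : lmodType R) :
    twist q M -> tpow n M -> twist (iter n succz q) M :=
  match n with
  | 0 => fun t (c : R) => c *: t
  | m.+1 => fun t s => tens_lift (fun u x => twist_succ (twist_mul t u) x) s
  end.

Definition twist_pair q n (M : lmodType R) (t : twist (q - n%:Z) M) (s : tpow n M) :
    twist q M :=
  eq_rect _ (fun p => twist p M) (twist_mul t s) _ (iter_succz q n).

End TensorPower.

(* ['Z_N] is [Z/N] only when [1 < N], and then [#|'Z_N| = N]. Using [#|'Z_N|] in
   place of [N] below gives ['Z_N]-modules without a hypothesis on [N]. *)
Section TorsionModule.
Context (N : nat) (A : zmodType) (AN : forall x : A, x *+ #|'Z_N| = 0).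

Definition zscale (c : 'Z_N) (x : A) : A := x *+ c.

Lemma mulrn_mod (x : A) m : x *+ (m %% (Zp_trunc N).+2) = x *+ m.
Proof.
have := AN; rewrite card_ord => AN'.
by rewrite [in RHS](divn_eq m (Zp_trunc N).+2) mulrnDr mulrnA AN' add0r.
Qed.

Fact zscaleA a b x : zscale a (zscale b x) = zscale (a * b) x.
Proof. by rewrite /zscale /= mulrn_mod mulnC mulrnA. Qed.
Fact zscale1 : left_id 1 zscale.
Proof. by move=> x; rewrite /zscale /= mulrn_mod mulr1n. Qed.
Fact zscaleDr : right_distributive zscale +%R.
Proof. by move=> c x y; rewrite /zscale mulrnDl. Qed.
Fact zscaleDl x : {morph zscale^~ x : a b / a + b}.
Proof. by move=> a b; rewrite /zscale /= mulrn_mod mulrnDr. Qed.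

End TorsionModule.

Section ModN.
Context (N : nat) (A : zmodType).

Definition Nmultiple : {pred A} := [pred x | `[< exists y, x = y *+ #|'Z_N| >]].

Fact Nmultiple_closed : zmod_closed Nmultiple.
Proof.
split; first by apply: asboolT; exists 0; rewrite mul0rn.
move=> x y; rewrite !inE => -[u ->] [v ->].
by exists (u - v); rewrite mulrnBl.
Qed.
HB.instance Definition _ := GRing.isZmodClosed.Build A Nmultiple Nmultiple_closed.

Definition modN : Type := Quotient.quot Nmultiple.
HB.instance Definition _ := GRing.Zmodule.on modN.

Definition modN_pi (x : A) : modN := \pi_(Quotient.quot Nmultiple) x.

Fact modN_torsion (u : modN) : u *+ #|'Z_N| = 0.
Proof.
rewrite -[u](@reprK _ (Quotient.quot Nmultiple)) -raddfMn -[RHS](raddf0 \pi).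
apply/eqP; rewrite -Quotient.idealrBE subr0; apply: asboolT.
by exists (repr (u : Quotient.quot Nmultiple)).
Qed.

HB.instance Definition _ := GRing.Zmodule_isLmodule.Build 'Z_N modN
  (zscaleA modN_torsion) (zscale1 modN_torsion)
  (@zscaleDr N modN) (zscaleDl modN_torsion).

End ModN.

Section RootsOfUnity.
Context (N : nat) (E : fieldType).

(* [mu_N(E)], written additively. *)
Record mu : Type := Mu { mu_val :> E; _ : mu_val ^+ #|'Z_N| == 1 }.

HB.instance Definition _ := [isSub for mu_val].
HB.instance Definition _ := [Choice of mu by <:].

Lemma muP (x : mu) : val x ^+ #|'Z_N| = 1. Proof. exact/eqP/(valP x). Qed.

Lemma mu_neq0 (x : mu) : val x != 0.
Proof.
apply/eqP => x0; have := muP x; rewrite x0 card_ord expr0n /=.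
by move/eqP; rewrite eq_sym oner_eq0.
Qed.

Fact mu_one_subproof : (1 : E) ^+ #|'Z_N| == 1. Proof. by rewrite expr1n. Qed.
Fact mu_mul_subproof (x y : mu) : (val x * val y) ^+ #|'Z_N| == 1.
Proof. by rewrite exprMn !muP mulr1. Qed.
Fact mu_inv_subproof (x : mu) : (val x)^-1 ^+ #|'Z_N| == 1.
Proof. by rewrite exprVn muP invr1. Qed.

Definition mu_one := Mu mu_one_subproof.
Definition mu_mul x y := Mu (mu_mul_subproof x y).
Definition mu_inv x := Mu (mu_inv_subproof x).

Fact mu_mulA : associative mu_mul.
Proof. by move=> x y z; apply: val_inj; rewrite /= mulrA. Qed.
Fact mu_mulC : commutative mu_mul.
Proof. by move=> x y; apply: val_inj; rewrite /= mulrC. Qed.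
Fact mu_mul1 : left_id mu_one mu_mul.
Proof. by move=> x; apply: val_inj; rewrite /= mul1r. Qed.
Fact mu_mulV : left_inverse mu_one mu_inv mu_mul.
Proof. by move=> x; apply: val_inj; rewrite /= mulVf // mu_neq0. Qed.

HB.instance Definition _ :=
  GRing.isZmodule.Build mu mu_mulA mu_mulC mu_mul1 mu_mulV.

Lemma mu_valMn (x : mu) n : val (x *+ n) = val x ^+ n.
Proof. by elim: n => [//|n IH]; rewrite mulrS exprS -IH. Qed.

Fact mu_torsion (x : mu) : x *+ #|'Z_N| = 0.
Proof. by apply: val_inj; rewrite mu_valMn muP. Qed.

HB.instance Definition _ := GRing.Zmodule_isLmodule.Build 'Z_N mu
  (zscaleA mu_torsion) (zscale1 mu_torsion)
  (@zscaleDr N mu) (zscaleDl mu_torsion).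

End RootsOfUnity.

Section Galois.
Context (F E : fieldType) (i : {rmorphism F -> E}).

(* The group [Aut(E / F)], used for [E] a separable closure of [F]. *)
Record gal : Type := Gal {
  gal_fun :> {rmorphism E -> E};
  gal_inv : {rmorphism E -> E};
  gal_funK : cancel gal_fun gal_inv;
  gal_invK : cancel gal_inv gal_fun;
  gal_fix : forall x, gal_fun (i x) = i x
}.

HB.instance Definition _ := gen_eqMixin gal.
HB.instance Definition _ := gen_choiceMixin gal.

Definition gal1 : gal := @Gal idfun idfun (fun=> erefl) (fun=> erefl) (fun=> erefl).

Fact galM_fix (s t : gal) x : (s \o t) (i x) = i x.
Proof. by rewrite /= !gal_fix. Qed.

Definition galM (s t : gal) : gal :=
  @Gal (gal_fun s \o gal_fun t) (gal_inv t \o gal_inv s)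
    (can_comp (gal_funK s) (gal_funK t))
    (can_comp (gal_invK t) (gal_invK s)) (galM_fix s t).

Fact galV_fix (s : gal) x : gal_inv s (i x) = i x.
Proof. by rewrite -[in LHS](gal_fix s) gal_funK. Qed.

Definition galV (s : gal) : gal :=
  Gal (gal_invK s) (gal_funK s) (galV_fix s).

End Galois.

(* A ['Z_N]-module with a linear action; only used for [mu_N] and its twists. *)
Record galmod (R : pzRingType) (F E : fieldType) (i : {rmorphism F -> E}) := Galmod {
  gm_sort :> lmodType R;
  gm_act : gal i -> gm_sort -> gm_sort;
  gm_act_linear : forall s, linear (gm_act s)
}.

Section MuModule.
Context (N : nat) (F E : fieldType) (i : {rmorphism F -> E}).

Fact mu_act_subproof (s : gal i) (x : mu N E) : (s (val x)) ^+ #|'Z_N| == 1.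
Proof. by rewrite -rmorphXn muP rmorph1. Qed.
Definition mu_act s x : mu N E := Mu (mu_act_subproof s x).

Fact mu_act_linear s : linear (mu_act s).
Proof.
move=> c x y; apply: val_inj; rewrite /= rmorphM; congr (_ * _).
rewrite -[val (c *: x)]/(val (x *+ c)) -[val (c *: mu_act s x)]/(val (mu_act s x *+ c)).
by rewrite !mu_valMn rmorphXn.
Qed.

Definition mumod : galmod 'Z_N i := Galmod mu_act_linear.

Definition tate (q : int) : galmod 'Z_N i :=
  @Galmod _ _ _ i (twist q mumod)
    (fun s => @twist_map _ q mumod mumod (mu_act s) (mu_act (galV s)))
    (fun s => twist_map_linear (mu_act_linear s) (mu_act_linear (galV s))).

End MuModule.

Section Cochains.
Context (R : pzRingType).

Definition cobd (G : Type) (V : lmodType R) n (f : ('I_n.+1 -> G) -> V) :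
    ('I_n.+2 -> G) -> V :=
  fun g => \sum_(j < n.+2) (-1) ^+ j *: f (fun l => g (fintype.lift j l)).

Lemma cobd_linear G V n : linear (@cobd G V n).
Proof.
move=> c f h; apply: funext => g.
rewrite -[RHS]/(c *: (cobd f g) + cobd h g) /cobd scaler_sumr -big_split.
apply: eq_bigr => j _; rewrite /= -[X in _ *: X]/(c *: f _ + h _).
rewrite scalerDr !scalerA; congr (_ *: _ + _).
exact/esym/commr_sign.
Qed.

Context (F E : fieldType) (i : {rmorphism F -> E}).

(* Continuity of a function of [n+1] variables on the Galois group with its
   Krull topology, i.e. the topology of pointwise convergence on the discrete
   set [E], to a discrete set. *)
Definition loc_const (T : Type) n (f : ('I_n.+1 -> gal i) -> T) : Prop :=
  forall g : 'I_n.+1 -> gal i, exists s : seq E, forall g' : 'I_n.+1 -> gal i,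
    (forall l, {in s, g' l =1 g l}) -> f g' = f g.

Context (M : galmod R i).

Definition cochain n : lmodType R := ('I_n.+1 -> gal i) -> M.

Definition equivariant n (f : cochain n) : Prop :=
  forall s g, f (fun l => galM s (g l)) = gm_act s (f g).

Definition ccochain n : {pred cochain n} :=
  [pred f | `[< loc_const f /\ equivariant f >]].
Arguments ccochain n : clear implicits.

Definition cocycle n : {pred cochain n} :=
  [pred f | `[< f \in ccochain n /\ cobd f = 0 >]].
Arguments cocycle n : clear implicits.

Definition coboundary n : {pred cochain n} :=
  match n with
  | 0 => [pred f | `[< f = 0 >]]
  | m.+1 => [pred f | `[< exists2 h, h \in ccochain m & f = cobd h >]]
  end.
Arguments coboundary n : clear implicits.

Lemma loc_const_linear (V : lmodType R) n c (f h : ('I_n.+1 -> gal i) -> V) :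
  loc_const f -> loc_const h -> loc_const (c *: f + h).
Proof.
move=> fc hc g; have [s fs] := fc g; have [t ht] := hc g; exists (s ++ t) => g' gg'.
rewrite -[LHS]/(c *: f g' + h g') -[RHS]/(c *: f g + h g) fs ?ht //.
  by move=> l x xt; apply: gg'; rewrite mem_cat xt orbT.
by move=> l x xs; apply: gg'; rewrite mem_cat xs.
Qed.

Fact ccochain_closed n : subsemimod_closed (ccochain n).
Proof.
apply: GRing.submod_closed_semi; split=> [|c f h].
  apply: asboolT; split=> [g|s g]; first by exists [::].
  rewrite -[0 _]/(0 : M); have := gm_act_linear s (-1) 0 (0 : M).
  by rewrite scaler0 addr0 scaleN1r addNr.
rewrite !inE => -[fc fe] [hc he]; split; first exact: loc_const_linear.
move=> s g; rewrite -[LHS]/(c *: f _ + h _) -[in RHS]/(c *: f g + h g).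
by rewrite gm_act_linear fe he.
Qed.
HB.instance Definition _ n :=
  GRing.isSubmodClosed.Build R (cochain n) (ccochain n) (ccochain_closed n).

Fact cocycle_closed n : subsemimod_closed (cocycle n).
Proof.
apply: GRing.submod_closed_semi; split=> [|c f h].
  apply: asboolT; split; first exact: rpred0.
  by have := cobd_linear (-1) 0 (0 : cochain n); rewrite scaler0 addr0 scaleN1r addNr.
move=> /asboolW[fc fz] /asboolW[hc hz]; apply: asboolT.
split; first by rewrite rpredD ?rpredZ.
by rewrite cobd_linear fz hz scaler0 addr0.
Qed.
HB.instance Definition _ n :=
  GRing.isSubmodClosed.Build R (cochain n) (cocycle n) (cocycle_closed n).

Fact coboundary_closed n : subsemimod_closed (coboundary n).
Proof.
apply: GRing.submod_closed_semi; split=> [|c f h].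
  case: n => [|n]; apply: asboolT => //; exists 0; first exact: rpred0.
  by have := cobd_linear (-1) 0 (0 : cochain n); rewrite scaler0 addr0 scaleN1r addNr.
case: n f h => [|n] f h.
  by move=> /asboolW -> /asboolW ->; apply: asboolT; rewrite scaler0 addr0.
move=> /asboolW[f' f'c ->] /asboolW[h' h'c ->]; apply: asboolT; exists (c *: f' + h'); last by rewrite cobd_linear.
by rewrite rpredD ?rpredZ.
Qed.
HB.instance Definition _ n :=
  GRing.isSubmodClosed.Build R (cochain n) (coboundary n) (coboundary_closed n).

Definition cohom n : lmodType R := subquot (cocycle n) (coboundary n).

Definition ccls n (f : cochain n) : cohom n := scls (cocycle n) (coboundary n) f.
Definition crep n (c : cohom n) : cochain n := srep c.

Lemma ccls_linear n c (f h : cochain n) : f \in cocycle n -> h \in cocycle n ->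
  ccls (c *: f + h) = c *: ccls f + ccls h.
Proof.
move=> fz hz; rewrite /ccls /scls -linearP; congr qpi; apply: val_inj.
have sz : c *: f + h \in cocycle n by rewrite rpredD ?rpredZ.
rewrite insubdK // -[RHS]/(c *: val (insubd 0 f : subm (cocycle n)) +
  val (insubd 0 h : subm (cocycle n))).
by rewrite !insubdK.
Qed.

End Cochains.

Arguments ccochain {R F E i} M n.
Arguments cocycle {R F E i} M n.
Arguments coboundary {R F E i} M n.
Arguments ccls {R F E i M n}.
Arguments crep {R F E i M n}.

(* Cup product with respect to a pairing [m]; meaningful for [n = (p + q)%N]. *)
Definition cup (R : pzRingType) (F E : fieldType) (i : {rmorphism F -> E})
    (M1 M2 M3 : galmod R i) (m : M1 -> M2 -> M3) p q n
    (c1 : cohom M1 p) (c2 : cohom M2 q) : cohom M3 n :=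
  ccls (fun g : 'I_n.+1 -> gal i =>
    m (crep c1 (fun l => g (inord l))) (crep c2 (fun l => g (inord (p + l))))).

(* Functoriality for a group homomorphism [phi] and a compatible map [u]. *)
Definition pullback (R : pzRingType) (F E F' E' : fieldType)
    (i : {rmorphism F -> E}) (i' : {rmorphism F' -> E'})
    (phi : gal i' -> gal i) (M : galmod R i) (M' : galmod R i') (u : M -> M') n
    (c : cohom M n) : cohom M' n :=
  ccls (fun g => u (crep c (fun l => phi (g l)))).

(* [A] is local with residue field [K]. *)
Definition residue_map (A : comUnitRingType) (K : fieldType)
    (r : {rmorphism A -> K}) : Prop :=
  (forall y, exists x, r x = y) /\ (forall x, (r x != 0) = (x \is a GRing.unit)).

Definition henselian (A : comUnitRingType) (K : fieldType)
    (r : {rmorphism A -> K}) : Prop :=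
  forall (f : {poly A}) (x0 : K), f \is monic ->
    root (map_poly r f) x0 -> ~~ root (map_poly r f)^`() x0 ->
    exists2 x, root f x & r x = x0.

Definition separably_closed (K : fieldType) : Prop :=
  forall p : {poly K}, separable_poly p -> (1 < size p)%N -> exists x, root p x.

Definition separable_closure (F E : fieldType) (i : {rmorphism F -> E}) : Prop :=
  (forall x, exists2 p : {poly F}, separable_poly p & root (map_poly i p) x)
  /\ separably_closed E.

(* The strict henselization of the local ring [(A, K)] with respect to a
   separable closure [kap : K -> Ks], by its universal property among strictly
   henselian local [A]-algebras. *)
Definition strict_henselization (A As : comUnitRingType) (K Ks : fieldType)
    (r : {rmorphism A -> K}) (kap : {rmorphism K -> Ks})
    (rs : {rmorphism As -> Ks}) (i : {rmorphism A -> As}) : Prop :=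
  [/\ separable_closure kap,
      residue_map rs,
      henselian rs,
      (forall x, rs (i x) = kap (r x))
    & forall (H : comUnitRingType) (KH : fieldType) (rH : {rmorphism H -> KH})
        (u : {rmorphism A -> H}) (h : {rmorphism Ks -> KH}),
        residue_map rH -> henselian rH -> separably_closed KH ->
        (forall x, h (kap (r x)) = rH (u x)) ->
      let P (f : {rmorphism As -> H}) :=
        (forall x, f (i x) = u x) /\ (forall y, rH (f y) = h (rs y)) in
      exists2 f, P f & forall f', P f' -> f' =1 f].

Definition total_group_order (G : zmodType) (le : G -> G -> Prop) : Prop :=
  [/\ forall x, le x x,
      forall x y, le x y -> le y x -> x = y,
      forall x y z, le x y -> le y z -> le x z,
      forall x y, le x y \/ le y x
    & forall x y z, le x y -> le (z + x) (z + y)].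

(* [v] is a valuation with value group [G]; only its values on [L^*] matter. *)
Definition valuation (L : fieldType) (G : zmodType) (le : G -> G -> Prop)
    (v : L -> G) : Prop :=
  [/\ forall x y, x != 0 -> y != 0 -> v (x * y) = v x + v y,
      forall x y, x != 0 -> y != 0 -> x + y != 0 ->
        le (v x) (v (x + y)) \/ le (v y) (v (x + y))
    & forall c, exists2 x, x != 0 & v x = c].

(* A henselian valuation ring [W] with fraction field [L], residue field [k]
   and value group [Gam]. *)
Record henselian_valuation_ring := HenselianValuationRing {
  hvW : idomainType;
  hvL : fieldType;
  hvk : fieldType;
  hvGam : zmodType;
  hv_incl : {rmorphism hvW -> hvL};
  hv_res : {rmorphism hvW -> hvk};
  hv_le : hvGam -> hvGam -> Prop;
  hv_val : hvL -> hvGam;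
  hv_incl_inj : injective hv_incl;
  hv_valuation_ring :
    forall x, (exists w, hv_incl w = x) \/ (exists w, hv_incl w = x^-1);
  hv_residue : residue_map hv_res;
  hv_henselian : henselian hv_res;
  hv_order : total_group_order hv_le;
  hv_valuation : valuation hv_le hv_val;
  hv_val_ge0 : forall x, x != 0 -> (hv_le 0 (hv_val x) <-> exists w, hv_incl w = x)
}.

(* The strict henselization [Wsh] of [W], with residue field a separable closure
   [ks] of [k], and its fraction field [Lur] inside a separable closure [Ls] of
   [L]. *)
Record strict_data (V : henselian_valuation_ring) := StrictData {
  sdW : idomainType;
  sdks : fieldType;
  sdLur : fieldType;
  sdLs : fieldType;
  sd_hens : {rmorphism hvW V -> sdW};
  sd_kap : {rmorphism hvk V -> sdks};
  sd_res : {rmorphism sdW -> sdks};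
  sd_incl : {rmorphism sdW -> sdLur};
  sd_ur : {rmorphism hvL V -> sdLur};
  sd_sep : {rmorphism sdLur -> sdLs};
  sd_strict : strict_henselization (hv_res V) sd_kap sd_res sd_hens;
  sd_incl_inj : injective sd_incl;
  sd_frac : forall z, exists a b, b != 0 /\ z = sd_incl a / sd_incl b;
  sd_comm : forall w, sd_ur (hv_incl V w) = sd_incl (sd_hens w);
  sd_closure : separable_closure (sd_sep \o sd_ur : {rmorphism hvL V -> sdLs})
}.

Section HochschildSerre.
Context (V : henselian_valuation_ring) (D : strict_data V) (N : nat).

Definition sd_base : {rmorphism hvL V -> sdLs D} := sd_sep D \o sd_ur D.

Local Notation GL := (gal sd_base).
Local Notation Gk := (gal (sd_kap D)).
Local Notation I := (gal (sd_sep D)).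

Definition inertia_incl (s : I) : GL :=
  @Gal _ _ sd_base (gal_fun s) (gal_inv s) (gal_funK s) (gal_invK s)
    (fun x => gal_fix s (sd_ur D x)).

(* The surjection [G_L -> G_k]: the automorphism of the residue field [ks] of
   [Wsh] induced by an automorphism of [Ls]. *)
Definition specialize (s : GL) : Gk :=
  xget (gal1 (sd_kap D)) [set t : Gk | forall x y : sdW D,
    s (sd_sep D (sd_incl D x)) = sd_sep D (sd_incl D y) ->
    t (sd_res D x) = sd_res D y].

(* The identification of [mu_N(ks)] with [mu_N(Ls)] through [mu_N(Wsh)], and
   its inverse. *)
Definition mu_reduces (x : mu N (sdLs D)) (y : mu N (sdks D)) : Prop :=
  exists2 u : sdW D, sd_sep D (sd_incl D u) = val x & sd_res D u = val y.

Definition mu_lift (y : mu N (sdks D)) : mu N (sdLs D) :=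
  xget 0 [set x | mu_reduces x y].
Definition mu_red (x : mu N (sdLs D)) : mu N (sdks D) :=
  xget 0 [set y | mu_reduces x y].

Definition HL q a : lmodType 'Z_N := cohom (tate N sd_base q) a.
Definition Hk q a : lmodType 'Z_N := cohom (tate N (sd_kap D) q) a.

Definition inflation q a : Hk q a -> HL q a :=
  @pullback _ _ _ _ _ (sd_kap D) sd_base specialize
    (tate N (sd_kap D) q) (tate N sd_base q)
    (@twist_map _ q _ _ mu_lift mu_red) a.

Definition restriction1 :
    cohom (mumod N sd_base) 1 -> cohom (mumod N (sd_sep D)) 1 :=
  @pullback _ _ _ _ _ sd_base (sd_sep D) inertia_incl
    (mumod N sd_base) (mumod N (sd_sep D)) id 1.

(* [c] is the Kummer class of [z] in [H^1(I, mu_N)], represented by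
   [s |-> s(y) / y], where [y ^ N = z]. *)
Definition kummer (z : sdLur D) (c : cohom (mumod N (sd_sep D)) 1) : Prop :=
  exists y : sdLs D, [/\ y != 0, y ^+ #|'Z_N| = sd_sep D z
    & exists2 f : cochain (mumod N (sd_sep D)) 1,
        forall g, val (f g : mu N (sdLs D)) = g (inord 1) y / g (inord 0) y
      & c = ccls f].

(* The valuation of [Wsh] on [Lur], whose value group is that of [W]: every
   element of [Lur^*] is the product of a unit of [Wsh] and of an element of
   [L^*]. *)
Definition val_ur (z : sdLur D) (c : hvGam V) : Prop :=
  exists u x, [/\ u \is a GRing.unit, x != 0,
    z = sd_incl D u * sd_ur D x & hv_val x = c].

(* The isomorphism [H^1(I, mu_N) = Gam / N Gam], as a relation. *)
Definition inertia_iso (c : cohom (mumod N (sd_sep D)) 1) (b : modN N (hvGam V)) :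
    Prop :=
  exists z d, [/\ kummer z c, val_ur z d & b = modN_pi N d].

Section Filtration.
Context (M : galmod 'Z_N sd_base).

(* Model of derived functors by homogeneous continuous cochains.
   The discrete [G_L]-modules [X^j] of all continuous maps [G_L^(j+1) -> M] are
   acyclic for invariants under [I] and resolve [M], so [RGamma(I, M)] is the
   complex of discrete [G_k]-modules [(X^j)^I]; an element of [G_k] acts on it
   through any lift to [G_L]. *)
Definition inert_cochain j (f : cochain M j) : Prop :=
  loc_const f /\
  forall (s : I) g, f (fun l => galM (inertia_incl s) (g l)) =
                    gm_act (inertia_incl s) (f g).

(* The truncation [tau^{<= r}]. *)
Definition trunc_cochain r j (f : cochain M j) : Prop :=
  inert_cochain f /\ [\/ (j < r)%N, j = r /\ cobd f = 0 | f = 0].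

Definition bicochain : Type :=
  forall p j, ('I_p.+1 -> Gk) -> cochain M j.

(* For a subcomplex [K] of [(X^j)^I], [RGamma(G_k, K)] is the total complex of
   the double complex of homogeneous continuous equivariant cochains of [G_k]
   with values in [K]; [tot K n] is its term of degree [n]. *)
Definition tot (K : forall j, cochain M j -> Prop) (n : int) (Phi : bicochain) :
    Prop :=
  [/\ forall p j t, (p + j)%:Z != n -> Phi p j t = 0,
      forall p j t, K j (Phi p j t),
      forall p j, loc_const (Phi p j)
    & forall p j (s : GL) t g,
        Phi p j (fun l => galM (specialize s) (t l)) (fun l => galM s (g l)) =
        gm_act s (Phi p j t g)].

Definition tot_d (Phi : bicochain) : bicochain := fun p j t =>
  match p return ('I_p.+1 -> Gk) -> cochain M j with
  | 0 => fun=> 0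
  | p'.+1 => cobd (Phi p' j)
  end t +
  match j return cochain M j with
  | 0 => 0
  | j'.+1 => (-1) ^+ p *: cobd (Phi p j' t)
  end.
Arguments tot_d Phi p j t : clear implicits.

(* The augmentation from the complex [(X^a)^{G_L}] of cochains of [G_L] to the
   total complex of [RGamma(G_k, RGamma(I, M))], a quasi-isomorphism which is
   the inverse of the transitivity equivalence. *)
Definition augment (a : nat) (z : cochain M a) : bicochain := fun p j _ g =>
  if (p == 0)%N && (j == a) then z (fun l => g (inord l)) else 0.
Arguments augment {a} z p j t g.

(* The classes whose image in [H^a RGamma(G_k, RGamma(I, M))] comes from
   [H^a RGamma(G_k, tau^{<= r} RGamma(I, M))]. *)
Definition FHS (a r : nat) : {pred cohom M a} := [pred c | `[<
  exists z (Phi : bicochain),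
  [/\ z \in cocycle M a, c = ccls z,
      tot (trunc_cochain r) a Phi, (forall p j t g, tot_d Phi p j t g = 0)
    & exists2 Psi : bicochain, tot inert_cochain (a%:Z - 1) Psi
      & forall p j t g,
          augment z p j t g = Phi p j t g + tot_d Psi p j t g] >]].
Arguments FHS a r : clear implicits.

Lemma inert_cochain_linear j c (f h : cochain M j) :
  inert_cochain f -> inert_cochain h -> inert_cochain (c *: f + h).
Proof.
move=> [fc fe] [hc he]; split=> [|s g]; first exact: loc_const_linear.
rewrite -[LHS]/(c *: f _ + h _) -[in RHS]/(c *: f g + h g).
by rewrite gm_act_linear fe he.
Qed.

Lemma trunc_cochain_linear r j c (f h : cochain M j) :
  trunc_cochain r f -> trunc_cochain r h -> trunc_cochain r (c *: f + h).
Proof.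
have d0 : cobd (0 : cochain M j) = 0.
  by have := cobd_linear (-1) 0 (0 : cochain M j); rewrite scaler0 addr0 scaleN1r addNr.
move=> [fi fr] [hi hr]; split; first exact: inert_cochain_linear.
case: fr => [jr|[jr fd]|f0]; first by constructor 1.
  case: hr => [jr'|[_ hd]|h0]; first by constructor 1.
    by constructor 2; split=> //; rewrite cobd_linear fd hd scaler0 addr0.
  by constructor 2; split=> //; rewrite cobd_linear fd h0 d0 scaler0 addr0.
case: hr => [jr|[jr hd]|h0]; first by constructor 1.
  by constructor 2; split=> //; rewrite cobd_linear f0 d0 hd scaler0 addr0.
by constructor 3; rewrite f0 h0 scaler0 addr0.
Qed.

Definition bilin c (Phi Psi : bicochain) : bicochain :=
  fun p j t => c *: Phi p j t + Psi p j t.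
Arguments bilin c Phi Psi p j t : clear implicits.

Lemma tot_linear (K : forall j, cochain M j -> Prop) n c Phi Psi :
  (forall j d (f h : cochain M j), K j f -> K j h -> K j (d *: f + h)) ->
  tot K n Phi -> tot K n Psi -> tot K n (bilin c Phi Psi).
Proof.
move=> KL [Pd PK Pl Pe] [Qd QK Ql Qe]; split=> [p j t pj|p j t|p j|p j s t g].
- by rewrite /bilin Pd ?Qd // scaler0 addr0.
- exact: KL.
- exact: loc_const_linear.
- rewrite -[LHS]/(c *: Phi p j _ _ + Psi p j _ _).
  by rewrite -[in RHS]/(c *: Phi p j t g + Psi p j t g) gm_act_linear Pe Qe.
Qed.

Lemma tot_d_linear c Phi Psi p j t :
  tot_d (bilin c Phi Psi) p j t = c *: tot_d Phi p j t + tot_d Psi p j t.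
Proof.
rewrite /tot_d scalerDr addrACA; congr (_ + _).
  case: p t => [|p] t; first by rewrite scaler0 addr0.
  exact: (congr1 (fun F => F t) (cobd_linear c (Phi p j) (Psi p j))).
case: j => [|j]; first by rewrite scaler0 addr0.
rewrite [X in _ *: X = _](cobd_linear c (Phi p j t) (Psi p j t)) scalerDr !scalerA.
by congr (_ *: _ + _); exact/esym/commr_sign.
Qed.

Lemma tot0 (K : forall j, cochain M j -> Prop) n :
  (forall j, K j 0) -> tot K n (fun p j t => 0).
Proof.
move=> K0; split=> // [p j g|p j s t g]; first by exists [::].
have := gm_act_linear s (-1) 0 (0 : M).
by rewrite scaler0 addr0 scaleN1r addNr.
Qed.

Lemma tot_d0 p j t : tot_d (fun p j t => 0) p j t = 0.
Proof.
have d0 (G : Type) (U : lmodType 'Z_N) n : @cobd _ G U n 0 = 0.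
  by have := cobd_linear (-1) 0 (0 : ('I_n.+1 -> G) -> U); rewrite scaler0 addr0 scaleN1r addNr.
rewrite /tot_d; case: p t => [|p] t; case: j => [|j]; rewrite ?addr0 ?add0r //.
- by rewrite [cobd _]d0 scaler0.
- exact: (congr1 (fun F => F t) (d0 _ (cochain M 0) p)).
- rewrite [X in _ + _ *: X]d0 scaler0 addr0.
  exact: (congr1 (fun F => F t) (d0 _ (cochain M j.+1) p)).
Qed.

Fact FHS_closed a r : subsemimod_closed (FHS a r).
Proof.
have act0 (s : GL) : gm_act s (0 : M) = 0.
  have := gm_act_linear s (-1) 0 (0 : M).
  by rewrite scaler0 addr0 scaleN1r addNr.
have I0 j : inert_cochain (0 : cochain M j).
  by split=> [g|s g]; [exists [::]|rewrite -[LHS]/(0 : M) act0].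
apply: GRing.submod_closed_semi; split=> [|c x y].
  apply: asboolT; exists 0, (fun p j t => 0); split.
  - exact: rpred0.
  - apply/eqP; rewrite eq_sym; apply/eqP.
    by have := ccls_linear (-1) (rpred0 (cocycle M a)) (rpred0 (cocycle M a));
      rewrite scaler0 addr0 scaleN1r addNr.
  - by apply: tot0 => j; split; [exact: I0|constructor 3].
  - by move=> p j t g; rewrite tot_d0.
  - exists (fun p j t => 0); first exact: tot0.
    by move=> p j t g; rewrite tot_d0 /augment; case: ifP => _; rewrite addr0.
move=> /asboolW[z [Phi [zz -> Pt Pd [Psi Qt Q]]]].
move=> /asboolW[z' [Phi' [zz' -> Pt' Pd' [Psi' Qt' Q']]]].
apply: asboolT; exists (c *: z + z'), (bilin c Phi Phi'); split.
- by rewrite rpredD ?rpredZ.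
- by rewrite ccls_linear.
- by apply: tot_linear => // j d f h; exact: trunc_cochain_linear.
- move=> p j t g; rewrite tot_d_linear.
  by rewrite -[LHS]/(c *: tot_d Phi p j t g + tot_d Phi' p j t g) Pd Pd' scaler0 addr0.
- exists (bilin c Psi Psi').
    by apply: tot_linear => // j d f h; exact: inert_cochain_linear.
  move=> p j t g; rewrite tot_d_linear.
  rewrite -[X in _ = _ + X]/(c *: tot_d Psi p j t g + tot_d Psi' p j t g).
  rewrite -[X in _ = X + _]/(c *: Phi p j t g + Phi' p j t g).
  rewrite addrACA -scalerDr -Q -Q' /augment; case: ifP => // _.
  by rewrite scaler0 addr0.
Qed.
HB.instance Definition _ a r :=
  GRing.isSubmodClosed.Build 'Z_N (cohom M a) (FHS a r) (FHS_closed a r).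

(* [F_{r-1}], with [F_{-1} = 0]. *)
Definition FHSpred (a r : nat) : {pred cohom M a} :=
  if r is s.+1 then FHS a s else pred1 0.
Arguments FHSpred a r : clear implicits.

Fact FHSpred_closed a r : subsemimod_closed (FHSpred a r).
Proof.
case: r => [|r]; last exact: FHS_closed.
apply: GRing.submod_closed_semi; split=> [|c x y]; first exact: eqxx.
by move=> /eqP -> /eqP ->; rewrite scaler0 addr0; exact: eqxx.
Qed.
HB.instance Definition _ a r :=
  GRing.isSubmodClosed.Build 'Z_N (cohom M a) (FHSpred a r) (FHSpred_closed a r).

Definition grHS (a r : nat) : lmodType 'Z_N := subquot (FHS a r) (FHSpred a r).

End Filtration.
End HochschildSerre.

Definition is_basis (R : pzRingType) (M : lmodType R) (B : choiceType) (e : B -> M) :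
    Prop :=
  (forall (s : seq B) (c : B -> R), uniq s ->
     \sum_(b <- s) c b *: e b = 0 -> {in s, forall b, c b = 0}) /\
  (forall x, exists (s : seq B) (c : B -> R), x = \sum_(b <- s) c b *: e b).

(* [fr_e] is the inclusion of the basis [B] in [Gam / N Gam], [fr_w b] is [w_b]. *)
Record frame (V : henselian_valuation_ring) (D : strict_data V) (N : nat) := Frame {
  fr_disp : Order.disp_t;
  fr_B : orderType fr_disp;
  fr_e : fr_B -> modN N (hvGam V);
  fr_w : fr_B -> cohom (mumod N (sd_base D)) 1;
  fr_basis : is_basis fr_e;
  fr_restr : forall b, inertia_iso (restriction1 (fr_w b)) (fr_e b)
}.

Section Theta.
Context (V : henselian_valuation_ring) (D : strict_data V) (N : nat).

Fixpoint wprod n : ('I_n -> cohom (mumod N (sd_base D)) 1) -> HL D N n%:Z n :=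
  match n with
  | 0 => fun _ => @ccls _ _ _ _ (tate N (sd_base D) 0) 0 (fun=> (1 : 'Z_N))
  | m.+1 => fun w =>
      @cup _ _ _ _ (tate N (sd_base D) m%:Z) (mumod N (sd_base D))
        (tate N (sd_base D) m.+1%:Z) (@tens _ _ _) m 1 m.+1
        (wprod (fun i => w (widen_ord (leqnSn m) i))) (w ord_max)
  end.

Context (fr : frame D N) (q : int) (a : nat).

Fact size_sort_fset (J : {fset fr_B fr}) : size (sort <=%O J) == #|` J|.
Proof. by rewrite size_sort. Qed.

Definition fset_nth (J : {fset fr_B fr}) (i : 'I_#|` J|) : fr_B fr :=
  tnth (Tuple (size_sort_fset J)) i.

Definition wJ (J : {fset fr_B fr}) : HL D N #|` J|%:Z #|` J| :=
  wprod (fun i => fr_w (fset_nth i)).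

Definition theta_idx : choiceType := {J : {fset fr_B fr} | (#|` J| <= a)%N}.

Definition theta_summand (J : theta_idx) : lmodType 'Z_N :=
  Hk D N (q - #|` val J|%:Z) (a - #|` val J|).

Definition theta_dom : lmodType 'Z_N := dsum theta_summand.

Definition theta_term (J : theta_idx) (x : theta_summand J) : HL D N q a :=
  @cup _ _ _ _ (tate N (sd_base D) (q - #|` val J|%:Z))
    (tate N (sd_base D) #|` val J|%:Z) (tate N (sd_base D) q)
    (@twist_pair _ q #|` val J| (mumod N (sd_base D)))
    (a - #|` val J|) #|` val J| a (inflation x) (wJ (val J)).

Definition theta (al : theta_dom) : HL D N q a :=
  \sum_(J \in [set: theta_idx]) theta_term (dcoord al J).

Definition theta_dom_le (r : nat) : set theta_dom :=
  [set al : theta_dom | forall J : theta_idx, (r < #|` val J|)%N -> dcoord al J = 0].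

Definition theta_dom0 : set theta_dom :=
  [set al : theta_dom | forall J : theta_idx, val J != fset0 -> dcoord al J = 0].

Fact idx0_subproof : (#|` (fset0 : {fset fr_B fr})| <= a)%N.
Proof. by rewrite cardfs0. Qed.
Definition idx0 : theta_idx := exist _ fset0 idx0_subproof.

Fact idx0_twist : q - #|` val idx0|%:Z = q.
Proof. by rewrite -[val idx0]/(fset0 : {fset fr_B fr}) cardfs0 subr0. Qed.
Fact idx0_degree : (a - #|` val idx0|)%N = a.
Proof. by rewrite -[val idx0]/(fset0 : {fset fr_B fr}) cardfs0 subn0. Qed.

(* The summand indexed by the empty set is [H^a(k, mu_N^{(x) q})]. *)
Definition theta_coord0 (al : theta_dom) : Hk D N q a :=
  eq_rect _ (fun n => Hk D N q n)
    (eq_rect _ (fun p => Hk D N p (a - #|` val idx0|)) (dcoord al idx0) _ idx0_twist)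
    _ idx0_degree.

End Theta.

Arguments theta {V D N} fr q a al.
Arguments theta_dom_le {V D N} fr q a r.
Arguments theta_dom0 {V D N} fr q a.
Arguments FHS {V D N M} a r.
Arguments grHS {V D N} M a r.
Arguments inflation {V D N q a}.

(* Main.v *)
(* Cohomology is computed with homogeneous cochains. The cup products [w_J] are defined over the
   whole of [G_L] and restrict to a basis of the cohomology of the inertia group [I], so a
   Leray-Hirsch argument applies: by induction on the inertia degree, every cocycle of the total
   complex of [G_k] and [I] is cohomologous to a sum of products of cocycles of [G_k] with the
   [w_J], whose classes are unique. The Alexander-Whitney map, which inverts the augmentation up
   to homotopy, carries these products to [inf(alpha_J) \cup w_J], and it carries the truncation
   of the total complex to the filtration; this gives the isomorphism and its filtered form.
   That the [w_J] restrict to a basis comes from tame ramification: up to a group without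
   [l]-torsion, [I] acts on the [l]-power roots of elements whose values form a basis of
   [Gam / N Gam] through all the tuples of [l]-adic integers indexed by [B], and the cohomology of
   such a group is computed by taking antiderivatives of periodic functions one variable at a
   time. *)

From HB Require Import structures.
From mathcomp Require Import all_boot all_order all_algebra all_fingroup separable finmap.
From mathcomp Require Import boolp classical_sets functions cardinality fsbigop filter.
From mathcomp Require Import zify ring.
From mathcomp Require pgroup.
From mathcomp.multinomials Require Import freeg.

Require Import Defs.

Set Implicit Arguments.
Unset Strict Implicit.
Unset Printing Implicit Defensive.

Import Order.TTheory GRing.Theory.
Local Open Scope ring_scope.

(** The spectral sequence is never formed. The descent works on cochains because the [w_J] are
    cocycles of all of [G_L]: uniqueness alone forces the coefficients of an equivariant family of
    inertia cocycles to be equivariant cochains of [G_k]. Primitives are not unique, and making them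
    equivariant and continuous is the delicate point. Cochains of all degrees are functions on
    lists, so that homotopies are plain recursions, and continuity becomes dependence on one uniform
    level, which compactness of Galois groups supplies. The [w_b] are known modulo [N] only, while
    an antiderivative of a periodic function has a period longer by the factor [N]; hence the lifts
    of the coordinates to all levels [l ^ m]. That [G_L] acts on [Wsh], and that it preserves values
    in the separable closure, has to be derived from the data. Both use a valuation ring [O] of the
    separable closure that dominates [Wsh]: it is strictly henselian, so the universal property of
    [Wsh] applies to it. *)

(** * Deciding identities in abelian groups *)

Inductive zexp := ZVar of nat | ZZero | ZAdd of zexp & zexp | ZOpp of zexp.

Fixpoint zev (M : zmodType) (e : seq M) (x : zexp) : M :=
  match x with
  | ZVar n => e`_n | ZZero => 0 | ZAdd a b => zev e a + zev e b | ZOpp a => - zev e a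
  end.

Fixpoint zcoef (x : zexp) (i : nat) : int :=
  match x with
  | ZVar n => (n == i)%:Z | ZZero => 0 | ZAdd a b => zcoef a i + zcoef b i
  | ZOpp a => - zcoef a i
  end.

Lemma zevE (M : zmodType) (e : seq M) x :
  zev e x = \sum_(i < size e) e`_i *~ zcoef x i.
Proof.
elim: x => [n| |a IHa b IHb|a IHa] /=.
- have [ln|ln] := ltnP n (size e); last first.
    rewrite nth_default // big1 // => i _; case: eqP => [ni|//].
    by have := ltn_ord i; rewrite -ni ltnNge ln.
  rewrite (bigD1 (Ordinal ln)) //= eqxx big1 ?addr0 // => i ni.
  by case: eqP => [nE|//]; case/eqP: ni; apply: val_inj.
- by rewrite big1.
- by rewrite IHa IHb -big_split /=; apply: eq_bigr => i _; rewrite mulrzDr.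
- by rewrite IHa -sumrN; apply: eq_bigr => i _; rewrite mulrNz.
Qed.

Lemma zev_eq (M : zmodType) (e : seq M) x y :
  all (fun i => zcoef x i == zcoef y i) (iota 0 (size e)) -> zev e x = zev e y.
Proof.
move=> /allP xy; rewrite !zevE; apply: eq_bigr => i _.
by rewrite (eqP (xy i _)) // mem_iota /= add0n.
Qed.

Create HintDb zmod_conv discriminated.
Ltac zsame a b := unify a b with zmod_conv.
Ltac zidx a l := match l with
  | cons ?b _ => let _ := match goal with _ => zsame a b end in constr:(0%N)
  | cons _ ?l' => let n := zidx a l' in constr:(S n) end.
Ltac zmem a l := match l with
  | cons ?b _ => let _ := match goal with _ => zsame a b end in constr:(true)
  | cons _ ?l' => zmem a l'
  | nil => constr:(false) end.
Ltac zatoms t l := lazymatch t with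
  | (?a + ?b)%R => let l' := zatoms a l in zatoms b l'
  | (- ?a)%R => zatoms a l
  | 0%R => l
  | _ => let m := zmem t l in lazymatch m with true => l | false => constr:(cons t l) end
  end.
Ltac zreify t l := lazymatch t with
  | (?a + ?b)%R => let x := zreify a l in let y := zreify b l in constr:(ZAdd x y)
  | (- ?a)%R => let x := zreify a l in constr:(ZOpp x)
  | 0%R => constr:(ZZero)
  | _ => let n := zidx t l in constr:(ZVar n)
  end.
(** Decides identities valid in every abelian group: both sides are reified over a common list of
    atoms, and [zev_eq] compares the integer coefficients by computation. *)
Ltac zmod := lazymatch goal with |- @eq ?T ?a ?b =>
  let l0 := constr:(@nil T) in
  let l1 := zatoms a l0 in let l := zatoms b l1 in
  let x := zreify a l in let y := zreify b l in
  refine (@zev_eq _ l x y _); vm_compute; exact (erefl true) end.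

(** * Cochains on lists *)

Section ListCochains.
Context (G : Type) (M : zmodType).
Implicit Types (f h : seq G -> M) (s : seq G).

(* A single function on lists encodes cochains of all degrees at once, a list
   of [n+1] elements being an argument of degree [n]. *)
Fixpoint dl f s : M :=
  if s is x :: s' then f s' - dl (fun u => f (x :: u)) s' else 0.

Lemma eq_dl f h s : (forall u, (size u).+1 = size s -> f u = h u) -> dl f s = dl h s.
Proof.
elim: s f h => //= x s IH f h fh; rewrite fh //; congr (_ - _).
by apply: IH => u us; apply: fh; rewrite /= us.
Qed.

Lemma dl_zero f s : (forall u, (size u).+1 = size s -> f u = 0) -> dl f s = 0.
Proof.
elim: s f => //= x s IH f f0; rewrite f0 // IH ?subrr // => u us.
by rewrite f0 //= us.
Qed.

Lemma dlD f h s : dl (fun u => f u + h u) s = dl f s + dl h s.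
Proof. by elim: s f h => [|x s IH] f h /=; rewrite ?addr0 // IH opprD addrACA. Qed.

Lemma dlN f s : dl (fun u => - f u) s = - dl f s.
Proof. by elim: s f => [|x s IH] f /=; rewrite ?oppr0 // IH opprB opprK addrC. Qed.

Lemma dlB f h s : dl (fun u => f u - h u) s = dl f s - dl h s.
Proof. by rewrite dlD dlN. Qed.

Lemma dl_sum (I : Type) (r : seq I) (F : I -> seq G -> M) s :
  dl (fun u => \sum_(i <- r) F i u) s = \sum_(i <- r) dl (F i) s.
Proof.
elim: r => [|i r IH].
  by rewrite big_nil; apply: dl_zero => u _; rewrite big_nil.
rewrite big_cons -IH -dlD; apply: eq_dl => u _; exact: big_cons.
Qed.

Lemma dlMn f n s : dl (fun u => f u *+ n) s = dl f s *+ n.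
Proof. by elim: s f => [|x s IH] f /=; rewrite ?mul0rn // IH mulrnBl. Qed.

Lemma dl_dl f s : dl (dl f) s = 0.
Proof.
elim: s f => //= x s IH f.
by rewrite dlB IH subr0 subrr.
Qed.

End ListCochains.

Lemma dl_map (G G' : Type) (M : zmodType) (phi : G -> G') (f : seq G' -> M) s :
  dl f (map phi s) = dl (fun u => f (map phi u)) s.
Proof. by elim: s f => //= x s IH f; rewrite IH. Qed.

Lemma dl_morph (G : Type) (M M' : zmodType) (u : M -> M') (f : seq G -> M) s :
  {morph u : x y / x - y} -> u (dl f s) = dl (fun l => u (f l)) s.
Proof.
move=> ub; have u0 : u 0 = 0 by rewrite -[X in u X](subrr 0) ub subrr.
by elim: s f => //= x s IH f; rewrite ub IH.
Qed.

(** * The Alexander-Whitney map *)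

Section AlexanderWhitney.
Context (G Q : Type) (pi : G -> Q) (M : zmodType).
Implicit Types (Phi : seq Q -> seq G -> M) (t : seq Q) (s : seq G).

(** A list of [n] entries has degree [n - 1], so this is the sign of the degree, [(-1) ^ (n - 1)],
    written without natural subtraction. *)
Definition sgn (n : nat) (x : M) : M := if odd n then x else - x.

Lemma sgnD n x y : sgn n (x + y) = sgn n x + sgn n y.
Proof. by rewrite /sgn; case: ifP => //; rewrite opprD. Qed.
Lemma sgnN n x : sgn n (- x) = - sgn n x.
Proof. by rewrite /sgn; case: ifP. Qed.
Lemma sgnB n x y : sgn n (x - y) = sgn n x - sgn n y.
Proof. by rewrite sgnD sgnN. Qed.
Lemma sgn0 n : sgn n 0 = 0. Proof. by rewrite /sgn oppr0 if_same. Qed.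
Lemma sgnS n x : sgn n.+1 x = - sgn n x.
Proof. by rewrite /sgn /=; case: (odd n); rewrite ?opprK. Qed.
Lemma sgnK n : involutive (sgn n).
Proof. by move=> x; rewrite /sgn; case: (odd n); rewrite ?opprK. Qed.

Definition dtot Phi t s : M := dl (fun u => Phi u s) t + sgn (size t) (dl (Phi t) s).

Lemma dtot_cons Phi x t s :
  dtot Phi (x :: t) s = Phi t s - dtot (fun u => Phi (x :: u)) t s.
Proof. by rewrite /dtot /= sgnS opprD addrA. Qed.

Lemma dtotD Phi Psi t s :
  dtot (fun u v => Phi u v + Psi u v) t s = dtot Phi t s + dtot Psi t s.
Proof. by rewrite /dtot !dlD sgnD addrACA. Qed.

Lemma dtotN Phi t s : dtot (fun u v => - Phi u v) t s = - dtot Phi t s.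
Proof. by rewrite /dtot !dlN sgnN opprD. Qed.

Lemma dtotB Phi Psi t s :
  dtot (fun u v => Phi u v - Psi u v) t s = dtot Phi t s - dtot Psi t s.
Proof. by rewrite dtotD dtotN. Qed.

Lemma dtot_dtot Phi t s : dtot (dtot Phi) t s = 0.
Proof.
elim: t s Phi => [|x t IH] s Phi.
  have E u : dtot Phi [::] u = sgn 0 (dl (Phi [::]) u) by rewrite /dtot /= add0r.
  rewrite {1}/dtot /= add0r (eq_dl (h := fun u => - dl (Phi [::]) u)) => [|u _].
    by rewrite dlN dl_dl oppr0 sgn0.
  by rewrite E.
rewrite dtot_cons {1}/dtot; set X := dtot (fun _ => _) t s.
have -> : X = dtot Phi t s - dtot (dtot (fun u => Phi (x :: u))) t s.
  rewrite -dtotB; congr (_ + sgn _ _); apply: eq_dl => u _; exact: dtot_cons.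
by rewrite IH subr0 subrr.
Qed.

(** Unfolded in [aw_sum]: the sum over [k] of [Phi] at the front face [pi s_0, ..., pi s_k] and the
    back face [s_k, ..., s_n]. The vertex [s_k] occurs in both. *)
Fixpoint aw Phi s : M :=
  if s is x :: s' then Phi [:: pi x] s + aw (fun t => Phi (pi x :: t)) s' else 0.

Lemma eq_aw Phi Psi s :
  (forall t v, t <> [::] -> v <> [::] -> (size t + size v = (size s).+1)%N -> Phi t v = Psi t v) ->
  aw Phi s = aw Psi s.
Proof.
elim: s Phi Psi => //= x s IH Phi Psi e; rewrite e ?add1n //; congr (_ + _).
by apply: IH => t v _ v0 h; apply: e => //=; rewrite addSn h.
Qed.

Lemma awD Phi Psi s : aw (fun t v => Phi t v + Psi t v) s = aw Phi s + aw Psi s.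
Proof. by elim: s Phi Psi => [|x s IH] Phi Psi /=; rewrite ?addr0 // IH addrACA. Qed.

Lemma awN Phi s : aw (fun t v => - Phi t v) s = - aw Phi s.
Proof. by elim: s Phi => [|x s IH] Phi /=; rewrite ?oppr0 // IH opprD. Qed.

Lemma awB Phi Psi s : aw (fun t v => Phi t v - Psi t v) s = aw Phi s - aw Psi s.
Proof. by rewrite awD awN. Qed.

(** The chain map property. The term [Phi [::] s] vanishes for true bicochains, but the induction
    passes to [Px], whose value at the empty list is [Phi [:: pi x]]. *)
Lemma dl_aw Phi s : (forall t, Phi t [::] = 0) ->
  dl (aw Phi) s = aw (dtot Phi) s - Phi [::] s.
Proof.
elim: s Phi => [|x s IH] Phi P0 /=; first by rewrite P0 subrr.
rewrite dlD IH //; set Px := fun t => Phi (pi x :: t).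
have -> : aw (fun t => dtot Phi (pi x :: t)) s = aw Phi s - aw (dtot Px) s.
  by rewrite -awB; apply: eq_aw => t v _ _ _; rewrite dtot_cons.
have -> : dtot Phi [:: pi x] (x :: s) =
    Phi [::] (x :: s) + (Phi [:: pi x] s - dl (fun u => Phi [:: pi x] (x :: u)) s).
  by rewrite /dtot /= subr0.
have -> : (fun u => Phi [:: pi x] (x :: u)) = (fun u => Px [::] (x :: u)) by [].
have -> : Phi [:: pi x] s = Px [::] s by [].
zmod.
Qed.

Definition augl (f : seq G -> M) : seq Q -> seq G -> M :=
  fun t s => if size t == 1 then f s else 0.

Lemma aw_augl f s : f [::] = 0 -> aw (augl f) s = f s.
Proof.
case: s => [|x s] f0 //=; set b := aw _ _.
suff -> : b = 0 by rewrite addr0.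
rewrite /b (eq_aw (Psi := fun _ _ => 0)) => [|[|y t] v]; rewrite ?/augl //.
by elim: s {b} => //= y s ->; rewrite addr0.
Qed.

(* The homotopy between the identity and [augl \o aw]. *)
Fixpoint awh Phi t s : M :=
  match t, s with
  | _ :: _, x :: s' =>
      Phi (pi x :: t) s - sgn (size t) (awh (fun u => Phi (pi x :: u)) t s')
  | _, _ => 0
  end.

Lemma eq_awh Phi Psi t s : (forall u v, (size t < size u)%N -> Phi u v = Psi u v) ->
  awh Phi t s = awh Psi t s.
Proof.
elim: s Phi Psi t => [|x s IH] Phi Psi [|y t] e //=.
rewrite e //; congr (_ - sgn _ _).
by apply: IH => u v h; apply: e => /=; rewrite ltnW.
Qed.

Lemma awhB Phi Psi t s :
  awh (fun u v => Phi u v - Psi u v) t s = awh Phi t s - awh Psi t s.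
Proof.
elim: s Phi Psi t => [|x s IH] Phi Psi [|y t] /=; rewrite ?subrr //.
rewrite IH sgnB; zmod.
Qed.

Lemma awh_nil Phi t : awh Phi t [::] = 0. Proof. by case: t. Qed.

(** Both differentials are expanded along the first vertex [x] of [s]; what remains is the same
    identity for [Px] on the tail. *)
Lemma awhE Phi t s : t <> [::] -> (forall u, Phi u [::] = 0) ->
  dtot (awh Phi) t s + awh (dtot Phi) t s = Phi t s - augl (aw Phi) t s.
Proof.
elim: s Phi t => [|x s IH] Phi t t0 P0.
  case: t t0 => [//|y t] _; rewrite /augl /= if_same P0 subrr addr0.
  rewrite /dtot [dl (awh _ _) _]/= sgn0 addr0; apply: dl_zero => u _; exact: awh_nil.
set Px := fun u => Phi (pi x :: u).
have Px0 u : Px u [::] = 0 by rewrite /Px P0.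
have {IH} := IH Px t t0 Px0.
have Ed : awh (fun u => dtot Phi (pi x :: u)) t s = awh Phi t s - awh (dtot Px) t s.
  by rewrite -awhB; apply: eq_awh => u v _; rewrite dtot_cons.
have Eh : awh (dtot Phi) t (x :: s) =
    Phi t (x :: s) - dtot Px t (x :: s) - sgn (size t) (awh Phi t s - awh (dtot Px) t s).
  by case: t t0 Ed => [//|y t] _ /= <-; rewrite dtot_cons.
have Ev : dl (awh Phi t) (x :: s) = awh Phi t s -
    (dl (fun u => Px t (x :: u)) s - sgn (size t) (dl (awh Px t) s)).
  rewrite /=; congr (_ - _); rewrite (dl_morph _ _ (@sgnB (size t))) -dlB.
  by case: t t0 {Ed Eh} => [//|y t] _; apply: eq_dl.
pose e := (size t == 1)%N.
(* If [t] has one entry, deleting it leaves the empty list, where [awh] is 0 instead of its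
   recursive formula. The missing term [Px [::] (x :: s)] is the first summand of
   [aw Phi (x :: s)]. *)
have Eu : dl (fun u => awh Phi u (x :: s)) t =
    dl (fun u => Px u (x :: s)) t + sgn (size t) (dl (fun u => awh Px u s) t) -
    (if e then Px [::] (x :: s) else 0).
  rewrite (dl_morph _ _ (@sgnB (size t))) -dlD.
  case: t t0 @e {Ed Eh Ev} => [//|y [|z t]] _.
    by have n0 F u : awh F [::] u = 0 by [case: u]; rewrite /= !n0 !subr0 sgn0; zmod.
  move=> e; have -> : e = false by []; rewrite subr0; apply: eq_dl => -[//|w u] us /=.
  case: us => us; rewrite -[X in _ = _ + X]/(sgn (size t).+2 (awh Px (w :: u) s)).
  by rewrite us [in RHS]sgnS.
move=> /(canRL (addKr _)) IHt.
rewrite Eh IHt /dtot Eu Ev /augl -/e !(sgnB, sgnD, sgnN, sgnK).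
have -> : sgn (size t) (if e then aw Px s else 0) = if e then aw Px s else 0.
  by rewrite /e; case: eqP => [->|_] //; exact: sgn0.
have -> : dl (fun u => Px t (x :: u)) s = Px t s - dl (Px t) (x :: s) by rewrite /= subKr.
have -> : aw Phi (x :: s) = Px [::] (x :: s) + aw Px s by [].
case: (e); rewrite ?(sgnB, sgnD, sgnN, sgnK); zmod.
Qed.

End AlexanderWhitney.

(* [pg_eqv v x y] means that [x] and [y] agree modulo the open normal subgroup [v], so that this
   is a profinite group without completeness. *)
Record pgrp := Pgrp {
  pg_car :> choiceType;
  pg_mul : pg_car -> pg_car -> pg_car;
  pg_one : pg_car;
  pg_inv : pg_car -> pg_car;
  pg_mulA : associative pg_mul;
  pg_mul1 : left_id pg_one pg_mul;
  pg_mulV : left_inverse pg_one pg_inv pg_mul;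
  pg_lev : Type;
  pg_eqv : pg_lev -> pg_car -> pg_car -> Prop;
  pg_refl : forall v x, pg_eqv v x x;
  pg_sym : forall v x y, pg_eqv v x y -> pg_eqv v y x;
  pg_trans : forall v y x z, pg_eqv v x y -> pg_eqv v y z -> pg_eqv v x z;
  pg_eqvl : forall v z x y, pg_eqv v x y -> pg_eqv v (pg_mul z x) (pg_mul z y);
  pg_eqvr : forall v z x y, pg_eqv v x y -> pg_eqv v (pg_mul x z) (pg_mul y z);
  pg_dir : forall v w, exists u, forall x y, pg_eqv u x y -> pg_eqv v x y /\ pg_eqv w x y;
  pg_fin : forall v, exists s : nat -> pg_car, exists n, forall x,
    exists2 i, (i < n)%N & pg_eqv v x (s i);
  pg_lev0 : pg_lev
}.

(** * Levels of a profinite group and smooth functions *)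

Section Pgrp.
Context (G : pgrp).
Implicit Types (x y z : G) (s : seq G) (v : pg_lev G).
Local Notation "x ** y" := (pg_mul x y) (at level 40, left associativity).
Local Notation e := (pg_one G).
Local Notation inv := (@pg_inv G).

Lemma pg_mulKl x : cancel (pg_mul x) (pg_mul (inv x)).
Proof. by move=> y; rewrite pg_mulA pg_mulV pg_mul1. Qed.
Lemma pg_mulIl x y z : x ** y = x ** z -> y = z.
Proof. by move/(congr1 (pg_mul (inv x))); rewrite !pg_mulKl. Qed.
Lemma pg_mulr1 x : x ** e = x.
Proof. by apply: (@pg_mulIl (inv x)); rewrite pg_mulA pg_mulV pg_mul1. Qed.
Lemma pg_mulrV x : x ** inv x = e.
Proof. by apply: (@pg_mulIl (inv x)); rewrite pg_mulA pg_mulV pg_mul1 pg_mulr1. Qed.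
Lemma pg_mulVKl x : cancel (pg_mul (inv x)) (pg_mul x).
Proof. by move=> y; rewrite pg_mulA pg_mulrV pg_mul1. Qed.
Lemma pg_invM x y : inv (x ** y) = inv y ** inv x.
Proof.
by apply: (@pg_mulIl (x ** y)); rewrite pg_mulrV -pg_mulA (pg_mulA y) pg_mulrV pg_mul1 pg_mulrV.
Qed.
Lemma pg_inv1 : inv e = e.
Proof. by rewrite -[LHS]pg_mul1 pg_mulrV. Qed.

Lemma pg_eqvV v x y : pg_eqv v x y -> pg_eqv v (inv x) (inv y).
Proof.
move=> /(pg_eqvl (inv x))/(pg_eqvr (inv y)); rewrite pg_mulV pg_mul1 -pg_mulA pg_mulrV pg_mulr1.
exact: pg_sym.
Qed.

Fixpoint eqvs v s s' : Prop :=
  match s, s' with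
  | [::], [::] => True
  | x :: s1, y :: s2 => pg_eqv v x y /\ eqvs v s1 s2
  | _, _ => False
  end.

Lemma eqvs_size v s s' : eqvs v s s' -> size s = size s'.
Proof. by elim: s s' => [|x s IH] [|y s'] //= [_ /IH->]. Qed.
Lemma eqvs_refl v s : eqvs v s s.
Proof. by elim: s => //= x s IH; split=> //; exact: pg_refl. Qed.
Lemma eqvs_mull v z s s' : eqvs v s s' -> eqvs v (map (pg_mul z) s) (map (pg_mul z) s').
Proof. by elim: s s' => [|x s IH] [|y s'] //= [/(pg_eqvl z) ? /IH]. Qed.
Lemma eqvs_mul v z z' s s' : pg_eqv v z z' -> eqvs v s s' ->
  eqvs v (map (pg_mul z) s) (map (pg_mul z') s').
Proof.
move=> zz'; elim: s s' => [|x s IH] [|y s'] //= [xy /IH]; split=> //.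
exact: pg_trans (pg_eqvr x zz') (pg_eqvl z' xy).
Qed.
Lemma eqvs_sub v w s s' : (forall x y, pg_eqv v x y -> pg_eqv w x y) ->
  eqvs v s s' -> eqvs w s s'.
Proof. by move=> vw; elim: s s' => [|x s IH] [|y s'] //= [/vw ? /IH]. Qed.
Lemma eqvs_cat v s s' u u' : eqvs v s s' -> eqvs v u u' -> eqvs v (s ++ u) (s' ++ u').
Proof. by elim: s s' => [|x s IH] [|y s'] //= [? /IH]; auto. Qed.

(** What compactness is used for later: data given list by list become uniform, as finitely many
    lists represent all of them at level [v]. *)
Lemma eqvs_fin v n : exists L : seq (seq G), forall t, size t = n ->
  exists2 t', t' \in L & eqvs v t t'.
Proof.
have [f [k fk]] := pg_fin v.
elim: n => [|n [L IH]]; first by exists [:: [::]] => -[|//] _; exists [::].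
exists [seq f i :: t | i <- iota 0 k, t <- L] => -[//|x t] [tn].
have [i ik xi] := fk x; have [t' t'L tt'] := IH t tn.
exists (f i :: t') => //; apply/allpairsP; exists (i, t'); split=> //.
by rewrite mem_iota.
Qed.

(** Uniform local constancy: one level for all arguments. On a compact group this is continuity, see
    [loc_const_smooth]. *)
Definition smooth (T : Type) n (f : seq G -> T) :=
  exists v, forall s s', size s = n -> eqvs v s s' -> f s = f s'.

Lemma smooth_op2 (T T' T'' : Type) (op : T -> T' -> T'') n f g :
  smooth n f -> smooth n g -> smooth n (fun s => op (f s) (g s)).
Proof.
move=> [v fv] [w gw]; have [u uvw] := pg_dir v w.
exists u => s s' sn ss'; rewrite (fv s s') ?(gw s s') //.
  by apply: eqvs_sub ss' => x y /uvw[].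
by apply: eqvs_sub ss' => x y /uvw[].
Qed.

Lemma smooth_op1 (T T' : Type) (op : T -> T') n f : smooth n f -> smooth n (fun s => op (f s)).
Proof. by move=> [v fv]; exists v => s s' sn /(fv _ _ sn) ->. Qed.

Lemma smooth_cst (T : Type) n (c : T) : smooth n (fun=> c).
Proof. by exists (pg_lev0 G). Qed.

Lemma eq_smooth (T : Type) n (f g : seq G -> T) :
  (forall s, size s = n -> f s = g s) -> smooth n f -> smooth n g.
Proof.
move=> fg [v fv]; exists v => s s' sn ss'.
by rewrite -!fg -?(eqvs_size ss') //; exact: fv.
Qed.

(* A level is not affected by deleting entries, so [dl] does not need a smaller one. *)
Lemma dl_eqvs (M : zmodType) v (f : seq G -> M) s s' :
  (forall u u', (size u).+1 = size s -> eqvs v u u' -> f u = f u') ->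
  eqvs v s s' -> dl f s = dl f s'.
Proof.
elim: s s' f => [|x s IH] [|y s'] //= f fv [xy ss']; rewrite (fv s s') //; congr (_ - _).
transitivity (dl (fun u => f (x :: u)) s').
  by apply: IH => // u u' us uu'; apply: fv; rewrite /= ?us //; split=> //; exact: pg_refl.
by apply: eq_dl => u us; apply: fv => /=; rewrite ?us ?(eqvs_size ss') //; split=> //; exact: eqvs_refl.
Qed.

End Pgrp.

(** * The Leray-Hirsch argument *)

Section LerayHirsch.
Context (G Q : pgrp) (pi : G -> Q) (M : zmodType) (act : G -> M -> M).
Context (A : nat -> zmodType) (actA : forall r, Q -> A r -> A r).
Context (W : forall r, A r -> seq G -> M).
Local Notation "x ** y" := (pg_mul x y) (at level 40, left associativity).
Local Notation inv := (@pg_inv _).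

Hypothesis piM : forall x y, pi (x ** y) = pi x ** pi y.
Hypothesis pi_surj : forall y, exists x, pi x = y.
Hypothesis pi_open : forall v, exists u, forall x,
  pg_eqv u (pi x) (pg_one Q) -> exists2 i, pi i = pg_one Q & pg_eqv v x i.
Hypothesis act_add : forall x m m', act x (m - m') = act x m - act x m'.
Hypothesis actM : forall x y m, act (x ** y) m = act x (act y m).
Hypothesis act_smooth : exists v, forall x m, pg_eqv v x (pg_one G) -> act x m = m.
Hypothesis actA_add : forall r x m m', @actA r x (m - m') = actA x m - actA x m'.

(** Cochains of the kernel of [pi], defined on all of [G] as in [(X^j)^I]; [n] counts arguments, so
    the degree is [n - 1]. The value 0 at the empty list makes coboundaries of degree 0, which are
    [dl h [:: x] = h [::]], vanish. *)
Definition Kc n (f : seq G -> M) := [/\ smooth n f,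
  forall i s, pi i = pg_one Q -> size s = n -> f (map (pg_mul i) s) = act i (f s)
  & f [::] = 0].

(** The group [A r] is a model of the cohomology of the kernel in degree [r], and [W] realizes its
    classes by cocycles that are equivariant under all of [G]. This global equivariance is what a
    mere basis of classes would not give. *)
Hypothesis W_sub : forall r a b s, @W r (a - b) s = W a s - W b s.
Hypothesis W_smooth : forall r a, smooth r.+1 (@W r a).
Hypothesis W_equiv : forall r a x s, size s = r.+1 ->
  @W r (actA (pi x) a) (map (pg_mul x) s) = act x (W a s).
Hypothesis W_closed : forall r a s, size s = r.+2 -> dl (@W r a) s = 0.
Hypothesis H_ex : forall r f, Kc r.+1 f -> (forall s, size s = r.+2 -> dl f s = 0) ->
  exists c : A r, exists2 h, Kc r h & forall s, size s = r.+1 -> f s = W c s + dl h s.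
Hypothesis H_un : forall r (c : A r) h, Kc r h ->
  (forall s, size s = r.+1 -> W c s = dl h s) -> c = 0.

Lemma pi1 : pi (pg_one G) = pg_one Q.
Proof. by apply: (@pg_mulIl _ (pi (pg_one G))); rewrite -piM pg_mulr1 pg_mulr1. Qed.
Lemma piV x : pi (inv x) = inv (pi x).
Proof. by apply: (@pg_mulIl _ (pi x)); rewrite -piM !pg_mulrV pi1. Qed.
Lemma act0 x : act x 0 = 0.
Proof. by rewrite -[X in act x X](subrr 0) act_add subrr. Qed.
Lemma actN x m : act x (- m) = - act x m.
Proof. by rewrite -sub0r act_add act0 sub0r. Qed.
Lemma actD x m m' : act x (m + m') = act x m + act x m'.
Proof. by rewrite -[in LHS](opprK m') act_add actN opprK. Qed.

Lemma W0 r s : W (0 : A r) s = 0.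
Proof. by rewrite -[X in W X](subrr 0) W_sub subrr. Qed.
Lemma actA0 r x : actA x (0 : A r) = 0.
Proof. by rewrite -[X in actA x X](subrr 0) actA_add subrr. Qed.

Definition jsmooth (T : Type) n m (Phi : seq Q -> seq G -> T) :=
  exists u v, forall t t' s s', size t = n -> size s = m -> eqvs u t t' -> eqvs v s s' ->
    Phi t s = Phi t' s'.

Lemma jsmooth_op2 (T T' T'' : Type) (op : T -> T' -> T'') n m f g :
  jsmooth n m f -> jsmooth n m g -> jsmooth n m (fun t s => op (f t s) (g t s)).
Proof.
move=> [v1 [w1 f1]] [v2 [w2 f2]].
have [v vv] := pg_dir v1 v2; have [w ww] := pg_dir w1 w2.
exists v, w => t t' s s' tn sm tt' ss'; rewrite (f1 t t' s s') ?(f2 t t' s s') //;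
  by [apply: eqvs_sub tt' => x y /vv[] | apply: eqvs_sub ss' => x y /ww[]].
Qed.

Lemma jsmooth_op1 (T T' : Type) (op : T -> T') n m f :
  jsmooth n m f -> jsmooth n m (fun t s => op (f t s)).
Proof. by move=> [v [w fv]]; exists v, w => t t' s s' a b c d; rewrite (fv t t' s s'). Qed.

Lemma jsmooth_cst (T : Type) n m (c : T) : jsmooth n m (fun _ _ => c).
Proof. by exists (pg_lev0 Q), (pg_lev0 G). Qed.

Lemma eq_jsmooth (T : Type) n m (f g : seq Q -> seq G -> T) :
  (forall t s, size t = n -> size s = m -> f t s = g t s) -> jsmooth n m f -> jsmooth n m g.
Proof.
move=> fg [v [w fv]]; exists v, w => t t' s s' tn sm tt' ss'.
by rewrite -!fg -?(eqvs_size ss') -?(eqvs_size tt') //; exact: fv.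
Qed.

Lemma jsmooth_dlv n m (Phi : seq Q -> seq G -> M) : jsmooth n m Phi -> jsmooth n m.+1 (fun t => dl (Phi t)).
Proof.
move=> [v [w fv]]; exists v, w => t t' s s' tn sm tt' ss'.
transitivity (dl (Phi t') s).
  by apply: eq_dl => u us; apply: fv => //; [apply: succn_inj; rewrite us|exact: eqvs_refl].
apply: dl_eqvs ss' => u u' us uu'; apply: fv => //; last exact: eqvs_refl.
  by rewrite -(eqvs_size tt').
by apply: succn_inj; rewrite us.
Qed.

Lemma jsmooth_dlh n m (Phi : seq Q -> seq G -> M) : jsmooth n m Phi -> jsmooth n.+1 m (fun t s => dl (fun u => Phi u s) t).
Proof.
move=> [v [w fv]]; exists v, w => t t' s s' tn sm tt' ss'.
transitivity (dl (fun u => Phi u s') t).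
  by apply: eq_dl => u us; apply: fv => //; [apply: succn_inj; rewrite us|exact: eqvs_refl].
apply: dl_eqvs tt' => u u' us uu'; apply: fv => //; last exact: eqvs_refl.
  by apply: succn_inj; rewrite us.
by rewrite -(eqvs_size ss').
Qed.

Lemma jsmooth_dtot n m (Phi : seq Q -> seq G -> M) : (forall p q, jsmooth p q Phi) -> jsmooth n m (dtot Phi).
Proof.
move=> P; apply: (@jsmooth_op2 M M M +%R).
  case: n => [|n]; last exact: jsmooth_dlh.
  by apply: (eq_jsmooth (f := fun _ _ => 0)); [case|exact: jsmooth_cst].
apply: (eq_jsmooth (f := fun t s => sgn n (dl (Phi t) s))) => [t s -> //|].
apply: jsmooth_op1; case: m => [|m]; last exact: jsmooth_dlv.
by apply: (eq_jsmooth (f := fun _ _ => 0)); [move=> t []|exact: jsmooth_cst].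
Qed.

Definition equivb (Phi : seq Q -> seq G -> M) := forall x t s,
  Phi (map (pg_mul (pi x)) t) (map (pg_mul x) s) = act x (Phi t s).

Lemma equivb_sub Phi Psi : equivb Phi -> equivb Psi -> equivb (fun t s => Phi t s - Psi t s).
Proof. by move=> e e' x t s; rewrite e e' act_add. Qed.

Lemma sgn_act x n m : sgn n (act x m) = act x (sgn n m).
Proof. by rewrite /sgn; case: ifP => // _; rewrite actN. Qed.

Lemma equivb_dtot Phi : equivb Phi -> equivb (dtot Phi).
Proof.
move=> e x t s; rewrite /dtot actD -sgn_act size_map; congr (_ + sgn _ _).
  by rewrite dl_map (dl_morph _ _ (act_add x)); apply: eq_dl => u _.
by rewrite dl_map (dl_morph _ _ (act_add x)); apply: eq_dl => u _.
Qed.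

(** The kernel is normal, so translating by [x] keeps equivariance under it. *)
Lemma Kc_conj r h x : Kc r h -> Kc r (fun s => act x (h (map (pg_mul (inv x)) s))).
Proof.
move=> [[v hv] hi h0]; split=> [|i s ii sr|]; last by rewrite /= h0 act0.
  by exists v => s s' sr ss'; congr act; apply: hv; rewrite ?size_map //; exact: eqvs_mull.
rewrite -actM -map_comp.
have -> : map (pg_mul (inv x) \o pg_mul i) s =
    map (pg_mul (inv x ** i ** x)) (map (pg_mul (inv x)) s).
  by rewrite -map_comp; apply: eq_map => y /=; rewrite -!pg_mulA pg_mulVKl.
rewrite hi ?size_map //; last by rewrite !piM ii pg_mulr1 -piM pg_mulV pi1.
by rewrite -actM -!pg_mulA pg_mulVKl.
Qed.

Lemma Kc_sub r h h' : Kc r h -> Kc r h' -> Kc r (fun s => h s - h' s).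
Proof.
move=> [hs hi h0] [hs' hi' h0']; split; first exact: (smooth_op2 (fun a b => a - b)).
  by move=> i s ii sr; rewrite hi ?hi' ?act_add.
by rewrite h0 h0' subrr.
Qed.

(* Equivariance is obtained by normalizing the first entry of the list to [1]. *)
Lemma family_decomposition (Phi : seq Q -> seq G -> M) P R : (0 < P)%N ->
  jsmooth P R.+1 Phi -> equivb Phi -> (forall t, Phi t [::] = 0) ->
  (forall t s, size t = P -> size s = R.+2 -> dl (Phi t) s = 0) ->
  exists (beta : seq Q -> A R) (h : seq Q -> seq G -> M),
  [/\ smooth P beta,
      forall x t, size t = P -> beta (map (pg_mul (pi x)) t) = actA (pi x) (beta t),
      jsmooth P R h, equivb h & [/\ forall t, h t [::] = 0,
      forall t s, (size t != P) || (size s != R) -> h t s = 0,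
      forall t, size t != P -> beta t = 0 &
      forall t s, size t = P -> size s = R.+1 -> Phi t s = W (beta t) s + dl (h t) s]].
Proof.
move=> P0 Ps Pe Pn Pd.
pose cut n (f : seq G -> M) s := if size s == n then f s else 0.
pose spec f (p : A R * (seq G -> M)) := Kc R p.2 /\
  forall s, size s = R.+1 -> f s = W p.1 s + dl p.2 s.
(* The decomposition is a function of the cochain and not of [t]: equal slices get equal components,
   and smoothness in [t] carries over. For the same reason slices are cut off outside the relevant
   length. *)
have /choice[ch chP] : forall f, exists p, Kc R.+1 f ->
    (forall s, size s = R.+2 -> dl f s = 0) -> spec f p.
  move=> f.
  have [[fK fd]|nf] := pselect (Kc R.+1 f /\ forall s, size s = R.+2 -> dl f s = 0).
    by have [c [h hK E]] := H_ex fK fd; exists (c, h).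
  by exists (0, fun=> 0) => fK fd; case: nf.
pose f0 t := cut R.+1 (Phi t).
have f0d t s : size t = P -> size s = R.+2 -> dl (f0 t) s = 0.
  move=> tP sR; rewrite -[RHS](Pd t s) //; apply: eq_dl => u us.
  by rewrite /f0 /cut; rewrite sR in us; case: us => ->; rewrite eqxx.
have f0K t : size t = P -> Kc R.+1 (f0 t).
  move=> tP; split=> [|i s ii sR|//].
    have [u [v E]] := Ps; exists v => s s' sR ss'.
    rewrite /f0 /cut -(eqvs_size ss'); case: ifP => // _.
    by apply: E => //; exact: eqvs_refl.
  rewrite /f0 /cut size_map sR eqxx -[in RHS]Pe ii; congr (Phi _ _).
  by rewrite -[LHS]map_id; apply: eq_map => y; rewrite pg_mul1.
have spec0 t : size t = P -> spec (f0 t) (ch (f0 t)).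
  by move=> tP; apply: chP; [exact: f0K|move=> s; exact: f0d].
pose c0 t := (ch (f0 t)).1; pose h0 t := (ch (f0 t)).2.
have K0 t : size t = P -> Kc R (h0 t) by move=> /spec0[].
have E0 t s : size t = P -> size s = R.+1 -> Phi t s = W (c0 t) s + dl (h0 t) s.
  move=> tP sR; have [_ /(_ s sR)] := spec0 t tP.
  by rewrite {1}/f0 /cut sR eqxx.
(* Translating the decomposition of the slice at [t] by [x] decomposes the slice at [pi x] times
   [t]; uniqueness compares the two classes. *)
have c0e x t : size t = P -> c0 (map (pg_mul (pi x)) t) = actA (pi x) (c0 t).
  move=> tP; apply/eqP; rewrite -subr_eq0; apply/eqP.
  pose h1 s := act x (h0 t (map (pg_mul (inv x)) s)).
  apply: (@H_un _ _ (fun s => h1 s - h0 (map (pg_mul (pi x)) t) s)).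
    by apply: Kc_sub; [apply: Kc_conj; exact: K0|apply: K0; rewrite size_map].
  move=> s sR; rewrite W_sub dlB.
  pose s1 := map (pg_mul (inv x)) s.
  have s1E : s = map (pg_mul x) s1.
    by rewrite /s1 -map_comp -[LHS]map_id; apply: eq_map => y /=; rewrite pg_mulVKl.
  have s1R : size s1 = R.+1 by rewrite size_map.
  have E1 := E0 (map (pg_mul (pi x)) t) s; rewrite size_map in E1.
  have E2 : dl h1 s = act x (dl (h0 t) s1).
    by rewrite (dl_morph _ _ (act_add x)) /s1 dl_map.
  have E3 : Phi (map (pg_mul (pi x)) t) s = act x (W (c0 t) s1) + dl h1 s.
    by rewrite E2 -actD -E0 // -Pe -s1E.
  rewrite {2}s1E W_equiv //; have := E3; rewrite E1 // => /eqP.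
  rewrite -subr_eq0 => /eqP E4; rewrite E2; apply/eqP; rewrite -subr_eq0 -E4; apply/eqP.
  rewrite E2; zmod.
have [lift liftP] := choice pi_surj.
pose hd t := if t is a :: _ then lift a else pg_one G.
pose h t s := if (size t == P) && (size s == R) then
  act (hd t) (h0 (map (pg_mul (inv (pi (hd t)))) t) (map (pg_mul (inv (hd t))) s)) else 0.
pose beta t := if size t == P then c0 t else 0.
have sP t n (E : size t = n) x : size (map (@pg_mul Q x) t) = n by rewrite size_map.
have he : equivb h.
  move=> y t s; rewrite /h !size_map; case: ifP => [/andP[/eqP tP /eqP sR]|_]; last by rewrite act0.
  case: t tP => [tP|a t tP]; first by rewrite -tP in P0.
  have -> : hd (map (pg_mul (pi y)) (a :: t)) = lift (pi y ** a) by [].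
  have -> : hd (a :: t) = lift a by [].
  set x := lift a; set x' := lift _.
  have px : pi x = a by exact: liftP.
  have px' : pi x' = pi y ** a by exact: liftP.
  (* The chosen lift of [pi y ** a] and the product of [y] with the lift of [a] differ by an element
     of the kernel, under which [h0] is already equivariant. *)
  pose i := inv x ** inv y ** x'.
  have ii : pi i = pg_one Q by rewrite !piM px' !piV px -!pg_mulA pg_mulKl pg_mulV.
  have xi : x' = y ** (x ** i) by rewrite /i -!pg_mulA !pg_mulVKl.
  clearbody i.
  have -> : map (pg_mul (inv (pi x'))) (map (pg_mul (pi y)) (a :: t)) =
      map (pg_mul (inv (pi x))) (a :: t).
    rewrite px px' /=; congr (_ :: _); first by rewrite pg_invM -!pg_mulA pg_mulKl.
    by rewrite -map_comp; apply: eq_map => z /=; rewrite pg_invM -!pg_mulA pg_mulKl.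
  have [_ hi _] := K0 (map (pg_mul (inv (pi x))) (a :: t)) (sP _ _ tP _).
  rewrite [X in act X _ = _]xi !actM; congr (act y (act x _)); rewrite -(hi i) ?size_map //; congr (h0 _ _).
  by rewrite -!map_comp; apply: eq_map => z /=; rewrite xi !pg_invM -!pg_mulA !pg_mulKl pg_mulVKl.
have hE t s : size t = P -> size s = R.+1 -> Phi t s = W (beta t) s + dl (h t) s.
  move=> tP sR; rewrite /beta tP eqxx.
  set x := hd t; set t1 := map (pg_mul (inv (pi x))) t.
  set s1 := map (pg_mul (inv x)) s.
  have s1E : s = map (pg_mul x) s1.
    by rewrite /s1 -map_comp -[LHS]map_id; apply: eq_map => y /=; rewrite pg_mulVKl.
  have t1E : t = map (pg_mul (pi x)) t1.
    by rewrite /t1 -map_comp -[LHS]map_id; apply: eq_map => y /=; rewrite pg_mulVKl.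
  have t1P : size t1 = P by rewrite size_map.
  have s1R : size s1 = R.+1 by rewrite size_map.
  rewrite {1}t1E {1}s1E Pe E0 // actD -W_equiv // -s1E -c0e // -t1E; congr (_ + _).
  rewrite (dl_morph _ _ (act_add x)) /s1 dl_map; apply: eq_dl => u us.
  by rewrite sR in us; case: us => us; rewrite /h tP us !eqxx.
exists beta, h; split=> //.
- have [u [v E]] := Ps; exists u => t t' tP tt'.
  rewrite /beta -(eqvs_size tt') tP eqxx /c0; congr (_ (ch _)); apply: funext => s.
  by rewrite /f0 /cut; case: ifP => // /eqP sR; apply: E => //; exact: eqvs_refl.
- by move=> x t tP; rewrite /beta size_map tP eqxx c0e.
- have [u1 [v1 E]] := Ps.
  have f0u t t' : size t = P -> eqvs u1 t t' -> f0 t = f0 t'.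
    move=> tP tt'; apply: funext => s; rewrite /f0 /cut; case: ifP => // /eqP sR.
    by apply: E => //; exact: eqvs_refl.
  pose Pt t v := forall s s', size s = R -> eqvs v s s' -> h0 t s = h0 t s'.
  (* Each [h0 t] has its own level; only finitely many slices occur modulo [u1], so one level serves
     all. *)
  have [v2 hv2] : exists v, forall t, size t = P -> Pt t v.
    have [L HL] := eqvs_fin u1 P.
    have [w Hw] : exists v, forall t, t \in L -> size t = P -> Pt t v.
      elim: L {HL} => [|t L [w Hw]]; first by exists (pg_lev0 G).
      have [tP|tP] := eqVneq (size t) P; last first.
        exists w => t'; rewrite inE => /orP[/eqP -> /eqP|/Hw//].
        by rewrite (negbTE tP).
      have [[w1 Hw1] _ _] := K0 t tP; have [w2 w12] := pg_dir w w1.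
      exists w2 => t'; rewrite inE => /orP[/eqP -> _|t'L t'P] s s' sR ss'.
        by apply: Hw1 => //; apply: eqvs_sub ss' => x y /w12[].
      by apply: Hw => //; apply: eqvs_sub ss' => x y /w12[].
    exists w => t tP; have [t' t'L tt'] := HL t tP.
    rewrite /Pt /h0 (f0u _ _ tP tt'); apply: Hw => //; by rewrite -(eqvs_size tt').
  have [v3 av3] := act_smooth; have [v vE] := pg_dir v2 v3.
  have [u2 ou2] := pi_open v; have [u uE] := pg_dir u1 u2.
  exists u, v => t t' s s' tP sR tt' ss'.
  rewrite /h -(eqvs_size tt') -(eqvs_size ss') tP sR !eqxx /=.
  case: t t' tP tt' => [|a t] [|b t'] //; first by move=> tP; rewrite -tP in P0.
  move=> tP tt'; have [ab _] := tt'; rewrite [hd _]/= [hd _]/=.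
  set x := lift a; set x' := lift b.
  have px : pi x = a by exact: liftP.
  have px' : pi x' = b by exact: liftP.
  (* Lifts of close elements need not be close. By [pi_open] they are so up to a kernel element [i],
     absorbed by the equivariance of [h0]; the remaining factor [e] is close to 1 and acts
     trivially. *)
  have [i ii xi] : exists2 i, pi i = pg_one Q & pg_eqv v (inv x ** x') i.
    apply: ou2; rewrite piM piV px px'.
    have [_ ab2] := uE _ _ ab; have := pg_eqvl (inv a) ab2.
    by rewrite pg_mulV => /pg_sym.
  pose e := inv i ** (inv x ** x').
  have x'E : x' = x ** (i ** e) by rewrite /e !pg_mulVKl.
  have e1 : pg_eqv v e (pg_one G) by rewrite -(pg_mulV i); exact: pg_eqvl.
  clearbody e.
  set w := map _ (a :: t); set w' := map _ (b :: t').
  have wP : size w = P by rewrite size_map.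
  have ww' : h0 w = h0 w'.
    rewrite /h0 (f0u w w') //; apply: eqvs_mul; last by apply: eqvs_sub tt' => p q /uE[].
    by rewrite px px'; apply: pg_eqvV; have [] := uE _ _ ab.
  rewrite -ww'. rewrite [X in _ = act X _]x'E !actM; congr (act x).
  have [_ hi _] := K0 w wP.
  have {}e1' : forall m, act e m = m by move=> m; apply: av3; have [] := vE _ _ e1.
  rewrite e1' -hi ?size_map -?(eqvs_size ss') //.
  apply: hv2; rewrite ?size_map //; rewrite -map_comp.
  apply: (@eqvs_sub _ v); first by move=> p q /vE[].
  have -> : map (pg_mul i \o pg_mul (inv x')) s' = map (pg_mul (i ** inv x')) s'.
    by apply: eq_map => z /=; rewrite pg_mulA.
  apply: eqvs_mul => //.
  rewrite x'E !pg_invM !pg_mulA.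
  have := pg_eqvr (inv i ** inv x) (pg_eqvl i (pg_eqvV e1)).
  by rewrite pg_inv1 pg_mulr1 !pg_mulA pg_mulrV pg_mul1 => /pg_sym.
- split=> //.
  + move=> t; rewrite /h; case: ifP => // /andP[/eqP tP /eqP /= R0].
    by have [_ _ /= ->] := K0 _ (sP _ _ tP (inv (pi (hd t)))); rewrite act0.
  + by move=> t s; rewrite /h -negb_and => /negbTE ->.
  + by move=> t /negbTE tP; rewrite /beta tP.
Qed.

(* [n] is the total number of arguments, i.e. the total degree plus 2. *)
Definition totl n (Phi : seq Q -> seq G -> M) := [/\
  forall t s, ~~ [&& t != [::], s != [::] & (size t + size s == n)%N] -> Phi t s = 0,
  forall p q, jsmooth p q Phi & equivb Phi].

(* [r] is the number of arguments, so that this is the truncation in degrees [< r]. *)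
Definition truncl r (Phi : seq Q -> seq G -> M) :=
  (forall t s, (r < size s)%N -> Phi t s = 0) /\
  forall t s, size s = r.+1 -> dl (Phi t) s = 0.

(** The product of a cochain of [Q] with coefficients in inertia classes and the cocycles that
    realize these classes. *)
Definition TT r (alpha : seq Q -> A r) t s := if size s == r.+1 then W (alpha t) s else 0.

Definition cochA P r (alpha : seq Q -> A r) := [/\ forall t, size t != P -> alpha t = 0,
  smooth P alpha, alpha [::] = 0 &
  forall x t, alpha (map (pg_mul (pi x)) t) = actA (pi x) (alpha t)].

Definition cocA P r (alpha : seq Q -> A r) :=
  cochA P alpha /\ forall t, size t = P.+1 -> dl alpha t = 0.

Lemma tot_nil n Phi : totl n Phi -> (forall t, Phi t [::] = 0) /\ (forall s, Phi [::] s = 0).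
Proof. by move=> [P _ _]; split=> [t|s]; apply: P; rewrite ?andbF. Qed.

Lemma tot_sub n Phi Psi : totl n Phi -> totl n Psi -> totl n (fun t s => Phi t s - Psi t s).
Proof.
move=> [P Ps Pe] [R Rs Re]; split=> [t s h|p q|].
- by rewrite P ?R ?subrr.
- exact: (jsmooth_op2 (fun a b => a - b)).
- exact: equivb_sub.
Qed.

Lemma tot_add n Phi Psi : totl n Phi -> totl n Psi -> totl n (fun t s => Phi t s + Psi t s).
Proof.
move=> [P Ps Pe] [R Rs Re]; split=> [t s h|p q|].
- by rewrite P ?R ?addr0.
- exact: (jsmooth_op2 +%R).
- by move=> x t s; rewrite Pe Re actD.
Qed.

Lemma tot_zero n : totl n (fun _ _ => 0).
Proof. by split=> [//|p q|x t s]; [exact: jsmooth_cst|rewrite act0]. Qed.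

Lemma tot_dtot n Psi : totl n Psi -> totl n.+1 (dtot Psi).
Proof.
move=> T; have [Psi0 Psi1] := tot_nil T; case: T => P Ps Pe.
split=> [t s|p q|]; [|exact: jsmooth_dtot|exact: equivb_dtot].
case: t => [|a t] /= h.
  rewrite /dtot /= add0r dl_zero ?sgn0 // => u _; exact: Psi1.
case: s h => [|b s] /= h.
  rewrite /dtot [dl (Psi _) _]/= sgn0 addr0; apply: dl_zero => u _; exact: Psi0.
rewrite /dtot dl_zero => [|u us]; last first.
  by apply: P; apply: contra h => /and3P[_ _ /eqP E]; apply/eqP; move: us E => /=; lia.
rewrite add0r dl_zero ?sgn0 // => u us.
by apply: P; apply: contra h => /and3P[_ _ /eqP E]; apply/eqP; move: us E => /=; lia.
Qed.

Lemma tot_TT n r (alpha : seq Q -> A r) P : cochA P alpha -> (P + r.+1 = n)%N -> totl n (TT alpha).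
Proof.
move=> [a0 as_ an ae] Pn; split=> [t s|p q|x t s].
- rewrite /TT => h; have [sr|//] := eqVneq (size s) r.+1.
  have [tP|tP] := eqVneq (size t) P; last by rewrite (a0 _ tP) W0.
  case: t tP h => [|b t] tP h; first by rewrite an W0.
  by case: s sr h => // c s sr; rewrite sr tP Pn eqxx.
- have [qr|qr] := eqVneq q r.+1; last first.
    apply: (eq_jsmooth (f := fun _ _ => 0)); last exact: jsmooth_cst.
    by move=> t s _ sq; rewrite /TT sq (negbTE qr).
  have [pP|pP] := eqVneq p P; last first.
    apply: (eq_jsmooth (f := fun _ _ => 0)); last exact: jsmooth_cst.
    by move=> t s tp _; rewrite /TT a0 ?W0 ?if_same // tp.
  rewrite {p}pP {q}qr; have [u Eu] := as_.
  have [L HL] := eqvs_fin u P.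
  have [v Ev] : exists v, forall t, t \in L -> forall s s', size s = r.+1 -> eqvs v s s' ->
      W (alpha t) s = W (alpha t) s'.
    elim: L {HL} => [|t L [v Hv]]; first by exists (pg_lev0 G).
    have [w Hw] := W_smooth (alpha t); have [w2 w2E] := pg_dir v w.
    exists w2 => t'; rewrite inE => /orP[/eqP ->|t'L] s s' sr ss'.
      by apply: Hw => //; apply: eqvs_sub ss' => x y /w2E[].
    by apply: Hv => //; apply: eqvs_sub ss' => x y /w2E[].
  exists u, v => t t' s s' tP sr tt' ss'.
  rewrite /TT -(eqvs_size ss') sr eqxx -(Eu t t') //.
  by have [t1 t1L tt1] := HL t tP; rewrite (Eu t t1) //; exact: Ev.
- rewrite /TT size_map; case: eqP => [sr|_]; last by rewrite act0.
  by rewrite ae W_equiv.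
Qed.

Lemma tot_TT_sub n r (alpha : seq Q -> A r) : cochA (n - r.+1)%N alpha -> totl n (TT alpha).
Proof.
move=> ac; have [rn|nr] := leqP r.+1 n; first by apply: tot_TT ac _; rewrite subnK.
suff -> : TT alpha = fun _ _ => 0 by exact: tot_zero.
apply: funext => t; apply: funext => s; have [a0 _ an _] := ac.
suff E : alpha t = 0 by rewrite /TT E W0 if_same.
have [tP|tP] := eqVneq (size t) (n - r.+1)%N; last exact: a0.
by case: t tP => //= b t; rewrite (eqP (ltnW nr)).
Qed.

(** As [W] takes cocycles for values, only the horizontal differential survives. *)
Lemma dtot_TT P r (alpha : seq Q -> A r) t s : cochA P alpha -> t <> [::] ->
  dtot (TT alpha) t s = TT (dl alpha) t s.
Proof.
move=> [a0 _ an _] t0; rewrite /dtot {2}/TT [X in _ + X](_ : _ = 0) ?addr0.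
  rewrite /TT; case: ifP => _; last by rewrite dl_zero.
  by rewrite [RHS](dl_morph (u := fun a => W a s) alpha t (fun a b => W_sub a b s)).
rewrite [dl _ _](_ : _ = 0) ?sgn0 //.
have [sr|sr] := eqVneq (size s) r.+2; last first.
  apply: dl_zero => u us; rewrite /TT; case: eqP => // ur.
  by case/eqP: sr; rewrite -us ur.
rewrite -[RHS](W_closed (alpha t) sr); apply: eq_dl => u us.
by rewrite /TT; rewrite sr in us; case: us => ->; rewrite eqxx.
Qed.

Fixpoint Tspan R (n : nat) (F : seq Q -> seq G -> M) : Prop :=
  if R is r.+1 then exists (alpha : seq Q -> A r) F',
    [/\ cocA (n - r.+1)%N alpha, Tspan r n F' & forall t s, F t s = TT alpha t s + F' t s]
  else forall t s, F t s = 0.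

Lemma cocA0 P r : cocA P (fun=> 0 : A r).
Proof.
split; last by move=> t _; rewrite dl_zero.
by split=> // [|x t]; [exact: smooth_cst|rewrite actA0].
Qed.

Lemma equivb_guard P R (beta : seq Q -> A R) : (0 < P)%N ->
  smooth P beta -> (forall t, size t != P -> beta t = 0) ->
  (forall x t, size t = P -> beta (map (pg_mul (pi x)) t) = actA (pi x) (beta t)) ->
  cochA P beta.
Proof.
move=> P0 bs b0 be; split=> // [|x t]; first by apply: b0; rewrite eq_sym -lt0n.
have [tP|tP] := eqVneq (size t) P; first exact: be.
by rewrite !b0 ?actA0 ?size_map.
Qed.

(** The truncation makes every slice in the top inertia degree a cocycle, so [family_decomposition]
    applies to it. The sign put on [h] cancels the one in [dtot]. *)
Lemma top_component R n Phi : totl n Phi -> truncl R.+1 Phi -> (R.+1 < n)%N ->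
  exists (beta : seq Q -> A R) (Psi : seq Q -> seq G -> M),
  [/\ cochA (n - R.+1)%N beta, totl n.-1 Psi, (forall t s, size s != R -> Psi t s = 0) &
   forall t s, t <> [::] -> size s = R.+1 -> Phi t s = TT beta t s + dtot Psi t s].
Proof.
move=> T tr Rn; have [Phi0 Phi1] := tot_nil T; case: (T) => P Ps Pe.
have P0 : (0 < n - R.+1)%N by rewrite subn_gt0.
have [beta [h [bs be hs he [hn h0 b0 hE]]]] :=
  family_decomposition P0 (Ps _ R.+1) Pe Phi0 (fun t s _ => tr.2 t s).
have bc := equivb_guard P0 bs b0 be.
have E2 t s : size s = R.+1 -> size t != (n - R.+1)%N -> Phi t s = 0.
  move=> sR tP; apply: P; apply: contra tP => /and3P[_ _ /eqP <-].
  by rewrite sR addnK.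
exists beta, (fun t s => sgn (size t) (h t s)); split=> //.
- split=> [t s|p q|x t s].
  + have [->|sn] := eqVneq s [::]; first by rewrite hn sgn0.
    move=> nh; rewrite h0 ?sgn0 //; apply: contraR nh; rewrite negb_or !negbK.
    move=> /andP[/eqP tP /eqP sR]; rewrite -size_eq0 tP sR -lt0n P0 /=.
    by apply/eqP; lia.
  + apply: (eq_jsmooth (f := fun t s => sgn p (h t s))) => [t s -> //|].
    apply: jsmooth_op1.
    have [/andP[/eqP -> /eqP ->] //|npq] := boolP ((p == (n - R.+1)%N) && (q == R)).
    apply: (eq_jsmooth (f := fun _ _ => 0)); last exact: jsmooth_cst.
    by move=> t s tp sq; rewrite h0 // tp sq -negb_and.
  + by rewrite he size_map sgn_act.
- by move=> t s sR; rewrite h0 ?sgn0 // sR orbT.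
- move=> t s t0 sR; rewrite /dtot dl_zero ?add0r => [|u _]; last first.
    by rewrite h0 ?sgn0 // sR (gtn_eqF (ltnSn R)) orbT.
  rewrite -(dl_morph _ _ (sgnB _)) sgnK /TT sR eqxx.
  have [tP|tP] := eqVneq (size t) (n - R.+1)%N; first exact: hE.
  rewrite E2 // b0 // W0 dl_zero ?addr0 // => u _.
  by rewrite h0 // tP.
Qed.

(** Once the top row is 0, the total cocycle condition in that row loses its horizontal part and
    says that the row below is closed in the inertia direction. *)
Lemma trunc_lower R n Phi : totl n Phi ->
  (forall t s, (R < size s)%N -> Phi t s = 0) ->
  (forall t s, t <> [::] -> size s = R.+1 -> dtot Phi t s = 0) -> truncl R Phi.
Proof.
move=> T v d; have [_ Phi1] := tot_nil T; split=> // t s sR.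
case: t => [|a t]; first by rewrite dl_zero.
have := d (a :: t) s; rewrite /dtot dl_zero => [/(_ _ sR)|u _]; last by apply: v; rewrite sR.
rewrite add0r => E; have t0 : a :: t <> [::] by [].
have /(congr1 (sgn (size (a :: t)))) := E t0; by rewrite sgnK sgn0.
Qed.

Lemma Kc_slice n Phi t R : totl n Phi -> Kc R (Phi t).
Proof.
move=> T; have [Phi0 _] := tot_nil T; case: T => _ Ps Pe; split=> // [|i s ii _].
  have [u [v E]] := Ps (size t) R; exists v => s s' sR ss'; apply: E => //; exact: eqvs_refl.
rewrite -Pe ii; congr (Phi _ _); rewrite -[LHS]map_id; apply: eq_map => y; by rewrite pg_mul1.
Qed.

(** Writes the total differential in the top row as [W] of [dl beta] plus an inertia coboundary, the
    shape to which [H_un] applies. *)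
Lemma top_dtot R n P Phi Psi (beta : seq Q -> A R) t s :
  totl n Phi -> totl n.-1 Psi -> (0 < n)%N -> cochA P beta ->
  (forall t s, t <> [::] -> size s = R.+1 -> Phi t s = TT beta t s + dtot Psi t s) ->
  t <> [::] -> size s = R.+1 -> dtot Phi t s =
    W (dl beta t) s + dl (fun s => sgn (size t) (Phi t s - dtot Psi t s)) s.
Proof.
move=> TP Tpsi n0 [_ _ bn _] E t0 sR; have [Phi0 Phi1] := tot_nil TP.
have [_ dPsi1] := tot_nil (tot_dtot Tpsi).
rewrite {1}/dtot (eq_dl (h := fun u => W (beta u) s + dtot Psi u s)) => [|u _]; last first.
  case: u => [|a u]; first by rewrite Phi1 dPsi1 bn W0 addr0.
  by rewrite E // /TT sR eqxx.
rewrite dlD -(dl_morph (u := fun a => W a s) beta t (fun a b => W_sub a b s)) -addrA.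
congr (_ + _); have := dtot_dtot Psi t s; rewrite {1}/dtot => /(canRL (addrK _)) ->.
rewrite -(dl_morph (u := sgn (size t)) _ _ (sgnB _)) dlB sgnB; zmod.
Qed.

Lemma dl_support P r (alpha : seq Q -> A r) t : cochA P alpha -> size t != P.+1 -> dl alpha t = 0.
Proof.
move=> [a0 _ _ _] tP; rewrite dl_zero // => u us; apply: a0; apply: contra tP => /eqP <-.
by rewrite us.
Qed.

Lemma dtot_high R (Psi : seq Q -> seq G -> M) t s : (forall t s, size s != R -> Psi t s = 0) -> (R.+1 < size s)%N ->
  dtot Psi t s = 0.
Proof.
move=> P0 Rs; rewrite /dtot !dl_zero ?sgn0 ?addr0 // => u us; apply: P0.
  by move: us Rs; lia.
by rewrite gtn_eqF // ltnW.
Qed.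

Lemma top_component_gen R n Phi : totl n Phi -> truncl R.+1 Phi ->
  exists (beta : seq Q -> A R) (Psi : seq Q -> seq G -> M),
  [/\ cochA (n - R.+1)%N beta, totl n.-1 Psi, (forall t s, size s != R -> Psi t s = 0) &
   forall t s, t <> [::] -> size s = R.+1 -> Phi t s = TT beta t s + dtot Psi t s].
Proof.
move=> T tr; have [Rn|Rn] := ltnP R.+1 n; first exact: top_component.
exists (fun=> 0), (fun _ _ => 0); split=> //; [by case: (cocA0 (n - R.+1)%N R)|exact: tot_zero|].
move=> t s t0 sR; rewrite /TT W0 if_same add0r /dtot !dl_zero ?sgn0 ?addr0 //.
case: T => -> //; case: t t0 => //= a t _.
by rewrite negb_and; apply/orP; right; lia.
Qed.

Lemma remainder_high R Phi Psi (beta : seq Q -> A R) n : totl n Phi -> totl n (dtot Psi) ->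
  cochA (n - R.+1)%N beta -> truncl R.+1 Phi -> (forall t s, size s != R -> Psi t s = 0) ->
  (forall t s, t <> [::] -> size s = R.+1 -> Phi t s = TT beta t s + dtot Psi t s) ->
  forall t s, (R < size s)%N -> Phi t s - TT beta t s - dtot Psi t s = 0.
Proof.
move=> T Td bc tr Pv E t s; rewrite leq_eqVlt => /orP[/eqP/esym sR|Rs].
  have [_ Phi1] := tot_nil T; have [_ dPsi1] := tot_nil Td.
  case: t => [|a t]; last by rewrite E //; zmod.
  by rewrite Phi1 dPsi1 /TT; case: bc => _ _ -> _; rewrite W0 if_same !subr0.
by rewrite tr.1 // /TT gtn_eqF // (dtot_high _ Pv) // !subr0.
Qed.

(** Descent on the top inertia degree. By [top_dtot] and [H_un] the top coefficient [beta] is a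
    cocycle of [Q]; subtracting its product with [W] and the boundary of [Psi0] leaves a total
    cocycle truncated one degree lower. *)
Theorem total_cocycle_decomposition R n Phi : (1 < n)%N -> totl n Phi -> truncl R Phi ->
  (forall t s, t <> [::] -> s <> [::] -> dtot Phi t s = 0) ->
  exists F Psi, [/\ Tspan R n F, totl n.-1 Psi &
    forall t s, t <> [::] -> s <> [::] -> Phi t s = F t s + dtot Psi t s].
Proof.
move=> n1; elim: R Phi => [|R IH] Phi T tr d.
  exists (fun _ _ => 0), (fun _ _ => 0); split=> //; first exact: tot_zero.
  by move=> t [//|b s] _ _; rewrite tr.1 // /dtot !dl_zero ?sgn0 ?addr0.
have [beta [Psi0 [bc Pt Pv PE]]] := top_component_gen T tr.
have Td : totl n (dtot Psi0) by rewrite -[n]prednK ?(ltnW n1) //; exact: tot_dtot.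
have bd t : dl beta t = 0.
  have [tP|tP] := eqVneq (size t) (n - R.+1)%N.+1; last exact: (dl_support bc).
  have t0 : t <> [::] by case: t tP.
  apply: (@H_un _ _ (fun s => - sgn (size t) (Phi t s - dtot Psi0 t s))).
    have [hs hi h0] := Kc_slice t R (tot_sub T Td).
    split; first by apply: (smooth_op1 (fun m => - sgn (size t) m)).
      by move=> i s ii sR; rewrite hi // sgn_act actN.
    by rewrite h0 sgn0 oppr0.
  move=> s sR; have s0 : s <> [::] by case: s sR.
  have := d t s t0 s0; rewrite (top_dtot T Pt _ bc PE) ?(ltnW n1) // dlN.
  by move=> /eqP; rewrite addr_eq0 => /eqP.
have bcoc : cocA (n - R.+1)%N beta by split.
pose Phi' t s := Phi t s - TT beta t s - dtot Psi0 t s.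
have TT_tot := tot_TT_sub bc.
have T' : totl n Phi' by do 2![apply: tot_sub => //].
have v' := remainder_high T Td bc tr Pv PE.
have d' t s : t <> [::] -> s <> [::] -> dtot Phi' t s = 0.
  move=> t0 s0; rewrite /Phi' !dtotB d // dtot_dtot (dtot_TT _ bc) //.
  by rewrite /TT bd W0 if_same !subr0.
have [F [Psi [Fs TPsi FE]]] : exists F Psi, [/\ Tspan R n F, totl n.-1 Psi &
    forall t s, t <> [::] -> s <> [::] -> Phi' t s = F t s + dtot Psi t s].
  apply: IH => //; apply: trunc_lower T' v' _ => t s t0 sR; apply: d' => //.
  by case: s sR.
exists (fun t s => TT beta t s + F t s), (fun t s => Psi0 t s + Psi t s); split.
- by exists beta, F.
- exact: tot_add.
move=> t s t0 s0; rewrite dtotD; have := FE t s t0 s0; rewrite /Phi' => /eqP.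
rewrite subr_eq => /eqP/(canRL (subrK _)) ->; zmod.
Qed.

(** The same descent on the primitive [Psi]: its top coefficient [beta] satisfies
    [alpha R = dl beta] by [H_un], and the product of [beta] with [W] is removed from [Psi] before
    passing to the next row. *)
Theorem coboundary_components R n Psi (alpha : forall r, seq Q -> A r) : (1 < n)%N ->
  totl n.-1 Psi -> truncl R Psi ->
  (forall r, (r < R)%N -> cocA (n - r.+1)%N (alpha r)) ->
  (forall t s, t <> [::] -> s <> [::] ->
     \sum_(r < R) TT (alpha r) t s = dtot Psi t s) ->
  forall r, (r < R)%N -> exists2 beta, cochA (n - r.+1)%N.-1 beta &
    forall t, size t = (n - r.+1)%N -> alpha r t = dl beta t.
Proof.
move=> n1; elim: R Psi => [//|R IH] Psi T tr ac E.
have [beta [Psi0 [bc Pt Pv PE]]] := top_component_gen T tr.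
have n0 : (0 < n.-1)%N by rewrite -ltnS prednK // ltnW.
have Td : totl n.-1 (dtot Psi0) by rewrite -[n.-1]prednK //; exact: tot_dtot.
have aE t : t <> [::] -> alpha R t = dl beta t.
  move=> t0; apply/eqP; rewrite -subr_eq0; apply/eqP.
  apply: (@H_un _ _ (fun s => sgn (size t) (Psi t s - dtot Psi0 t s))).
    have [hs hi h0] := Kc_slice t R (tot_sub T Td).
    split; first by apply: (smooth_op1 (sgn (size t))).
      by move=> i s ii sR; rewrite hi // sgn_act.
    by rewrite h0 sgn0.
  move=> s sR; have s0 : s <> [::] by case: s sR.
  have := E t s t0 s0; rewrite (top_dtot T Pt n0 bc PE) // big_ord_recr /=.
  rewrite big1 => [|r _]; last by rewrite /TT sR eqSS gtn_eqF.
  by rewrite add0r /TT sR eqxx W_sub => ->; zmod.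
pose Psi' t s := Psi t s - TT beta t s - dtot Psi0 t s.
have T' : totl n.-1 Psi' by do 2![apply: tot_sub => //]; exact: tot_TT_sub.
have v' := remainder_high T Td bc tr Pv PE.
have d' t s : t <> [::] -> s <> [::] -> \sum_(r < R) TT (alpha r) t s = dtot Psi' t s.
  move=> t0 s0; rewrite /Psi' !dtotB -E // dtot_dtot (dtot_TT _ bc) // big_ord_recr /=.
  by rewrite {3}/TT aE // -/(TT (dl beta) t s) subr0 addrK.
move=> r; rewrite ltnS leq_eqVlt => /orP[/eqP ->|rR].
  exists beta; first by have -> : ((n - R.+1).-1 = n.-1 - R.+1)%N by lia.
  move=> t tn; case: t tn => [|b t] tn; last exact: aE.
  by have [[_ _ -> _] _] := ac R (ltnSn R).
apply: (IH Psi') => // [|q qR]; last exact: ac (ltnW qR).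
apply: trunc_lower T' v' _ => t s t0 sR; rewrite -d' //; last by case: s sR.
by rewrite big1 // => q _; rewrite /TT sR eqSS gtn_eqF.
Qed.

End LerayHirsch.

(** * Cohomology of periodic functions *)

Section Periodic.
Context (B : eqType) (M : zmodType) (l nu : nat).
Hypothesis l_gt0 : (0 < l)%N.
Hypothesis tors : forall x : M, x *+ (l ^ nu) = 0.
Implicit Types (a x y : B -> nat) (s : seq (B -> nat)) (f h u v : seq (B -> nat) -> M).

Definition shn k (b : B) a : B -> nat := fun c => (a c + k * (c == b))%N.

Fixpoint agree (S : seq B) m s s' : Prop :=
  match s, s' with
  | [::], [::] => True
  | x :: s1, y :: s2 => (forall b, b \in S -> x b = y b %[mod l ^ m]) /\ agree S m s1 s2
  | _, _ => False
  end.

(** Tuples of [l]-adic integers enter only through residues, so they are modelled by [B -> nat], and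
    continuity by dependence on the coordinates in a finite [S] modulo [l ^ m]. *)
Definition per S m f := forall s s', agree S m s s' -> f s = f s'.
Definition inv (T : seq B) f := forall b s, b \in T -> f (map (shn 1 b) s) = f s.

Lemma agree_size S m s s' : agree S m s s' -> size s = size s'.
Proof. by elim: s s' => [|x s IH] [|y s'] //= [_ /IH->]. Qed.
Lemma agree_refl S m s : agree S m s s. Proof. by elim: s. Qed.
Lemma agree_shn S m k b s s' : agree S m s s' -> agree S m (map (shn k b) s) (map (shn k b) s').
Proof.
elim: s s' => [|x s IH] [|y s'] //= [xy /IH]; split=> // c cS.
by rewrite /shn -modnDml xy // modnDml.
Qed.
Lemma agree_le S m m' s s' : (m <= m')%N -> agree S m' s s' -> agree S m s s'.
Proof.
move=> mm'; elim: s s' => [|x s IH] [|y s'] //= [xy /IH]; split=> // b bS.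
have d : (l ^ m %| l ^ m')%N by exact: dvdn_exp2l.
by rewrite -(modn_dvdm (x b) d) xy // modn_dvdm.
Qed.
Lemma agree_period S m k b s : (l ^ m %| k)%N -> agree S m (map (shn k b) s) s.
Proof.
move=> mk; elim: s => //= x s IH; split=> // c _.
by rewrite /shn -modnDmr (eqP (dvdn_mulr _ mk)) addn0.
Qed.

Lemma shnC k k' b c a : shn k b (shn k' c a) = shn k' c (shn k b a).
Proof. by apply: funext => d; rewrite /shn addnAC. Qed.
Lemma shnD k k' b a : shn k b (shn k' b a) = shn (k' + k) b a.
Proof. by apply: funext => d; rewrite /shn mulnDl addnA. Qed.
Lemma map_shnC k k' b c s : map (shn k b) (map (shn k' c) s) = map (shn k' c) (map (shn k b) s).
Proof. by rewrite -!map_comp; apply: eq_map => a; exact: shnC. Qed.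

Lemma mulrn_congr (z : M) m i j : (nu <= m)%N -> i = j %[mod l ^ m] -> z *+ i = z *+ j.
Proof.
move=> num ij; have z0 k : z *+ (k * l ^ m) = 0.
  by rewrite -(subnK num) expnD mulnA mulrnA -mulrnA mulnC mulrnA tors mul0rn.
by rewrite (divn_eq i (l ^ m)) (divn_eq j (l ^ m)) !mulrnDr !z0 ij.
Qed.

(** On [x_0, ..., x_r] this is [c] times the product of the differences [x_i b_i - x_(i-1) b_i]: the
    homogeneous cup product of the coordinate homomorphisms indexed by [J]. *)
Fixpoint wl (c : M) (J : seq B) s : M :=
  match J, s with
  | [::], [:: _] => c
  | b :: J', x :: (y :: _) as s' => wl c J' s' *+ y b - wl c J' s' *+ x b
  | _, _ => 0
  end.

Definition xw b f s : M := if s is x :: _ then f s *+ x b else 0.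

Lemma dl_xw b f x y s : dl (xw b f) [:: x, y & s] =
  f (y :: s) *+ y b - (f (y :: s) - dl f [:: x, y & s]) *+ x b.
Proof.
rewrite [LHS]/= -/(dl (fun t => f (x :: t) *+ x b) (y :: s)) dlMn.
by congr (_ - _ *+ _); rewrite [dl f _]/= subKr.
Qed.

Lemma wl_closed c J s : dl (wl c J) s = 0.
Proof.
elim: J s => [|b J IH] s.
  case: s => [|x [|y [|z s]]] //=; rewrite ?subr0 ?subrr //.
  by rewrite dl_zero ?subrr // => u _; case: u.
suff E t : wl c (b :: J) t = dl (xw b (wl c J)) t.
  by rewrite (eq_dl (fun t _ => E t)) dl_dl.
by case: t => [|x [|y t]]; [|rewrite /= subrr|rewrite dl_xw IH subr0].
Qed.

(** The product becomes a coboundary once invariance under the shift of [b] is given up: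
    multiplication by the first entry's coordinate [x b] is a primitive. *)
Lemma wl_cons c b J s : wl c (b :: J) s = dl (xw b (wl c J)) s.
Proof.
by case: s => [|x [|y s]]; [|rewrite /= subrr|rewrite dl_xw wl_closed subr0].
Qed.

Lemma wl_shn c J k b s : wl c J (map (shn k b) s) = wl c J s.
Proof.
elim: J s => [|d J IH] [|x [|y s]] //; rewrite [LHS]/= [RHS]/=.
have := IH (y :: s) => /= ->; rewrite /shn !mulrnDr; zmod.
Qed.

Lemma wl_sub c c' J s : wl (c - c') J s = wl c J s - wl c' J s.
Proof.
elim: J s => [|d J IH] [|x [|y s]] //=; rewrite ?subrr //.
rewrite IH !mulrnBl; zmod.
Qed.

Lemma wl0 J s : wl 0 J s = 0.
Proof. by rewrite -[X in wl X](subrr 0) wl_sub subrr. Qed.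

Lemma wl_per S m c J : {subset J <= S} -> (nu <= m)%N -> per S m (wl c J).
Proof.
move=> JS num; elim: J JS => [|b J IH] JS [|x [|y s]] [|x' [|y' s']] //=; try by move=> [_ []].
move=> [xx' [yy' ss']]; have bS : b \in S by apply: JS; rewrite mem_head.
have {}IH : wl c J (y :: s) = wl c J (y' :: s').
  by apply: IH => [z zJ|]; [apply: JS; rewrite inE zJ orbT|].
by rewrite IH; congr (_ - _); apply: (mulrn_congr _ num); [exact: yy'|exact: xx'].
Qed.

Fixpoint subs (T : seq B) r : seq (seq B) :=
  match T, r with
  | _, 0 => [:: [::]]
  | [::], _.+1 => [::]
  | b :: T', r'.+1 => map (cons b) (subs T' r') ++ subs T' r
  end.

Lemma subs_mem T r J : J \in subs T r -> size J = r /\ {subset J <= T}.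
Proof.
elim: T r J => [|b T IH] [|r] J //=; try by rewrite inE => /eqP ->.
rewrite mem_cat => /orP[/mapP[J' /IH[<- JT] ->]|/IH[-> JT]]; split=> // c.
  by rewrite !inE => /orP[->//|/JT ->]; rewrite orbT.
by move=> /JT cT; rewrite inE cT orbT.
Qed.

Lemma sum_period (F : nat -> M) p k : (forall i, F (i + p)%N = F i) ->
  \sum_(i < k * p) F i = (\sum_(i < p) F i) *+ k.
Proof.
move=> Fp; have Fkp q i : F (q * p + i)%N = F i.
  by elim: q => [|q IH]; rewrite ?mul0n // mulSn addnAC addnC addnA -IH -[RHS]Fp; congr F; lia.
elim: k => [|k IH]; first by rewrite mul0n big_ord0 mulr0n.
rewrite mulSn addnC big_split_ord /= IH mulrSr; congr (_ + _).
by apply: eq_bigr => i _; exact: Fkp.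
Qed.

(* Sums of a periodic torsion function are periodic, whence antiderivatives. *)
Lemma antiderivative S m b v T : per S m v -> inv T v -> v [::] = 0 -> b \in S -> b \notin T ->
  exists v', [/\ per S (m + nu) v', inv T v', v' [::] = 0 &
    forall s, v' (map (shn 1 b) s) - v' s = v s].
Proof.
move=> vp vi v0 bS bT; pose K := (l ^ (m + nu))%N.
have K0 : (0 < K)%N by rewrite expn_gt0 l_gt0.
pose F s i := v (map (shn i b) s).
have Fs s i : F (map (shn 1 b) s) i = F s i.+1.
  by rewrite /F -map_comp; congr v; apply: eq_map => a /=; rewrite shnD.
have FD s i j : (l ^ m %| j)%N -> F s (i + j)%N = F s i.
  move=> mj; rewrite /F; apply: vp.
  have -> : map (shn (i + j) b) s = map (shn j b) (map (shn i b) s).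
    by rewrite -map_comp; apply: eq_map => a /=; rewrite shnD.
  exact: agree_period.
have F0 s : F s 0 = v s.
  by rewrite /F; congr v; rewrite -[RHS]map_id; apply: eq_map => a; apply: funext => c; rewrite /shn addn0.
have mK : (l ^ m %| K)%N by apply: dvdn_exp2l; rewrite leq_addr.
(* Shifting by [K - x b %% K] acts as the shift by [- x b], so [v'] sums [v] along the path that
   starts where the first entry has coordinate 0 at [b] and stops just before [s]. *)
pose v' s := if s is x :: _ then \sum_(i < x b %% K) F s (K - x b %% K + i)%N else 0.
exists v'; split=> //.
- move=> [|x s] [|y s'] //= [xy ss']; rewrite /K xy //; apply: eq_bigr => i _.
  apply: vp; apply: (@agree_shn _ _ _ _ (x :: s) (y :: s')); split=> [c cS|]; last first.
    exact: (agree_le (leq_addr nu m)).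
  have d : (l ^ m %| l ^ (m + nu))%N by exact: mK.
  by rewrite -(modn_dvdm (x c) d) xy // modn_dvdm.
- move=> c [|x s] cT //=; have cb : b == c = false by apply: contraNF bT => /eqP ->.
  have -> : shn 1 c x b = x b by rewrite /shn cb muln0 addn0.
  by apply: eq_bigr => i _; rewrite /F -[_ :: map _ s]/(map (shn 1 c) (x :: s)) map_shnC vi.
- move=> [|x s]; first by rewrite /= v0 subrr.
  set n := (x b %% K)%N; have nK : (n < K)%N by rewrite ltn_mod.
  have E : v' (map (shn 1 b) (x :: s)) =
      \sum_(i < (n + 1) %% K) F (map (shn 1 b) (x :: s)) (K - (n + 1) %% K + i)%N.
    by rewrite /v' [map _ _]/= /shn eqxx muln1 /n modnDml.
  rewrite E; set s1 := x :: s.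
  have -> : v' s1 = \sum_(i < n) F s1 (K - n + i)%N by [].
  have [n1K|] := ltnP (n + 1) K.
    rewrite modn_small // addn1; under eq_bigr do rewrite Fs.
    rewrite big_ord_recr /= -/s1.
    have -> : (K - n.+1 + n).+1 = (0 + K)%N by lia.
    rewrite FD // F0 (eq_bigr (fun i : 'I_n => F s1 (K - n + i)%N)) => [|i _].
      by rewrite addrC addrK.
    by congr F; lia.
  (* At the wrap-around the difference becomes a sum over the full period [K = l ^ nu * l ^ m],
     which is [l ^ nu] times a sum over [l ^ m] terms, hence 0. *)
  rewrite addn1 => Kn; have {}Kn : K = n.+1 by lia.
  rewrite -Kn modnn big_ord0 sub0r; apply/eqP; rewrite eq_sym -subr_eq0 opprK.
  have -> : v s1 + \sum_(i < n) F s1 (K - n + i)%N = \sum_(i < K) F s1 i.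
    rewrite Kn big_ord_recl F0; congr (_ + _); apply: eq_bigr => i _.
    by congr F; rewrite subSnn.
  have -> : K = (l ^ nu * l ^ m)%N by rewrite /K addnC expnD.
  by rewrite sum_period ?tors // => i; exact: FD.
Qed.

(** Induction on the variables. Ignoring [b] gives a primitive [u]; its defect of invariance under
    the shift of [b] is a cocycle one degree lower and provides the products containing [b]. The
    level [m'] does not depend on [f], which [inertia_H_ex] relies on. *)
Theorem periodic_cohomology S T : uniq T -> {subset T <= S} -> forall r m, (nu <= m)%N ->
  exists2 m', (m <= m')%N & forall f, per S m f -> inv T f ->
    (forall s, size s = r.+2 -> dl f s = 0) ->
    exists (c : seq B -> M) h, [/\ per S m' h, inv T h, h [::] = 0 &
      forall s, size s = r.+1 -> f s = \sum_(J <- subs T r) wl (c J) J s + dl h s].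
Proof.
elim: T => [|b T IH] /= uT TS r m num.
  (* Without invariance conditions, inserting the constant tuple [o] in front is a contracting
     homotopy; only the constants in degree 0 survive. *)
  exists m => // f fp fi fd; pose o : B -> nat := fun=> 0%N.
  case: r fd => [|r] fd.
    exists (fun=> f [:: o]), (fun=> 0); split=> // -[//|x [|//]] _.
    rewrite big_seq1 dl_zero // addr0 /=; have := fd [:: o; x] erefl.
    by rewrite /= subr0 => /eqP; rewrite subr_eq0 => /eqP.
  exists (fun=> 0), (fun s => if size s == r.+1 then f (o :: s) else 0); split=> //.
    move=> s s' ss'; rewrite (agree_size ss'); case: ifP => // _; apply: fp; split=> //.
  move=> s sr; rewrite big_nil add0r.
  have := fd (o :: s); rewrite /= sr => /(_ erefl)/eqP; rewrite subr_eq0 => /eqP ->.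
  apply: eq_dl => u; rewrite sr => -[->]; by rewrite eqxx.
have /andP[bT uT'] := uT; have bS : b \in S by apply: TS; rewrite mem_head.
have TS' : {subset T <= S} by move=> c cT; apply: TS; rewrite inE cT orbT.
have {}IH := IH uT' TS'.
case: r => [|r].
  exists m => // f fp fi fd; have [m1 _ E] := IH 0%N m num.
  have fi' : inv T f by move=> c s cT; apply: fi; rewrite inE cT orbT.
  have [c [h [_ _ h0 fE]]] := E f fp fi' fd.
  exists c, (fun=> 0); split=> // s s1; rewrite fE //; congr (_ + _).
    by case: {fp fi fi' fE E IH TS TS' uT bT uT'} T.
  by case: s s1 => [|x [|]] //= _; rewrite h0.
have [m1 mm1 E1] := IH r.+1 m num.
have [m2 m12 E2] := IH r m1 (leq_trans num mm1).
exists (m2 + nu)%N; first by lia.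
move=> f fp fi fd.
have fi' : inv T f by move=> c s cT; apply: fi; rewrite inE cT orbT.
have [c [u [up ui u0 fE]]] := E1 f fp fi' fd.
(* The cochain [f] is invariant under the shift of [b], [u] need not be. The defect [g] is closed
   because [dl u] differs from [f] by shift-invariant products. *)
pose g s := if size s == r.+1 then u (map (shn 1 b) s) - u s else 0.
have shm d s s' m0 : agree S m0 s s' -> agree S m0 (map (shn 1 d) s) (map (shn 1 d) s').
  exact: agree_shn.
have [|||c' [v [vp vi v0 gE]]] := E2 g.
- move=> s s' ss'; rewrite /g (agree_size ss'); case: ifP => // _.
  by rewrite (up _ _ ss') (up _ _ (shm b _ _ _ ss')).
- move=> d s dT; rewrite /g size_map; case: ifP => // _.
  by rewrite map_shnC !(ui d).
- move=> s sr; transitivity (dl u (map (shn 1 b) s) - dl u s).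
    rewrite dl_map -dlB; apply: eq_dl => t ts; rewrite /g; rewrite sr in ts.
    by case: ts => ->; rewrite eqxx.
  have := fE s sr; have := fE (map (shn 1 b) s); rewrite size_map fi ?mem_head // => /(_ sr) ->.
  rewrite (eq_bigr (fun J => wl (c J) J s)) => [/addrI ->|J _]; first by rewrite subrr.
  exact: wl_shn.
have [v' [v'p v'i v'0 v'E]] := antiderivative vp vi v0 bS bT.
(* The defect of [X] is the product part of [g], and that of [dl v'] is [dl v]; subtracting both
   makes [u] invariant under the shift of [b]. *)
pose X s := \sum_(J <- subs T r) xw b (wl (c' J) J) s.
pose h s := if size s == r.+1 then u s - X s - dl v' s else 0.
pose cc J := if J is d :: J' then if d == b then c' J' else c J else c J.
exists cc, h; split=> //.
- move=> s s' ss'; rewrite /h (agree_size ss'); case: ifP => // _.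
  have ss1 : agree S m1 s s' by apply: agree_le ss'; lia.
  congr (_ - _ - _); first exact: up.
    rewrite /X big_seq [in RHS]big_seq; apply: eq_bigr => J /subs_mem[_ JT].
    have wE : wl (c' J) J s = wl (c' J) J s'.
      apply: (@wl_per S m1 (c' J) J _ _ s s' ss1) => [z /JT /TS'//|]; lia.
    case: s s' ss' ss1 wE => [|x s] [|y s'] //= [xy _] _ ->.
    by apply: mulrn_congr (xy b bS); lia.
  elim: s s' v' v'p {vp vi v0 gE v'i v'0 v'E X h ss1} ss' => [|x s IHs] [|y s'] //= w wp [xy ss'].
  rewrite (wp s s') //; congr (_ - _).
  transitivity (dl (fun t => w (y :: t)) s); first by apply: eq_dl => t _; apply: wp; split=> //; exact: agree_refl.
  by apply: IHs => // t t' tt'; apply: wp.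
- move=> d s; rewrite inE /h size_map => /orP[/eqP ->|dT]; case: eqP => // sr; last first.
    rewrite (ui d) // dl_map; congr (_ - _ - _); last by apply: eq_dl => t _; rewrite v'i.
    apply: eq_bigr => J _; case: s {sr} => //= x s.
    rewrite -[_ :: map _ s]/(map (shn 1 d) (x :: s)) wl_shn; congr (_ *+ _).
    by rewrite /shn (_ : b == d = false) ?addn0 //; apply: contraNF bT => /eqP ->.
  have Eu : u (map (shn 1 b) s) = u s + (\sum_(J <- subs T r) wl (c' J) J s + dl v s).
    by rewrite -gE // /g sr eqxx addrC subrK.
  have EX : X (map (shn 1 b) s) = X s + \sum_(J <- subs T r) wl (c' J) J s.
    rewrite /X -big_split; apply: eq_bigr => J _; case: s sr {Eu} => //= x s _.
    rewrite -[_ :: map _ s]/(map (shn 1 b) (x :: s)) wl_shn.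
    by rewrite {1}/shn eqxx muln1 mulrnDr.
  have Ev : dl v' (map (shn 1 b) s) = dl v' s + dl v s.
    by rewrite dl_map -dlD; apply: eq_dl => t _; rewrite -v'E addrC subrK.
  rewrite Eu EX Ev; zmod.
move=> s sr; have -> : dl h s = dl u s - \sum_(J <- subs T r) wl (c' J) (b :: J) s.
  transitivity (dl (fun t => u t - X t - dl v' t) s).
    by apply: eq_dl => t; rewrite sr => -[tr]; rewrite /h tr eqxx.
  rewrite !dlB dl_dl subr0 /X dl_sum; congr (_ - _); apply: eq_bigr => J _.
  by rewrite wl_cons.
rewrite fE // big_cat big_map /=.
have -> : \sum_(J <- subs T r.+1) wl (cc J) J s = \sum_(J <- subs T r.+1) wl (c J) J s.
  rewrite big_seq [in RHS]big_seq; apply: eq_bigr => -[|d J] /subs_mem[_ JT] //.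
  rewrite /cc; case: eqP => // db; case/negP: bT; rewrite -db.
  by apply: JT; rewrite mem_head.
have -> : \sum_(J <- subs T r) wl (if b == b then c' J else c (b :: J)) (b :: J) s =
          \sum_(J <- subs T r) wl (c' J) (b :: J) s by rewrite eqxx.
zmod.
Qed.

(** Moving the products with [b] into the primitive, as [h - X], leaves the products without [b],
    which vanish by induction. The shift defect of [h - X] is then both minus the sum of the
    [c (b :: J)] products and a coboundary of functions invariant under [T]. *)
Theorem periodic_cohomology_inj S T : uniq T -> {subset T <= S} -> forall r m c h,
  (nu <= m)%N -> per S m h -> inv T h -> h [::] = 0 ->
  (forall s, size s = r.+1 -> \sum_(J <- subs T r) wl (c J) J s = dl h s) ->
  {in subs T r, forall J, c J = 0}.
Proof.
elim: T => [|b T IH] /= uT TS r m c h num hp hi h0 E J.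
  case: r E => [|r] E //=; rewrite inE => /eqP ->.
  by have := E [:: fun=> 0%N] erefl; rewrite big_seq1 /= h0 subr0.
have /andP[bT uT'] := uT; have bS : b \in S by apply: TS; rewrite mem_head.
have TS' : {subset T <= S} by move=> d dT; apply: TS; rewrite inE dT orbT.
have {}IH := IH uT' TS'.
have hi' : inv T h by move=> d s dT; apply: hi; rewrite inE dT orbT.
case: r E => [|r] E.
  rewrite inE => /eqP ->.
  by have := E [:: fun=> 0%N] erefl; rewrite big_seq1 /= h0 subr0.
pose X s := \sum_(J <- subs T r) xw b (wl (c (b :: J)) J) s.
have X0 : X [::] = 0 by rewrite /X big1.
have Xp : per S m X.
  move=> s s' ss'; rewrite /X big_seq [in RHS]big_seq; apply: eq_bigr => K /subs_mem[_ KT].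
  have wE : wl (c (b :: K)) K s = wl (c (b :: K)) K s'.
    by apply: (@wl_per S m _ K _ _ s s' ss') => // z /KT /TS'.
  case: s s' ss' wE => [|x s] [|y s'] //= [xy _] ->.
  by apply: mulrn_congr (xy b bS).
have Xi : inv T X.
  move=> d s dT; apply: eq_bigr => K _; case: s => //= x s.
  rewrite -[_ :: map _ s]/(map (shn 1 d) (x :: s)) wl_shn; congr (_ *+ _).
  by rewrite /shn (_ : b == d = false) ?addn0 //; apply: contraNF bT => /eqP ->.
have EX s : X (map (shn 1 b) s) = X s + \sum_(J <- subs T r) wl (c (b :: J)) J s.
  rewrite /X -big_split; apply: eq_bigr => K _; case: s => /= [|x s].
    by case: K => [|? ?] /=; rewrite addr0.
  rewrite -[_ :: map _ s]/(map (shn 1 b) (x :: s)) wl_shn.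
  by rewrite {1}/shn eqxx muln1 mulrnDr.
have dX s : dl X s = \sum_(J <- subs T r) wl (c (b :: J)) (b :: J) s.
  by rewrite /X dl_sum; apply: eq_bigr => K _; rewrite wl_cons.
have E' s : size s = r.+2 -> \sum_(J <- subs T r.+1) wl (c J) J s = dl (fun s => h s - X s) s.
  by move=> sr; rewrite dlB dX -E // big_cat big_map /= addrAC subrr add0r.
have hXp : per S m (fun s => h s - X s) by move=> s s' ss'; rewrite (hp _ _ ss') (Xp _ _ ss').
have hXi : inv T (fun s => h s - X s) by move=> d s dT; rewrite hi' ?Xi.
have hX0 : h [::] - X [::] = 0 by rewrite h0 X0 subrr.
have c0 := IH r.+1 m c _ num hXp hXi hX0 E'.
rewrite mem_cat => /orP[/mapP[K KT ->]|]; last exact: c0.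
pose h2 s := if size s == r.+1 then h s - X s else 0.
have [m' mm' PC] := periodic_cohomology uT' TS' r num.
have [|||c2 [v [vp vi v0 h2E]]] := PC h2.
- by move=> s s' ss'; rewrite /h2 (agree_size ss'); case: ifP => // _; exact: hXp.
- by move=> d s dT; rewrite /h2 size_map; case: ifP => // _; exact: hXi.
- move=> s sr; transitivity (dl (fun s => h s - X s) s).
    by apply: eq_dl => t; rewrite sr => -[tr]; rewrite /h2 tr eqxx.
  by rewrite -E' // big_seq big1 // => L /c0 ->; rewrite wl0.
pose v2 s := v s - v (map (shn 1 b) s).
apply: (IH r m' (fun J => c (b :: J)) v2 (leq_trans num mm')) KT.
- by move=> s s' ss'; rewrite /v2 (vp _ _ ss') (vp _ _ (agree_shn 1 b ss')).
- by move=> d s dT; rewrite /v2 map_shnC !(vi d).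
- by rewrite /v2 /= subrr.
move=> s sr; have := h2E s sr; have := h2E (map (shn 1 b) s); rewrite size_map => /(_ sr).
rewrite /h2 size_map sr eqxx EX hi ?mem_head //.
have -> : \sum_(J <- subs T r) wl (c2 J) J (map (shn 1 b) s) = \sum_(J <- subs T r) wl (c2 J) J s.
  by apply: eq_bigr => L _; exact: wl_shn.
move=> e1 e2; rewrite /v2 dlB -(dl_map (shn 1 b)).
set Y := \sum_(J <- subs T r) wl (c (b :: J)) J s in e1 *.
have -> : Y = (h s - X s) - (h s - (X s + Y)) by zmod.
rewrite e1 e2; zmod.
Qed.

End Periodic.

(** * Representatives modulo a level *)

Section Transversal.
Context (G : pgrp).
Local Notation "x ** y" := (pg_mul x y) (at level 40, left associativity).

Definition transversal (v : pg_lev G) (C : G -> Prop) (P : seq G) := [/\ uniq P,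
  forall p, p \in P -> C p, {in P &, forall p q, pg_eqv v p q -> p = q} &
  forall x, C x -> exists2 p, p \in P & pg_eqv v x p].

Lemma transversal_ex v C : exists P, transversal v C P.
Proof.
have [f [n fE]] := pg_fin v.
suff [P [uP CP iP sP]] : exists P, [/\ uniq P, forall p, p \in P -> C p,
    {in P &, forall p q, pg_eqv v p q -> p = q} &
    forall i x, (i < n)%N -> C x -> pg_eqv v x (f i) -> exists2 p, p \in P & pg_eqv v x p].
  by exists P; split=> // x Cx; have [i ni xi] := fE x; exact: sP ni Cx xi.
elim: n {fE} => [|n [P [uP CP iP sP]]]; first by exists [::].
have [[x [Cx xn nP]]|nx] := pselect (exists x, [/\ C x, pg_eqv v x (f n) &
    forall p, p \in P -> ~ pg_eqv v x p]).
  exists (x :: P); split.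
  - by rewrite /= uP andbT; apply/negP => /nP; apply; exact: pg_refl.
  - by move=> p; rewrite inE => /orP[/eqP ->|/CP].
  - move=> p q; rewrite !inE => /orP[/eqP ->|pP] /orP[/eqP ->|qP] //.
    + by move=> /nP => /(_ qP).
    + by move=> /pg_sym/nP => /(_ pP).
    + exact: iP.
  - move=> i y; rewrite ltnS leq_eqVlt => /orP[/eqP -> _ yn|ni Cy yi].
      by exists x; [rewrite mem_head|exact: pg_trans yn (pg_sym xn)].
    by have [p pP yp] := sP i y ni Cy yi; exists p => //; rewrite inE pP orbT.
exists P; split=> // i x; rewrite ltnS leq_eqVlt => /orP[/eqP -> Cx xn|]; last exact: sP.
have [//|np] := pselect (exists2 p, p \in P & pg_eqv v x p).
by case: nx; exists x; split=> // p pP xp; apply: np; exists p.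
Qed.

Lemma transversal_perm v C P P' : transversal v C P -> transversal v C P' ->
  exists phi : G -> G, perm_eq (map phi P) P' /\ {in P, forall p, pg_eqv v p (phi p)}.
Proof.
move=> [uP CP iP sP] [uP' CP' iP' sP'].
have /choice[phi phiE] : forall p, exists q, p \in P -> q \in P' /\ pg_eqv v p q.
  move=> p; have [/CP/sP'[q qP' pq]|] := boolP (p \in P); first by exists q.
  by exists p.
exists phi; split; last by move=> p /phiE[].
apply: uniq_perm => //.
  rewrite map_inj_in_uniq // => p q pP qP pq; apply: iP => //.
  have [_ p1] := phiE p pP; have [_ q1] := phiE q qP.
  by apply: pg_trans p1 _; rewrite pq; exact: pg_sym.
move=> q; apply/mapP/idP => [[p pP ->]|qP']; first by have [] := phiE p pP.
have [p pP qp] := sP q (CP' q qP'); exists p => //; have [pq1 pq2] := phiE p pP.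
by apply: iP' => //; exact: pg_trans qp pq2.
Qed.

Lemma transversal_sum (M : zmodType) v C P P' (F : G -> M) :
  transversal v C P -> transversal v C P' ->
  (forall x y, pg_eqv v x y -> F x = F y) -> \sum_(p <- P) F p = \sum_(p <- P') F p.
Proof.
move=> tP tP' Fv; have [phi [pe phiv]] := transversal_perm tP tP'.
transitivity (\sum_(p <- P) F (phi p)); last by rewrite -(big_map phi xpredT F); exact: perm_big.
by apply: eq_big_seq => p /phiv; exact: Fv.
Qed.

Lemma transversal_size v C P P' : transversal v C P -> transversal v C P' -> size P = size P'.
Proof. by move=> tP tP'; have [phi [/perm_size <- _]] := transversal_perm tP tP'; rewrite size_map. Qed.

Lemma transversal_mul v C P i : transversal v C P ->
  transversal v (fun x => C (pg_inv i ** x)) (map (pg_mul i) P).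
Proof.
move=> [uP CP iP sP]; split.
- by rewrite map_inj_uniq //; exact: (can_inj (@pg_mulKl _ i)).
- by move=> _ /mapP[p pP ->]; rewrite pg_mulKl; exact: CP.
- move=> _ _ /mapP[p pP ->] /mapP[q qP ->] /(pg_eqvl (pg_inv i)); rewrite !pg_mulKl => pq.
  by rewrite (iP p q).
- move=> x /sP[p pP xp]; exists (i ** p); first exact: map_f.
  by have := pg_eqvl i xp; rewrite pg_mulVKl.
Qed.

End Transversal.

(** * Cohomology of inertia by averaging *)

Section InertiaCohomology.
Context (G : pgrp) (inI : G -> Prop) (M : zmodType) (B : eqType) (l nu : nat).
Context (Y : B -> G -> nat) (IS : seq B -> nat -> G -> Prop).
Local Notation "x ** y" := (pg_mul x y) (at level 40, left associativity).
Local Notation e1 := (pg_one G).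

Hypothesis l_pr : prime l.
Hypothesis tors : forall x : M, x *+ (l ^ nu) = 0.
Hypothesis IM : forall x y, inI x -> inI y -> inI (x ** y).
Hypothesis IV : forall x, inI x -> inI (pg_inv x).

(** The exponents [Y] of the given classes are known modulo [l ^ nu] only, whereas antiderivatives
    need finer levels. [X] lifts [Y] to a function modulo [l ^ m] on all of [G], and inertia
    translates it by the character [chi]. *)
Record coordinates m (X chi : B -> G -> nat) : Prop := Coordinates {
  co_mul : forall b i g, inI i -> X b (i ** g) = chi b i + X b g %[mod l ^ m];
  co_smooth : forall b, exists v, forall x y, pg_eqv v x y -> X b x = X b y %[mod l ^ m];
  co_Y : forall b g, X b g = Y b g %[mod l ^ nu];
  co_IS : forall S m' i, (m' <= m)%N -> inI i ->
    IS S m' i <-> forall b, b \in S -> chi b i = 0 %[mod l ^ m'];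
  co_surj : forall (S : seq B) (a : B -> nat), exists2 i, inI i &
    forall b, b \in S -> chi b i = a b %[mod l ^ m]
}.

Hypothesis co_ex : forall m, (nu <= m)%N -> exists X chi, coordinates m X chi.
Hypothesis prime_to_l : forall v, exists (S0 : seq B) m0, forall (S : seq B) m, {subset S0 <= S} -> (m0 <= m)%N ->
  forall P, transversal v (fun i => inI i /\ IS S m i) P -> coprime l (size P).

Definition Ki n (f : seq G -> M) := [/\ smooth n f,
  forall i s, inI i -> size s = n -> f (map (pg_mul i) s) = f s & f [::] = 0].

Section Averaging.
Context (v : pg_lev G) (S : seq B) (m m' : nat) (X chi : B -> G -> nat).
Hypothesis co : coordinates m' X chi.
Hypothesis mm' : (m <= m')%N.
Hypothesis num : (nu <= m)%N.
Hypothesis pl : forall P, transversal v (fun i => inI i /\ IS S m i) P -> coprime l (size P).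

Definition Cset (a : B -> nat) : G -> Prop :=
  fun i => inI i /\ forall b, b \in S -> chi b i = a b %[mod l ^ m].
Definition tr (a : B -> nat) : seq G := xget [::] [set P | transversal v (Cset a) P]%classic.

Lemma trP a : transversal v (Cset a) (tr a).
Proof.
rewrite /tr; case: xgetP => [P -> //|nP]; have [P PP] := transversal_ex v (Cset a).
by case: (nP P).
Qed.

Lemma chiM b x y : inI x -> inI y -> chi b (x ** y) = chi b x + chi b y %[mod l ^ m'].
Proof.
move=> xI yI; have e2 := co_mul co b e1 (IM xI yI).
have e3 := co_mul co b y xI; have e4 := co_mul co b e1 yI; rewrite !pg_mulr1 in e2 e4.
by apply/eqP; rewrite -(eqn_modDr (X b e1)) -e2 e3 -modnDmr e4 modnDmr addnA.
Qed.

Lemma chiMm b x y : inI x -> inI y -> chi b (x ** y) = chi b x + chi b y %[mod l ^ m].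
Proof.
have d : (l ^ m %| l ^ m')%N by exact: dvdn_exp2l.
by move=> xI yI; rewrite -(modn_dvdm _ d) (chiM b xI yI) modn_dvdm.
Qed.

Lemma XmulM b i g : inI i -> X b (i ** g) = chi b i + X b g %[mod l ^ m].
Proof.
have d : (l ^ m %| l ^ m')%N by exact: dvdn_exp2l.
by move=> iI; rewrite -(modn_dvdm _ d) (co_mul co) // modn_dvdm.
Qed.

Lemma Cset_mul a a' i : inI i -> (forall b, b \in S -> a' b = chi b i + a b %[mod l ^ m]) ->
  (fun x => Cset a (pg_inv i ** x)) = Cset a'.
Proof.
move=> iI aa'; apply: funext => x; apply/propext; rewrite /Cset; split=> -[xI xE].
  have xI' : inI x by rewrite -(pg_mulVKl i x); exact: IM.
  split=> // b bS; rewrite -(pg_mulVKl i x) (chiMm b iI xI) aa' //.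
  by rewrite -modnDmr (xE b bS) modnDmr.
have xI' : inI (pg_inv i ** x) by apply: IM => //; exact: IV.
split=> // b bS; apply/eqP; rewrite -(eqn_modDl (chi b i)) -(chiMm b iI xI') pg_mulVKl.
by rewrite xE // aa'.
Qed.

Lemma tr_congr a a' : (forall b, b \in S -> a b = a' b %[mod l ^ m]) -> tr a = tr a'.
Proof.
move=> aa'; suff E : Cset a = Cset a' by rewrite /tr E.
by apply: funext => i; apply/propext; split=> -[iI E]; split=> // b bS; rewrite E ?aa'.
Qed.

Lemma tr_mul_sum a a' i (F : G -> M) : inI i ->
  (forall b, b \in S -> a' b = chi b i + a b %[mod l ^ m]) ->
  (forall x y, pg_eqv v x y -> F x = F y) ->
  \sum_(p <- tr a') F p = \sum_(p <- tr a) F (i ** p).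
Proof.
move=> iI aa' Fv; rewrite -(big_map (pg_mul i) xpredT F).
apply: transversal_sum Fv; first exact: trP.
by rewrite -(Cset_mul iI aa'); apply: transversal_mul; exact: trP.
Qed.

Let k := size (tr (fun=> 0%N)).

Lemma tr_size a : size (tr a) = k.
Proof.
have [i iI iE] := co_surj co S a.
have aE b : b \in S -> a b = chi b i + 0 %[mod l ^ m].
  have d : (l ^ m %| l ^ m')%N by exact: dvdn_exp2l.
  by move=> bS; rewrite addn0 -(modn_dvdm (a b) d) -iE // modn_dvdm.
rewrite /k -[RHS](size_map (pg_mul i)); apply: (@transversal_size _ v (Cset a)); first exact: trP.
by rewrite -(Cset_mul iI aE); apply: transversal_mul; exact: trP.
Qed.

Lemma k_coprime : coprime l k.
Proof.
apply: pl; have := trP (fun=> 0%N); congr transversal; apply: funext => i; apply/propext.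
by split=> -[iI E]; split=> //; have [E1 E2] := co_IS co S mm' iI; [exact: E2|exact: E1].
Qed.

(** Division by the number [k] of representatives: [k] is prime to [l], so [e] inverts it on a
    module killed by [l ^ nu]. *)
Let e := (egcdn k (l ^ nu)).1.

Lemma keE (x : M) : x *+ k *+ e = x.
Proof.
have k0 : (0 < k)%N by have := k_coprime; case: (k) => //; rewrite /coprime gcdn0 => /eqP l1; move: l_pr; rewrite l1.
rewrite -mulrnA /e; case: (egcdnP (l ^ nu) k0) => u w E _ /=.
have := k_coprime; rewrite coprime_sym => /(coprimeXr nu); move=> gk'.
by rewrite mulnC E (eqP gk') mulrnDr mulrnA tors add0r.
Qed.

(** Averaging map from cochains on [G] to periodic functions: each entry [a] is replaced by the mean
    over representatives of the inertia elements with character [a]. *)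
Fixpoint Rl (f : seq G -> M) (s : seq (B -> nat)) : M :=
  if s is a :: s' then (\sum_(p <- tr a) Rl (fun u => f (p :: u)) s') *+ e else f [::].

Lemma eq_Rl f h s : (forall u, size u = size s -> f u = h u) -> Rl f s = Rl h s.
Proof.
elim: s f h => [|a s IH] f h fh /=; first exact: fh.
by congr (_ *+ _); apply: eq_bigr => p _; apply: IH => u us; apply: fh; rewrite /= us.
Qed.

Lemma RlB f h s : Rl (fun u => f u - h u) s = Rl f s - Rl h s.
Proof.
elim: s f h => [|a s IH] f h //=; rewrite -mulrnBl -sumrB; congr (_ *+ _).
by apply: eq_bigr => p _; rewrite IH.
Qed.

Lemma avg_cst a (x : M) : (\sum_(p <- tr a) x) *+ e = x.
Proof. by rewrite big_const_seq count_predT tr_size iter_addr_0 keE. Qed.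

Lemma Rl_cst f (x : M) s : (forall u, size u = size s ->
  (forall i, (i < size s)%N -> Cset (nth (fun=> 0%N) s i) (nth e1 u i)) -> f u = x) -> Rl f s = x.
Proof.
elim: s f => [|a s IH] f fx /=; first by apply: fx.
rewrite -[RHS](avg_cst a); congr (_ *+ _).
apply: eq_big_seq => p pa; apply: IH => u us uE; apply: fx => /=; first by rewrite us.
by case=> [_|i /uE //]; have [_ /(_ p pa)] := trP a.
Qed.

Lemma Rl_dl f s : Rl (dl f) s = dl (Rl f) s.
Proof.
elim: s f => [|a s IH] f //=; rewrite dlMn dl_sum -[Rl f s](avg_cst a) -mulrnBl -sumrB.
congr (_ *+ _); apply: eq_bigr => p _.
by rewrite -IH; exact: (RlB f (dl (fun w => f (p :: w)))).
Qed.

Lemma Rl_per f : per l S m (Rl f).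
Proof.
move=> s s'; elim: s s' f => [|a s IH] [|a' s'] f //= [aa' ss'].
by rewrite (tr_congr aa'); congr (_ *+ _); apply: eq_bigr => p _; exact: IH.
Qed.

Definition vsm n (f : seq G -> M) := forall s s', size s = n -> eqvs v s s' -> f s = f s'.

Lemma vsm_cons n f p : vsm n.+1 f -> vsm n (fun u => f (p :: u)).
Proof. by move=> fv s s' sn ss'; apply: fv; rewrite /= ?sn //; split=> //; exact: pg_refl. Qed.

Lemma Rl_mul f i s s' : inI i -> vsm (size s) f ->
  agree l S m s' (map (fun a b => (chi b i + a b)%N) s) ->
  Rl f s' = Rl (fun u => f (map (pg_mul i) u)) s.
Proof.
move=> iI; elim: s s' f => [|a s IH] [|a' s'] f //= fv [aa' ss'].
rewrite (@tr_mul_sum a a' i) // => [|x y xy]; last first.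
  apply: eq_Rl => u us; apply: fv => /=; last by split=> //; exact: eqvs_refl.
  by rewrite us (agree_size ss') size_map.
congr (_ *+ _); apply: eq_bigr => p _; apply: IH => //; exact: vsm_cons.
Qed.

Definition XV (g : G) : B -> nat := fun b => X b g.

Lemma Rl_XV f i s : inI i -> vsm (size s) f ->
  Rl f (map XV (map (pg_mul i) s)) = Rl (fun u => f (map (pg_mul i) u)) (map XV s).
Proof.
move=> iI fv; apply: Rl_mul => //; first by rewrite size_map.
by elim: s {fv} => //= g s IH; split=> // b _; exact: XmulM.
Qed.

(** Prism operator: the vertices up to [x] are kept, then come an average over the coset of [x] and
    the averages of the later vertices. By [HlE] it joins the identity to averaging followed by
    pullback along [X]. *)
Fixpoint Hl (f : seq G -> M) (s : seq G) : M :=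
  if s is x :: s' then
    (\sum_(p <- tr (XV x)) Rl (fun u => f (x :: p :: u)) (map XV s')) *+ e - Hl (fun u => f (x :: u)) s'
  else 0.

Lemma eq_Hl f h s : (forall u, size u = (size s).+1 -> f u = h u) -> Hl f s = Hl h s.
Proof.
elim: s f h => [|x s IH] f h fh //=; congr (_ *+ _ - _); last first.
  by apply: IH => u us; apply: fh; rewrite /= us.
by apply: eq_bigr => p _; apply: eq_Rl => u us; apply: fh; rewrite /= us size_map.
Qed.

Lemma HlB f h s : Hl (fun u => f u - h u) s = Hl f s - Hl h s.
Proof.
elim: s f h => [|x s IH] f h /=; first by rewrite subrr.
rewrite IH (eq_bigr _ (fun p _ => RlB _ _ _)) sumrB mulrnBl; zmod.
Qed.

Lemma HlE f s : dl (Hl f) s + Hl (dl f) s = Rl f (map XV s) - f s.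
Proof.
elim: s f => [|x s IH] f /=; first by rewrite subrr addr0.
set fx := fun u => f (x :: u); have {}IH := IH fx.
rewrite dlB dlMn dl_sum HlB.
have -> : \sum_(p <- tr (XV x)) dl (fun u => Rl (fun w => f [:: x, p & w]) (map XV u)) s =
    \sum_(p <- tr (XV x)) Rl (dl (fun w => f [:: x, p & w])) (map XV s).
  by apply: eq_bigr => p _; rewrite Rl_dl dl_map.
have -> : \sum_(p <- tr (XV x)) Rl (fun u => f (p :: u) - (fx u - dl (fun w => f [:: x, p & w]) u)) (map XV s) =
   \sum_(p <- tr (XV x)) Rl (fun u => f (p :: u)) (map XV s) - (\sum_(p <- tr (XV x)) Rl fx (map XV s)
     - \sum_(p <- tr (XV x)) Rl (dl (fun w => f [:: x, p & w])) (map XV s)).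
  by rewrite -!sumrB; apply: eq_bigr => p _; rewrite !RlB.
rewrite !mulrnBl avg_cst; move/(canRL (addrK _)): IH => ->; zmod.
Qed.

Lemma X_level : exists u, forall x y, pg_eqv u x y ->
  pg_eqv v x y /\ forall b, b \in S -> X b x = X b y %[mod l ^ m'].
Proof.
suff [u uE] : exists u, forall x y, pg_eqv u x y -> forall b, b \in S -> X b x = X b y %[mod l ^ m'].
  by have [w wE] := pg_dir u v; exists w => x y /wE[/uE].
elim: S => [|b T [u uE]]; first by exists v.
have [w wE] := co_smooth co b; have [z zE] := pg_dir u w.
exists z => x y /zE[xyu xyw] c; rewrite inE => /orP[/eqP ->|cT]; [exact: wE|exact: uE].
Qed.

Lemma XV_agree u s s' : (forall x y, pg_eqv u x y ->
    pg_eqv v x y /\ forall b, b \in S -> X b x = X b y %[mod l ^ m']) ->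
  eqvs u s s' -> agree l S m' (map XV s) (map XV s').
Proof. by move=> uE; elim: s s' => [|x s IH] [|y s'] //= [/uE[_ xy] /IH]. Qed.

Lemma Hl_smooth n f : vsm n.+1 f -> smooth n (Hl f).
Proof.
have [u uE] := X_level; move=> fv; exists u => s s'.
elim: s s' n f fv => [|x s IH] [|y s'] //= n f fv sn [xy ss'].
have [xyv xyX] := uE _ _ xy.
have mX b : b \in S -> X b x = X b y %[mod l ^ m].
  have d : (l ^ m %| l ^ m')%N by exact: dvdn_exp2l.
  by move=> bS; rewrite -(modn_dvdm (X b x) d) xyX // modn_dvdm.
case: n sn fv => // n [sn] fv.
rewrite (@tr_congr (XV x) (XV y)) //; congr (_ *+ _ - _).
  apply: eq_bigr => p _; rewrite (Rl_per _ (agree_le mm' (XV_agree uE ss'))).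
  apply: eq_Rl => w; rewrite size_map -(eqvs_size ss') => ws.
  by apply: fv; rewrite /= ?ws ?sn //; do !split=> //; [exact: pg_refl|exact: eqvs_refl].
transitivity (Hl (fun u => f (y :: u)) s); last by apply: (IH s' n) => //; exact: vsm_cons.
apply: eq_Hl => w ws; apply: fv; rewrite /= ?ws ?sn //; split=> //; exact: eqvs_refl.
Qed.

Lemma Hl_inv n f i s : inI i -> vsm n.+1 f ->
  (forall u, size u = n.+1 -> f (map (pg_mul i) u) = f u) -> size s = n ->
  Hl f (map (pg_mul i) s) = Hl f s.
Proof.
move=> iI fv fi sn; transitivity (Hl (fun u => f (map (pg_mul i) u)) s); last first.
  by apply: eq_Hl => u; rewrite sn; exact: fi.
elim: s n f fv sn {fi} => [|x s IH] n f fv sn //=.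
case: n sn fv => // n [sn] fv; congr (_ *+ _ - _); last by apply: (IH n) => //; exact: vsm_cons.
rewrite (@tr_mul_sum (XV x) (XV (i ** x)) i) // => [|b bS|p q pq]; last 2 first.
- exact: XmulM.
- apply: eq_Rl => u; rewrite !size_map => us; apply: fv; rewrite /= ?us ?sn //.
  by do !split=> //; [exact: pg_refl|exact: eqvs_refl].
apply: eq_bigr => p _; apply: Rl_XV => //; rewrite sn.
exact: (@vsm_cons n (fun u => f (i ** x :: u)) (i ** p) (@vsm_cons _ f (i ** x) fv)).
Qed.

End Averaging.

Definition YV (g : G) : B -> nat := fun b => Y b g.

Lemma wl_YX m X chi c J s : coordinates m X chi ->
  wl (M := M) c J (map YV s) = wl c J (map (XV X) s).
Proof.
move=> co; apply: (@wl_per _ _ l nu tors J nu) => //.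
by elim: s => //= g s IH; split=> // b _; rewrite -(co_Y co).
Qed.

Lemma wl_add (c : M) J s (k : B -> nat) : wl c J (map (fun a b => (k b + a b)%N) s) = wl c J s.
Proof.
elim: J s => [|d J IH] [|x [|y s]] //; rewrite [LHS]/= [RHS]/=.
have := IH (y :: s) => /= ->; rewrite !mulrnDr; zmod.
Qed.

(** Coordinates outside [S] are irrelevant by periodicity, and those in [S] are translated one after
    the other by iterated unit shifts. *)
Lemma inv_add S m (f : seq (B -> nat) -> M) (k : B -> nat) s s' : uniq S -> per l S m f -> inv S f ->
  agree l S m s' (map (fun a b => (k b + a b)%N) s) -> f s' = f s.
Proof.
move=> uS fp fi ss'; rewrite (fp _ _ ss') {s' ss'}.
pose add (T : seq B) (a : B -> nat) b := ((if b \in T then k b else 0) + a b)%N.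
have invk j b t : b \in S -> f (map (shn j b) t) = f t.
  move=> bS; elim: j => [|j IH].
    by congr f; rewrite -[RHS]map_id; apply: eq_map => a; apply: funext => c; rewrite /shn addn0.
  rewrite -IH -[RHS](fi b) //; congr f; rewrite -map_comp; apply: eq_map => a.
  by rewrite /= shnD addn1.
transitivity (f (map (add S) s)).
  by apply: fp; elim: s => //= a s IH; split=> // b bS; rewrite /add bS.
have {fp fi} : {subset S <= S} by [].
elim: {1 2 4}S uS => [|b T IH] uT TS.
  by congr f; rewrite -[RHS]map_id; apply: eq_map => a; exact: funext.
have /andP[bT uT'] := uT.
rewrite -IH // => [|c cT]; last by apply: TS; rewrite inE cT orbT.
rewrite -[RHS](invk (k b) b); last by apply: TS; rewrite mem_head.
congr f; rewrite -map_comp; apply: eq_map => a; apply: funext => c /=.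
rewrite /add /shn inE; case: eqP => [->|_] /=; last by rewrite muln0 addn0.
by rewrite (negbTE bT) muln1 add0n addnC.
Qed.

(** The averaged cochain is periodic and shift-invariant, so [periodic_cohomology] decomposes it;
    pulling back along [X] and correcting by the homotopy [H] returns to [f]. Any [T] containing
    [S0] will do, so that the caller may sort it. *)
Theorem inertia_H_ex r f : Ki r.+1 f -> (forall s, size s = r.+2 -> dl f s = 0) ->
  exists S0 : seq B, forall T : seq B, uniq T -> {subset S0 <= T} -> exists c h, Ki r h /\
    forall s, size s = r.+1 -> f s = \sum_(J <- subs T r) wl (c J) J (map YV s) + dl h s.
Proof.
move=> [[v fv] fi _] fd; have [S0 [m0 pl]] := prime_to_l v; exists S0 => T uT S0T.
pose m := maxn m0 nu; have num : (nu <= m)%N by rewrite leq_maxr.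
have [m' mm' PC] := periodic_cohomology (prime_gt0 l_pr) tors uT (fun b bT => bT) r num.
(* Coordinates are needed at the level [m'] of the primitive, and the averaged cochain in turn
   depends on them. There is no circle because [m'] is known before the cochain. *)
have [X [chi co]] := co_ex (leq_trans num mm').
have {}pl := pl T m S0T (leq_maxl _ _).
pose f0 s := if size s == r.+1 then f s else 0.
have f0v n : vsm v n f0.
  by move=> s s' sn ss'; rewrite /f0 -(eqvs_size ss'); case: eqP => // sr; exact: fv.
have f0i i s : inI i -> f0 (map (pg_mul i) s) = f0 s.
  by move=> iI; rewrite /f0 size_map; case: eqP => // sr; exact: fi.
have f0d s : size s = r.+2 -> dl f0 s = 0.
  by move=> sr; rewrite -(fd s sr); apply: eq_dl => u; rewrite sr /f0 => -[->]; rewrite eqxx.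
pose R := Rl v T m chi; pose H := Hl v T m X chi.
have Rp : per l T m (R f0) by exact: Rl_per.
have Ri : inv T (R f0).
  (* An inertia element whose character is the indicator of [b] turns invariance of [f0] under
     inertia into invariance under the unit shift of [b]. *)
  move=> b s bT; have [i iI iE] := co_surj co T (fun c => (c == b)%:R).
  rewrite /R (@Rl_mul _ _ _ _ _ _ co mm' f0 i s) //; first by apply: eq_Rl => u _; exact: f0i.
  elim: s => //= a s IH; split=> // c cT; rewrite /shn mul1n addnC.
  have d : (l ^ m %| l ^ m')%N by exact: dvdn_exp2l.
  rewrite -modnDml -[in RHS]modnDml; congr ((_ + _) %% _)%N.
  by rewrite -[in RHS](modn_dvdm _ d) iE // modn_dvdm; case: (c == b).
have Rd s : size s = r.+2 -> dl (R f0) s = 0.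
  move=> sr; rewrite /R -(Rl_dl co mm' pl); apply: (Rl_cst co mm' pl) => u us _.
  by apply: f0d; rewrite us.
have [c [h' [h'p h'i h'0 RE]]] := PC (R f0) Rp Ri Rd.
pose h s := h' (map (XV X) s) - H f0 s.
exists c, h; split.
  split.
  - apply: (smooth_op2 (fun a b => a - b)); last exact: (Hl_smooth T co mm' (f0v r.+1)).
    have [u uE] := X_level v T co; exists u => s s' sr ss'.
    by apply: h'p; exact: XV_agree uE ss'.
  - move=> i s iI sr; rewrite /h; congr (_ - _).
      apply: (inv_add (k := fun b => chi b i) uT h'p h'i).
      by elim: s {sr} => //= g s IH; split=> // b _; rewrite (co_mul co).
    by apply: (Hl_inv T co mm' iI (f0v r.+1)) => // u _; exact: f0i.
  - by rewrite /h /= h'0 subrr.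
move=> s sr; have E := HlE co mm' pl f0 s.
have -> : f s = f0 s by rewrite /f0 sr eqxx.
have Hd : Hl v T m X chi (dl f0) s = 0.
  have -> : Hl v T m X chi (dl f0) s = Hl v T m X chi (fun u => 0 - 0) s.
    by apply: eq_Hl => u; rewrite sr subrr; exact: f0d.
  by rewrite HlB subrr.
rewrite Hd addr0 in E.
have -> : f0 s = R f0 (map (XV X) s) - dl (H f0) s by rewrite /H E subKr.
rewrite RE ?size_map // -addrA; congr (_ + _).
  by apply: eq_bigr => J _; rewrite (wl_YX _ _ _ co).
by rewrite /h dlB dl_map.
Qed.

(** Averaging the equation gives one between periodic functions, where [periodic_cohomology_inj]
    applies. The averages are taken over the larger set [S], which contains [S0], so that the index
    is prime to [l]. *)
Theorem inertia_H_un T r c h : uniq T -> Ki r h ->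
  (forall s, size s = r.+1 -> \sum_(J <- subs T r) wl (c J) J (map YV s) = dl h s) ->
  {in subs T r, forall J, c J = 0}.
Proof.
move=> uT [[v hv] hi h0] E; have [S0 [m0 pl]] := prime_to_l v.
pose m := maxn m0 nu; have num : (nu <= m)%N by rewrite leq_maxr.
have [X [chi co]] := co_ex num.
pose S := T ++ S0; have {}pl : forall P, transversal v (fun i => inI i /\ IS S m i) P -> coprime l (size P).
  by apply: pl; [move=> b bS; rewrite mem_cat bS orbT|rewrite leq_maxl].
have TS : {subset T <= S} by move=> b bT; rewrite mem_cat bT.
pose h1 s := if size s == r then h s else 0.
have h1v n : vsm v n h1.
  by move=> s s' sn ss'; rewrite /h1 -(eqvs_size ss'); case: eqP => // sr; exact: hv.
have h1i i s : inI i -> h1 (map (pg_mul i) s) = h1 s.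
  by move=> iI; rewrite /h1 size_map; case: eqP => // sr; exact: hi.
pose R := Rl v S m chi.
have Ri : inv T (R h1).
  move=> b s bT; have [i iI iE] := co_surj co S (fun c => (c == b)%:R).
  rewrite /R (@Rl_mul _ _ _ _ _ _ co (leqnn m) h1 i s) //; first by apply: eq_Rl => u _; exact: h1i.
  elim: s => //= a s IH; split=> // d dT; rewrite /shn mul1n addnC.
  by rewrite -modnDml -[in RHS]modnDml iE //; case: (d == b).
have Rd s : size s = r.+1 -> \sum_(J <- subs T r) wl (c J) J s = dl (R h1) s.
  move=> sr; rewrite /R -(Rl_dl co (leqnn m) pl); apply/esym/(Rl_cst co (leqnn m) pl) => u us uE.
  have -> : dl h1 u = dl h u.
    by apply: eq_dl => w; rewrite us sr => -[wr]; rewrite /h1 wr eqxx.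
  rewrite -E ?us //; apply: eq_big_seq => J /subs_mem[_ JT].
  (* A representative [x] in the coset of [a] has [X b x] equal to [a b + X b 1]; the common
     translation by [X b 1] does not change [wl]. *)
  rewrite (wl_YX _ _ _ co) -(wl_add _ _ s (fun b => X b e1)).
  apply: (@wl_per _ _ l nu tors S m (c J) J) => // [b /JT/TS //|].
  elim: s u us uE {sr} => [|a s IH] [|x u] //= [us] uE.
  split; last by apply: IH => // i; exact: (uE i.+1).
  move=> b bS; have [xI xE] := uE 0%N isT.
  by rewrite /XV -[x]pg_mulr1 (co_mul co) // -modnDml xE // modnDml addnC.
apply: (periodic_cohomology_inj (h := R h1) (prime_gt0 l_pr) tors uT TS num _ Ri _ Rd).
  exact: Rl_per.
by rewrite /R /= /h1; case: ifP.
Qed.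

End InertiaCohomology.

(** * Ring morphisms and minimal polynomials *)

Lemma rmorph_ext (R S : pzRingType) (f g : {rmorphism R -> S}) : f =1 g -> f = g.
Proof.
move: f g => [f [[fa] [fb]]] [g [[ga] [gb]]] /= fg.
have E : f = g by apply: funext.
by move: fa fb ga gb; rewrite E => *; do 3!f_equal; exact: Prop_irrelevance.
Qed.

Lemma rmorph_ex (R S : pzRingType) (f : R -> S) : (forall x y, f (x - y) = f x - f y) ->
  (forall x y, f (x * y) = f x * f y) -> f 1 = 1 -> exists g : {rmorphism R -> S}, g =1 f.
Proof.
move=> fB fM f1.
pose fa := GRing.isZmodMorphism.Build R S f fB.
pose fm := GRing.isMonoidMorphism.Build R S f (f1, fM).
by exists (HB.pack f fa fm : {rmorphism R -> S}).
Qed.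

Lemma poly_root_list (E : fieldType) (p : {poly E}) : p != 0 ->
  exists rs : seq E, forall x, root p x -> x \in rs.
Proof.
move=> p0; suff H n : (exists rs : seq E, forall x, root p x -> x \in rs) \/
    exists rs : seq E, [/\ uniq rs, all (root p) rs & size rs = n].
  have [//|[rs [ur ar sr]]] := H (size p).
  by have := max_poly_roots p0 ar ur; rewrite sr ltnn.
elim: n => [|n [|[rs [ur ar sr]]]]; [by right; exists [::]|by left|].
have [h|/existsNP[x /not_implyP[rx /negP nx]]] := pselect (forall x, root p x -> x \in rs).
  by left; exists rs.
by right; exists (x :: rs); rewrite /= nx ur rx ar sr.
Qed.

Lemma minimal_poly (K E : fieldType) (phi : {rmorphism K -> E}) (x : E) (p : {poly K}) :
  p != 0 -> root (map_poly phi p) x ->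
  exists P0 : {poly K}, [/\ P0 != 0, (1 < size P0)%N & forall P, root (map_poly phi P) x = (P0 %| P)].
Proof.
move=> p0 px; pose A n := `[< exists P : {poly K}, [/\ P != 0, root (map_poly phi P) x & size P = n] >].
have exA : exists n, A n by exists (size p); apply/asboolP; exists p.
case: (ex_minnP exA) => m /asboolP[P0 [P00 P0x P0m]] Pmin.
have sP0 : (1 < size P0)%N.
  rewrite ltnNge; apply/negP => /size1_polyC PE.
  move: P0x; rewrite PE map_polyC rootC fmorph_eq0 => /eqP c0.
  by move: P00; rewrite PE c0 eqxx.
exists P0; split=> // P; apply/idP/idP => [Px|/dvdpP[Q ->]]; last first.
  by rewrite rmorphM rootM P0x orbT.
apply/negPn/negP => nd; have nz : P %% P0 != 0 by [].
have : (size (P %% P0)%R < m)%N by rewrite -P0m ltn_modp.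
rewrite ltnNge => /negP; apply; apply: Pmin; apply/asboolP; exists (P %% P0); split=> //.
have := Px; rewrite {1}(divp_eq P P0) rmorphD rmorphM /= rootE !hornerE.
by rewrite (rootP P0x) mulr0 add0r -rootE.
Qed.

Lemma minimal_coprime (K E : fieldType) (phi : {rmorphism K -> E}) (x : E) (P0 P : {poly K}) :
  (1 < size P0)%N -> (forall P, root (map_poly phi P) x = (P0 %| P)) -> ~~ (P0 %| P) ->
  coprimep P0 P.
Proof.
move=> s1 P0P nd; have PQ : P0 = P0 %/ gcdp P0 P * gcdp P0 P by apply/esym/divpK/dvdp_gcdl.
have P00 : P0 != 0 by rewrite -size_poly_gt0 ltnW.
have : root (map_poly phi P0) x by rewrite P0P dvdpp.
rewrite {1}PQ rmorphM rootM !P0P => /orP[d|d]; last first.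
  by case/negP: nd; exact: dvdp_trans d (dvdp_gcdr _ _).
have Q0 : P0 %/ gcdp P0 P != 0 by apply/eqP => z; move: P00; rewrite {1}PQ z mul0r eqxx.
have g0 : gcdp P0 P != 0 by rewrite gcdp_eq0 negb_and P00.
rewrite coprimep_def; have := dvdp_leq Q0 d; rewrite size_divp //.
have := g0; rewrite -size_poly_gt0; have := dvdp_leq P00 (dvdp_gcdl P0 P).
by move=> h1 h2 h3; apply/eqP; lia.
Qed.

(** * Galois theory of a separable closure *)

Section PartialIso.
Context (E E' : fieldType).
Implicit Types (R : set (E * E')).

(* Graphs of isomorphisms between subfields of [E] and [E']. *)
Record piso R : Prop := Piso {
  piso1 : R (1, 1);
  pisoB : forall x y, R x -> R y -> R (x.1 - y.1, x.2 - y.2);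
  pisoM : forall x y, R x -> R y -> R (x.1 * y.1, x.2 * y.2);
  pisoV : forall x, R x -> R (x.1^-1, x.2^-1);
  piso0 : forall y, R (0, y) -> y = 0
}.

Lemma piso_fun R x y y' : piso R -> R (x, y) -> R (x, y') -> y = y'.
Proof.
move=> pR xy xy'; apply/eqP; rewrite -subr_eq0; apply/eqP.
by apply: (piso0 pR); have := pisoB pR xy xy'; rewrite /= subrr.
Qed.

(** Polynomial expressions in an algebraic [x] already form a field: the Bezout relation with the
    minimal polynomial [P0] gives one [V] that inverts [P] both at [x] and at [x']. *)
Lemma piso_adjoin (K : fieldType) (p1 : {rmorphism K -> E}) (p2 : {rmorphism K -> E'}) (P0 : {poly K}) x x' :
  (1 < size P0)%N ->
  (forall P, root (map_poly p1 P) x = (P0 %| P)) -> root (map_poly p2 P0) x' ->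
  piso [set u | exists P : {poly K}, u = ((map_poly p1 P).[x], (map_poly p2 P).[x'])]%classic.
Proof.
move=> s1 P0P P0x'; set R := (X in piso X).
have R0 P : root (map_poly p1 P) x -> (map_poly p2 P).[x'] = 0.
  rewrite P0P => /dvdpP[Q ->]; rewrite rmorphM hornerM (rootP P0x'); exact: mulr0.
split=> /=.
- by exists 1; rewrite !rmorph1 !hornerE.
- by move=> _ _ [P ->] [Q ->]; exists (P - Q); rewrite !rmorphB /= !hornerE.
- by move=> _ _ [P ->] [Q ->]; exists (P * Q); rewrite !rmorphM /= !hornerE.
- move=> _ [P ->] /=; have [Px|Px] := boolP (root (map_poly p1 P) x).
    by exists 0; rewrite !rmorph0 !horner0 (R0 _ Px) (rootP Px) !invr0.
  have cP : coprimep P0 P by apply: (minimal_coprime s1 P0P); rewrite -P0P.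
  have /Bezout_eq1_coprimepP[[U V] /= UV] := cP.
  have e1 : (map_poly p1 V).[x] * (map_poly p1 P).[x] = 1.
    have /(congr1 (fun p => (map_poly p1 p).[x])) := UV.
    rewrite rmorphD !rmorphM rmorph1 /= !hornerE => <-.
    by have := P0P P0; rewrite dvdpp => /rootP ->; rewrite mulr0 add0r.
  have e2 : (map_poly p2 V).[x'] * (map_poly p2 P).[x'] = 1.
    have /(congr1 (fun p => (map_poly p2 p).[x'])) := UV.
    by rewrite rmorphD !rmorphM rmorph1 /= !hornerE (rootP P0x') mulr0 add0r.
  exists V; congr pair.
    by apply: (mulIf Px); rewrite e1 mulVf.
  have P2 : (map_poly p2 P).[x'] != 0.
    by apply/eqP => z; move: e2; rewrite z mulr0 => /eqP; rewrite eq_sym oner_eq0.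
  by apply: (mulIf P2); rewrite e2 mulVf.
- by move=> y [P [Px ->]]; apply: R0; rewrite rootE -Px.
Qed.

Section Extension.
Context (R : set (E * E')) (pR : piso R).

Definition pdom : {pred E} := [pred x | `[< exists y, R (x, y) >]].

Fact pdom_closed : divring_closed pdom.
Proof.
split=> [|x y|x y].
- by apply: asboolT; exists 1; exact: piso1.
- by move=> /asboolW[x' xx'] /asboolW[y' yy']; apply: asboolT; exists (x' - y'); exact: (pisoB pR xx' yy').
- move=> /asboolW[x' xx'] /asboolW[y' yy']; apply: asboolT; exists (x' / y').
  exact: (pisoM pR xx' (pisoV pR yy')).
Qed.

HB.instance Definition _ := GRing.isDivringClosed.Build E pdom pdom_closed.

(** The domain of the graph as a field type, so that minimal polynomials over it make sense. *)
Record pfield := Pfield { pf_val :> E; _ : pf_val \in pdom }.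
HB.instance Definition _ := [isSub for pf_val].
HB.instance Definition _ := [Choice of pfield by <:].
HB.instance Definition _ := [SubChoice_isSubIntegralDomain of pfield by <:].
HB.instance Definition _ := [SubIntegralDomain_isSubField of pfield by <:].

Lemma pf_ex : exists phi : {rmorphism pfield -> E'}, forall x, R (val x, phi x).
Proof.
have /choice[f fE] : forall x : pfield, exists y, R (val x, y).
  by move=> [x /= xR]; have /asboolW := xR.
have [||//|g gE] := @rmorph_ex pfield E' f.
- by move=> x y; apply: (piso_fun pR (fE _)); exact: (pisoB pR (fE x) (fE y)).
- by move=> x y; apply: (piso_fun pR (fE _)); exact: (pisoM pR (fE x) (fE y)).
- by apply: (piso_fun pR (fE _)); exact: piso1.
by exists g => x; rewrite gE.
Qed.

Lemma piso_step (F : fieldType) (i : {rmorphism F -> E}) (j : {rmorphism F -> E'}) (x : E) (p : {poly F}) :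
  (forall c, R (i c, j c)) -> separably_closed E' ->
  separable_poly p -> root (map_poly i p) x ->
  exists R', [/\ piso R', (R `<=` R')%classic & exists y, R' (x, y)].
Proof.
move=> Rij scE psep px; have [phi phiR] := pf_ex.
have iK c : i c \in pdom by apply: asboolT; exists (j c).
have [g gE] : exists g : {rmorphism F -> pfield}, g =1 fun c => Pfield (iK c).
  by apply: rmorph_ex => *; apply: val_inj; rewrite /= ?rmorphB ?rmorphM ?rmorph1.
pose vm : {rmorphism pfield -> E} := val.
have vg c : vm (g c) = i c by rewrite gE.
have phig c : phi (g c) = j c by apply: (piso_fun pR (phiR _)); rewrite -/(vm (g c)) vg.
pose q := map_poly g p.
have qi : map_poly vm q = map_poly i p.
  by rewrite /q -map_poly_comp; apply: eq_map_poly => c; exact: vg.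
have qx : root (map_poly vm q) x by rewrite qi.
have q0 : q != 0 by rewrite map_poly_eq0; exact: separable_poly_neq0.
have [P0 [P00 s1 P0P]] := minimal_poly q0 qx.
have P0sep : separable_poly P0.
  by apply: (@dvdp_separable _ q); [rewrite -P0P|rewrite separable_map].
have [x' P0x'] : exists x', root (map_poly phi P0) x'.
  by apply: scE; rewrite ?separable_map // size_map_poly.
exists [set u | exists P : {poly pfield}, u = ((map_poly vm P).[x], (map_poly phi P).[x'])]%classic.
split; first exact: piso_adjoin P0P P0x'.
  move=> [u w] uw; have uK : u \in pdom by apply: asboolT; exists w.
  exists (Pfield uK)%:P; rewrite !map_polyC !hornerC; congr pair.
  exact: (piso_fun pR uw (phiR (Pfield uK))).
by exists x'; exists 'X; rewrite !map_polyX !hornerX.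
Qed.

End Extension.

Theorem piso_total (F : fieldType) (i : {rmorphism F -> E}) (j : {rmorphism F -> E'}) R0 :
  piso R0 -> (forall c, R0 (i c, j c)) ->
  (forall x, exists2 p : {poly F}, separable_poly p & root (map_poly i p) x) ->
  separably_closed E' ->
  exists f : {rmorphism E -> E'}, forall u, R0 u -> f u.1 = u.2.
Proof.
move=> pR0 R0ij alg scE.
have [A [/= pA maxA]] : exists A, piso (A `|` R0)%classic /\
    forall B, (A `<` B)%classic -> ~ piso (B `|` R0)%classic.
  apply: (Zorn_bigcup (P := [set A | piso (A `|` R0)]%classic)) => FF FP tot /=.
  pose F' := (FF `|` [set set0])%classic.
  have F'P X : F' X -> piso (X `|` R0)%classic.
    by move=> [/FP//|/= ->]; rewrite set0U.
  have F'tot X Y : F' X -> F' Y -> (X `<=` Y)%classic \/ (Y `<=` X)%classic.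
    by move=> [FX|/= ->] [FY|/= ->]; [exact: tot|right|left|left].
  have mem u : (\bigcup_(X in FF) X `|` R0)%classic u -> exists2 X, F' X & (X `|` R0)%classic u.
    by move=> [[X FX Xu]|ru]; [exists X; left|exists set0; right].
  have inc X u : F' X -> (X `|` R0)%classic u -> (\bigcup_(X in FF) X `|` R0)%classic u.
    by move=> [FX|/= ->] [Xu|ru] //; [left; exists X|right|right].
  have two u w : (\bigcup_(X in FF) X `|` R0)%classic u ->
      (\bigcup_(X in FF) X `|` R0)%classic w ->
      exists2 X, F' X & (X `|` R0)%classic u /\ (X `|` R0)%classic w.
    move=> /mem[X FX Xu] /mem[Y FY Yw]; have [XY|YX] := F'tot X Y FX FY.
      by exists Y => //; split=> //; case: Xu => [/XY|]; [left|right].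
    by exists X => //; split=> //; case: Yw => [/YX|]; [left|right].
  split.
  - by right; exact: piso1.
  - by move=> u w /two/[apply] -[X FX [Xu Xw]]; apply: inc FX (pisoB (F'P X FX) Xu Xw).
  - by move=> u w /two/[apply] -[X FX [Xu Xw]]; apply: inc FX (pisoM (F'P X FX) Xu Xw).
  - by move=> u /mem[X FX Xu]; apply: inc FX (pisoV (F'P X FX) Xu).
  - by move=> y /mem[X FX Xu]; exact: (piso0 (F'P X FX) Xu).
have totA x : exists y, (A `|` R0)%classic (x, y).
  apply: contrapT => nx; have [p psep px] := alg x.
  have [R' [pR' AR' [y xy]]] := piso_step pA (fun c => or_intror (R0ij c)) scE psep px.
  apply: (maxA R'); last first.
    suff -> : (R' `|` R0)%classic = R' by [].
    by apply/seteqP; split=> u; [case=> // ru; apply: AR'; right|left].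
  split; first by move=> u Au; apply: AR'; left.
  by move=> R'A; apply: nx; exists y; left; exact: R'A.
have /choice[f fE] := totA.
have [||//|g gE] := @rmorph_ex E E' f.
- by move=> x y; apply: (piso_fun pA (fE _)); exact: (pisoB pA (fE x) (fE y)).
- by move=> x y; apply: (piso_fun pA (fE _)); exact: (pisoM pA (fE x) (fE y)).
- by apply: (piso_fun pA (fE _)); exact: piso1.
by exists g => -[x y] xy; rewrite gE; apply: (piso_fun pA (fE x)); right.
Qed.

End PartialIso.

Section GaloisGroup.
Context (F E : fieldType) (i : {rmorphism F -> E}).
Implicit Types (s t : gal i) (x y z : E).

Lemma gal_ext s t : s =1 t -> s = t.
Proof.
case: s t => [f f' fK f'K ff] [g g' gK g'K gg] /= fg.
have E1 : f = g by exact: rmorph_ext.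
have E2 : f' = g'.
  by apply: rmorph_ext => x; rewrite -[LHS]gK -fg f'K.
by move: fK f'K ff gK g'K gg; rewrite E1 E2 => *; f_equal; exact: Prop_irrelevance.
Qed.

Lemma galMA : associative (@galM _ _ i). Proof. by move=> s t u; exact: gal_ext. Qed.
Lemma gal1M : left_id (gal1 i) (@galM _ _ i). Proof. by move=> s; exact: gal_ext. Qed.
Lemma galVM : left_inverse (gal1 i) (@galV _ _ i) (@galM _ _ i).
Proof. by move=> s; apply: gal_ext => x /=; exact: gal_funK. Qed.
Lemma galME s t x : galM s t x = s (t x). Proof. by []. Qed.
Lemma gal_inj s : injective s. Proof. exact: can_inj (gal_funK s). Qed.
Lemma galVK s : cancel (galV s) s. Proof. exact: gal_invK. Qed.
Lemma galKV s : cancel s (galV s). Proof. exact: gal_funK. Qed.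

Hypothesis sc : separable_closure i.

Lemma gal_root s (p : {poly F}) x : root (map_poly i p) x -> root (map_poly i p) (s x).
Proof.
move=> px; have -> : map_poly i p = map_poly s (map_poly i p).
  by rewrite -map_poly_comp; apply: eq_map_poly => c /=; rewrite gal_fix.
by rewrite (@mapf_root _ _ s).
Qed.

Lemma orbit_bound x : exists rs : seq E, forall s, s x \in rs.
Proof.
have [p ps px] := sc.1 x; have p0 : map_poly i p != 0.
  by rewrite map_poly_eq0; exact: separable_poly_neq0.
have [rs rsE] := poly_root_list p0; exists rs => s; apply: rsE; exact: gal_root.
Qed.

Definition orb x : seq E := xget [::] [set r | uniq r /\ forall y, y \in r <-> exists s, s x = y]%classic.

Lemma orbP x : uniq (orb x) /\ forall y, y \in orb x <-> exists s, s x = y.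
Proof.
rewrite /orb; case: xgetP => [r -> //|nr].
have [rs rsE] := orbit_bound x.
pose r := undup [seq y <- rs | `[< exists s, s x = y >]].
case: (nr r) => /=; split; first exact: undup_uniq.
move=> y; rewrite mem_undup mem_filter; split; first by case/andP => /asboolP.
by move=> [s sxy]; rewrite -sxy rsE andbT; apply/asboolP; exists s.
Qed.

Lemma orb_uniq x : uniq (orb x). Proof. exact: (orbP x).1. Qed.
Lemma mem_orbP x y : reflect (exists s, s x = y) (y \in orb x).
Proof. by apply: (iffP idP) => [/(orbP x).2|h]; last exact/(orbP x).2. Qed.
Lemma mem_orb s x : s x \in orb x. Proof. by apply/mem_orbP; exists s. Qed.
Lemma orb_refl x : x \in orb x. Proof. exact: (mem_orb (gal1 i)). Qed.
Lemma orb_closed s x y : y \in orb x -> s y \in orb x.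
Proof. by move=> /mem_orbP[t <-]; apply/mem_orbP; exists (galM s t). Qed.

Lemma perm_orb s x : perm_eq (map s (orb x)) (orb x).
Proof.
have sub : {subset map s (orb x) <= orb x} by move=> _ /mapP[y yx ->]; exact: orb_closed.
have us : uniq (map s (orb x)) by rewrite map_inj_uniq ?orb_uniq //; exact: gal_inj.
have [_ e] := uniq_min_size us sub (eq_leq (esym (size_map _ _))).
exact: uniq_perm us (orb_uniq x) e.
Qed.

(** Compactness, by an ultrafilter containing, for every [u0], the lists above [u0]. Orbits are
    finite, so each [sig u k x] is constant on a large set of [u]; the limit values form an
    automorphism, approximated on any finite set of arguments by some late [sig u]. *)
Lemma gal_limit (K T : choiceType) (sig : seq T -> K -> gal i) : exists g : K -> gal i,
  forall (u0 : seq T) (t : seq (K * E)), exists u : seq T, {subset u0 <= u} /\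
    forall k x, (k, x) \in t -> sig u k x = g k x.
Proof.
pose Fl : set_system (seq T) := [set A | exists u0 : seq T, forall u : seq T, {subset u0 <= u} -> A u]%classic.
have FP : ProperFilter Fl.
  apply: Build_ProperFilter_ex.
    by move=> A [u0 uA]; exists u0; exact: uA.
  split; first by exists [::].
    move=> A B [u uA] [w wB]; exists (u ++ w) => z zs; split.
      by apply: uA => a au; apply: zs; rewrite mem_cat au.
    by apply: wB => a au; apply: zs; rewrite mem_cat au orbT.
  by move=> A B AB [u uA]; exists u => w /uA/AB.
have [U [UU FU]] := ultraFilterLemma FP.
have Uex (A : set (seq T)) : U A -> exists u, A u by move=> UA; exact: (@filter_ex _ U).
have Uand (A B : set (seq T)) : U A -> U B -> U (A `&` B)%classic by move=> *; exact: filterI.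
have lim k x : exists y, U [set u | sig u k x = y]%classic.
  have [rs rsE] := orbit_bound x.
  have : forall u, sig u k x \in rs by move=> u; exact: rsE.
  suff H : U [set u | sig u k x \in rs]%classic -> exists y, U [set u | sig u k x = y]%classic.
    move=> h; apply: H; apply: filterS filterT => u _; exact: h.
  elim: rs {rsE} => [|r rs IH] h; first by have [u] := Uex _ h.
  have [hr|hr] := in_ultra_setVsetC [set u | sig u k x = r]%classic UU; first by exists r.
  apply: IH; apply: filterS (Uand _ _ h hr) => u [/=].
  by rewrite inE => /orP[/eqP|].
have lim2 k : exists f : E -> E, forall x, U [set u | sig u k x = f x]%classic by have /choice[f fE] := lim k; exists f.
(* The inverses are followed as well, so that the limit is invertible. *)
have limV k x : exists y, U [set u | gal_inv (sig u k) x = y]%classic.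
  have [rs rsE] := orbit_bound x.
  have : forall u, gal_inv (sig u k) x \in rs by move=> u; exact: (rsE (galV _)).
  suff H : U [set u | gal_inv (sig u k) x \in rs]%classic -> exists y, U [set u | gal_inv (sig u k) x = y]%classic.
    move=> h; apply: H; apply: filterS filterT => u _; exact: h.
  elim: rs {rsE} => [|r rs IH] h; first by have [u] := Uex _ h.
  have [hr|hr] := in_ultra_setVsetC [set u | gal_inv (sig u k) x = r]%classic UU; first by exists r.
  apply: IH; apply: filterS (Uand _ _ h hr) => u [/=].
  by rewrite inE => /orP[/eqP|].
have lim2V k : exists f : E -> E, forall x, U [set u | gal_inv (sig u k) x = f x]%classic by have /choice[f fE] := limV k; exists f.
have limg k : exists g : gal i, forall x, U [set u | sig u k x = g x]%classic.
  have [f fE] := lim2 k; have [f' f'E] := lim2V k.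
  have [||//|g gE] := @rmorph_ex E E f.
  - move=> x y; have [u [/= [<- <-] <-]] := Uex _ (Uand _ _ (Uand _ _ (fE x) (fE y)) (fE (x - y))).
    by rewrite rmorphB.
  - move=> x y; have [u [/= [<- <-] <-]] := Uex _ (Uand _ _ (Uand _ _ (fE x) (fE y)) (fE (x * y))).
    by rewrite rmorphM.
  - by have [u /= <-] := Uex _ (fE 1); rewrite rmorph1.
  have [||//|g' g'E] := @rmorph_ex E E f'.
  - move=> x y; have [u [/= [<- <-] <-]] := Uex _ (Uand _ _ (Uand _ _ (f'E x) (f'E y)) (f'E (x - y))).
    by rewrite rmorphB.
  - move=> x y; have [u [/= [<- <-] <-]] := Uex _ (Uand _ _ (Uand _ _ (f'E x) (f'E y)) (f'E (x * y))).
    by rewrite rmorphM.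
  - by have [u /= <-] := Uex _ (f'E 1); rewrite rmorph1.
  have gK : cancel g g'.
    move=> x; rewrite gE g'E; have [u [/= e1 <-]] := Uex _ (Uand _ _ (fE x) (f'E (f x))).
    by rewrite -e1 gal_funK.
  have g'K : cancel g' g.
    move=> x; rewrite g'E gE; have [u [/= e1 <-]] := Uex _ (Uand _ _ (f'E x) (fE (f' x))).
    by rewrite -e1 gal_invK.
  have gi c : g (i c) = i c by rewrite gE; have [u /= <-] := Uex _ (fE (i c)); rewrite gal_fix.
  by exists (Gal gK g'K gi) => x /=; rewrite gE; exact: fE.
have [g gE] := choice limg; exists g => u0 t.
suff [u [u0u uE]] : exists u, ([set u : seq T | {subset u0 <= u}] `&` [set u : seq T | forall k x, (k, x) \in t ->
    sig u k x = g k x])%classic u by exists u.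
apply: (Uex); apply: (Uand); first by apply: FU; exists u0.
elim: t => [|[k x] t IH]; first by apply: filterS filterT.
apply: filterS (Uand _ _ IH (gE k x)) => u [/= h1 h2] k' x'.
by rewrite inE => /orP[/eqP[-> ->]|/h1].
Qed.

(** An endomorphism over the base is injective and maps the finite set of roots of each polynomial
    of the base to itself, hence is onto. *)
Lemma gal_endo (f : {rmorphism E -> E}) : (forall c, f (i c) = i c) -> exists s, s =1 f.
Proof.
move=> fi; have finj : injective f by exact: fmorph_inj.
have fsurj y : exists x, f x = y.
  have [p ps py] := sc.1 y; have p0 : map_poly i p != 0.
    by rewrite map_poly_eq0; exact: separable_poly_neq0.
  have [rs rsE] := poly_root_list p0.
  pose rt := undup [seq r <- rs | root (map_poly i p) r].
  have rtE z : (z \in rt) = root (map_poly i p) z.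
    rewrite mem_undup mem_filter; case: (boolP (root _ z)) => // rz; exact: rsE.
  have frt : {subset map f rt <= rt}.
    move=> w /mapP[z]; rewrite !rtE => zr ->.
    have -> : map_poly i p = map_poly f (map_poly i p).
      by rewrite -map_poly_comp; apply: eq_map_poly => c /=; rewrite fi.
    by rewrite (@mapf_root _ _ f).
  have us : uniq (map f rt) by rewrite map_inj_uniq // undup_uniq.
  have [_ e] := uniq_min_size us frt (eq_leq (esym (size_map _ _))).
  have : y \in map f rt by rewrite e rtE.
  by case/mapP => x _ ->; exists x.
have [g gE] := choice fsurj.
have fg : cancel g f by exact: gE.
have gf : cancel f g by move=> x; apply: finj; rewrite gE.
have [||//|g' g'E] := @rmorph_ex E E g.
- by move=> x y; apply: finj; rewrite rmorphB !fg.
- by move=> x y; apply: finj; rewrite rmorphM !fg.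
- by apply: finj; rewrite rmorph1 fg.
have fK : cancel f g' by move=> x; rewrite g'E gf.
have gK : cancel g' f by move=> x; rewrite g'E fg.
by exists (Gal fK gK fi).
Qed.

Lemma piso_graph (E' : fieldType) (j : {rmorphism F -> E'}) :
  piso [set u | exists c, u = (i c, j c)]%classic.
Proof.
split.
- by exists 1; rewrite !rmorph1.
- by move=> _ _ [c ->] [d ->]; exists (c - d); rewrite !rmorphB.
- by move=> _ _ [c ->] [d ->]; exists (c * d); rewrite !rmorphM.
- by move=> _ [c ->]; exists c^-1; rewrite !fmorphV.
- by move=> y [c [/esym/eqP]]; rewrite fmorph_eq0 => /eqP -> ->; rewrite rmorph0.
Qed.

Lemma sep_extend (E' : fieldType) (j : {rmorphism F -> E'}) : separably_closed E' ->
  exists f : {rmorphism E -> E'}, forall c, f (i c) = j c.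
Proof.
move=> scE; have [|f fE] := piso_total (piso_graph j) (i := i) (j := j) _ sc.1 scE.
  by move=> c; exists c.
by exists f => c; apply: (fE (i c, j c)); exists c.
Qed.

(** Any root of the minimal polynomial is the image of [z] under an automorphism, hence equals [z].
    Being separable, the polynomial then has degree 1. *)
Lemma fixed_field z : (forall s, s z = z) -> exists c, z = i c.
Proof.
move=> sz; have [p ps pz] := sc.1 z.
have [P0 [P00 s1 P0P]] := minimal_poly (separable_poly_neq0 ps) pz.
have P0s : separable_poly P0 by apply: (@dvdp_separable _ p) => //; rewrite -P0P.
have P0z : root (map_poly i P0) z by rewrite P0P.
have fixr z' : root (map_poly i P0) z' -> z' = z.
  move=> P0z'; have pR := piso_adjoin s1 P0P P0z'.
  have [|f fE] := piso_total pR (i := i) (j := i) _ sc.1 sc.2.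
    by move=> c; exists c%:P; rewrite map_polyC !hornerC.
  have [|s sE] := @gal_endo f.
    by move=> c; apply: (fE (i c, i c)); exists c%:P; rewrite map_polyC !hornerC.
  rewrite -(sz s) sE; apply/esym/(fE (z, z')); exists 'X; by rewrite map_polyX !hornerX.
have := P0z => /factor_theorem[q qE].
have q0 : q != 0 by apply: contraTneq P00 => q0; rewrite -(map_poly_eq0 i) qE q0 mul0r eqxx.
have sq : size q = 1%N.
  apply/eqP; rewrite eqn_leq size_poly_gt0 q0 andbT leqNgt; apply/negP => sq.
  have sepP : separable_poly (map_poly i P0) by rewrite separable_map.
  have sepq : separable_poly q by apply: dvdp_separable sepP; rewrite qE dvdp_mulr.
  have [z' qz'] := sc.2 q sepq sq.
  have /fixr zz' : root (map_poly i P0) z' by rewrite qE rootM qz'.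
  have : coprimep q ('X - z%:P) by apply: (separable_coprime sepP); rewrite qE.
  by rewrite coprimep_XsubC -zz' qz'.
have s2 : size P0 = 2%N.
  by rewrite -(size_map_poly i) qE size_Mmonic ?monicXsubC // sq size_XsubC.
exists (- P0`_0 / P0`_1).
have := P0z; rewrite rootE horner_coef size_map_poly s2 !big_ord_recl big_ord0 /=.
rewrite !coef_map /= expr0 expr1 mulr1 addr0.
have l1 : P0`_1 != 0 by have := P00; rewrite -lead_coef_eq0 lead_coefE s2.
have li : i P0`_1 != 0 by rewrite fmorph_eq0.
rewrite addrC addr_eq0 => /eqP h; apply: (mulfI li); rewrite h.
by rewrite rmorphM fmorphV rmorphN mulrCA mulfV // mulr1.
Qed.

Lemma fixed_poly (p : {poly E}) : (forall s, map_poly s p = p) -> exists q : {poly F}, p = map_poly i q.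
Proof.
move=> sp; have /choice[c cE] : forall k, exists c, p`_k = i c.
  by move=> k; apply: fixed_field => s; rewrite -[in RHS](sp s) coef_map.
exists (\poly_(k < size p) c k); apply/polyP => k; rewrite coef_map coef_poly.
case: ltnP => [_|kp]; first exact: cE.
by rewrite nth_default //; exact/esym/rmorph0.
Qed.

(** Agreement is required on all conjugates [u x], which makes the corresponding open subgroup
    normal. *)
Definition gal_lev_eqv (v : seq E) s t := forall x, x \in v -> forall u : gal i, s (u x) = t (u x).

Definition gal_pgrp : pgrp.
Proof.
refine (@Pgrp (gal i) (@galM _ _ i) (gal1 i) (@galV _ _ i) galMA gal1M galVM (seq E) gal_lev_eqv
  _ _ _ _ _ _ _ [::]).
- by [].
- by move=> v s t st x xv u; rewrite st.
- by move=> v t s u st tu x xv w; rewrite st ?tu.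
- by move=> v u s t st x xv w /=; rewrite st.
- by move=> v u s t st x xv w; have := st x xv (galM u w).
- move=> v w; exists (v ++ w) => s t st; split=> x xv u; apply: st; rewrite mem_cat xv ?orbT //.
(* If finitely many classes never suffice, every finite list misses some element [sig L]. A limit
   [g] of these agrees with [sig L] at level [v] for some list [L] that contains [g], a
   contradiction. *)
- move=> v; apply: contrapT => nf.
  have /choice[sig sigE] : forall L : seq (gal i), exists s, forall t, t \in L -> ~ gal_lev_eqv v s t.
    move=> L; apply: contrapT => nL; apply: nf; exists (nth (gal1 i) L), (size L) => s.
    apply: contrapT => ns; apply: nL; exists s => t tL st; apply: ns.
    by exists (index t L); rewrite ?index_mem // nth_index.
  have [g gE] := gal_limit (fun L (_ : unit) => sig L).
  have [L [Lg LE]] := gE [:: g tt] [seq (tt, y) | y <- flatten [seq orb x | x <- v]].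
  apply: (sigE L (g tt)); first by apply: Lg; rewrite mem_head.
  move=> x xv u; apply: LE; apply: map_f; apply/flattenP; exists (orb x); [exact: map_f|exact: mem_orb].
Defined.

End GaloisGroup.

Record vring (E : fieldType) (O : set E) : Prop := Vring {
  vr1 : O 1;
  vrB : forall x y, O x -> O y -> O (x - y);
  vrM : forall x y, O x -> O y -> O (x * y);
  vr_val : forall x, O x \/ O x^-1
}.

(** * Extension of places *)

Section Chevalley.
Context (E : fieldType) (A0 : comUnitRingType) (iota : {rmorphism A0 -> E}).
Hypothesis iota_inj : injective iota.
Hypothesis loc : forall x y : A0, x \isn't a GRing.unit -> y \isn't a GRing.unit ->
  x + y \isn't a GRing.unit.

(** The ideal of [A] generated by the maximal ideal of the local ring [A0]. *)
Definition idl (A : set E) (x : E) := exists s : seq (A0 * E),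
  (forall u, u \in s -> u.1 \isn't a GRing.unit /\ A u.2) /\ x = \sum_(u <- s) iota u.1 * u.2.

Record dominates (A : set E) : Prop := Dominates {
  do1 : A 1;
  doB : forall x y, A x -> A y -> A (x - y);
  doM : forall x y, A x -> A y -> A (x * y);
  do_iota : forall w, A (iota w);
  do_proper : ~ idl A 1
}.

Section Ideal.
Context (A : set E) (dA : dominates A).

Lemma idl0 : idl A 0.
Proof. by exists [::]; rewrite big_nil. Qed.

Lemma idlD x y : idl A x -> idl A y -> idl A (x + y).
Proof.
move=> [s [sA ->]] [t [tA ->]]; exists (s ++ t); rewrite big_cat; split=> // u.
by rewrite mem_cat => /orP[/sA|/tA].
Qed.

Lemma idlM x y : idl A x -> A y -> idl A (x * y).
Proof.
move=> [s [sA ->]] Ay; exists [seq (u.1, u.2 * y) | u <- s]; split.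
  by move=> _ /mapP[u /sA[u1 u2] ->]; split=> //; exact: (doM dA).
by rewrite big_map mulr_suml; apply: eq_bigr => u _; rewrite mulrA.
Qed.

Lemma do0 : A 0.
Proof. by rewrite -(subrr 1); apply: (doB dA); exact: (do1 dA). Qed.
Lemma doN x : A x -> A (- x).
Proof. by move=> Ax; rewrite -sub0r; apply: (doB dA) => //; exact: do0. Qed.
Lemma doD x y : A x -> A y -> A (x + y).
Proof. by move=> Ax Ay; rewrite -[y]opprK; apply: (doB dA) => //; exact: doN. Qed.

Lemma idl_sub x : idl A x -> A x.
Proof.
move=> [s [sA ->]]; rewrite big_seq; elim/big_ind: _ => [||u /sA[_ u2]].
- exact: do0.
- exact: doD.
- by apply: (doM dA) => //; exact: (do_iota dA).
Qed.

(** An equation, of degree less than [n] in [x], showing that the maximal ideal of [A0] generates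
    the unit ideal of [A[x]]. *)
Definition relation x n := exists p : {poly E}, [/\ (size p <= n)%N, forall k, idl A p`_k & p.[x] = 1].

Lemma relation1 x : ~ relation x 1.
Proof.
move=> [p [sp pi px]]; apply: (do_proper dA); rewrite -px.
by rewrite (size1_polyC sp) hornerC.
Qed.

Lemma relation_step x n m : x != 0 -> (m <= n)%N -> (0 < n)%N ->
  relation x n.+1 -> relation x^-1 m.+1 -> relation x n.
Proof.
move=> x0 mn n0 [p [sp pi px]] [q [sq qi qx]].
pose a := p`_n; pose b := q`_0.
(* The relation for [x] is multiplied by [1 - b], and its leading term [a (1 - b) x ^ n] is replaced
   by means of the relation for [x^-1], which expresses [(1 - b) x ^ n] in lower powers. Adding [b]
   restores the value 1. *)
pose r := (1 - b) *: (\poly_(k < n) p`_k) + b%:P + a *: \sum_(j < m) q`_j.+1 *: 'X^(n - j.+1).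
have Ab : A (1 - b) by apply: (doB dA); [exact: (do1 dA)|exact: idl_sub (qi _)].
exists r; split.
- apply: (leq_trans (size_polyD _ _)); rewrite geq_max; apply/andP; split.
    apply: (leq_trans (size_polyD _ _)); rewrite geq_max (leq_trans (size_scale_leq _ _)) ?size_poly //=.
    by rewrite (leq_trans (size_polyC_leq1 _)).
  apply: (leq_trans (size_scale_leq _ _)); apply: (leq_trans (size_sum _ _ _)).
  apply/bigmax_leqP => j _; apply: (leq_trans (size_scale_leq _ _)); rewrite size_polyXn.
  by have := ltn_ord j; lia.
- move=> k; rewrite !coefD !coefZ coefC coef_poly; apply: idlD; first apply: idlD.
  + by rewrite mulrC; apply: idlM => //; case: ifP => // _; exact: idl0.
  + by case: ifP => _; [exact: qi|exact: idl0].
  + apply: idlM; first exact: pi.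
    rewrite coef_sum; elim/big_ind: _ => [||j _]; [exact: do0|exact: doD|].
    rewrite coefZ coefXn; apply: (doM dA); first exact: idl_sub (qi _).
    by case: eqP => _; [exact: (do1 dA)|exact: do0].
- have pE : p = \poly_(k < n) p`_k + a *: 'X^n.
    apply/polyP => k; rewrite coefD coef_poly coefZ coefXn.
    have [kn|kn|->] := ltngtP k n; rewrite ?mulr0 ?addr0 ?add0r ?mulr1 ?mulr0n //.
    by rewrite nth_default ?mulr0 // (leq_trans sp).
  have e1 : (\poly_(k < n) p`_k).[x] = 1 - a * x ^+ n.
    by rewrite -px {2}pE hornerD hornerZ hornerXn addrK.
  have e2 : 1 - b = \sum_(j < m) q`_j.+1 * x^-1 ^+ j.+1.
    rewrite -qx (horner_coef_wide _ sq) big_ord_recl expr0 mulr1 addrAC subrr add0r.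
    by [].
  have e3 : (\sum_(j < m) q`_j.+1 *: 'X^(n - j.+1)).[x] = (1 - b) * x ^+ n.
    rewrite e2 horner_sum mulr_suml; apply: eq_bigr => j _; rewrite hornerZ hornerXn.
    rewrite -mulrA; congr (_ * _); rewrite exprVn.
    have jn : (j.+1 <= n)%N by rewrite (leq_trans (ltn_ord j)).
    by rewrite -{2}(subnK jn) exprD mulrCA mulVf ?mulr1 // expf_neq0.
  rewrite /r !hornerD !hornerZ hornerC e1 e3; ring.
Qed.

Lemma relation_absurd x n m : x != 0 -> relation x n -> relation x^-1 m -> False.
Proof.
have [k] := ubnP (n + m); elim: k x n m => // k IH x n m nm x0 rn rm.
have leW y c d : (c <= d)%N -> relation y c -> relation y d.
  by move=> cd [p [sp h1 h2]]; exists p; split=> //; exact: leq_trans cd.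
case: n nm rn => [|[|n]] nm rn; [by apply: (relation1 (x := x)); apply: leW rn|exact: relation1 rn|].
case: m nm rm => [|[|m]] nm rm; [by apply: (relation1 (x := x^-1)); apply: leW rm|exact: relation1 rm|].
have [mn|/ltnW mn] := leqP m n.
  by apply: (IH x n.+1 m.+2); [lia| |apply: relation_step rm|].
apply: (IH x n.+2 m.+1); [lia| | |] => //; apply: (@relation_step _ _ n.+1) => //.
  by rewrite invr_eq0.
by rewrite invrK.
Qed.

Definition adjoin x : set E := [set y | exists2 p : {poly E}, forall k, A p`_k & y = p.[x]]%classic.

Lemma adjoin_dom x : (forall n, ~ relation x n) -> dominates (adjoin x).
Proof.
move=> nr; split.
- exists 1 => [k|]; last by rewrite hornerC.
  by rewrite coef1; case: eqP => _; [exact: (do1 dA)|exact: do0].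
- move=> _ _ [p pA ->] [q qA ->]; exists (p - q) => [k|]; last by rewrite !hornerE.
  by rewrite coefB; exact: (doB dA).
- move=> _ _ [p pA ->] [q qA ->]; exists (p * q) => [k|]; last by rewrite hornerM.
  rewrite coefM; elim/big_ind: _ => [||j _]; [exact: do0|exact: doD|exact: (doM dA)].
- move=> w; exists (iota w)%:P => [k|]; last by rewrite hornerC.
  by rewrite coefC; case: eqP => _; [exact: (do_iota dA)|exact: do0].
- move=> [s [sA s1]].
  suff [p [pi pE]] : exists p : {poly E}, (forall k, idl A p`_k) /\
      p.[x] = \sum_(u <- s) iota u.1 * u.2.
    by apply: (nr (size p)); exists p; split=> //; rewrite pE -s1.
  elim: s sA {s1} => [|u s IH] sA.
    by exists 0; rewrite horner0 big_nil; split=> // k; rewrite coef0; exact: idl0.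
  have [|p [pi pE]] := IH; first by move=> w ws; apply: sA; rewrite inE ws orbT.
  have [u1 [q qA qE]] := sA u (mem_head _ _).
  exists (iota u.1 *: q + p); split=> [k|]; last by rewrite hornerD hornerZ pE big_cons qE.
  rewrite coefD coefZ; apply: idlD => //; exists [:: (u.1, q`_k)]; rewrite big_seq1; split=> //.
  by move=> w; rewrite inE => /eqP ->; split=> //; exact: qA.
Qed.

End Ideal.

Lemma dom_iota : dominates [set x | exists w, x = iota w]%classic.
Proof.
split.
- by exists 1; rewrite rmorph1.
- by move=> _ _ [x ->] [y ->]; exists (x - y); rewrite rmorphB.
- by move=> _ _ [x ->] [y ->]; exists (x * y); rewrite rmorphM.
- by move=> w; exists w.
move=> [s [sA s1]].
suff [m [mu mE]] : exists m, m \isn't a GRing.unit /\ iota m = \sum_(u <- s) iota u.1 * u.2.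
  have m1 : m = 1 by apply: iota_inj; rewrite mE -s1 rmorph1.
  by move: mu; rewrite m1 unitr1.
elim: s sA {s1} => [|u s IH] sA; first by exists 0; rewrite rmorph0 big_nil unitr0.
have [|m [mu mE]] := IH; first by move=> w ws; apply: sA; rewrite inE ws orbT.
have [u1 [w wE]] := sA u (mem_head _ _).
exists (u.1 * w + m); rewrite rmorphD rmorphM mE big_cons wE; split=> //.
by apply: loc => //; apply: contra u1; rewrite unitrM => /andP[].
Qed.

(** A maximal subring dominating [A0] contains every [x] without a relation, and [x] and [x^-1]
    cannot both have one: the relations would shorten each other. *)
Theorem chevalley : exists O : set E, [/\ vring O, forall w, O (iota w) &
  forall w, w \isn't a GRing.unit -> iota w != 0 -> ~ O (iota w)^-1].
Proof.
set R0 := [set x | exists w, x = iota w]%classic.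
have [A [/= dA maxA]] : exists A, dominates (A `|` R0)%classic /\
    forall B, (A `<` B)%classic -> ~ dominates (B `|` R0)%classic.
  apply: (Zorn_bigcup (P := [set A | dominates (A `|` R0)]%classic)) => FF FP tot /=.
  pose F' := (FF `|` [set set0])%classic.
  have F'P X : F' X -> dominates (X `|` R0)%classic.
    by move=> [/FP//|/= ->]; rewrite set0U; exact: dom_iota.
  have F'tot X Y : F' X -> F' Y -> (X `<=` Y)%classic \/ (Y `<=` X)%classic.
    by move=> [FX|/= ->] [FY|/= ->]; [exact: tot|right|left|left].
  have mem u : (\bigcup_(X in FF) X `|` R0)%classic u -> exists2 X, F' X & (X `|` R0)%classic u.
    by move=> [[X FX Xu]|ru]; [exists X; left|exists set0; right].
  have inc X u : F' X -> (X `|` R0)%classic u -> (\bigcup_(X in FF) X `|` R0)%classic u.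
    by move=> [FX|/= ->] [Xu|ru] //; [left; exists X|right|right].
  have all_in (s : seq E) : (forall u, u \in s -> (\bigcup_(X in FF) X `|` R0)%classic u) ->
      exists2 X, F' X & forall u, u \in s -> (X `|` R0)%classic u.
    elim: s => [|u s IH] sU; first by exists set0 => //; right.
    have [|X FX Xs] := IH; first by move=> w ws; apply: sU; rewrite inE ws orbT.
    have [Y FY Yu] := mem _ (sU u (mem_head _ _)).
    have [XY|YX] := F'tot X Y FX FY; [exists Y|exists X] => // w; rewrite inE => /orP[/eqP -> //|/Xs //].
      by case=> [/XY|]; [left|right].
    by case: Yu => [/YX|]; [left|right].
  have two u w : (\bigcup_(X in FF) X `|` R0)%classic u ->
      (\bigcup_(X in FF) X `|` R0)%classic w ->
      exists2 X, F' X & (X `|` R0)%classic u /\ (X `|` R0)%classic w.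
    move=> uU wU; have [|X FX Xs] := all_in [:: u; w].
      by move=> z; rewrite !inE => /orP[] /eqP ->.
    by exists X => //; split; apply: Xs; rewrite !inE eqxx ?orbT.
  split.
  - by right; exists 1; rewrite rmorph1.
  - by move=> u w /two/[apply] -[X FX [Xu Xw]]; apply: inc FX (doB (F'P X FX) Xu Xw).
  - by move=> u w /two/[apply] -[X FX [Xu Xw]]; apply: inc FX (doM (F'P X FX) Xu Xw).
  - by move=> w; right; exists w.
  - move=> [s [sA s1]]; have [|X FX Xs] := all_in [seq u.2 | u <- s].
      by move=> _ /mapP[u /sA[_ u2] ->].
    apply: (do_proper (F'P X FX)); exists s; split=> // u us; split; first by case: (sA u us).
    by apply: Xs; exact: map_f.
have clos x : (forall n, ~ relation (A `|` R0)%classic x n) -> (A `|` R0)%classic x.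
  move=> nr; have dB := adjoin_dom dA nr; apply: contrapT => nx.
  have AB : ((A `|` R0) `<=` adjoin (A `|` R0) x)%classic.
    move=> y Ay; exists y%:P => [k|]; last by rewrite hornerC.
    by rewrite coefC; case: eqP => // _; exact: (do0 dA).
  apply: (maxA (adjoin (A `|` R0)%classic x)).
    split; first by move=> y Ay; apply: AB; left.
    move=> BA; apply: nx; left; apply: BA; exists 'X => [k|]; last by rewrite hornerX.
    by rewrite coefX; case: eqP => _; [exact: (do1 dA)|exact: (do0 dA)].
  suff -> : (adjoin (A `|` R0) x `|` R0 = adjoin (A `|` R0) x)%classic by [].
  by apply/seteqP; split=> u; [case=> // ru; apply: AB; right|left].
exists (A `|` R0)%classic; split.
- split; [exact: (do1 dA)|exact: (doB dA)|exact: (doM dA)|].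
  move=> x; have [->|x0] := eqVneq x 0; first by left; exact: (do0 dA).
  have [/clos|/existsNP[n /contrapT rn]] := pselect (forall n, ~ relation (A `|` R0)%classic x n).
    by left.
  right; apply: clos => m rm; exact: (relation_absurd dA x0 rn rm).
- by move=> w; exact: (do_iota dA).
- move=> w wu w0 Aw; apply: (do_proper dA); exists [:: (w, (iota w)^-1)]; rewrite big_seq1 mulfV //.
  by split=> // u; rewrite inE => /eqP ->.
Qed.

End Chevalley.

(** * Valuation rings of a separably closed field *)

Section ValuationRing.
Context (E : fieldType) (O : set E) (vO : vring O).
Implicit Types x y z : E.

(** Membership in the units of [O]; [vm] is membership in its maximal ideal. *)
Definition vu x := [/\ x != 0, O x & O x^-1].
Definition vm x := O x /\ (x != 0 -> ~ O x^-1).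

Lemma vr0 : O 0. Proof. by rewrite -(subrr 1); apply: (vrB vO); exact: (vr1 vO). Qed.
Lemma vrN x : O x -> O (- x).
Proof. by move=> Ox; rewrite -sub0r; apply: (vrB vO) => //; exact: vr0. Qed.
Lemma vrD x y : O x -> O y -> O (x + y).
Proof. by move=> Ox Oy; rewrite -[y]opprK; apply: (vrB vO) => //; exact: vrN. Qed.
Lemma vrX x n : O x -> O (x ^+ n).
Proof. by move=> Ox; elim: n => [|n IH]; rewrite ?exprS; [exact: (vr1 vO)|exact: (vrM vO)]. Qed.
Lemma vr_sum (I : eqType) (r : seq I) (f : I -> E) :
  (forall k, k \in r -> O (f k)) -> O (\sum_(k <- r) f k).
Proof. by move=> h; rewrite big_seq; elim/big_ind: _ => //; [exact: vr0|exact: vrD]. Qed.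
Lemma vr_prod (I : eqType) (r : seq I) (f : I -> E) :
  (forall k, k \in r -> O (f k)) -> O (\prod_(k <- r) f k).
Proof. by move=> h; rewrite big_seq; elim/big_ind: _ => //; [exact: (vr1 vO)|exact: (vrM vO)]. Qed.

Lemma vm0 : vm 0. Proof. by split; [exact: vr0|rewrite eqxx]. Qed.
Lemma vmM x y : vm x -> O y -> vm (x * y).
Proof.
move=> [Ox nx] Oy; split; first exact: (vrM vO).
rewrite mulf_eq0 negb_or => /andP[x0 y0] h; apply: (nx x0).
have -> : x^-1 = y * (x * y)^-1 by rewrite invfM mulrCA mulfV ?mulr1.
exact: (vrM vO).
Qed.
Lemma vmMl x y : O x -> vm y -> vm (x * y).
Proof. by move=> Ox my; rewrite mulrC; exact: vmM. Qed.
Lemma vmN x : vm x -> vm (- x).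
Proof. by move=> mx; rewrite -mulrN1; apply: vmM => //; apply: vrN; exact: (vr1 vO). Qed.
Lemma vm_nu x : vm x -> vu x -> False.
Proof. by move=> [_ nx] [x0 _ /(nx x0)]. Qed.
Lemma vm_or_vu x : O x -> vm x \/ vu x.
Proof.
move=> Ox; have [->|x0] := eqVneq x 0; first by left; exact: vm0.
by have [h|h] := pselect (O x^-1); [right|left; split].
Qed.
Lemma vmD x y : vm x -> vm y -> vm (x + y).
Proof.
suff H u v : u != 0 -> v != 0 -> O (u / v) -> vm u -> vm v -> vm (u + v).
  have [->|x0] := eqVneq x 0; first by rewrite add0r.
  have [->|y0] := eqVneq y 0; first by rewrite addr0.
  by have [h|] := vr_val vO (x / y); [|rewrite invf_div addrC => h mx my]; exact: H.
move=> u0 v0 uv _ mv.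
have -> : u + v = v * (u / v + 1) by rewrite mulrDr mulr1 mulrCA mulfV ?mulr1.
by apply: vmM => //; apply: vrD => //; exact: (vr1 vO).
Qed.
Lemma vmB x y : vm x -> vm y -> vm (x - y).
Proof. by move=> mx my; apply: vmD => //; exact: vmN. Qed.
Lemma vm_sum (I : eqType) (r : seq I) (f : I -> E) :
  (forall k, k \in r -> vm (f k)) -> vm (\sum_(k <- r) f k).
Proof. by move=> h; rewrite big_seq; elim/big_ind: _ => //; [exact: vm0|exact: vmD]. Qed.
Lemma vu1 : vu 1. Proof. by split; rewrite ?oner_eq0 ?invr1 //; exact: (vr1 vO). Qed.
Lemma vm1 : ~ vm 1. Proof. by move=> /vm_nu; apply; exact: vu1. Qed.
Lemma vuM x y : vu x -> vu y -> vu (x * y).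
Proof.
move=> [x0 Ox xO] [y0 Oy yO]; split; rewrite ?mulf_neq0 ?invfM //; exact: (vrM vO).
Qed.
Lemma vuV x : vu x -> vu x^-1.
Proof. by move=> [x0 Ox xO]; split; rewrite ?invr_eq0 ?invrK. Qed.
Lemma vu_addm x y : vu x -> vm y -> vu (x + y).
Proof.
move=> ux my; have [x0 Ox _] := ux.
have [m|//] := vm_or_vu (vrD Ox my.1); case: (@vm_nu x) => //.
by rewrite -(addrK y x); exact: vmB.
Qed.
Lemma vmMP x y : O x -> O y -> vm (x * y) -> vm x \/ vm y.
Proof.
move=> Ox Oy m; have [|ux] := vm_or_vu Ox; first by left.
have [|uy] := vm_or_vu Oy; first by right.
by case: (vm_nu m); exact: vuM.
Qed.
Lemma vuMP x y : O x -> O y -> vu (x * y) -> vu x.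
Proof.
move=> Ox Oy u; have [mx|//] := vm_or_vu Ox.
by case: (@vm_nu (x * y)) => //; exact: vmM.
Qed.
Lemma vu_inv_or x : x != 0 -> [\/ vm x, vu x | vm x^-1].
Proof.
move=> x0; have [Ox|Ox] := vr_val vO x.
  by have [] := vm_or_vu Ox; [constructor 1|constructor 2].
have [|] := vm_or_vu Ox; first by constructor 3.
by move=> /vuV; rewrite invrK; constructor 2.
Qed.

Lemma vmaximal (s : seq E) : (exists2 x, x \in s & x != 0) ->
  exists x, [/\ x \in s, x != 0 & forall y, y \in s -> O (y / x)].
Proof.
elim: s => [[] //|a s IH] [x]; rewrite inE => h x0.
have [nz|/existsNP[y /not_implyP[ys /eqP y0]]] := pselect (forall y, y \in s -> y = 0).
  have a0 : a != 0 by case/orP: h => [/eqP <- //|/nz xz]; rewrite xz eqxx in x0.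
  exists a; split=> //; first exact: mem_head.
  move=> y; rewrite inE => /orP[/eqP ->|/nz ->]; last by rewrite mul0r; exact: vr0.
  by rewrite mulfV //; exact: (vr1 vO).
have [|m [ms m0 mE]] := IH; first by exists y.
have [am|ma] := vr_val vO (a / m).
  by exists m; split=> // [|z]; rewrite inE ?ms ?orbT // => /orP[/eqP ->//|/mE].
have [az|a0] := eqVneq a 0.
  exists m; split=> // [|z]; rewrite inE ?ms ?orbT // => /orP[/eqP ->|/mE//].
  by rewrite az mul0r; exact: vr0.
exists a; split=> // [|z]; first exact: mem_head.
rewrite inE => /orP[/eqP ->|/mE zm]; first by rewrite mulfV //; exact: (vr1 vO).
have -> : z / a = z / m * (a / m)^-1 by rewrite invf_div mulrA mulfVK.
exact: (vrM vO).
Qed.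

Definition polyO (p : {poly E}) := forall k, O p`_k.

Lemma polyO_horner p x : polyO p -> O x -> O p.[x].
Proof.
move=> pO Ox; rewrite horner_coef; elim/big_ind: _ => //; [exact: vr0|exact: vrD|].
by move=> k _; apply: (vrM vO) => //; exact: vrX.
Qed.

(** The index of the first coefficient of least valuation, at which Gauss's lemma isolates a single
    dominant term of the product. *)
Lemma content_index (p : {poly E}) : p != 0 -> exists i, [/\ p`_i != 0,
  forall k, O (p`_k / p`_i) & forall k, (k < i)%N -> vm (p`_k / p`_i)].
Proof.
move=> p0; pose A i := `[< p`_i != 0 /\ forall k, O (p`_k / p`_i) >].
have exA : exists i, A i.
  have [|x [xp x0 xE]] := @vmaximal p.
    by exists (lead_coef p); rewrite ?lead_coef_eq0 // lead_coefE mem_nth // prednK // size_poly_gt0.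
  exists (index x p); apply/asboolP; rewrite nth_index //; split=> // k.
  have [kp|kp] := ltnP k (size p); first by apply: xE; exact: mem_nth.
  by rewrite nth_default // mul0r; exact: vr0.
case: (ex_minnP exA) => i /asboolP[i0 iE] imin; exists i; split=> // k ki.
have [//|[k0 _ kO]] := vm_or_vu (iE k).
have : A k; last by move=> /imin; rewrite leqNgt ki.
apply/asboolP; split.
  by move: k0; rewrite mulf_eq0 negb_or => /andP[].
move=> n; have -> : p`_n / p`_k = p`_n / p`_i * (p`_k / p`_i)^-1 by rewrite invf_div mulrA mulfVK.
exact: (vrM vO).
Qed.

(* Gauss's lemma. *)
Lemma polyO_div (d p : {poly E}) : d \is monic -> polyO (d * p) -> polyO p.
Proof.
move=> dm dpO; have [->|p0] := eqVneq p 0; first by move=> k; rewrite coef0; exact: vr0.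
have [i [i0 iO im]] := content_index (monic_neq0 dm).
have [j [j0 jO jm]] := content_index p0.
have di : O (d`_i)^-1.
  by have := iO (size d).-1; rewrite -lead_coefE (monicP dm) mul1r.
have E1 : vu ((d * p)`_(i + j) / (d`_i * p`_j)).
  rewrite coefM mulr_suml (bigD1 (inord i)) //= inordK ?ltnS ?leq_addr // addKn.
  rewrite mulfV ?mulf_neq0 //; apply: vu_addm; first exact: vu1.
  elim/big_ind: _ => [||k ki]; [exact: vm0|exact: vmD|].
  have -> : d`_k * p`_(i + j - k) / (d`_i * p`_j) = (d`_k / d`_i) * (p`_(i + j - k) / p`_j).
    by rewrite invfM mulrACA.
  have [kli|ilk|ki'] := ltngtP k i; last first.
  - by case/eqP: ki; apply: val_inj; rewrite /= inordK ?ltnS ?leq_addr.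
  - by apply: vmMl => //; apply: jm; have := ltn_ord k; lia.
  - by apply: vmM => //; exact: im.
have Oij : O (d`_i * p`_j).
  have [x0 _ xO] := E1; have := vrM vO (dpO (i + j)%N) xO.
  by rewrite invf_div mulrCA mulfV ?mulr1 //; move: x0; rewrite mulf_eq0 negb_or => /andP[].
have Oj : O p`_j by rewrite -(mulKf i0 p`_j); exact: (vrM vO).
by move=> k; rewrite -(mulfVK j0 p`_k); exact: (vrM vO).
Qed.

Lemma polyO_factor (g h : {poly E}) : g \is monic -> h \is monic -> polyO (g * h) ->
  polyO g /\ polyO h.
Proof. by move=> gm hm gh; split; [apply: (polyO_div hm); rewrite mulrC|exact: polyO_div gh]. Qed.

Lemma integral_root (f : {poly E}) r : f \is monic -> polyO f -> root f r -> O r.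
Proof.
move=> fm fO /factor_theorem[q qE].
have qm : q \is monic by rewrite -(monicMr _ (monicXsubC r)) -qE.
have := fO; rewrite qE => /(polyO_factor qm (monicXsubC r))[_ /(_ 0%N)].
by rewrite coefB coefX coefC sub0r /= => /vrN; rewrite opprK.
Qed.

Hypothesis scE : separably_closed E.

Lemma monic_split (f : {poly E}) : f \is monic -> (2 < size f)%N -> f^`() != 0 -> exists g h,
  [/\ g \is monic, h \is monic, f = g * h & (size g < size f)%N && (size h < size f)%N].
Proof.
move=> fm sf f'0; have f0 := monic_neq0 fm.
have [sepf|nsep] := boolP (separable_poly f).
  have [r /factor_theorem[q qE]] := scE sepf (ltnW sf).
  have qm : q \is monic by rewrite -(monicMr _ (monicXsubC r)) -qE.
  exists q, ('X - r%:P); split=> //; first exact: monicXsubC.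
  rewrite size_XsubC sf andbT qE size_Mmonic ?monicXsubC ?monic_neq0 // size_XsubC.
  by have := size_poly_gt0 q; rewrite monic_neq0 //; lia.
pose d0 := gcdp f f^`().
have d00 : d0 != 0 by rewrite gcdp_eq0 negb_and f0.
pose d := (lead_coef d0)^-1 *: d0.
have lc0 : lead_coef d0 != 0 by rewrite lead_coef_eq0.
have dm : d \is monic by rewrite monicE lead_coefZ mulVf.
have df : d %| f by rewrite dvdpZl ?invr_eq0 // dvdp_gcdl.
have dE : f = d * (f %/ d) by rewrite mulrC divpK.
have em : (f %/ d) \is monic by rewrite -(monicMl _ dm) -dE.
have sd1 : (1 < size d)%N.
  rewrite size_scale ?invr_eq0 //; move: nsep; rewrite unlock coprimep_def -/d0.
  by have := size_poly_gt0 d0; rewrite d00; case: (size d0) => [|[|]].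
have sdf : (size d < size f)%N.
  apply: (leq_ltn_trans _ (lt_size_deriv f0)); apply: dvdp_leq f'0 _.
  by rewrite dvdpZl ?invr_eq0 // dvdp_gcdr.
exists d, (f %/ d); split=> //; rewrite sdf /=.
have := congr1 (fun p : {poly E} => size p) dE; rewrite size_Mmonic ?monic_neq0 // => ->.
have := size_poly_gt0 (f %/ d); rewrite monic_neq0 //; move: sd1; clear.
by move: (size d) => [|[|m]] // _ _; rewrite !addSn /= ltnS leq_addl.
Qed.

Lemma hensel (f : {poly E}) a : f \is monic -> polyO f -> O a -> vm f.[a] -> vu f^`().[a] ->
  exists r, [/\ root f r, O r & vm (a - r)].
Proof.
have [n] := ubnP (size f); elim: n f => // n IH f sn fm fO Oa fa f'a.
have f'0 : f^`() != 0.
  by apply/eqP => f'0; move: f'a; rewrite f'0 horner0 => -[]; rewrite eqxx.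
have [s2|s2] := leqP (size f) 2.
  have sf : size f = 2%N.
    apply/eqP; rewrite eqn_leq s2 ltnNge; apply/negP => /size1_polyC fE.
    by move: f'0; rewrite fE derivC eqxx.
  have fE : f = 'X + (f`_0)%:P.
    apply/polyP => k; rewrite coefD coefX coefC.
    case: k => [|[|k]]; rewrite ?add0r ?addr0 //=.
      by have := monicP fm; rewrite lead_coefE sf.
    by rewrite nth_default // sf.
  exists (- f`_0); split; [|exact: vrN|].
    by rewrite rootE fE !hornerE -fE addNr.
  by rewrite opprK; have := fa; rewrite {1}fE !hornerE.
have [g [h [gm hm fE /andP[sg sh]]]] := monic_split fm s2 f'0.
have [gO hO] : polyO g /\ polyO h by apply: polyO_factor => //; rewrite -fE.
have gp k : polyO k -> polyO k^`().
  move=> kO m; rewrite coef_deriv; move: (kO m.+1); move: (k`_m.+1) => c Oc.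
  by elim: m.+1 => [|q IHq]; [rewrite mulr0n; exact: vr0|rewrite mulrS; exact: vrD].
have go := polyO_horner gO Oa; have ho := polyO_horner hO Oa.
have go' := polyO_horner (gp _ gO) Oa; have ho' := polyO_horner (gp _ hO) Oa.
move: fa f'a; rewrite fE derivM hornerM hornerD !hornerM => fa f'a.
have lt (k : {poly E}) : (size k < size f)%N -> (size k < n)%N by move=> h1; apply: leq_trans h1 _; rewrite -ltnS.
have [ga|ha] := vmMP go ho fa.
  have u : vu (g^`().[a] * h.[a]).
    by rewrite -(addrK (g.[a] * h^`().[a]) (_ * h.[a])); apply: vu_addm => //; apply: vmN; exact: vmM.
  have [r [rr Or ar]] := IH g (lt _ sg) gm gO Oa ga (vuMP go' ho u).
  by exists r; split=> //; rewrite rootM rr.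
have u : vu (h^`().[a] * g.[a]).
  rewrite mulrC -(addKr (g^`().[a] * h.[a]) (g.[a] * _)) addrC; apply: vu_addm => //.
  by apply: vmN; exact: vmMl.
have [r [rr Or ar]] := IH h (lt _ sh) hm hO Oa ha (vuMP ho' go u).
by exists r; split=> //; rewrite rootM rr orbT.
Qed.

Definition vpred : {pred E} := [pred x | `[< O x >]].

Fact vpred_closed : subring_closed vpred.
Proof.
split=> [|x y|x y]; first by apply: asboolT; exact: (vr1 vO).
  by move=> /asboolW Ox /asboolW Oy; apply: asboolT; exact: (vrB vO).
by move=> /asboolW Ox /asboolW Oy; apply: asboolT; exact: (vrM vO).
Qed.
HB.instance Definition _ := GRing.isSubringClosed.Build E vpred vpred_closed.

Record vtype := Vtype { v_val :> E; _ : v_val \in vpred }.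
HB.instance Definition _ := [isSub for v_val].
HB.instance Definition _ := [Choice of vtype by <:].
HB.instance Definition _ := [SubChoice_isSubComNzRing of vtype by <:].

Lemma vtypeP (x : vtype) : O (val x).
Proof. by have /asboolW := valP x. Qed.

Definition vunit : {pred vtype} := [pred x | `[< vu (val x) >]].
Definition vinv (x : vtype) : vtype := if x \in vunit then insubd x (val x)^-1 else x.

Fact vmulVx : {in vunit, left_inverse 1 vinv *%R}.
Proof.
move=> x xu; apply: val_inj; rewrite /vinv xu /=; have /asboolW[x0 _ xO] := xu.
by rewrite insubdK ?mulVf //; exact: asboolT.
Qed.
Fact vunitPl (x y : vtype) : y * x = 1 -> vunit x.
Proof.
move=> /(congr1 val) /= yx; apply: asboolT.
have x0 : val x != 0 by apply/eqP => x0; move: yx; rewrite x0 mulr0 => /eqP; rewrite eq_sym oner_eq0.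
split=> //; first exact: vtypeP.
by have -> : (val x)^-1 = val y by [apply: (mulIf x0); rewrite mulVf]; exact: vtypeP.
Qed.
Fact vinv_out : {in [predC vunit], vinv =1 id}.
Proof. by move=> x; rewrite inE /= /vinv => /negbTE ->. Qed.
HB.instance Definition _ := GRing.ComNzRing_hasMulInverse.Build vtype vmulVx vunitPl vinv_out.

Definition vmax : {pred vtype} := [pred x | `[< vm (val x) >]].

Fact vmax_closed : idealr_closed vmax.
Proof.
split; first by apply: asboolT; exact: vm0.
  by apply/negP => /asboolW/vm1.
move=> a x y /asboolW mx /asboolW my; apply: asboolT => /=.
apply: vmD => //; apply: vmMl => //; exact: vtypeP.
Qed.
HB.instance Definition _ := isIdealr.Build vtype vmax vmax_closed.

Definition vres := {ideal_quot vmax}.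
HB.instance Definition _ := GRing.ComNzRing.on vres.

Definition vpi (x : vtype) : vres := \pi_vres%qT x.
Lemma vpi_eq0 (x : vtype) : (vpi x = 0) <-> vm (val x).
Proof.
split=> [/eqP|mx].
  by rewrite /vpi -[X in _ == X](raddf0 \pi%qT) -Quotient.idealrBE subr0 => /asboolW.
apply/eqP; rewrite /vpi -[X in _ == X](raddf0 \pi%qT) -Quotient.idealrBE subr0; exact: asboolT.
Qed.

Definition vresV (x : vres) : vres :=
  if x == 0 then 0 else vpi ((generic_quotient.repr x)^-1).
Fact vres_mulVf (x : vres) : x != 0 -> vresV x * x = 1.
Proof.
move=> x0; rewrite /vresV (negbTE x0).
have ux : vu (val (generic_quotient.repr x)).
  have [m|//] := vm_or_vu (vtypeP (generic_quotient.repr x)).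
  by case/eqP: x0; rewrite -[x]generic_quotient.reprK; apply/vpi_eq0.
rewrite -{2}[x]generic_quotient.reprK /vpi -rmorphM mulVr ?rmorph1 //; exact: asboolT.
Qed.
Fact vresV0 : vresV 0 = 0. Proof. by rewrite /vresV eqxx. Qed.
HB.instance Definition _ := GRing.ComNzRing_isField.Build vres vres_mulVf vresV0.

(** Presents [O] and its residue field as bundled structures, the form in which the universal
    property of the strict henselization takes its target. *)
Theorem vring_package : exists (H : comUnitRingType) (K : fieldType) (rH : {rmorphism H -> K})
    (j : {rmorphism H -> E}), [/\ injective j, forall x, O x <-> exists h, j h = x,
    residue_map rH & forall h, rH h = 0 <-> vm (j h)].
Proof.
have [||//|rho rhoE] := @rmorph_ex vtype vres vpi.
- by move=> x y; rewrite /vpi rmorphB.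
- by move=> x y; rewrite /vpi rmorphM.
- by rewrite /vpi rmorph1.
pose j : {rmorphism vtype -> E} := val.
exists vtype, vres, rho, j; split.
- exact: val_inj.
- move=> x; split=> [Ox|[h <-]]; last exact: vtypeP.
  by exists (Vtype (asboolT Ox : x \in vpred)).
- split; first by move=> y; exists (generic_quotient.repr y); rewrite rhoE /vpi generic_quotient.reprK.
  move=> x; rewrite rhoE; apply/idP/idP => [/eqP x0|xu].
    have [m|u] := vm_or_vu (vtypeP x); last exact: asboolT.
    by case: x0; apply/vpi_eq0.
  apply/eqP => /vpi_eq0 m; have /asboolW u := xu; exact: vm_nu m u.
- by move=> h; rewrite rhoE; exact: vpi_eq0.
Qed.

End ValuationRing.

Lemma poly_lift (R S : nzRingType) (f : {rmorphism R -> S}) (p : {poly S}) :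
  (forall k, exists c, f c = p`_k) -> exists2 q : {poly R}, map_poly f q = p & (size q <= size p)%N.
Proof.
move=> /choice[c cE]; exists (\poly_(k < size p) c k); last exact: size_poly.
apply/polyP => k; rewrite coef_map coef_poly; case: ltnP => kp; first exact: cE.
by rewrite nth_default //; exact: rmorph0.
Qed.

Lemma monic_lift (R S : nzRingType) (f : {rmorphism R -> S}) (p : {poly S}) :
  p \is monic -> (forall k, exists c, f c = p`_k) ->
  exists q : {poly R}, [/\ q \is monic, map_poly f q = p & size q = size p].
Proof.
move=> pm /choice[c cE]; have sp : (0 < size p)%N by rewrite size_poly_gt0 monic_neq0.
pose q := \poly_(k < (size p).-1) c k + 'X^((size p).-1).
have sq : (size (\poly_(k < (size p).-1) c k) < size ('X^((size p).-1) : {poly R}))%N.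
  by rewrite size_polyXn ltnS size_poly.
exists q; split.
- by rewrite monicE /q lead_coefDr // lead_coefXn.
- apply/polyP => k; rewrite coef_map coefD coef_poly coefXn.
  have [kp|kp|->] := ltngtP k (size p).-1; rewrite ?addr0 ?add0r.
  + exact: cE.
  + rewrite nth_default; first exact: rmorph0.
    by move: kp; case: (size p).
  + by rewrite -lead_coefE (monicP pm); exact: rmorph1.
- by rewrite /q addrC size_polyDl // size_polyXn prednK.
Qed.

Section Package.
Context (E : fieldType) (O : set E) (vO : vring O) (scE : separably_closed E).
Context (H : comUnitRingType) (K : fieldType) (rH : {rmorphism H -> K}) (j : {rmorphism H -> E}).
Hypothesis j_inj : injective j.
Hypothesis jO : forall x, O x <-> exists h, j h = x.
Hypothesis rmap : residue_map rH.
Hypothesis rHm : forall h, rH h = 0 <-> vm O (j h).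

Lemma pk_O h : O (j h). Proof. by apply/jO; exists h. Qed.
Lemma pk_vu h : rH h != 0 <-> vu O (j h).
Proof.
split=> [/eqP nz|u].
  by have [m|//] := vm_or_vu vO (pk_O h); case: nz; apply/rHm.
by apply/eqP => /rHm m; exact: vm_nu m u.
Qed.
Lemma pk_polyO (p : {poly H}) : polyO O (map_poly j p).
Proof. by move=> k; rewrite coef_map; exact: pk_O. Qed.
Lemma pk_eq h h' : rH h = rH h' <-> vm O (j h - j h').
Proof.
rewrite -rmorphB; split=> [e|/rHm]; first by apply/rHm; rewrite rmorphB e subrr.
by rewrite rmorphB => /eqP; rewrite subr_eq0 => /eqP.
Qed.

Lemma pk_henselian : henselian rH.
Proof.
move=> f x0 fm fx f'x; have [a aE] := rmap.1 x0; pose F := map_poly j f.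
have Fm : F \is monic by exact: monic_map.
have [||r [Fr Or ar]] := hensel vO scE Fm (pk_polyO f) (pk_O a).
- by rewrite horner_map; apply/rHm; rewrite -horner_map aE; exact/rootP.
- rewrite /F deriv_map horner_map; apply/pk_vu; rewrite -horner_map aE.
  by move: f'x; rewrite deriv_map rootE.
have /jO[r' r'E] := Or; exists r'; last first.
  by rewrite -aE; apply/esym/pk_eq; rewrite r'E.
by rewrite rootE -(inj_eq j_inj) rmorph0 -horner_map r'E.
Qed.

(** A monic lift [F] of a separable polynomial is separable: by Gauss its gcd with the derivative is
    defined over [O], and it reduces to a common factor of the polynomial and its derivative, hence
    to a constant. A root of [F] lies in [O] and reduces to the root sought. *)
Lemma pk_sepclosed : separably_closed K.
Proof.
move=> p ps sp; have p0 := separable_poly_neq0 ps.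
pose q := (lead_coef p)^-1 *: p; have lp0 : lead_coef p != 0 by rewrite lead_coef_eq0.
have qm : q \is monic by rewrite monicE lead_coefZ mulVf.
have qp : q %= p by rewrite eqp_scale // invr_eq0.
have qs : separable_poly q by rewrite (eqp_separable qp).
have [f [fm fE sf]] := monic_lift qm (fun k => rmap.1 q`_k).
pose F := map_poly j f; have Fm : F \is monic by exact: monic_map.
have sF : size F = size p.
  by rewrite size_map_poly_id0 ?(eqP (fm : lead_coef f == 1)) ?rmorph1 ?oner_eq0 // sf (eqp_size qp).
have FO := pk_polyO f.
suff [r Fr] : exists r, root F r.
  have /jO[r' r'E] := integral_root vO Fm FO Fr.
  exists (rH r'); rewrite -(eqp_root qp) -fE rootE horner_map.
  have -> : f.[r'] = 0; last by rewrite rmorph0.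
  by apply: j_inj; rewrite -horner_map r'E rmorph0; exact/rootP.
have [Fs|nFs] := boolP (separable_poly F); first by apply: scE => //; rewrite sF.
pose d0 := gcdp F F^`(); have F0 := monic_neq0 Fm.
have d00 : d0 != 0 by rewrite gcdp_eq0 negb_and F0.
pose d := (lead_coef d0)^-1 *: d0.
have lc0 : lead_coef d0 != 0 by rewrite lead_coef_eq0.
have dm : d \is monic by rewrite monicE lead_coefZ mulVf.
have dF : d %| F by rewrite dvdpZl ?invr_eq0 // dvdp_gcdl.
have dF' : d %| F^`() by rewrite dvdpZl ?invr_eq0 // dvdp_gcdr.
have dE : F = d * (F %/ d) by rewrite mulrC divpK.
have dE' : F^`() = d * (F^`() %/ d) by rewrite mulrC divpK.
have em : (F %/ d) \is monic by rewrite -(monicMl _ dm) -dE.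
have [dO eO] : polyO O d /\ polyO O (F %/ d) by apply: (polyO_factor vO) => //; rewrite -dE.
have e'O : polyO O (F^`() %/ d).
  by apply: (polyO_div vO dm); rewrite -dE' /F deriv_map; exact: pk_polyO.
have lift p' : polyO O p' -> exists p'' : {poly H}, map_poly j p'' = p'.
  by move=> pO; have [|p'' p''E _] := @poly_lift _ _ j p'; [move=> k; exact/jO|exists p''].
have [dH dHE] := lift d dO; have [eH eHE] := lift _ eO; have [eH' eHE'] := lift _ e'O.
have jm_inj : injective (map_poly j) by exact: map_inj_poly (rmorph0 j).
have fd : f = dH * eH by apply: jm_inj; rewrite rmorphM /= dHE eHE.
have fd' : f^`() = dH * eH' by apply: jm_inj; rewrite rmorphM /= dHE eHE' -dE' deriv_map.
have dHm : dH \is monic.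
  apply/eqP/j_inj; rewrite rmorph1 -(monicP dm) -dHE lead_coef_map_inj //; exact: rmorph0.
have q'E : q^`() = map_poly rH dH * map_poly rH eH' by rewrite -fE deriv_map fd' rmorphM.
have qE : q = map_poly rH dH * map_poly rH eH by rewrite -fE fd rmorphM.
have cop : size (map_poly rH dH) == 1%N.
  have := qs; rewrite unlock coprimep_def => /eqP sg; rewrite eqn_leq -{1}[1%N]sg.
  rewrite size_poly_gt0 monic_neq0 ?monic_map // andbT; apply: dvdp_leq.
    by rewrite gcdp_eq0 negb_and monic_neq0.
  by rewrite dvdp_gcd q'E {1}qE !dvdp_mulr.
have sd : size d = 1%N.
  rewrite -dHE size_map_inj_poly ?rmorph0 // -(eqP cop) size_map_poly_id0 //.
  by rewrite (monicP dHm) rmorph1 oner_eq0.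
have sd0 : size d0 = 1%N by rewrite -sd size_scale ?invr_eq0.
by case/negP: nFs; rewrite unlock coprimep_def -/d0 sd0.
Qed.

End Package.

(** * Places above the henselization and Galois invariance of values *)

Section Valuation.
Context (V : henselian_valuation_ring) (D : strict_data V).

Definition sd_iota : {rmorphism sdW D -> sdLs D} := sd_sep D \o sd_incl D.
Local Notation iota := sd_iota.
Local Notation base := (sd_base D).
Local Notation GL := (gal base).

Lemma iota_inj : injective iota.
Proof. by apply: inj_comp; [exact: fmorph_inj|exact: sd_incl_inj]. Qed.

Lemma strictP : strict_henselization (hv_res V) (sd_kap D) (sd_res D) (sd_hens D).
Proof. exact: sd_strict. Qed.

Lemma sd_res_map : residue_map (sd_res D). Proof. by have [] := strictP. Qed.
Lemma kap_sc : separable_closure (sd_kap D). Proof. by have [] := strictP. Qed.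
Lemma sd_res_hens w : sd_res D (sd_hens D w) = sd_kap D (hv_res V w). Proof. by have [] := strictP. Qed.
Lemma iota_hens w : iota (sd_hens D w) = base (hv_incl V w).
Proof. by rewrite /= sd_comm. Qed.

(** A valuation ring of the separable closure that dominates [Wsh]. *)
Record place (O : set (sdLs D)) : Prop := Place {
  pl_vring : vring O;
  pl_iota : forall w, O (iota w);
  pl_dom : forall w, w \isn't a GRing.unit -> iota w != 0 -> ~ O (iota w)^-1
}.

Lemma place_ex : exists O, place O.
Proof.
have [||O [O1 O2 O3]] := @chevalley _ _ iota; last by exists O.
- exact: iota_inj.
- have [_ ru] := sd_res_map; move=> x y; rewrite -!ru !negbK rmorphD => /eqP -> /eqP ->.
  by rewrite addr0.
Qed.

Context (O : set (sdLs D)) (plO : place O).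
Let vO := pl_vring plO.
Local Notation vu := (vu O).
Local Notation vm := (vm O).

Lemma iota_vm w : vm (iota w) <-> sd_res D w = 0.
Proof.
have [_ ru] := sd_res_map; split=> [[_ h]|r0].
  apply/eqP; rewrite -[_ == 0]negbK ru; apply/negP => wu.
  have [w0|w0] := eqVneq (iota w) 0.
    by move: wu; rewrite -[w]/w (iota_inj (x2 := 0) (x1 := w)) ?rmorph0 // unitr0.
  apply: (h w0); rewrite -rmorphV //; exact: (pl_iota plO).
split=> [|w0]; first exact: (pl_iota plO).
by apply: (pl_dom plO) => //; rewrite -ru r0 eqxx.
Qed.

Lemma iota_vu w : vu (iota w) <-> sd_res D w <> 0.
Proof.
split=> [u /iota_vm m|nr]; first exact: vm_nu m u.
by have [/iota_vm//|] := vm_or_vu vO (pl_iota plO w).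
Qed.

Lemma base_vm w : vm (base (hv_incl V w)) <-> hv_res V w = 0.
Proof.
rewrite -iota_hens; split=> [/iota_vm|r0].
  by rewrite sd_res_hens => /eqP; rewrite fmorph_eq0 => /eqP.
by apply/iota_vm; rewrite sd_res_hens r0 rmorph0.
Qed.

Lemma base_O c : O (base c) <-> exists w, hv_incl V w = c.
Proof.
split=> [Oc|[w <-]]; last by rewrite -iota_hens; exact: (pl_iota plO).
have [//|[w wE]] := hv_valuation_ring c.
have [c0|c0] := eqVneq c 0; first by exists 0; rewrite rmorph0 c0.
have cw : base c = (base (hv_incl V w))^-1 by rewrite wE fmorphV invrK.
have [r0|r0] := eqVneq (hv_res V w) 0.
  have [_ h] := (base_vm w).2 r0; case: h; last by rewrite -cw.
  by rewrite fmorph_eq0 wE invr_eq0.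
have wu : w \is a GRing.unit by rewrite -(hv_residue V).2.
by exists w^-1; rewrite rmorphV // wE invrK.
Qed.

Lemma orb_sum_fixed (f : sdLs D -> sdLs D) z (s : GL) :
  (forall y, s (f y) = f (s y)) -> s (\sum_(y <- orb base z) f y) = \sum_(y <- orb base z) f y.
Proof.
move=> sf; rewrite rmorph_sum (eq_bigr _ (fun y _ => sf y)) -(big_map s xpredT f).
apply: perm_big; exact: perm_orb (sd_closure D) s z.
Qed.

Lemma orb_prod_fixed (R : comNzRingType) (f : sdLs D -> R) z (s : GL) :
  \prod_(y <- orb base z) f (s y) = \prod_(y <- orb base z) f y.
Proof.
rewrite -(big_map s xpredT f); apply: perm_big; exact: perm_orb (sd_closure D) s z.
Qed.

Lemma orb_poly_fixed (c : sdLs D) z (s : GL) : s c = c ->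
  map_poly s (\prod_(y <- orb base z) ('X - (c * y)%:P)) = \prod_(y <- orb base z) ('X - (c * y)%:P).
Proof.
move=> sc; rewrite rmorph_prod -[RHS](orb_prod_fixed _ _ s); apply: eq_bigr => y _.
by rewrite rmorphB /= map_polyX map_polyC /= rmorphM sc.
Qed.

Lemma polyO_prod (r : seq (sdLs D)) : (forall y, y \in r -> O y) -> polyO O (\prod_(y <- r) ('X - y%:P)).
Proof.
elim: r => [|y r IH] rO.
  by rewrite big_nil => k; rewrite coef1; case: eqP => _; [exact: (vr1 vO)|exact: (vr0 vO)].
rewrite big_cons => k; rewrite mulrBl coefB coefXM coefCM; apply: (vrB vO).
  case: eqP => _; first exact: (vr0 vO).
  by apply: IH => z zr; apply: rO; rewrite inE zr orbT.
apply: (vrM vO); first by apply: rO; rewrite mem_head.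
by apply: IH => z zr; apply: rO; rewrite inE zr orbT.
Qed.

Lemma descend_poly (f : {poly sdLs D}) : f \is monic -> polyO O f ->
  (forall s : GL, map_poly s f = f) ->
  exists2 g : {poly hvW V}, g \is monic & map_poly (base \o hv_incl V) g = f.
Proof.
move=> fm fO fs; have [q qE] := fixed_poly (sd_closure D) fs.
have [|g [gm gE _]] := @monic_lift _ _ (base \o hv_incl V : {rmorphism _ -> _}) f fm; last by exists g.
move=> k; have : O (base q`_k) by rewrite -coef_map -qE.
by move=> /base_O[w wE]; exists w; rewrite /= wE qE coef_map.
Qed.

(** This is where [W] is henselian. If [w] strictly dominates its other conjugates, their sum [a] is
    [w] times a unit congruent to 1. The polynomial with roots [y / a] then descends to [W] and has
    1 as a simple root modulo the maximal ideal; a lift of this root to [W] is some [y / a], so a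
    conjugate of [w], and with it [w], is fixed. *)
Lemma conj_min w : w != 0 -> (forall s : GL, s w = w \/ vm (s w / w)) -> forall s : GL, s w = w.
Proof.
move=> w0 ws; set r := orb base w; have ur : uniq r by exact: orb_uniq (sd_closure D) w.
have wr : w \in r by exact: orb_refl (sd_closure D) w.
have rE y : y \in r -> y = w \/ vm (y / w).
  by move=> /(mem_orbP (sd_closure D))[s <-]; exact: ws.
pose a := \sum_(y <- r) y.
have aw : exists2 m, vm m & a / w = 1 + m.
  exists (\sum_(y <- rem w r) y / w).
    apply: (vm_sum vO) => y; rewrite mem_rem_uniq // inE => /andP[yw /rE[] //].
    by move=> yw'; rewrite yw' eqxx in yw.
  by rewrite /a (big_rem w) //= mulrDl mulfV // mulr_suml.
have [m mm awE] := aw; have ua : vu (a / w) by rewrite awE; apply: vu_addm => //; exact: vu1.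
have a0 : a != 0 by have [h _ _] := ua; apply: contraNneq h => ->; rewrite mul0r.
have aS (s : GL) : s a = a by exact: (orb_sum_fixed (f := id)).
have ya y : y \in r -> y = w \/ vm (a^-1 * y).
  move=> /rE[|h]; [by left|right].
  have -> : a^-1 * y = (y / w) * (a / w)^-1 by rewrite invf_div mulrA mulfVK // mulrC.
  by apply: vmM => //; have [_ _] := ua.
have wa : vu (a^-1 * w) by have := vuV ua; rewrite invf_div mulrC.
have w1 : vm (1 - a^-1 * w).
  have -> : 1 - a^-1 * w = m * (a / w)^-1.
    have -> : m = a / w - 1 by rewrite awE addrC addKr.
    by rewrite mulrBl mul1r mulfV ?invf_div 1?mulrC // mulf_neq0 ?invr_eq0.
  by apply: vmM => //; have [_ _] := ua.
pose f := \prod_(y <- r) ('X - (a^-1 * y)%:P).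
have fm : f \is monic by exact: monic_prod_XsubC.
have fO : polyO O f.
  rewrite /f -(big_map (fun y => a^-1 * y) xpredT (fun y => 'X - y%:P)); apply: polyO_prod.
  by move=> _ /mapP[y /ya[->|[? _]] ->] //; have [] := wa.
have [g gm gE] := descend_poly fm fO (fun s => orb_poly_fixed w (etrans (fmorphV s a) (congr1 _ (aS s)))).
have fE : f = ('X - (a^-1 * w)%:P) * \prod_(y <- rem w r) ('X - (a^-1 * y)%:P).
  by rewrite /f (big_rem w).
have f1 : vm f.[1].
  rewrite fE hornerM hornerXsubC; apply: vmM => //.
  apply: (polyO_horner vO _ (vr1 vO)).
  rewrite -(big_map (fun y => a^-1 * y) xpredT (fun y => 'X - y%:P)); apply: polyO_prod.
  by move=> _ /mapP[y /mem_rem/ya[->|[? _]] ->] //; have [] := wa.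
have f'1 : vu f^`().[1].
  rewrite fE derivM derivXsubC mul1r hornerD hornerM hornerXsubC; apply: vu_addm => //; last first.
    apply: vmM => //; apply: (polyO_horner vO _ (vr1 vO)) => k; rewrite coef_deriv.
    set c := _`_k.+1; have : O c.
      rewrite /c -(big_map (fun y => a^-1 * y) xpredT (fun y => 'X - y%:P)); apply: polyO_prod.
      by move=> _ /mapP[y /mem_rem/ya[->|[? _]] ->] //; have [] := wa.
    by move=> Oc; elim: k.+1 => [|q IHq]; [rewrite mulr0n; exact: (vr0 vO)|rewrite mulrS; exact: vrD].
  rewrite horner_prod big_seq; elim/big_ind: _ => [||y]; [exact: vu1|exact: vuM|].
  rewrite mem_rem_uniq // inE => /andP[yw /ya[yw'|h]]; first by rewrite yw' eqxx in yw.
  by rewrite hornerXsubC; apply: vu_addm => //; [exact: vu1|exact: vmN].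
have gh (q : {poly hvW V}) : base (hv_incl V q.[1]) = (map_poly (base \o hv_incl V) q).[1].
  by rewrite -[1 in RHS](rmorph1 (base \o hv_incl V : {rmorphism _ -> _})) horner_map.
have [||x xr x1] := hv_henselian (f := g) (x0 := 1) gm.
- rewrite rootE -(rmorph1 (hv_res V)) horner_map; apply/eqP/base_vm.
  by rewrite gh gE.
- rewrite deriv_map rootE -(rmorph1 (hv_res V)) horner_map; apply/eqP => /base_vm.
  rewrite gh -deriv_map gE => m1; exact: vm_nu m1 f'1.
have : root f (base (hv_incl V x)).
  by rewrite -gE rootE (horner_map (base \o hv_incl V : {rmorphism _ -> _})) (rootP xr) rmorph0.
rewrite /f -(big_map (fun y => a^-1 * y) xpredT (fun y => 'X - y%:P)) root_prod_XsubC.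
move=> /mapP[y yr yE]; have [c cE] := fixed_field (sd_closure D) aS.
have ys (s : GL) : s y = y.
  have -> : y = base (c * hv_incl V x) by rewrite rmorphM yE -cE mulVKf.
  exact: gal_fix.
have [t tE] : exists t : GL, t w = y by apply/(mem_orbP (sd_closure D)).
have wy : w = y by apply: (gal_inj (s := t)); rewrite tE ys.
by move=> s; rewrite wy.
Qed.

(** The henselian property gives uniqueness of the extension of the valuation. [m] is a conjugate of
    least valuation and [w] the product of all conjugates in [Zm], those of the valuation of [m].
    Any automorphism either permutes [Zm] or makes [w] strictly smaller, so [conj_min] fixes [w],
    and hence no conjugate of [m] has another valuation. *)
Theorem vconj (s : GL) z : z != 0 -> vu (s z / z).
Proof.
move=> z0; have sc := sd_closure D.
have gal0 (t : GL) y : y != 0 -> t y != 0 by move=> y0; rewrite fmorph_eq0.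
have nz y : y \in orb base z -> y != 0 by move=> /(mem_orbP sc)[t <-]; exact: gal0.
have [|m [mz m0 mE]] := vmaximal vO (s := orb base z); first by exists z => //; exact: orb_refl sc z.
pose Zm := [seq y <- orb base z | `[< vu (y / m) >]].
have ZmP y : y \in Zm -> y \in orb base z /\ vu (y / m).
  by rewrite mem_filter => /andP[/asboolP].
have uZ : uniq Zm by rewrite filter_uniq // (orb_uniq sc).
have mZ : m \in Zm by rewrite mem_filter mz andbT; apply/asboolP; rewrite mulfV //; exact: vu1.
pose w := \prod_(y <- Zm) y.
have w0 : w != 0.
  by rewrite /w big_seq; elim/big_ind: _ => [|x y|y /ZmP[/nz]]; rewrite ?oner_eq0 //; exact: mulf_neq0.
have swE (t : GL) : t w / w = \prod_(y <- Zm) (t y / m * (y / m)^-1).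
  rewrite /w rmorph_prod -prodf_div; apply: eq_big_seq => y _.
  by rewrite invf_div mulrA mulfVK.
have tO (t : GL) y : y \in Zm -> O (t y / m) by move=> /ZmP[yz _]; apply: mE; exact: (orb_closed sc).
have dich (t : GL) : (forall y, y \in Zm -> vu (t y / m)) /\ t w = w \/
    vm (t w / w) /\ exists2 y, y \in Zm & vm (t y / m).
  have [all_u|/existsNP[y /not_implyP[yZ nu]]] := pselect (forall y, y \in Zm -> vu (t y / m)).
    left; split=> //; rewrite /w rmorph_prod -(big_map t xpredT id).
    have ut : uniq (map t Zm) by rewrite map_inj_uniq //; exact: gal_inj.
    apply: perm_big; have sub : {subset map t Zm <= Zm}.
      move=> _ /mapP[y yZ ->]; rewrite mem_filter; apply/andP; split; first exact/asboolP/all_u.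
      by apply: (orb_closed sc); case: (ZmP y yZ).
    have [_ e] := uniq_min_size ut sub (eq_leq (esym (size_map _ _))).
    exact: uniq_perm.
  have my : vm (t y / m) by have [] := vm_or_vu vO (tO t y yZ).
  right; split; last by exists y.
  rewrite swE (big_rem y) //=; apply: (vmM vO); first apply: (vmM vO) => //.
  - by have [_ /vuV[]] := ZmP y yZ.
  apply: (vr_prod vO) => x /mem_rem xZ; apply: (vrM vO); first exact: tO.
  by have [_ /vuV[]] := ZmP x xZ.
have wfix : forall t : GL, t w = w.
  by apply: conj_min => // t; have [[_ ->]|[h _]] := dich t; [left|right].
have mu_ (t : GL) : vu (t m / m).
  have [[h _]|[h _]] := dich t; first exact: h.
  by case: (vm1 vO); rewrite -(mulfV w0) -{1}(wfix t).
have [t tE] : exists t : GL, t z = m by apply/(mem_orbP sc).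
have zE : z = galV t m by rewrite -tE galKV.
have -> : s z / z = (galM s (galV t) m / m) * (galV t m / m)^-1.
  by rewrite invf_div mulrA mulfVK // zE.
by apply: (vuM vO) => //; exact: vuV.
Qed.

Lemma gal_O (s : GL) x : O x -> O (s x).
Proof.
move=> Ox; have [->|x0] := eqVneq x 0; first by rewrite rmorph0; exact: (vr0 vO).
by rewrite -(mulfVK x0 (s x)); apply: (vrM vO) => //; have [] := vconj s x0.
Qed.

Lemma gal_vm (s : GL) x : vm x -> vm (s x).
Proof.
move=> mx; have [->|x0] := eqVneq x 0; first by rewrite rmorph0; exact: (vm0 vO).
by rewrite -(mulfVK x0 (s x)); apply: (vmMl vO) => //; have [] := vconj s x0.
Qed.

End Valuation.

Lemma sepclosed_root (K E : fieldType) (h : {rmorphism K -> E}) (p : {poly K}) x :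
  separably_closed K -> separable_poly p -> root (map_poly h p) x -> exists z, x = h z.
Proof.
move=> sc ps px; have p0 := separable_poly_neq0 ps.
have [P [P0 sP PP]] := minimal_poly p0 px.
have Pp : P %| p by rewrite -PP.
have Ps : separable_poly P by exact: dvdp_separable ps.
have [z Pz] := sc P Ps sP; exists z.
have [Q QE] := factor_theorem _ _ Pz.
have : root (map_poly h P) x by rewrite PP.
have Q0 : Q != 0 by apply: contra_neq P0 => Q0; rewrite QE Q0 mul0r.
rewrite {1}QE rmorphM rootM PP => /orP[PQ|].
  have := dvdp_leq Q0 PQ; rewrite {1}QE size_Mmonic ?monicXsubC // size_XsubC addn2 /=.
  by rewrite ltnn.
by rewrite rmorphB /= map_polyX map_polyC root_XsubC => /eqP.
Qed.

(** * Specialization of automorphisms *)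

Section Specialization.
Context (V : henselian_valuation_ring) (D : strict_data V).
Local Notation iota := (sd_iota D).
Local Notation base := (sd_base D).
Local Notation GL := (gal base).
Local Notation Gk := (gal (sd_kap D)).
Local Notation res := (sd_res D).

Lemma res_surj y : exists x, res x = y. Proof. by have [h _] := sd_res_map D. Qed.

(** The universal property of [Wsh] with [Wsh] itself as target and [t] on the residue field. *)
Lemma wsh_end (t : Gk) : exists f : {rmorphism sdW D -> sdW D},
  (forall w, f (sd_hens D w) = sd_hens D w) /\ forall x, res (f x) = t (res x).
Proof.
have [_ rm he _ univ] := strictP D.
have [|f [f1 f2] _] := univ _ _ res (sd_hens D) t rm he (kap_sc D).2; last by exists f.
by move=> x; rewrite gal_fix sd_res_hens.
Qed.

Lemma wsh_end_id (f : {rmorphism sdW D -> sdW D}) :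
  (forall w, f (sd_hens D w) = sd_hens D w) -> (forall x, res (f x) = res x) -> f =1 id.
Proof.
move=> f1 f2; have [_ rm he _ univ] := strictP D.
have [|g _ gu] := univ _ _ res (sd_hens D) idfun rm he (kap_sc D).2.
  by move=> x; rewrite /= sd_res_hens.
by move=> x; rewrite (gu f) // -(gu idfun).
Qed.

Lemma sep_closure : separable_closure (sd_sep D).
Proof.
have [h1 h2] := sd_closure D; split=> // x; have [p ps px] := h1 x.
exists (map_poly (sd_ur D) p); first by rewrite separable_map.
by rewrite -map_poly_comp.
Qed.

Section Package.
Context (O : set (sdLs D)) (plO : place O).
Let vO := pl_vring plO.
Context (H : comUnitRingType) (K : fieldType) (rH : {rmorphism H -> K}) (j : {rmorphism H -> sdLs D}).
Hypothesis j_inj : injective j.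
Hypothesis jO : forall x, O x <-> exists h, j h = x.
Hypothesis rmap : residue_map rH.
Hypothesis rHm : forall h, rH h = 0 <-> vm O (j h).

Lemma lift_O (f : {rmorphism sdW D -> sdLs D}) : (forall x, O (f x)) ->
  exists g : {rmorphism sdW D -> H}, forall x, j (g x) = f x.
Proof.
move=> fO; have /choice[g gE] : forall x, exists h, j h = f x by move=> x; exact/jO.
have [||//|g' g'E] := @rmorph_ex (sdW D) H g; last by exists g' => x; rewrite g'E.
- by move=> x y; apply: j_inj; rewrite gE !rmorphB /= !gE.
- by move=> x y; apply: j_inj; rewrite gE !rmorphM /= !gE.
- by apply: j_inj; rewrite gE !rmorph1.
Qed.

Lemma res_factor (g : {rmorphism sdW D -> H}) : (forall x, res x = 0 -> rH (g x) = 0) ->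
  exists h : {rmorphism sdks D -> K}, forall x, h (res x) = rH (g x).
Proof.
move=> g0; have /choice[c cE] := res_surj.
have gE x y : res x = res y -> rH (g x) = rH (g y).
  move=> xy; apply/eqP; rewrite -subr_eq0 -!rmorphB; apply/eqP/g0.
  by rewrite rmorphB xy subrr.
have [||//|h hE] := @rmorph_ex (sdks D) K (fun y => rH (g (c y))).
- by move=> x y; rewrite -!rmorphB; apply: gE; rewrite rmorphB !cE.
- by move=> x y; rewrite -!rmorphM; apply: gE; rewrite rmorphM !cE.
- by rewrite -[RHS](rmorph1 rH) -[in RHS](rmorph1 g); apply: gE; rewrite cE rmorph1.
by exists h => x; rewrite hE; apply: gE; rewrite cE.
Qed.

Lemma res_embedding : exists (ih : {rmorphism sdW D -> H}) (h : {rmorphism sdks D -> K}),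
  (forall x, j (ih x) = iota x) /\ forall x, h (res x) = rH (ih x).
Proof.
have [g gE] := lift_O (pl_iota plO); exists g.
have [|h hE] := @res_factor g; last by exists h.
by move=> x x0; apply/rHm; rewrite gE; exact/(iota_vm plO).
Qed.

(** The valuation ring [H] is strictly henselian, so a map from [Wsh] to it is determined by its
    effect on residue fields. The restriction of [s] to [Wsh] and the inclusion composed with the
    endomorphism [f] attached to the induced [t] have the same effect, hence agree: [s] maps [Wsh]
    into itself. *)
Lemma spec_pkg (s : GL) : exists (t : Gk) (f : {rmorphism sdW D -> sdW D}),
  [/\ forall x, s (iota x) = iota (f x), forall x, res (f x) = t (res x) &
      forall w, f (sd_hens D w) = sd_hens D w].
Proof.
have [ih [h [ihE hE]]] := res_embedding.
have [|g gE] := @lift_O (gal_fun s \o iota); first by move=> x; exact: (gal_O plO s (pl_iota plO x)).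
have [|t0 t0E] := @res_factor g.
  by move=> x x0; apply/rHm; rewrite gE; apply: (gal_vm plO); exact/(iota_vm plO).
have gb w : g (sd_hens D w) = ih (sd_hens D w).
  by apply: j_inj; rewrite gE ihE /= -[sd_sep D _]/(iota _) iota_hens gal_fix.
have t0k c : t0 (sd_kap D c) = h (sd_kap D c).
  by have [w <-] := (hv_residue V).1 c; rewrite -sd_res_hens t0E hE gb.
(* The residue field [K] may exceed [ks], but the values of [t0] are roots of separable polynomials
   over [k], which have all their roots in [ks]. *)
have /choice[t tE] : forall y, exists z, t0 y = h z.
  move=> y; have [p ps py] := (kap_sc D).1 y.
  apply: (@sepclosed_root _ _ h (map_poly (sd_kap D) p)).
  - exact: (kap_sc D).2.
  - by rewrite separable_map.
  rewrite -map_poly_comp -(@eq_map_poly _ _ (t0 \o sd_kap D)); last by move=> c; exact: t0k.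
  by rewrite map_poly_comp rootE horner_map (rootP py) rmorph0.
have h_inj : injective h by exact: fmorph_inj.
have [||//|t' t'E] := @rmorph_ex (sdks D) (sdks D) t.
- by move=> x y; apply: h_inj; rewrite -tE !rmorphB /= !tE.
- by move=> x y; apply: h_inj; rewrite -tE !rmorphM /= !tE.
- by apply: h_inj; rewrite -tE !rmorph1.
have [|u uE] := gal_endo (kap_sc D) (f := t').
  by move=> c; apply: h_inj; rewrite t'E -tE.
have [f [f1 f2]] := wsh_end u; exists u, f; split=> // x.
rewrite -(ihE (f x)) -[s (iota x)]/((gal_fun s \o iota) x) -gE; congr (j _).
have [_ _ _ _ univ] := strictP D.
have hr : henselian rH by apply: (pk_henselian vO _ j_inj jO rmap rHm); exact: (sd_closure D).2.
have hK : separably_closed K by apply: (pk_sepclosed vO _ j_inj jO rmap); exact: (sd_closure D).2.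
have [|f0 _ fu] := univ _ _ rH (ih \o sd_hens D : {rmorphism _ -> _}) t0 rmap hr hK.
  by move=> w; rewrite /= t0k -sd_res_hens hE.
rewrite (fu g) -1?[RHS]/((ih \o f : {rmorphism _ -> _}) x) ?fu //.
  by split=> y; rewrite /= ?f1 // -hE f2 uE t'E tE.
by split=> y; rewrite /= ?gb // t0E.
Qed.

End Package.

Lemma spec_ex (s : GL) : exists (t : Gk) (f : {rmorphism sdW D -> sdW D}),
  [/\ forall x, s (iota x) = iota (f x), forall x, res (f x) = t (res x) &
      forall w, f (sd_hens D w) = sd_hens D w].
Proof.
have [O plO] := place_ex D; have [H [K [rH [j [h1 h2 h3 h4]]]]] := vring_package (pl_vring plO).
exact: (spec_pkg plO h1 h2 h3 h4).
Qed.

(** Discharges the [xget] in [specialize]: by [spec_ex] the set from which it chooses is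
    inhabited. *)
Lemma spec_res (s : GL) x y : s (iota x) = iota y -> specialize s (res x) = res y.
Proof.
rewrite /specialize; case: xgetP => [t _ h|nh]; first exact: h.
have [t [f [f1 f2 _]]] := spec_ex s; case: (nh t) => x' y' xy'.
by rewrite -f2; congr (res _); apply: iota_inj; rewrite -f1.
Qed.

Lemma spec_end (s : GL) : exists f : {rmorphism sdW D -> sdW D},
  [/\ forall x, s (iota x) = iota (f x), forall x, res (f x) = specialize s (res x) &
      forall w, f (sd_hens D w) = sd_hens D w].
Proof.
have [t [f [f1 f2 f3]]] := spec_ex s; exists f; split=> // x.
by apply/esym/spec_res.
Qed.

Lemma specM (s t : GL) : specialize (galM s t) = galM (specialize s) (specialize t).
Proof.
apply: gal_ext => y; have [x <-] := res_surj y.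
have [f [f1 f2 _]] := spec_end s; have [g [g1 g2 _]] := spec_end t.
by rewrite galME -g2 -f2; apply: spec_res; rewrite galME g1 f1.
Qed.

Lemma spec1 : specialize (gal1 base) = gal1 (sd_kap D).
Proof. by apply: gal_ext => y; have [x <-] := res_surj y; exact: spec_res. Qed.

(** If [s] is trivial on the residue field, uniqueness in the universal property makes the
    endomorphism of [Wsh] that it induces the identity, so [s] fixes all fractions. *)
Lemma spec_ker (s : GL) : specialize s = gal1 _ <-> exists u, inertia_incl u = s.
Proof.
split=> [s1|[u <-]]; last first.
  apply: gal_ext => y; have [x <-] := res_surj y; apply: spec_res.
  by rewrite /= (gal_fix u).
have [f [f1 f2 f3]] := spec_end s.
have fid : f =1 id by apply: wsh_end_id => // x; rewrite f2 s1.
have sfix z : s (sd_sep D z) = sd_sep D z.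
  have [a [b [b0 ->]]] := sd_frac z; rewrite !fmorph_div.
  by rewrite -[sd_sep D (sd_incl D a)]/(iota a) -[sd_sep D (sd_incl D b)]/(iota b) !f1 !fid.
exists (@Gal _ _ (sd_sep D) (gal_fun s) (gal_inv s) (gal_funK s) (gal_invK s) sfix).
exact: gal_ext.
Qed.

Lemma inertia_fix (s : GL) z : specialize s = gal1 _ -> s (sd_sep D z) = sd_sep D z.
Proof. by move=> /spec_ker[u <-]; exact: (gal_fix u). Qed.

Lemma inertia_fixed_field x : (forall s : GL, specialize s = gal1 _ -> s x = x) ->
  exists z, x = sd_sep D z.
Proof.
move=> sx; apply: (fixed_field sep_closure) => u.
exact: (sx (inertia_incl u) ((spec_ker _).2 (ex_intro _ u erefl))).
Qed.

(** The endomorphism of [Wsh] above [t] has the one above the inverse of [t] as left inverse, so it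
    is injective and extends to [Lur], and from there to the separable closure. *)
Lemma spec_surj (t : Gk) : exists s : GL, specialize s = t.
Proof.
have [f [f1 f2]] := wsh_end t; have [g [g1 g2]] := wsh_end (galV t).
have gf : g \o f =1 id.
  by apply: wsh_end_id => x /=; rewrite ?f1 ?g1 // g2 f2 galKV.
have f0 x : x != 0 -> iota (f x) != 0.
  apply: contra_neq => fx; rewrite -(gf x) /= (iota_inj (x1 := f x) (x2 := 0)) ?fx ?rmorph0 //.
have /choice[nd ndE] : forall z, exists u : sdW D * sdW D, u.2 != 0 /\ z = sd_incl D u.1 / sd_incl D u.2.
  by move=> z; have [a [b [b0 zE]]] := sd_frac z; exists (a, b).
have incl0 b : b != 0 -> sd_incl D b != 0.
  by apply: contra_neq => b0; apply: (@sd_incl_inj _ D); rewrite b0 rmorph0.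
pose phi z := iota (f (nd z).1) / iota (f (nd z).2).
have key a b n d : b != 0 -> d != 0 -> sd_incl D a / sd_incl D b = sd_incl D n / sd_incl D d ->
    iota (f n) / iota (f d) = iota (f a) / iota (f b).
  move=> b0 d0 e; apply/eqP; rewrite eqr_div ?f0 //; apply/eqP.
  rewrite -(rmorphM iota) -(rmorphM iota) -(rmorphM f) -(rmorphM f); congr (iota (f _)).
  apply: (@sd_incl_inj _ D); rewrite !rmorphM; move/eqP: e; rewrite eqr_div ?incl0 // => /eqP ->.
  by rewrite mulrC.
have phiE a b : b != 0 -> phi (sd_incl D a / sd_incl D b) = iota (f a) / iota (f b).
  by move=> b0; have [d0 e] := ndE (sd_incl D a / sd_incl D b); exact: key.
have [|||p pE] := @rmorph_ex (sdLur D) (sdLs D) phi.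
- move=> x y; have [a [b [b0 ->]]] := sd_frac x; have [c [d [d0 ->]]] := sd_frac y.
  rewrite -mulNr addf_div ?incl0 // -!rmorphN -!rmorphM -rmorphD !phiE ?mulf_neq0 //.
  rewrite -mulNr addf_div ?f0 //; congr (_ / _); last by rewrite (rmorphM f) (rmorphM iota).
  by rewrite -(rmorphN iota) -!(rmorphM iota) -(rmorphD iota) -(rmorphN f) -!(rmorphM f) -(rmorphD f).
- move=> x y; have [a [b [b0 ->]]] := sd_frac x; have [c [d [d0 ->]]] := sd_frac y.
  by rewrite mulf_div -!rmorphM !phiE ?mulf_neq0 // mulf_div -!rmorphM.
- have := phiE 1 1 (oner_neq0 _); rewrite (rmorph1 (sd_incl D)) divr1 => ->.
  by rewrite divff // f0 ?oner_neq0.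
have pi_ a : p (sd_incl D a) = iota (f a).
  by have := phiE a 1 (oner_neq0 _); rewrite -pE !rmorph1 !divr1.
have [sg sgE] := sep_extend sep_closure p (sd_closure D).2.
have [|s sE] := gal_endo (sd_closure D) (f := sg).
  have bw w : sg (base (hv_incl V w)) = base (hv_incl V w).
    by rewrite -iota_hens /= sgE pi_ f1.
  move=> c; have [[w <-]|[w wE]] := hv_valuation_ring c; first exact: bw.
  by apply: invr_inj; rewrite -!fmorphV -wE.
exists s; apply: gal_ext => y; have [x <-] := res_surj y; rewrite -f2; apply: spec_res.
by rewrite sE /= sgE pi_.
Qed.

Lemma spec_cont (v : seq (sdks D)) : exists u : seq (sdLs D), forall s t : GL,
  gal_lev_eqv u s t -> gal_lev_eqv v (specialize s) (specialize t).
Proof.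
have /choice[c cE] := res_surj.
exists [seq iota (c y') | y <- v, y' <- orb (sd_kap D) y] => s t st y yv u.
have [f [f1 f2 _]] := spec_end s; have [g [g1 g2 _]] := spec_end t.
rewrite -(cE (u y)) -f2 -g2; congr (res _); apply: (@iota_inj _ D); rewrite -f1 -g1.
apply: (st _ _ (gal1 base)); apply/allpairsPdep; exists y, (u y); split=> //.
exact: (mem_orb (kap_sc D)).
Qed.

(** Compactness again: elements whose specializations tend to 1, none of them close to the kernel,
    would have a limit in the kernel. *)
Lemma spec_open (v : seq (sdLs D)) : exists u : seq (sdks D), forall s : GL,
  gal_lev_eqv u (specialize s) (gal1 _) -> exists2 i : GL, specialize i = gal1 _ & gal_lev_eqv v s i.
Proof.
apply: contrapT => /forallNP nu.
have /choice[sig sigP] : forall u, exists s : GL, gal_lev_eqv u (specialize s) (gal1 _) /\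
    ~ exists2 i : GL, specialize i = gal1 _ & gal_lev_eqv v s i.
  by move=> u; have /existsNP[s /not_implyP] := nu u; exists s.
have [g gE] := gal_limit (sd_closure D) (fun u (_ : unit) => sig u).
have g1 : specialize (g tt) = gal1 _.
  apply: gal_ext => y; have [x <-] := res_surj y.
  have [u [su uE]] := gE [:: res x] [:: (tt, iota x)].
  have [f [f1 f2 _]] := spec_end (sig u).
  have -> : specialize (g tt) (res x) = res (f x).
    by apply: spec_res; rewrite -f1 -(uE tt) ?mem_head.
  by rewrite f2 ((sigP u).1 (res x) _ (gal1 _)) // su // mem_head.
have [u [_ uE]] := gE [::] [seq (tt, x') | x <- v, x' <- orb base x].
case: (sigP u) => _; case; exists (g tt) => // x xv s.
apply: uE; apply/allpairsPdep; exists x, (s x); split=> //.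
exact: (mem_orb (sd_closure D)).
Qed.

End Specialization.

(** * Roots of unity of [l]-power order and tameness *)

Lemma separable_XnsubC (K : fieldType) n (c : K) : n%:R != 0 :> K -> c != 0 ->
  separable_poly ('X^n - c%:P).
Proof.
move=> n0 c0; have n1 : (0 < n)%N by case: n n0 => //; rewrite eqxx.
rewrite unlock; apply/Bezout_coprimepP; exists ((- c^-1)%:P, (c^-1 * n%:R^-1) *: 'X) => /=.
rewrite derivB derivC subr0 derivXn.
have -> : (c^-1 / n%:R) *: 'X * ('X^(n.-1) *+ n) = (c^-1 *: 'X^n : {poly K}).
  by rewrite -scalerAl mulrnAr -exprS prednK // -scaler_nat scalerA mulfVK.
rewrite mul_polyC scalerBr !scaleNr opprK addrAC addNr add0r -mul_polyC -polyCM mulVf //.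
exact: eqpxx.
Qed.

Lemma deriv0_char (K : fieldType) (p : {poly K}) : p^`() = 0 -> (1 < size p)%N ->
  exists c (q : {poly K}), [/\ c \in [pchar K], p = q \Po 'X^c & (size q < size p)%N].
Proof.
move=> p'0 sp; have p0 : p != 0 by rewrite -size_poly_gt0 ltnW.
have nat0 k : p`_k != 0 -> (k%:R : K) = 0.
  case: k => [//|k] pk; have : p`_k.+1 * k.+1%:R = 0 by rewrite mulr_natr -coef_deriv p'0 coef0.
  by move/eqP; rewrite mulf_eq0 (negPf pk) => /eqP.
have n0 : (size p).-1%:R = 0 :> K by apply: nat0; rewrite -lead_coefE lead_coef_eq0.
have [|c cK] := @natf0_pchar K (size p).-1 _ (introT eqP n0); first by case: (size p) sp => [|[]].
have c0 : (0 < c)%N by have := pcharf_prime cK; exact: prime_gt0.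
have pE : p = (\poly_(k < size p) p`_(k * c)) \Po 'X^c.
  apply/polyP => i; rewrite coef_comp_poly_Xn //; case: (boolP (c %| i)%N) => [ci|ci].
    rewrite coef_poly; case: ltnP => h; first by rewrite divnK.
    by rewrite nth_default // (leq_trans h) // leq_div.
  by apply/eqP; apply: contraNT ci => /nat0 i0; rewrite (dvdn_pcharf cK) i0.
exists c, (\poly_(k < size p) p`_(k * c)); split=> //.
have := congr1 (fun q : {poly K} => (size q).-1) pE.
rewrite size_comp_poly size_polyXn /=; set q := \poly_(k < _) _ => e.
have c1 : (1 < c)%N by have := pcharf_prime cK; exact: prime_gt1.
by move: sp e; case: (size p) => [|[|n]] //= _; case: (size q) => [|[|k]] //= e; nia.
Qed.

Lemma coprime_exp1 (R : pzRingType) (w : R) n k : coprime n k -> w ^+ n = 1 -> w ^+ k = 1 -> w = 1.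
Proof.
case: n => [|n]; first by rewrite /coprime gcd0n => /eqP -> _; rewrite expr1.
move=> co wn wk; have [u v uv _] := egcdnP k (ltn0Sn n).
have : w ^+ (u * n.+1) = w by rewrite uv (eqP co) exprD mulnC exprM wk expr1n mul1r expr1.
by rewrite mulnC exprM wn expr1n.
Qed.

Lemma prim_root1 (R : nzRingType) : 1.-primitive_root (1 : R).
Proof. by apply/andP; split=> //; apply/forallP => i; rewrite ord1 unity_rootE expr1n !eqxx. Qed.

Section LPower.
Context (V : henselian_valuation_ring) (D : strict_data V).
Context (O : set (sdLs D)) (plO : place O).
Context (l : nat) (l_pr : prime l) (lW : (l%:R : hvW V) \is a GRing.unit).
Let vO := pl_vring plO.
Local Notation iota := (sd_iota D).
Local Notation base := (sd_base D).
Local Notation GL := (gal base).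
Local Notation res := (sd_res D).
Local Notation vu := (vu O).
Local Notation vm := (vm O).

Lemma l_ks : (l%:R : sdks D) != 0.
Proof.
rewrite -(rmorph_nat (sd_kap D)) fmorph_eq0 -(rmorph_nat (hv_res V)).
by rewrite (hv_residue V).2.
Qed.
Lemma lX_ks m : ((l ^ m)%N%:R : sdks D) != 0.
Proof. by rewrite natrX expf_neq0 // l_ks. Qed.
Lemma l_vu : vu (l%:R).
Proof.
rewrite -(rmorph_nat iota); apply/(iota_vu plO).
by rewrite rmorph_nat; exact/eqP/l_ks.
Qed.

(** Otherwise the sum of the powers [r ^ i], [i < l], is 0, although it is congruent to the unit
    [l]. *)
Lemma unity_cong r : r ^+ l = 1 -> vm (r - 1) -> r = 1.
Proof.
move=> rl rm; apply: contrapT => /eqP r1.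
have Or : O r by rewrite -(subrK 1 r); apply: (vrD vO); [exact: rm.1|exact: (vr1 vO)].
have := subrX1 r l; rewrite rl subrr => /esym/eqP; rewrite mulf_eq0 subr_eq0 (negPf r1) /= => /eqP s0.
have : vm (\sum_(i < l) (r ^+ i - 1)).
  apply: (vm_sum vO) => i _; rewrite subrX1; apply: (vmM vO) => //.
  by apply: (vr_sum vO) => k _; exact: (vrX vO).
rewrite sumrB s0 sumr_const card_ord sub0r => /(vmN vO); rewrite opprK => lm.
exact: vm_nu lm l_vu.
Qed.

Lemma wsh_root w m x : res w != 0 -> x ^+ (l ^ m)%N = res w ->
  exists t, t ^+ (l ^ m)%N = w /\ res t = x.
Proof.
move=> w0 xw; have [_ _ he _ _] := strictP D.
have n0 : (0 < l ^ m)%N by rewrite expn_gt0 prime_gt0.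
have mE : map_poly res ('X^(l ^ m) - w%:P) = 'X^(l ^ m) - (res w)%:P.
  by rewrite rmorphB /= map_polyXn map_polyC.
have x0 : x != 0.
  by apply: contraNneq w0 => x0; rewrite -xw x0 expr0n; case: (l ^ m)%N n0.
have [|||t tr tx] := he ('X^(l ^ m) - w%:P) x.
- exact: monicXnsubC.
- by rewrite mE rootE !hornerE xw subrr.
- rewrite mE derivB derivC subr0 derivXn rootE hornerMn hornerXn -mulr_natr.
  by rewrite mulf_neq0 ?lX_ks // expf_neq0.
exists t; split=> //; apply/eqP; rewrite -subr_eq0; move: tr; rewrite rootE !hornerE.
by [].
Qed.

Lemma ks_root m (c : sdks D) : c != 0 -> exists x, x ^+ (l ^ m)%N = c.
Proof.
move=> c0; have n0 : (0 < l ^ m)%N by rewrite expn_gt0 prime_gt0.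
have [||x] := (kap_sc D).2 ('X^(l ^ m) - c%:P).
- by apply: separable_XnsubC => //; exact: lX_ks.
- by rewrite size_XnsubC.
by rewrite rootE !hornerE subr_eq0 => /eqP; exists x.
Qed.

Lemma prim_lpow (R : nzRingType) (x : R) m : x ^+ (l ^ m.+1)%N = 1 -> x ^+ (l ^ m)%N != 1 ->
  (l ^ m.+1).-primitive_root x.
Proof.
move=> x1 xn1; have [k kp] := prim_order_exists (n := (l ^ m.+1)%N) (etrans (expn_gt0 _ _) (introT orP (or_introl (prime_gt0 l_pr)))) x1.
move=> /(dvdn_pfactor _ _ l_pr)[j jm kE]; move: jm; rewrite leq_eqVlt => /orP[/eqP <-|jm].
  by rewrite -kE.
case/negP: xn1; rewrite -(prim_order_dvd kp) kE dvdn_exp2l //.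
Qed.

Lemma ks_prim m : exists x : sdks D, (l ^ m).-primitive_root x.
Proof.
have [x0 x0p] : exists x : sdks D, (l ^ 1).-primitive_root x.
  have [||x] := (kap_sc D).2 (\sum_(i < l) 'X^i).
  - have sX : separable_poly ('X^l - 1 : {poly sdks D}).
      by rewrite -polyC1; apply: separable_XnsubC; rewrite ?l_ks ?oner_neq0.
    by apply: dvdp_separable sX; rewrite subrX1 dvdp_mull.
  - rewrite (_ : \sum_(i < l) 'X^i = \poly_(i < l) 1); last first.
      by rewrite poly_def; apply: eq_bigr => i _; rewrite scale1r.
    by rewrite size_poly_eq ?oner_neq0 // prime_gt1.
  rewrite rootE horner_sum => /eqP x0.
  have S0 : \sum_(i < l) x ^+ i = 0 by rewrite -[RHS]x0; apply: eq_bigr => i _; rewrite hornerXn.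
  exists x; apply: prim_lpow; rewrite ?expn0 ?expr1 ?expn1.
    by apply/eqP; rewrite -subr_eq0 subrX1 S0 mulr0.
  apply: contraTneq l_ks => x1; rewrite negbK -S0 x1.
  by rewrite (eq_bigr (fun=> 1)) ?sumr_const ?card_ord // => i _; rewrite expr1n.
elim: m => [|[|m] [x xp]]; [by exists 1; rewrite expn0; exact: prim_root1|by exists x0|].
have xn0 : x != 0.
  apply: contra_eq_neq (prim_expr_order xp) => ->; rewrite expr0n expn_eq0.
  by case: (l) l_pr => //= ? _; rewrite eq_sym oner_eq0.
have [y yx] := ks_root 1 xn0; exists y; apply: prim_lpow.
  by rewrite expnSr mulnC exprM -[l in y ^+ l]expn1 yx (prim_expr_order xp).
rewrite expnS exprM -[l in y ^+ l]expn1 yx -(prim_order_dvd xp) dvdn_Pexp2l ?prime_gt1 //.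
by rewrite ltnn.
Qed.

Lemma wsh_prim m : exists z : sdW D, (l ^ m).-primitive_root (iota z) /\ (l ^ m).-primitive_root (res z).
Proof.
have [x xp] := ks_prim m; have [||z [z1 zx]] := @wsh_root 1 m x.
- by rewrite rmorph1 oner_neq0.
- by rewrite rmorph1 (prim_expr_order xp).
exists z; rewrite zx; split=> //; case: m xp z1 zx => [|m] xp z1 zx.
  rewrite expn0 in z1 *; rewrite -(expr1 z) z1 rmorph1; exact: prim_root1.
apply: prim_lpow; first by rewrite -rmorphXn z1 rmorph1.
rewrite -rmorphXn -(rmorph1 iota) (inj_eq (@iota_inj _ D)).
apply: contraTneq xp => zm; apply/negP => xp.
have : x ^+ (l ^ m)%N == 1 by rewrite -zx -rmorphXn zm rmorph1.
by rewrite -(prim_order_dvd xp) dvdn_Pexp2l ?prime_gt1 // ltnn.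
Qed.

Lemma unity_wsh m (w : sdLs D) : w ^+ (l ^ m)%N = 1 ->
  exists2 z, iota z = w & z ^+ (l ^ m)%N = 1.
Proof.
move=> w1; have [z [zp _]] := wsh_prim m; have [k ->] := prim_rootP zp w1.
exists (z ^+ k); first by rewrite rmorphXn.
apply: (@iota_inj _ D); rewrite exprAC !rmorphXn (prim_expr_order zp) !expr1n rmorph1.
by [].
Qed.

Lemma unity_fix m (w : sdLs D) (s : GL) : specialize s = gal1 _ -> w ^+ (l ^ m)%N = 1 -> s w = w.
Proof. by move=> s1 /unity_wsh[z <- _]; exact: inertia_fix. Qed.

Section Package.
Context (H : comUnitRingType) (K : fieldType) (rH : {rmorphism H -> K}) (j : {rmorphism H -> sdLs D}).
Hypothesis j_inj : injective j.
Hypothesis jO : forall x, O x <-> exists h, j h = x.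
Hypothesis rmap : residue_map rH.
Hypothesis rHm : forall h, rH h = 0 <-> vm (j h).

(** Induction on the degree of a polynomial over [ks] that kills the residue of the unit. If it is
    separable, the residue lies in [ks] and the unit is congruent to an element of [Wsh], which [s]
    fixes, so the root of unity is congruent to 1. If its derivative is 0, the unit is replaced by
    its [c]-th power, [c] being the residue characteristic, which is prime to [l]. Otherwise the
    polynomial splits along the gcd with its derivative. *)
Lemma inertia_unit_pkg (s : GL) u w : specialize s = gal1 _ -> vu u -> s u = w * u -> w ^+ l = 1 -> w = 1.
Proof.
move=> s1; have [ih [h [ihE hE]]] := res_embedding plO j_inj jO rHm.
have main n (p : {poly sdks D}) u' w' : (size p < n)%N -> p != 0 -> root (map_poly h p) (rH u') ->
    vu (j u') -> s (j u') = w' * j u' -> w' ^+ l = 1 -> w' = 1.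
  elim: n p u' w' => // n IH p u' w'; rewrite ltnS => sp p0 pu uu su wl.
  have s1p : (1 < size p)%N.
    rewrite ltnNge; apply/negP => /size1_polyC pE; move: pu p0; rewrite pE map_polyC rootC fmorph_eq0.
    by rewrite polyC_eq0 => ->.
  have [ps|] := boolP (separable_poly p).
    have [z] := sepclosed_root (kap_sc D).2 ps pu; have [x <-] := res_surj z; rewrite hE => ux.
    have d1 : vm (j u' - iota x) by rewrite -ihE; apply/(pk_eq rHm).
    have sx : s (iota x) = iota x by exact: inertia_fix.
    have d2 := gal_vm plO s d1; rewrite rmorphB su sx in d2.
    have : vm ((w' - 1) * j u').
      have -> : (w' - 1) * j u' = (w' * j u' - iota x) - (j u' - iota x) by ring.
      exact: (vmB vO).
    have [u0 _ uV] := uu => /(vmM vO)/(_ uV); rewrite mulfK //; exact: unity_cong.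
  rewrite unlock coprimep_def; set d := gcdp p p^`() => dn1.
  have [p'0|p'0] := eqVneq p^`() 0.
    have [c [q [cK pE sq]]] := deriv0_char p'0 s1p.
    have cl : coprime c l.
      rewrite prime_coprime ?(pcharf_prime cK) // dvdn_prime2 ?(pcharf_prime cK) //.
      by apply: contraTneq l_ks => <-; rewrite negbK -(dvdn_pcharf cK).
    apply: (coprime_exp1 cl) => //; apply: (IH q (u' ^+ c)).
    - exact: leq_trans sq sp.
    - by apply: contraNneq p0 => q0; rewrite pE q0 comp_poly0.
    - move: pu; rewrite {1}pE map_comp_poly /= map_polyXn rootE horner_comp hornerXn -rmorphXn.
      by [].
    - by rewrite rmorphXn; elim: (c) => [|k IHk]; rewrite ?exprS; [exact: (vu1 vO)|exact: (vuM vO)].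
    - by rewrite !rmorphXn su exprMn.
    - by rewrite -exprM mulnC exprM wl expr1n.
  have dp : d %| p by exact: dvdp_gcdl.
  have d0 : d != 0 by rewrite gcdp_eq0 negb_and p0.
  have sd : (size d < size p)%N.
    have := leq_gcdpr p p'0; rewrite -/d => h1; apply: (leq_ltn_trans h1).
    exact: lt_size_deriv.
  have q0 : p %/ d != 0 by apply: contraNneq p0 => q0; rewrite -(divpK dp) q0 mul0r.
  move: pu; rewrite -{1}(divpK dp) rmorphM rootM => /orP[] pu; last first.
    by apply: (IH d u') => //; exact: leq_trans sd sp.
  apply: (IH (p %/ d) u') => //; apply: (leq_trans _ sp); rewrite size_divp // ltn_subrL.
  by move: d0 dn1; rewrite -size_poly_gt0 (ltnW s1p); case: (size d) => [|[]].
move=> uu su wl; have [u0 Ou _] := uu; have /jO[u' u'E] := Ou.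
(* Algebraicity of the residue: the conjugates of [u] lie in [O], so their polynomial descends to
   [W]. The factor 1 is there to match [orb_poly_fixed]. *)
pose f := \prod_(y <- orb base u) ('X - (1 * y)%:P).
have [|||g gm gE] := @descend_poly _ _ _ plO f.
- exact: monic_prod_XsubC.
- rewrite /f -(big_map (fun y => 1 * y) xpredT (fun y => 'X - y%:P)); apply: (polyO_prod plO).
  move=> _ /mapP[y /(mem_orbP (sd_closure D))[t <-] ->]; rewrite mul1r; exact: (gal_O plO).
- by move=> t; apply: orb_poly_fixed; exact: rmorph1.
apply: (main _ (map_poly (sd_kap D \o hv_res V) g) u') => //.
- by rewrite monic_neq0 // monic_map.
- have -> : map_poly h (map_poly (sd_kap D \o hv_res V) g) = map_poly rH (map_poly (ih \o sd_hens D) g).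
    rewrite -!map_poly_comp; apply: eq_map_poly => c /=.
    by rewrite -hE -sd_res_hens.
  suff g0 : (map_poly (ih \o sd_hens D) g).[u'] = 0 by rewrite rootE horner_map g0 rmorph0.
  apply: j_inj; rewrite rmorph0 -horner_map -map_poly_comp.
  have -> : map_poly (j \o (ih \o sd_hens D)) g = f.
    by rewrite -gE; apply: eq_map_poly => c; rewrite [LHS]ihE iota_hens.
  apply/rootP; rewrite /f -(big_map (fun y => 1 * y) xpredT (fun y => 'X - y%:P)) root_prod_XsubC.
  by apply/mapP; exists u; rewrite ?mul1r ?u'E // (orb_refl (sd_closure D)).
- by rewrite u'E.
- by rewrite u'E su.
Qed.

End Package.

(* Tameness: inertia acts on units through elements of order prime to [l]. *)
Lemma inertia_unit (s : GL) u w : specialize s = gal1 _ -> vu u -> s u = w * u -> w ^+ l = 1 -> w = 1.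
Proof.
have [H [K [rH [j [h1 h2 h3 h4]]]]] := vring_package vO.
exact: (inertia_unit_pkg h1 h2 h4).
Qed.

(** All conjugates of [y] have the same value by [vconj], so a power of [y] has the value of their
    product, which lies in the base. *)
Lemma torsion_value y : y != 0 -> exists n c, [/\ (0 < n)%N, c != 0 & vu (y ^+ n / base c)].
Proof.
move=> y0; have sc := sd_closure D.
have [c cE] : exists c, \prod_(x <- orb base y) x = base c.
  by apply: (fixed_field sc) => s; rewrite rmorph_prod; exact: (orb_prod_fixed (fun x => x)).
exists (size (orb base y)), c; rewrite -cE; split.
- by have := orb_refl sc y; case: (orb _ _).
- rewrite -(fmorph_eq0 base) -cE; rewrite prodf_seq_neq0; apply/allP => x /(mem_orbP sc)[s <-] /=.
  by rewrite fmorph_eq0.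
have -> : y ^+ size (orb base y) = \prod_(x <- orb base y) y.
  by rewrite big_const_seq count_predT iter_mulr_1.
rewrite -prodf_div big_seq; elim/big_ind: _ => [||x /(mem_orbP sc)[s <-]].
- exact: (vu1 vO).
- exact: (vuM vO).
- by rewrite -invf_div; apply: (vuV); exact: (vconj plO).
Qed.

End LPower.

(** Independence of automorphisms tested on a multiplicative set [S] only, which is enough as soon
    as [S] separates the members of [P]. It is meant for the elements of a finite layer. *)
Lemma dedekind (F K : fieldType) (i : {rmorphism F -> K}) (S : K -> Prop) (P : seq (gal i)) (c : gal i -> K) :
  S 1 -> (forall x y, S x -> S y -> S (x * y)) -> uniq P ->
  {in P &, forall p q : gal i, (forall e, S e -> p e = q e) -> p = q} ->
  (exists2 p, p \in P & c p != 0) -> exists e, S e /\ \sum_(p <- P) c p * p e != 0.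
Proof.
move=> S1 SM; elim: P c => [c _ _ [p]|p0 P IH c]; first by rewrite in_nil.
rewrite cons_uniq => /andP[p0P uP] sep ex.
have [[p1 p1P c1]|nP] := pselect (exists2 p, p \in P & c p != 0).
  have [e1 Se1 ne] : exists2 e, S e & p0 e <> p1 e.
    apply: contrapT => h; move: p0P; rewrite (sep p0 p1) ?mem_head ?inE ?p1P ?orbT // => e Se.
    by apply: contrapT => pe; apply: h; exists e.
  have [|||e [Se ne0]] := IH (fun p => c p * (p e1 - p0 e1)); first by [].
  - by move=> p q pP qP; apply: sep; rewrite inE ?pP ?qP orbT.
  - by exists p1 => //; rewrite mulf_neq0 // subr_eq0 eq_sym; exact/eqP.
  have [z|nz] := eqVneq (\sum_(p <- p0 :: P) c p * p e) 0; last by exists e.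
  exists (e1 * e); split; first exact: SM.
  have -> : \sum_(p <- p0 :: P) c p * p (e1 * e) =
      \sum_(p <- P) c p * (p e1 - p0 e1) * p e + p0 e1 * \sum_(p <- p0 :: P) c p * p e; last by rewrite z mulr0 addr0.
  rewrite !big_cons mulrDr addrCA mulr_sumr -big_split /=; congr (_ + _).
    by rewrite rmorphM; ring.
  by apply: eq_bigr => p _; rewrite rmorphM; ring.
exists 1; split=> //; rewrite big_cons big1_seq ?addr0 ?rmorph1 ?mulr1.
  by case: ex => p; rewrite inE => /predU1P[<-//|pP cp]; case: nP; exists p.
by move=> p /andP[_ pP]; apply/eqP; rewrite mulf_eq0; apply/orP; left; apply: contrapT => /negP cp; apply: nP; exists p.
Qed.

Section Values.
Context (V : henselian_valuation_ring).
Local Notation val := (@hv_val V).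

Lemma hv_valM x y : x != 0 -> y != 0 -> val (x * y) = val x + val y.
Proof. by have [h _ _] := hv_valuation V; exact: h. Qed.
Lemma hv_val1 : val 1 = 0.
Proof. by apply: (addrI (val 1)); rewrite -hv_valM ?oner_neq0 // mulr1 addr0. Qed.
Lemma hv_valV x : x != 0 -> val x^-1 = - val x.
Proof. by move=> x0; apply: (addrI (val x)); rewrite -hv_valM ?invr_eq0 // divff // hv_val1 subrr. Qed.
Lemma hv_valX x n : x != 0 -> val (x ^+ n) = val x *+ n.
Proof.
by move=> x0; elim: n => [|n IH]; rewrite ?hv_val1 // exprS mulrS hv_valM ?expf_neq0 // IH.
Qed.
Lemma hv_val_prod (I : eqType) (r : seq I) (f : I -> hvL V) : (forall k, f k != 0) ->
  \prod_(k <- r) f k != 0 /\ val (\prod_(k <- r) f k) = \sum_(k <- r) val (f k).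
Proof.
move=> f0; elim: r => [|k r [p0 pv]]; first by rewrite !big_nil oner_neq0 hv_val1.
by rewrite !big_cons mulf_neq0 // hv_valM // pv.
Qed.

End Values.

Lemma modN_eq N (A : zmodType) (x y : A) : modN_pi N x = modN_pi N y <-> exists z, x - y = z *+ #|'Z_N|.
Proof.
rewrite /modN_pi; split=> [/eqP|h]; last apply/eqP.
  by rewrite -Quotient.idealrBE => /asboolW.
by rewrite -Quotient.idealrBE; apply: asboolT.
Qed.
Lemma modN_pi_sum N (A : zmodType) (I : Type) (r : seq I) (f : I -> A) (c : I -> nat) :
  modN_pi N (\sum_(k <- r) f k *+ c k) = \sum_(k <- r) modN_pi N (f k) *+ c k.
Proof. by rewrite /modN_pi raddf_sum; apply: eq_bigr => k _; rewrite raddfMn. Qed.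

(** * Tame ramification *)

Section Ramification.
Context (V : henselian_valuation_ring) (D : strict_data V).
Context (O : set (sdLs D)) (plO : place O).
Context (l : nat) (l_pr : prime l) (lW : (l%:R : hvW V) \is a GRing.unit).
Let vO := pl_vring plO.
Local Notation iota := (sd_iota D).
Local Notation base := (sd_base D).
Local Notation GL := (gal base).
Local Notation Gk := (gal (sd_kap D)).
Local Notation res := (sd_res D).
Local Notation vu := (vu O).
Local Notation vm := (vm O).
Local Notation inI := (fun s : GL => specialize s = gal1 (sd_kap D)).

Lemma vuX x n : vu x -> vu (x ^+ n).
Proof. by move=> ux; rewrite -[n]card_ord -prodr_const; elim/big_ind: _ => //; [exact: (vu1 vO)|exact: (vuM vO)]. Qed.

Lemma val0_vu c : c != 0 -> (vu (base c) <-> hv_val c = 0).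
Proof.
move=> c0; have [r a _ _ _] := hv_order V.
have ge d : d != 0 -> (hv_le 0 (hv_val d) <-> O (base d)).
  by move=> d0; rewrite (hv_val_ge0 d0) -(base_O plO).
split=> [[_ h1 h2]|v0].
  have /(ge _ c0) g1 := h1; have : O (base c^-1) by rewrite fmorphV.
  move=> /ge; rewrite invr_eq0 hv_valV // => /(_ c0) g2.
  have [_ _ _ _ t] := hv_order V; apply: a => //.
  by have := t _ _ (hv_val c) g2; rewrite addr0 subrr.
split; rewrite ?fmorph_eq0 // -?fmorphV; apply/ge; rewrite ?invr_eq0 ?hv_valV ?v0 ?oppr0 //; exact: r.
Qed.

Lemma specV (s : GL) : specialize (galV s) = galV (specialize s).
Proof.
have h := specM s (galV s).
have e : galM s (galV s) = gal1 base by apply: gal_ext => x; exact: galVK.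
rewrite e spec1 in h; apply: gal_ext => y; apply: (gal_inj (s := specialize s)).
by rewrite galVK -galME -h.
Qed.

Lemma spec_eq_inertia (s t : GL) : specialize s = specialize t ->
  exists2 i : GL, inI i & s = galM t i.
Proof.
move=> st; exists (galM (galV t) s); first by rewrite specM specV st galVM.
by apply: gal_ext => x; rewrite !galME galVK.
Qed.

(* Hilbert 90 over the residue field: the cocycle [s |-> s z / z] with values in the [l]-th
   roots of unity is also the cocycle of an [l]-th root of a unit of [W]. *)
Lemma ur_root (z : sdLur D) c : z != 0 -> z ^+ l = sd_ur D c ->
  exists2 c', c' != 0 & vu (sd_sep D z / base c').
Proof.
move=> z0 zl; set y := sd_sep D z; have y0 : y != 0 by rewrite fmorph_eq0.
have yl : y ^+ l = base c by rewrite -rmorphXn zl.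
have sy0 (s : GL) : s y != 0 by rewrite fmorph_eq0.
have /choice[w wE] : forall s : GL, exists w : sdW D, s y = iota w * y /\ w ^+ l = 1.
  move=> s; have [|w0 w0E w01] := @unity_wsh _ D l l_pr lW 1 (s y / y).
    by rewrite expn1 expr_div_n -rmorphXn yl gal_fix divff // -yl expf_neq0.
  by exists w0; rewrite w0E divfK // -[l]expn1.
have w_inj a b : iota a * y = iota b * y -> a = b by move/(mulIf y0)/(@iota_inj _ D).
(* As an element of [Lur], [y] is fixed by inertia, so [w s] depends only on the specialization of
   [s] and descends to the function [om] on [G_k]. *)
have wI (s t : GL) : specialize s = specialize t -> w s = w t.
  move=> /spec_eq_inertia[i iI st]; apply: w_inj; rewrite -!(wE _).1 st galME.
  by rewrite /y inertia_fix.
have /choice[lf lfE] := @spec_surj _ D; pose om t := res (w (lf t)).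
have oml t : om t ^+ l = 1 by rewrite -rmorphXn (wE _).2 rmorph1.
have om0 t : om t != 0.
  by apply: contra_eq_neq (oml t) => ->; rewrite expr0n; case: (l) l_pr => // ? _; rewrite eq_sym oner_eq0.
have omM s t : om (galM s t) = om s * s (om t).
  have [f [f1 f2 _]] := spec_end (lf s).
  have ls : s (om t) = res (f (w (lf t))) by rewrite f2 lfE.
  rewrite ls -rmorphM; congr (res _); apply: w_inj.
  rewrite -(wE _).1 rmorphM -mulrA (mulrC _ y) mulrA -(wE _).1 mulrC -f1.
  have [i iI ->] : exists2 i : GL, inI i & lf (galM s t) = galM (galM (lf s) (lf t)) i.
    by apply: spec_eq_inertia; rewrite specM !lfE.
  by rewrite !galME /y (inertia_fix _ iI) -/y (wE (lf t)).1 rmorphM mulrC.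
have [u uP] := spec_open [:: y].
have omv s t : gal_lev_eqv u s t -> om s = om t.
  move=> st; congr (res _); apply: w_inj; rewrite -!(wE _).1.
  have [|i iI /(_ y (mem_head _ _) (gal1 _))] := uP (galM (galV (lf s)) (lf t)).
    rewrite specM specV !lfE => x xu g.
    exact: (etrans (congr1 (galV s) (esym (st x xu g))) (galKV s (g x))).
  rewrite [i _](inertia_fix z iI) => e.
  exact: (etrans (congr1 (lf s) (esym e)) (galVK (lf s) (lf t y))).
have [P tP] := @transversal_ex (gal_pgrp (kap_sc D)) u (fun=> True).
have [uP' _ iP sP] := tP.
(* The test elements [e] are those on which automorphisms equivalent at level [u] agree, so that the
   sum [b] is independent of the representatives [P]. *)
have [||||e [Se b0]] := @dedekind _ _ _ (fun e => forall s t : Gk, gal_lev_eqv u s t -> s e = t e)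
   P (fun p => (om p)^-1) _ _ uP'.
- by move=> s t _; rewrite !rmorph1.
- by move=> a b ha hb s t st; rewrite !rmorphM (ha _ _ st) (hb _ _ st).
- by move=> p q pP qP pq; apply: iP => // x xu g; apply: pq => s t; exact.
- by have [p pP _] := sP (gal1 _) I; exists p; rewrite ?invr_eq0.
set b := \sum_(p <- P) _ in b0.
have sb (s : Gk) : s b = om s * b.
  pose F p := (om p)^-1 * p e.
  have FE (p : Gk) : s (F p) = om s * F (galM s p).
    by rewrite /F omM rmorphM fmorphV invfM mulrA mulrA mulfV ?mul1r.
  rewrite /b rmorph_sum mulr_sumr (eq_bigr _ (fun p _ => FE p)) -!mulr_sumr; congr (_ * _).
  rewrite -(big_map (galM s) xpredT F).
  have tP2 := @transversal_mul (gal_pgrp (kap_sc D)) u (fun=> True) P s tP.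
  apply: (@transversal_sum (gal_pgrp (kap_sc D)) _ u (fun=> True) _ _ F tP2 tP).
  move=> p q pq.
  by rewrite /F (omv _ _ pq) (Se _ _ pq).
have [c0 c0E] : exists c0, b ^+ l = sd_kap D c0.
  by apply: (fixed_field (kap_sc D)) => s; rewrite rmorphXn sb exprMn oml mul1r.
have [w0 w0E] := (hv_residue V).1 c0.
have [||t [tl tb]] := @wsh_root _ D l l_pr lW (sd_hens D w0) 1 b.
- by rewrite sd_res_hens w0E -c0E expf_neq0.
- by rewrite expn1 sd_res_hens w0E.
rewrite expn1 in tl.
have ut : vu (iota t) by apply/(iota_vu plO); rewrite tb; exact/eqP.
have t0 : iota t != 0 by have [] := ut.
(* Both sides have the same [l]-th power and the same residue, since [s] multiplies [b] by [om];
   their quotient is 1 by [unity_cong]. Thus [t] has the cocycle of [y], and [y / t] lies in the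
   base. *)
have st (s : GL) : s (iota t) = iota (w s) * iota t.
  have [f [f1 f2 f3]] := spec_end s.
  have uw : vu (iota (w s)).
    by apply/(iota_vu plO) => r0; move/eqP: (rmorph1 res); rewrite -(wE s).2 rmorphXn r0 expr0n;
      case: (l) l_pr => // ? _; rewrite eq_sym oner_eq0.
  have u2 := vuM vO uw ut; have [n2 _ _] := u2.
  apply/eqP; rewrite -(inj_eq (mulIf (invr_neq0 n2))) divff //; apply/eqP.
  apply: (unity_cong plO lW).
    have el : iota (f t) ^+ l = (iota (w s) * iota t) ^+ l.
      by rewrite exprMn -(rmorphXn iota) -(rmorphXn f) tl f3 -(rmorphXn iota) (wE s).2
        -(rmorphXn iota) tl (rmorph1 iota) mul1r.
    by rewrite expr_div_n f1 el divff // expf_neq0.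
  rewrite -[1 in X in vm X](divff n2) -mulrBl; apply: (vmM vO); last by have [] := u2.
  rewrite f1 -rmorphM -rmorphB; apply/(iota_vm plO).
  rewrite rmorphB rmorphM f2 tb sb /om (wI s (lf (specialize s))) ?lfE //.
  by rewrite subrr.
have [c' c'E] : exists c', y / iota t = base c'.
  apply: (fixed_field (sd_closure D)) => s; rewrite fmorph_div st (wE s).1.
  by rewrite -mulf_div divff ?mul1r //; apply: contraTneq (sy0 s) => w00; rewrite (wE s).1 w00 mul0r eqxx.
exists c'; first by rewrite -(fmorph_eq0 base) -c'E mulf_neq0 ?invr_eq0.
by rewrite -c'E invf_div mulrA mulrAC divff // mul1r.
Qed.

Context (B : choiceType) (xb : B -> hvL V) (nu : nat).
Hypothesis nu0 : (0 < nu)%N.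
Local Notation N := (l ^ nu)%N.
Hypothesis xb0 : forall b, xb b != 0.
Hypothesis xb_basis : is_basis (fun b => modN_pi N (hv_val (xb b))).

Definition fix_roots (S : seq B) m (s : GL) :=
  forall b, b \in S -> forall r, r ^+ (l ^ m)%N = base (xb b) -> s r = r.

Lemma lX_gt1 k : (0 < k)%N -> (1 < l ^ k)%N.
Proof. by move=> k0; rewrite -(expn0 l) ltn_exp2l // prime_gt1. Qed.
Lemma card_ZN : #|'Z_N| = N.
Proof. by rewrite card_ord Zp_cast // lX_gt1. Qed.

(** The basis property holds modulo [N] only; it is applied again to the remainder [d], as in an
    [N]-adic expansion. *)
Lemma value_decomp k (g : hvGam V) : exists (s : seq (B * nat)) d,
  g = \sum_(p <- s) hv_val (xb p.1) *+ p.2 + d *+ (N ^ k)%N.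
Proof.
elim: k => [|k [s [d gE]]]; first by exists [::], g; rewrite big_nil add0r expn0 mulr1n.
have [s' [c cE]] := xb_basis.2 (modN_pi N d).
have /modN_eq[d' d'E] : modN_pi N d = modN_pi N (\sum_(b <- s') hv_val (xb b) *+ (c b : nat)).
  by rewrite modN_pi_sum cE.
exists (s ++ [seq (b, c b * N ^ k)%N | b <- s']), d'.
rewrite big_cat big_map /= gE -addrA; congr (_ + _).
have -> : d' *+ (N ^ k.+1)%N = d' *+ #|'Z_N| *+ (N ^ k)%N by rewrite card_ZN -mulrnA expnS.
rewrite -d'E mulrnBl.
have -> : \sum_(b <- s') hv_val (xb b) *+ (c b * N ^ k) = (\sum_(b <- s') hv_val (xb b) *+ (c b : nat)) *+ (N ^ k)%N.
  by rewrite -sumrMnl; apply: eq_bigr => b _; rewrite mulrnA.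
by rewrite addrC subrK.
Qed.

Lemma l_Ls k : ((l ^ k)%N%:R : sdLs D) != 0.
Proof. by rewrite natrX expf_neq0 //; have [] := l_vu plO lW. Qed.

Lemma root_ex k (c : sdLs D) : c != 0 -> exists r, r ^+ (l ^ k)%N = c.
Proof.
move=> c0; have n0 : (0 < l ^ k)%N by rewrite expn_gt0 prime_gt0.
have [||x] := (sd_closure D).2 ('X^(l ^ k) - c%:P).
- by apply: separable_XnsubC => //; exact: l_Ls.
- by rewrite size_XnsubC.
by rewrite rootE !hornerE subr_eq0 => /eqP; exists x.
Qed.

Lemma vu_root n x : (0 < n)%N -> vu (x ^+ n) -> vu x.
Proof.
move=> n0 [xn h1 h2]; have x0 : x != 0 by apply: contraNneq xn => ->; case: (n) n0 => // k _; rewrite expr0n eqxx.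
have e : x ^+ n = x ^+ n.-1 * x by rewrite -exprSr prednK.
have [mx|//|mx] := vu_inv_or vO x0; exfalso.
  apply: (vm_nu (x := x ^+ n) _ (And3 xn h1 h2)); rewrite e; apply: (vmMl vO) => //.
  by apply: (vrX vO); have [] := mx.
have e' : (x ^+ n)^-1 = x^-1 ^+ n.-1 * x^-1 by rewrite -exprSr prednK // exprVn.
apply: (vm_nu (x := (x ^+ n)^-1)); last exact: vuV (And3 xn h1 h2).
by rewrite e'; apply: (vmMl vO) => //; apply: (vrX vO); have [] := mx.
Qed.

(* Every element is, up to a unit and an exponent prime to [l], a monomial in roots of the
   [xb b] and of elements of the base. *)
Lemma root_tame y : y != 0 -> exists e (S' : seq B), forall m (S : seq B) s w, (e <= m)%N ->
  {subset S' <= S} -> inI s -> fix_roots S m s -> s y = w * y -> w ^+ l = 1 -> w = 1.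
Proof.
move=> y0; have [n [c [n0 c0 u0]]] := torsion_value plO y0.
have [e [n1 [n1l nE]]] : exists e n1, coprime n1 l /\ n = (n1 * l ^ e)%N.
  have [n1 co ->] := pfactor_coprime l_pr n0; exists (logn l n), n1; split=> //.
  by rewrite coprime_sym.
have [s0 [d sE]] := value_decomp e (hv_val c).
have [d0 dn0 dE] : exists2 d0, d0 != 0 & hv_val d0 = d by have [_ _ h] := hv_valuation V; exact: h.
exists e, (map fst s0) => m S s w em S'S s1 fx sy wl.
have /choice[r rE] : forall b, exists r, r ^+ (l ^ m)%N = base (xb b).
  by move=> b; apply: root_ex; rewrite fmorph_eq0.
(* Chosen so that [t ^ (l ^ e)] lies in the base and has the value of [c]. The remainder [d0] enters
   with exponent [N ^ e], which is a multiple of [l ^ e], so its part of the root is in the base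
   too. *)
pose t := \prod_(p <- s0) r p.1 ^+ (l ^ (m - e) * p.2)%N * base d0 ^+ (l ^ (nu * e - e))%N.
have st : s t = t.
  rewrite /t rmorphM rmorphXn gal_fix rmorph_prod; congr (_ * _); apply: eq_big_seq => p ps.
  by rewrite rmorphXn (fx p.1) // ?rE // S'S // map_f.
pose cc := \prod_(p <- s0) xb p.1 ^+ p.2 * d0 ^+ (N ^ e)%N.
have tE : t ^+ (l ^ e)%N = base cc.
  rewrite /t /cc exprMn -exprM rmorphM rmorphXn -expnD subnK ?expnM; last by rewrite leq_pmull.
  rewrite -prodrXl rmorph_prod; congr (_ * _); apply: eq_bigr => p _.
  by rewrite -exprM mulnAC -expnD subnK // exprM rE rmorphXn.
have [cc0 ccv] : cc != 0 /\ hv_val cc = hv_val c.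
  have [|p0 pv] := @hv_val_prod V _ s0 (fun p => xb p.1 ^+ p.2); first by move=> p; rewrite expf_neq0.
  rewrite /cc mulf_neq0 ?expf_neq0 // hv_valM ?expf_neq0 // pv hv_valX // dE sE; split=> //.
  by congr (_ + _); apply: eq_bigr => p _; rewrite hv_valX.
have t0 : t != 0.
  apply: contraTneq cc0 => t00; rewrite negbK -(fmorph_eq0 base) -tE t00 expr0n.
  by rewrite gtn_eqF ?eqxx ?expn_gt0 ?prime_gt0.
have uy : vu (y ^+ n1 / t).
  apply: (@vu_root (l ^ e)); first by rewrite expn_gt0 prime_gt0.
  rewrite expr_div_n -exprM -nE tE.
  have -> : y ^+ n / base cc = (y ^+ n / base c) * base (c / cc).
    by rewrite fmorph_div mulrA divfK // fmorph_eq0.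
  apply: (vuM vO) => //; apply/val0_vu; first by rewrite mulf_neq0 ?invr_eq0.
  by rewrite hv_valM ?invr_eq0 // hv_valV // ccv subrr.
have wn : w ^+ n1 = 1.
  apply: (inertia_unit plO l_pr lW s1 uy); last by rewrite exprAC wl expr1n.
  by rewrite fmorph_div st rmorphXn sy exprMn mulrA.
exact: coprime_exp1 n1l wn wl.
Qed.

End Ramification.

(** * Ramification groups and Kummer characters *)

Section RamificationGroups.
Import pgroup.
Context (V : henselian_valuation_ring) (D : strict_data V).
Context (l : nat) (l_pr : prime l) (lW : (l%:R : hvW V) \is a GRing.unit).
Local Notation iota := (sd_iota D).
Local Notation base := (sd_base D).
Local Notation GL := (gal base).
Local Notation inI := (fun s : GL => specialize s = gal1 (sd_kap D)).
Local Notation GLp := (gal_pgrp (sd_closure D)).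
Context (B : choiceType) (xb : B -> hvL V) (nu : nat).
Hypothesis nu0 : (0 < nu)%N.
Local Notation N := (l ^ nu)%N.
Hypothesis xb0 : forall b, xb b != 0.
Hypothesis xb_basis : is_basis (fun b => modN_pi N (hv_val (xb b))).

Lemma inIM (i j : GL) : inI i -> inI j -> inI (galM i j).
Proof. by move=> /= iI jI; rewrite specM iI jI gal1M. Qed.

Section Restriction.
Context (c : seq (sdLs D)) (c_closed : forall (s : GL) x, x \in c -> s x \in c).

Lemma restr_ex (s : GL) : exists p : {perm seq_sub c}, forall x, ssval (p x) = s (ssval x).
Proof.
pose f (x : seq_sub c) : seq_sub c := SeqSub (c_closed s (ssvalP x)).
have fi : injective f by move=> x y [] /(@gal_inj _ _ _ s) xy; exact: val_inj.
by exists (perm fi) => x; rewrite permE.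
Qed.
Definition restr s : {perm seq_sub c} := proj1_sig (cid (restr_ex s)).
Lemma restrE s x : ssval (restr s x) = s (ssval x).
Proof. exact: (proj2_sig (cid (restr_ex s))). Qed.
Lemma restrM s t : restr (galM s t) = (restr t * restr s)%g.
Proof. by apply/permP => x; apply: val_inj; rewrite permM /= !restrE. Qed.
Lemma restr1 : restr (gal1 base) = 1%g.
Proof. by apply/permP => x; apply: val_inj; rewrite perm1 /= restrE. Qed.
Lemma restrX s k x : ssval ((restr s ^+ k)%g x) = iter k s (ssval x).
Proof. by elim: k => [|k IH]; rewrite ?expg0 ?perm1 // expgSr permM restrE IH. Qed.

End Restriction.

(* [l] times the projector of an element of an orbit of size [l] on an eigenspace. *)
Definition resolvent (z : sdLs D) (F : nat -> sdLs D) j := \sum_(i < l) z ^- (i * j) * F i.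

Lemma resolvent_shift (s : GL) z F j : l.-primitive_root z -> s z = z -> (forall i, s (F i) = F i.+1) ->
  F l = F 0%N -> s (resolvent z F j) = z ^+ j * resolvent z F j.
Proof.
move=> zp sz sF Fl; have z0 : z != 0.
  by apply: contra_eq_neq (prim_expr_order zp) => ->; rewrite expr0n; case: (l) l_pr => // ? _; rewrite eq_sym oner_eq0.
pose G i := z ^- (i * j) * F i.
have GS i : s (z ^- (i * j) * F i) = z ^+ j * G i.+1.
  rewrite rmorphM fmorphV rmorphXn sz sF /G mulrA mulSn exprD invfM mulrA divff ?mul1r //.
  by rewrite expf_neq0.
rewrite /resolvent rmorph_sum (eq_bigr (fun i : 'I_l => z ^+ j * G i.+1)) => [|i _]; last exact: GS.
rewrite -mulr_sumr; congr (_ * _); apply: (addrI (G 0%N)).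
transitivity (\sum_(i < l.+1) G i); first by rewrite big_ord_recl.
rewrite big_ord_recr addrC; congr (_ + _).
by rewrite /G Fl mul0n expr0 mulnC exprM exprAC (prim_expr_order zp) expr1n.
Qed.

Lemma resolvent_sum z F : l.-primitive_root z -> \sum_(j < l) resolvent z F j = l%:R * F 0%N.
Proof.
move=> zp; rewrite exchange_big /=; have l0 := prime_gt0 l_pr.
rewrite (bigD1 (Ordinal l0)) //= [X in _ + X]big1 ?addr0.
  rewrite -mulr_suml (eq_bigr (fun=> 1)) ?sumr_const ?card_ord // => j _.
  by rewrite mul0n expr0 invr1.
move=> i i0; rewrite -mulr_suml.
have i0' : (0 < i)%N by rewrite lt0n; apply: contra_neq i0 => i0; exact: val_inj.
have zi1 : z ^- i != 1.
  rewrite invr_eq1 -(prim_order_dvd zp); apply/negP => /dvdn_leq; rewrite i0' => /(_ isT).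
  by rewrite leqNgt ltn_ord.
have := subrX1 (z ^- i) l; rewrite exprVn exprAC (prim_expr_order zp) expr1n invr1 subrr.
move=> /esym/eqP; rewrite mulf_eq0 subr_eq0 (negPf zi1) /= => /eqP s0.
rewrite (_ : \sum_(j < l) _ = 0) ?mul0r // -[RHS]s0; apply: eq_bigr => j _.
by rewrite exprM exprVn.
Qed.

(** If [l] divided the order, Cauchy's theorem would give an element of order [l] in the permutation
    group on [c]. One of its resolvents is a nonzero eigenvector with eigenvalue a nontrivial [l]-th
    root of unity, which [root_tame] excludes. *)
Theorem prime_to_l (v : seq (sdLs D)) : exists (S0 : seq B) m0, forall (S : seq B) m,
  {subset S0 <= S} -> (m0 <= m)%N ->
  forall P, @transversal GLp v (fun i => inI i /\ fix_roots l xb S m i) P -> coprime l (size P).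
Proof.
have [O plO] := place_ex D; have sc := sd_closure D.
pose c := flatten [seq orb base x | x <- v].
have c_closed (s : GL) x : x \in c -> s x \in c.
  by move=> /flatten_mapP[y yv xy]; apply/flatten_mapP; exists y => //; exact: orb_closed.
have [z0 [zp _]] := @wsh_prim _ D l l_pr lW 1; set z := iota z0 in zp; rewrite expn1 in zp.
pose F (p : {perm seq_sub c}) (x : seq_sub c) i := ssval ((p ^+ i)%g x).
pose Yt (t : {perm seq_sub c} * seq_sub c * 'I_l) := resolvent z (F t.1.1 t.1.2) t.2.
(* Resolvents are indexed by permutations of [c], not by automorphisms. There are finitely many, so
   one [S0] and one [m0] serve all of them before the element of order [l] is known. *)
have /choice[es esE] : forall t, exists u : nat * seq B, Yt t != 0 ->
    forall m (S : seq B) (s : GL) w, (u.1 <= m)%N ->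
    {subset u.2 <= S} -> inI s -> fix_roots l xb S m s -> s (Yt t) = w * Yt t -> w ^+ l = 1 -> w = 1.
  move=> t; have [->|y0] := eqVneq (Yt t) 0; first by exists (0%N, [::]).
  have [e [S' h]] := root_tame plO l_pr lW nu0 xb0 xb_basis y0; by exists (e, S').
exists (flatten [seq (es t).2 | t <- enum {: {perm seq_sub c} * seq_sub c * 'I_l}]), (\max_t (es t).1)%N.
move=> S m S0S mm P [uP CP iP sP].
pose C (i : GL) := inI i /\ fix_roots l xb S m i.
have C1 : C (gal1 base) by split=> //; exact: spec1.
have CM (s t : GL) : C s -> C t -> C (galM s t).
  move=> [s1 s2] [t1 t2]; split; first exact: inIM.
  by move=> b bS r rb; rewrite galME (t2 b) // (s2 b).
pose rs := restr c_closed.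
have rs_eqv (s t : GL) : rs s = rs t <-> @pg_eqv GLp v s t.
  split=> [st x xv u|st].
    have uc : u x \in c by apply/flatten_mapP; exists x => //; exact: mem_orb.
    by rewrite -[u x]/(ssval (SeqSub uc)) -!(restrE c_closed) -!/(rs _) st.
  apply/permP => -[y yc]; apply: val_inj; rewrite /= !restrE /=.
  by have /flatten_mapP[x xv /(mem_orbP sc)[u <-]] := yc; exact: st.
pose A := [set p : {perm seq_sub c} | `[< exists2 s, C s & rs s = p >]].
have AP p : reflect (exists2 s, C s & rs s = p) (p \in A) by rewrite inE; exact: asboolP.
have Ag : group_set A.
  apply/group_setP; split; first by apply/AP; exists (gal1 base) => //; exact: restr1.
  move=> p q /AP[s Cs <-] /AP[t Ct <-]; apply/AP; exists (galM t s); first exact: CM.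
  exact: restrM.
have cA : #|A| = size P.
  have uR : uniq (map rs P) by rewrite map_inj_in_uniq // => p q pP qP /rs_eqv; exact: iP.
  rewrite -(size_map rs) -(card_uniqP uR); apply: eq_card => p; apply/AP/mapP => [[s Cs <-]|[s sP' ->]].
    by have [t tP st] := sP s Cs; exists t => //; exact/rs_eqv.
  by exists s => //; exact: CP.
rewrite prime_coprime //; apply/negP; rewrite -cA => lA.
have [p pA pl] := Cauchy (G := Group Ag) l_pr lA; have [s [s1 s2] sp] := AP _ pA.
have px : exists x, p x != x.
  apply: contrapT => np; have p1 : p = 1%g.
    by apply/permP => x; rewrite perm1; apply: contrapT => /eqP px; apply: np; exists x.
  by move: pl l_pr; rewrite p1 order1 => <-.
have [x px'] := px.
have FE i : F p x i = iter i s (ssval x) by rewrite /F -sp restrX.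
have Fl : F p x l = F p x 0%N by rewrite /F -pl expg_order expg0.
have sF i : s (F p x i) = F p x i.+1 by rewrite !FE.
have sz : s z = z by exact: inertia_fix.
(* If all resolvents with [j > 0] vanish, the one with [j = 0] equals [l] times the point [x] and is
   fixed by [s], against the choice of [x]. *)
have [j jE] : exists j : 'I_l, (0 < j)%N /\ Yt (p, x, j) != 0.
  apply: contrapT => nj; have l0 := prime_gt0 l_pr.
  have Y0 (j : 'I_l) : j != Ordinal l0 -> resolvent z (F p x) j = 0.
    move=> j0; apply: contrapT => /eqP yj; apply: nj; exists j; split=> //.
    by rewrite lt0n; apply: contra_neq j0 => j0; exact: val_inj.
  have := resolvent_sum (F p x) zp; rewrite (bigD1 (Ordinal l0)) //= big1 // addr0 => e.
  have := resolvent_shift 0 zp sz sF Fl; rewrite e expr0 mul1r rmorphM rmorph_nat sF.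
  have ln0 : (l%:R : sdLs D) != 0 by have := l_Ls plO lW 1; rewrite expn1.
  move=> /(mulfI ln0); rewrite /F expg1 expg0 perm1 => /val_inj pxx.
  by rewrite pxx eqxx in px'.
have := esE (p, x, j) jE.2 m S s (z ^+ j) _ _ s1 s2 (resolvent_shift j zp sz sF Fl).
have -> : (z ^+ j) ^+ l = 1 by rewrite exprAC (prim_expr_order zp) expr1n.
move=> h; have {}h : z ^+ j = 1.
  apply: h => //; first by apply: leq_trans mm; exact: (leq_bigmax (p, x, j)).
  by move=> b bS; apply: S0S; apply/flatten_mapP; exists (p, x, j) => //; rewrite mem_enum.
have : (l %| j)%N by rewrite (prim_order_dvd zp) h.
by move=> /dvdn_leq; rewrite jE.1 => /(_ isT); rewrite leqNgt ltn_ord.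
Qed.

(** [Y] will hold the exponents of the cocycles of a frame. On inertia they are Kummer characters;
    on the rest of [G_L] only their behaviour under translation by inertia is used. *)
Context (Y : B -> GL -> nat) (zeta : sdLs D).
Hypothesis zeta_prim : N.-primitive_root zeta.
Hypothesis YM : forall b (i g : GL), inI i -> Y b (galM i g) = Y b i + Y b g %[mod N].
Hypothesis Y_kummer : forall b (i : GL) r, inI i -> r ^+ N = base (xb b) -> i r = zeta ^+ Y b i * r.
Hypothesis Y_smooth : forall b, exists v, forall x y : GLp, pg_eqv v x y -> Y b x = Y b y %[mod N].

Lemma lift_prim m : (nu <= m)%N -> exists2 z, (l ^ m).-primitive_root z & z ^+ (l ^ (m - nu)) = zeta.
Proof.
move=> nm; have [z0 [zp _]] := @wsh_prim _ D l l_pr lW m; set z := iota z0 in zp.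
have zp' : N.-primitive_root (z ^+ (l ^ (m - nu))).
  have := exp_prim_root zp (l ^ (m - nu)).
  rewrite (gcdn_idPl _) ?dvdn_exp2l ?leq_subr // -{1}(subnK nm) expnD mulKn //.
  by rewrite expn_gt0 prime_gt0.
have [k kE] := prim_rootP zp' (prim_expr_order zeta_prim).
have co : coprime k l.
  have : coprime k N by rewrite -(prim_root_exp_coprime _ zp') -kE.
  by rewrite coprime_pexpr.
exists (z ^+ k); last by rewrite exprAC.
by rewrite prim_root_exp_coprime // coprimeXr.
Qed.

Section Level.
Context (m : nat) (nm : (nu <= m)%N) (z : sdLs D).
Hypothesis zp : (l ^ m).-primitive_root z.
Hypothesis zz : z ^+ (l ^ (m - nu)) = zeta.
Context (r : B -> sdLs D) (rE : forall b, r b ^+ (l ^ m)%N = base (xb b)).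
Context (X0 : B -> GL -> nat).
Hypothesis X0E : forall b (g : GL), g (r b) = z ^+ X0 b g * r b.
Let m0 : (0 < m)%N. Proof. exact: leq_trans nu0 nm. Qed.
Let q1 : (1 < l ^ m)%N. Proof. exact: (lX_gt1 l_pr m0). Qed.

Let r0 b : r b != 0.
Proof.
have : base (xb b) != 0 by rewrite fmorph_eq0.
by apply: contraNneq => rb; rewrite -rE rb expr0n gtn_eqF // expn_gt0 prime_gt0.
Qed.
Let z_fix (i : GL) : inI i -> i z = z.
Proof. by move=> iI; apply: (unity_fix l_pr lW (m := m)) => //; exact: prim_expr_order. Qed.

Lemma zX_eq a b : z ^+ a = z ^+ b <-> a = b %[mod l ^ m].
Proof.
by split=> [/eqP|h]; [rewrite (eq_prim_root_expr zp) => /eqP|apply/eqP; rewrite (eq_prim_root_expr zp) h].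
Qed.

Lemma X0M b (i g : GL) : inI i -> X0 b (galM i g) = X0 b i + X0 b g %[mod l ^ m].
Proof.
move=> iI; apply/zX_eq/(mulIf (r0 b)); rewrite -X0E galME !X0E rmorphM rmorphXn z_fix // X0E.
by rewrite exprD mulrA [X in X * _]mulrC.
Qed.

Lemma X0Y b (i : GL) : inI i -> X0 b i = Y b i %[mod N].
Proof.
move=> iI; have := @Y_kummer b i (r b ^+ (l ^ (m - nu))) iI.
rewrite -exprM -expnD subnK // rE rmorphXn X0E exprMn exprAC zz => /(_ erefl).
move=> /(mulIf (expf_neq0 _ (r0 b)))/eqP; rewrite (eq_prim_root_expr zeta_prim) => /eqP.
by [].
Qed.

Lemma chi_comb (T : seq B) (ib : B -> GL) (k : B -> nat) : (forall t, inI (ib t)) ->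
  exists2 j : GL, inI j & forall b, X0 b j = (\sum_(t <- T) k t * X0 b (ib t))%N %[mod l ^ m].
Proof.
move=> ibI; have X1 b : X0 b (gal1 base) = 0 %[mod l ^ m].
  apply/zX_eq/(mulIf (r0 b)); rewrite -X0E expr0 mul1r.
  by [].
have pw (i : GL) n : inI i -> exists2 j : GL, inI j & forall b, X0 b j = (n * X0 b i)%N %[mod l ^ m].
  move=> iI; elim: n => [|n [j jI jE]]; first by exists (gal1 base); [exact: spec1|move=> b; rewrite X1].
  exists (galM i j); first exact: inIM.
  by move=> b; rewrite X0M // -modnDmr jE modnDmr mulSn.
elim: T => [|t T [j jI jE]]; first by exists (gal1 base); [exact: spec1|move=> b; rewrite big_nil X1].
have [i iI iE] := pw (ib t) (k t) (ibI t); exists (galM i j); first exact: inIM.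
by move=> b; rewrite X0M // big_cons -modnDm iE jE modnDm.
Qed.

(* Kummer theory: otherwise a monomial in the [l]-th roots would be fixed by inertia, hence
   unramified, against the independence of the values modulo [l]. *)
Lemma chi_unit (b0 : B) (S : seq B) : uniq (b0 :: S) ->
  (forall a : B -> nat, exists2 i : GL, inI i & forall b, b \in S -> X0 b i = a b %[mod l ^ m]) ->
  exists i : GL, [/\ inI i, forall b, b \in S -> X0 b i = 0 %[mod l ^ m] & ~~ (l %| X0 b0 i)%N].
Proof.
move=> uS su; apply: contrapT => nu_.
have [O plO] := place_ex D.
have all0 (i : GL) : inI i -> (forall b, b \in S -> X0 b i = 0 %[mod l ^ m]) -> (l %| X0 b0 i)%N.
  by move=> iI i0; apply: contrapT => /negP h; apply: nu_; exists i.
have /choice[ib ibE] : forall t, exists i : GL, inI i /\ forall b, b \in S -> X0 b i = nat_of_bool (b == t) %[mod l ^ m].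
  by move=> t; have [i iI iE] := su (fun b => nat_of_bool (b == t)); exists i.
have /andP[b0S uS'] := uS.
(* Here [(l ^ m).-1] stands for -1 modulo [l ^ m]. Removing from [i] its coordinates along the dual
   elements [ib b] kills all coordinates in [S]; the coordinate at [b0] of the result is the sum in
   [dvd]. *)
pose n b := (((l ^ m).-1) * X0 b0 (ib b))%N.
have lq : (l %| l ^ m)%N by rewrite -{1}(expn1 l) dvdn_exp2l.
have dvd (i : GL) : inI i -> (l %| X0 b0 i + \sum_(b <- S) n b * X0 b i)%N.
  move=> iI; have [j jI jE] := @chi_comb S ib (fun b => (l ^ m).-1 * X0 b i)%N (fun t => (ibE t).1).
  have key b : X0 b (galM i j) = (X0 b i + \sum_(t <- S) (l ^ m).-1 * X0 t i * X0 b (ib t))%N %[mod l ^ m].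
    by rewrite X0M // -modnDmr jE modnDmr.
  have : (l %| X0 b0 (galM i j))%N.
    apply: all0 => [|b bS]; first exact: inIM.
    have -> : (0 = X0 b i + (l ^ m).-1 * X0 b i %[mod l ^ m])%N.
      by rewrite -mulSn prednK ?modnMr ?mod0n // ltnW.
    have rest : (\sum_(t <- rem b S) (l ^ m).-1 * X0 t i * X0 b (ib t) = 0 %[mod l ^ m])%N.
      rewrite big_seq; elim/big_ind: _ => [//|x y hx hy|t]; first by rewrite -modnDm hx hy !(mod0n, addn0).
      rewrite mem_rem_uniq // inE => /andP[tb tS].
      rewrite -modnMmr (ibE t).2 //.
      have -> : (b == t) = false by apply/negbTE; rewrite eq_sym.
      by rewrite /= mod0n muln0 mod0n.
    have e : (\sum_(t <- S) (l ^ m).-1 * X0 t i * X0 b (ib t) = (l ^ m).-1 * X0 b i %[mod l ^ m])%N.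
      rewrite (big_rem b) //= -modnDmr rest mod0n addn0 -modnMmr (ibE b).2 // eqxx modnMmr.
      by rewrite muln1.
    by rewrite key -modnDmr e modnDmr.
  have -> : (l %| X0 b0 (galM i j))%N = (l %| X0 b0 i + \sum_(t <- S) (l ^ m).-1 * X0 t i * X0 b0 (ib t))%N.
    rewrite /dvdn -(modn_dvdm _ lq) key (modn_dvdm _ lq).
    by [].
  suff -> : (\sum_(t <- S) (l ^ m).-1 * X0 t i * X0 b0 (ib t) = \sum_(b <- S) n b * X0 b i)%N by [].
  by apply: eq_bigr => t _; rewrite /n mulnAC.
pose q := (l ^ m.-1)%N; have qE : (l * q)%N = (l ^ m)%N by rewrite -expnS prednK.
(* Each [r b ^+ q] is an [l]-th root of [xb b], and [dvd] says that inertia fixes this monomial. *)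
pose y := r b0 ^+ q * \prod_(b <- S) (r b ^+ q) ^+ n b.
have y0 : y != 0.
  rewrite mulf_neq0 ?expf_neq0 // prodf_seq_neq0; apply/allP => b _ /=.
  by rewrite !expf_neq0.
have yfix (i : GL) : inI i -> i y = y.
  move=> iI; have rq b : i (r b ^+ q) = z ^+ (X0 b i * q) * r b ^+ q by rewrite rmorphXn X0E exprMn exprM.
  have -> : i y = z ^+ ((X0 b0 i + \sum_(b <- S) n b * X0 b i) * q) * y.
    rewrite /y rmorphM rq rmorph_prod mulnDl exprD big_distrl /= expr_sum mulrACA -big_split.
    congr (_ * _); apply: eq_bigr => b _; rewrite rmorphXn rq exprMn /=; congr (_ * _).
    by rewrite -exprM; congr (_ ^+ _); rewrite mulnC mulnA.
  have /dvdnP[k ->] := dvd i iI.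
  by rewrite -mulnA qE mulnC exprM (prim_expr_order zp) expr1n mul1r.
have [zz' zzE] := inertia_fixed_field yfix.
pose x := xb b0 * \prod_(b <- S) xb b ^+ n b.
have yl : y ^+ l = base x.
  rewrite /y /x exprMn -exprM mulnC qE rE rmorphM rmorph_prod -prodrXl; congr (_ * _).
  by apply: eq_bigr => b _; rewrite -!exprM mulnC mulnA qE exprM rE rmorphXn.
have zz0 : zz' != 0 by rewrite -(fmorph_eq0 (sd_sep D)) -zzE.
have [|c' c0 uc] := ur_root plO l_pr lW (c := x) zz0; last first.
  rewrite -zzE in uc; have := vuX plO l uc; rewrite expr_div_n yl -rmorphXn -fmorph_div.
  have [p0 pv] := @hv_val_prod V _ S (fun b => xb b ^+ n b) (fun b => expf_neq0 _ (xb0 b)).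
  have x0 : x != 0 by rewrite mulf_neq0.
  move=> /(val0_vu plO (mulf_neq0 x0 (invr_neq0 (expf_neq0 l c0)))).1.
  rewrite hv_valM ?invr_eq0 ?expf_neq0 // hv_valV ?expf_neq0 // hv_valX // hv_valM // pv.
  move=> /subr0_eq vE.
  (* The relation of values modulo [l] is multiplied by [l ^ nu.-1] to become one modulo [N]. The
     coefficient of [b0] is then [l ^ nu.-1], which is not 0 modulo [N]. *)
  have [ind _] := xb_basis; pose k b := ((if b == b0 then 1 else n b) * l ^ nu.-1)%N.
  have := ind (b0 :: S) (fun b => (k b)%:R) uS.
  have -> : \sum_(b <- b0 :: S) (k b)%:R *: modN_pi N (hv_val (xb b)) = modN_pi N (\sum_(b <- b0 :: S) hv_val (xb b) *+ k b).
    by rewrite modN_pi_sum; apply: eq_bigr => b _; rewrite scaler_nat.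
  have -> : \sum_(b <- b0 :: S) hv_val (xb b) *+ k b = hv_val c' *+ N.
    rewrite -[in RHS](prednK nu0) expnS mulrnA -vE mulrnDl -sumrMnl big_cons /k eqxx mul1n.
    congr (_ + _); apply: eq_big_seq => b bS; rewrite hv_valX // -mulrnA.
    by case: eqP => // bb; move: b0S; rewrite -bb bS.
  have -> : modN_pi N (hv_val c' *+ N) = 0.
    rewrite -[RHS](_ : modN_pi N 0 = 0); last by rewrite /modN_pi raddf0.
    by apply/modN_eq; exists (hv_val c'); rewrite subr0 (card_ZN l_pr nu0).
  move=> /(_ erefl b0 (mem_head _ _)) /(congr1 val); rewrite /= val_Zp_nat; last exact: (lX_gt1 l_pr nu0).
  rewrite /k eqxx mul1n modn_small; last by rewrite ltn_exp2l ?prime_gt1 // prednK.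
  by move=> e; have : (0 < l ^ nu.-1)%N by [rewrite expn_gt0 prime_gt0]; rewrite e.
by apply: (fmorph_inj (sd_sep D)); rewrite rmorphXn -zzE yl.
Qed.

(** Triangular elimination: [chi_unit] gives an element trivial on the earlier coordinates and a
    unit on the new one, so a power of it corrects the new coordinate freely. *)
Lemma chi_surj (S : seq B) (a : B -> nat) :
  exists2 i : GL, inI i & forall b, b \in S -> X0 b i = a b %[mod l ^ m].
Proof.
suff H : uniq (undup S) -> forall a : B -> nat, exists2 i : GL, inI i & forall b, b \in undup S -> X0 b i = a b %[mod l ^ m].
  by have [i iI iE] := H (undup_uniq S) a; exists i => // b bS; apply: iE; rewrite mem_undup.
elim: (undup S) => [_ a'|b0 S' IH uS a']; first by exists (gal1 base) => //; exact: spec1.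
have [i0 [iI0 i00 i0u]] := chi_unit uS (IH (andP uS).2).
have [i1 iI1 i1E] := IH (andP uS).2 a'.
have co : coprime (X0 b0 i0) (l ^ m) by rewrite coprimeXr // coprime_sym prime_coprime.
have [u uE] : exists u, (u * X0 b0 i0 = 1 %[mod l ^ m])%N.
  have x0 : (0 < X0 b0 i0)%N by rewrite lt0n; apply: contraNneq i0u => ->; rewrite dvdn0.
  by have [u v uv _] := egcdnP (l ^ m) x0; exists u; rewrite uv (eqP co) modnMDl.
pose k := (u * (a' b0 + (l ^ m).-1 * X0 b0 i1))%N.
have [j jI jE] := @chi_comb [:: b0] (fun=> i0) (fun=> k) (fun=> iI0).
exists (galM i1 j); first exact: inIM.
move=> b; rewrite X0M // inE -modnDmr jE modnDmr big_seq1 => /predU1P[->|bS].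
  have -> : (k * X0 b0 i0 = (u * X0 b0 i0) * (a' b0 + (l ^ m).-1 * X0 b0 i1))%N by rewrite /k mulnAC.
  rewrite -modnDmr -modnMml uE modnMml mul1n modnDmr addnCA -mulSn prednK; last exact: (ltnW q1).
  by rewrite addnC mulnC modnMDl.
by rewrite -modnDmr -modnMmr i00 // mod0n muln0 mod0n addn0 i1E.
Qed.

(** Modulo [N], [X0] agrees with [Y] on inertia but not on all of [G_L]. The difference [Df] is
    unchanged by inertia, so adding it to [X0] keeps the character. *)
Lemma co_level : exists X chi, @coordinates GLp inI B l nu Y (fix_roots l xb) m X chi.
Proof.
have N0 : (0 < N)%N by rewrite expn_gt0 prime_gt0.
have NM : (N %| l ^ m)%N by exact: dvdn_exp2l.
pose Df b (g : GL) := ((Y b g + (N - X0 b g %% N)) %% N)%N.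
have DfE b g : Df b g + X0 b g = Y b g %[mod N].
  rewrite /Df modnDml -addnA -modnDmr -(modnDmr _ (X0 b g)) subnK ?modnn ?addn0 //.
  by rewrite ltnW // ltn_pmod.
have Df_eq b g g' : Df b g = Df b g' %[mod N] -> Df b g = Df b g' by rewrite /Df !modn_mod.
exists (fun b g => X0 b g + Df b g)%N, X0; split.
- move=> b i g iI; have -> : Df b (galM i g) = Df b g.
    apply: Df_eq; apply/eqP; rewrite -(eqn_modDr (X0 b (galM i g))); apply/eqP.
    have e : X0 b (galM i g) = X0 b i + X0 b g %[mod N] by rewrite -(modn_dvdm _ NM) X0M // modn_dvdm.
    rewrite DfE YM // -(modnDmr (Df b g)) e modnDmr addnCA -modnDm -(X0Y _ iI) -DfE modnDm.
    by [].
  by rewrite addnA -modnDml X0M // modnDml.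
- move=> b; have [v vE] := Y_smooth b; exists (r b :: v) => g g' gg.
  have e : X0 b g = X0 b g' %[mod l ^ m].
    by apply/zX_eq/(mulIf (r0 b)); rewrite -!X0E; exact: (gg (r b) (mem_head _ _) (gal1 _)).
  have -> : Df b g = Df b g'.
    apply: Df_eq; apply/eqP; rewrite -(eqn_modDr (X0 b g)) DfE.
    rewrite (vE _ g'); last by move=> x xv; apply: gg; rewrite inE xv orbT.
    by rewrite -DfE -(modnDmr _ (X0 b g)) -(modn_dvdm (X0 b g) NM) e modn_dvdm // modnDmr.
  by rewrite -modnDml e modnDml.
- by move=> b g; rewrite addnC DfE.
- move=> S m' i m'm iI.
  have rk b : (r b ^+ (l ^ (m - m'))) ^+ (l ^ m') = base (xb b) by rewrite -exprM -expnD subnK.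
  have ir b : i (r b ^+ (l ^ (m - m'))) = z ^+ (X0 b i * l ^ (m - m')) * r b ^+ (l ^ (m - m')).
    by rewrite rmorphXn X0E exprMn exprM.
  have iff b : z ^+ (X0 b i * l ^ (m - m')) = 1 <-> X0 b i = 0 %[mod l ^ m'].
    rewrite -[1](expr0 z); split=> [/zX_eq/eqP|/eqP]; rewrite !mod0n -!/(dvdn _ _) => h; last first.
      by apply/zX_eq/eqP; rewrite mod0n -/(dvdn _ _) -{1}(subnKC m'm) expnD dvdn_mul.
    apply/eqP; move: h; rewrite -{1}(subnKC m'm) expnD dvdn_pmul2r // expn_gt0 prime_gt0 //.
  split=> [fx b bS|ch b bS ρ ρE].
    apply/iff/(mulIf (expf_neq0 (l ^ (m - m')) (r0 b))); rewrite -ir mul1r; exact: (fx b).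
  have := (iff b).2 (ch b bS) => zz1; have := ir b; rewrite zz1 mul1r => ir1.
  set ρ0 := r b ^+ _ in ir1; have ρ00 : ρ0 != 0 by rewrite expf_neq0.
  rewrite -(divfK ρ00 ρ) rmorphM ir1 (unity_fix l_pr lW (m := m') iI) //.
  by rewrite expr_div_n ρE rk divff // fmorph_eq0.
- exact: chi_surj.
Qed.

End Level.

Theorem coordinates_ex m : (nu <= m)%N ->
  exists X chi, @coordinates GLp inI B l nu Y (fix_roots l xb) m X chi.
Proof.
move=> nm; have [O plO] := place_ex D.
have [z zp zz] := lift_prim nm.
have /choice[r rE] : forall b, exists r, r ^+ (l ^ m)%N = base (xb b).
  by move=> b; apply: (root_ex plO l_pr lW); rewrite fmorph_eq0.
have X0ex b (g : GL) : exists k, g (r b) = z ^+ k * r b.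
  have r0 : r b != 0.
    have : base (xb b) != 0 by rewrite fmorph_eq0.
    by apply: contraNneq => rb; rewrite -rE rb expr0n gtn_eqF // expn_gt0 prime_gt0.
  have [|k kE] := prim_rootP zp (x := g (r b) / r b); last by exists k; rewrite -kE divfK.
  by rewrite expr_div_n -rmorphXn rE gal_fix divff // fmorph_eq0.
have /choice[X0 X0E] : forall b, exists X : GL -> nat, forall g : GL, g (r b) = z ^+ X g * r b.
  by move=> b; have /choice[X XE] := X0ex b; exists X.
exact: (co_level nm zp zz rE X0E).
Qed.

End RamificationGroups.

(** One rewrite tuple for all consequences of linearity, for maps that come with a proof of [linear]
    and not with a bundled structure. *)
Lemma linB (R : pzRingType) (U W : lmodType R) (f : U -> W) : linear f ->
  (forall x y, f (x - y) = f x - f y) * (forall c x, f (c *: x) = c *: f x) * (f 0 = 0) *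
  (forall x y, f (x + y) = f x + f y).
Proof.
move=> fl; pose fa := GRing.isLinear.Build _ _ _ _ f fl.
pose F : {linear U -> W} := HB.pack f fa.
split; [split; [split|]|] => *; [exact: (linearB F)|exact: (linearZ_LR F)|exact: (linear0 F)|exact: (linearD F)].
Qed.

Lemma lin_comp (R : pzRingType) (U W X : lmodType R) (f : W -> X) (g : U -> W) :
  linear f -> linear g -> linear (f \o g).
Proof. by move=> fl gl c x y /=; rewrite gl fl. Qed.

Lemma lin_sum (R : pzRingType) (U W : lmodType R) (f : U -> W) (I : Type) (r : seq I) (F : I -> U) : linear f ->
  f (\sum_(k <- r) F k) = \sum_(k <- r) f (F k).
Proof.
move=> fl; elim: r => [|k r IH]; first by rewrite !big_nil (linB fl).
by rewrite !big_cons (linB fl) IH.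
Qed.

(** * Twists and exterior powers *)

Section FreeModule.
Context (R : nzRingType) (K : choiceType).

Lemma freeg_lin_ext (P : lmodType R) (f g : {freeg K / R} -> P) : linear f -> linear g ->
  (forall k, f << k >> = g << k >>) -> f =1 g.
Proof.
move=> fl gl fg D; rewrite -[D]freeg_sumE !lin_sum //; apply: eq_bigr => k _.
have -> : << coeff k D *g k >> = coeff k D *: << k >>.
  apply/eqP/freeg_eqP => y.
  by rewrite -[coeff k D *: _]/(fgscale _ _) coeff_fgscale !coeffU mul1r.
by rewrite !(linB fl) !(linB gl) fg.
Qed.

End FreeModule.

Lemma tens_ext (R : comNzRingType) (M M' P : lmodType R) (f g : tensor M M' -> P) :
  linear f -> linear g -> (forall x y, f (tens x y) = g (tens x y)) -> f =1 g.
Proof.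
move=> fl gl fg t; rewrite -[t]qreprK.
have ql : linear (qpi : {freeg (M * M')%type / R} -> tensor M M') by exact: linearP.
apply: (@freeg_lin_ext _ _ _ (f \o qpi) (g \o qpi)); [exact: lin_comp|exact: lin_comp|].
by move=> [x y]; exact: fg.
Qed.

Section Bilinear.
Context (R : comNzRingType) (M M' P : lmodType R).

Lemma tens_linl : forall y, linear (fun x : M => tens x (y : M')). Proof. exact: tens_linearl. Qed.
Lemma tens_linr : forall x, linear (tens (x : M) : M' -> _). Proof. exact: tens_linearr. Qed.

Lemma tens_mapE (Q Q' : lmodType R) (f : M -> Q) (g : M' -> Q') x y : linear f -> linear g ->
  tens_map f g (tens x y) = tens (f x) (g y).
Proof.
by move=> fl gl; rewrite /tens_map tens_liftM // => [u|u] c a b; rewrite ?gl ?fl ?tens_linearr ?tens_linearl.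
Qed.

End Bilinear.

Lemma tpow_mapS (R : comNzRingType) n (M Q : lmodType R) (f : M -> Q) (s : tpow n M) x : linear f ->
  tpow_map (n := n.+1) f (tens s x) = tens (tpow_map f s) (f x).
Proof. by move=> fl; apply: tens_mapE => //; exact: tpow_map_linear. Qed.

Lemma tpow_map_id (R : comNzRingType) n (M : lmodType R) (f : M -> M) : f =1 id -> tpow_map (n := n) f =1 id.
Proof.
move=> fid; have fl : linear f by move=> c x y; rewrite !fid.
elim: n => [//|n IH]; apply: tens_ext => [||x y]; first exact: (tpow_map_linear (n := n.+1)); first by [].
by rewrite (tpow_mapS (n := n)) // IH fid.
Qed.

Lemma tpow_map_comp (R : comNzRingType) n (M M' M'' : lmodType R) (f : M' -> M'') (g : M -> M') (h : M -> M'') :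
  linear f -> linear g -> h =1 f \o g -> forall t, tpow_map (n := n) h t = tpow_map f (tpow_map g t).
Proof.
move=> fl gl hfg; have hl : linear h by move=> c x y; rewrite !hfg /= gl fl.
elim: n => [//|n IH].
have L (N N' : lmodType R) (e : N -> N') k : linear e -> linear (tpow_map (n := k) e) by exact: tpow_map_linear.
apply: tens_ext => [||x y]; first exact: (L _ _ _ n.+1).
  exact: (lin_comp (L _ _ f n.+1 fl) (L _ _ g n.+1 gl)).
rewrite !(tpow_mapS (n := n)) //.
by rewrite IH hfg.
Qed.

Section DualMap.
Context (R : comNzRingType).

Lemma dual_lin (M : lmodType R) (phi : dual M) : linear (dual_app phi).
Proof. by have := valP phi; rewrite inE. Qed.

Lemma dual_ext (M : lmodType R) (phi psi : dual M) : dual_app phi =1 dual_app psi -> phi = psi.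
Proof. by move=> e; apply: val_inj; exact: funext. Qed.

Lemma dual_appP (M : lmodType R) c (phi psi : dual M) x :
  dual_app (c *: phi + psi) x = c * dual_app phi x + dual_app psi x.
Proof. by []. Qed.
Lemma dual_appZ (M : lmodType R) c (phi : dual M) x : dual_app (c *: phi) x = c * dual_app phi x.
Proof. by []. Qed.

Lemma dual_mapE (M M' : lmodType R) (g : M' -> M) (phi : dual M) x : linear g ->
  dual_app (dual_map g phi) x = dual_app phi (g x).
Proof.
move=> gl; rewrite /dual_app /dual_map insubdK // inE => c u v /=.
by rewrite gl (dual_lin phi).
Qed.

Lemma dual_ex (M : lmodType R) (f : M -> R^o) : linear f -> exists phi : dual M, dual_app phi =1 f.
Proof.
move=> fl; have fP : f \in @dual_pred R M by rewrite inE.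
by exists (Subm fP).
Qed.

End DualMap.

Section Twist.
Context (R : comNzRingType).
Implicit Types (M : lmodType R) (q : int).

Lemma twist_map_id q M (f g : M -> M) : f =1 id -> g =1 id -> twist_map (q := q) f g =1 id.
Proof.
move=> fid gid; case: q => n; first exact: tpow_map_id.
have gl : linear g by move=> c x y; rewrite !gid.
by apply: tpow_map_id => phi; apply: dual_ext => x; rewrite dual_mapE // gid.
Qed.

Lemma twist_map_comp q M M' M'' (f : M' -> M'') (f' : M'' -> M') (g : M -> M') (g' : M' -> M)
    (h : M -> M'') (h' : M'' -> M) :
  linear f -> linear f' -> linear g -> linear g' -> h =1 f \o g -> h' =1 g' \o f' ->
  forall t, twist_map (q := q) h h' t = twist_map f f' (twist_map g g' t).
Proof.
move=> fl fl' gl gl' hE hE'; have hl' : linear h' by move=> c x y; rewrite !hE' /= fl' gl'.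
case: q => n t; first exact: tpow_map_comp.
apply: tpow_map_comp => [||phi]; [exact: dual_map_linear|exact: dual_map_linear|].
by apply: dual_ext => x; rewrite /= !dual_mapE // hE'.
Qed.

Lemma contract_lin1 n M (x : M) : linear (fun t : tpow n.+1 (dual M) => contract t x).
Proof.
apply: tens_lift_linear => [s|phi] c u v; last by rewrite scalerDr !scalerA mulrC.
by rewrite dual_appP scalerDl scalerA.
Qed.

Lemma contractE n M (s : tpow n (dual M)) (phi : dual M) (x : M) :
  contract (tens s phi : tpow n.+1 (dual M)) x = dual_app phi x *: s.
Proof.
rewrite /contract tens_liftM // => [u|psi] c a b; last by rewrite scalerDr !scalerA mulrC.
by rewrite dual_appP scalerDl scalerA.
Qed.

Lemma contract_lin2 n M (t : tpow n.+1 (dual M)) : linear (contract t : M -> _).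
Proof.
move=> c x y; move: t.
apply: (@tens_ext _ _ _ _ (fun t : tpow n.+1 (dual M) => contract t (c *: x + y))
  (fun t => c *: contract t x + contract t y)).
- exact: contract_lin1.
- move=> d u v; rewrite !(linB (contract_lin1 (n := n) _)) !scalerDr !scalerA mulrC.
  by rewrite -!addrA; congr (_ + _); rewrite addrCA.
by move=> s phi; rewrite !contractE (dual_lin phi) scalerDl scalerA; congr (_ + _).
Qed.

Lemma twist_succ_lin1 q M (x : M) : linear (fun t : twist q M => twist_succ t x).
Proof.
case: q => [n|[|n]]; [exact: tens_linearl|exact: (contract_lin1 (n := 0))|exact: (contract_lin1 (n := n.+1))].
Qed.

Lemma twist_succ_lin2 q M (t : twist q M) : linear (twist_succ t).
Proof.
case: q t => [n|[|n]] t; [exact: tens_linearr|exact: (contract_lin2 (n := 0))|exact: (contract_lin2 (n := n.+1))].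
Qed.

Lemma twist_mul_lin2 q n M (t : twist q M) : linear (twist_mul (n := n) t).
Proof.
elim: n => [|n IH]; first by move=> c x y /=; rewrite scalerDl scalerA.
apply: tens_lift_linear => [s|x] c u v /=; first by rewrite twist_succ_lin2.
rewrite -[LHS]/(twist_succ (twist_mul t (c *: u + v)) x).
by rewrite -[RHS]/(c *: twist_succ (twist_mul t u) x + twist_succ (twist_mul t v) x) IH twist_succ_lin1.
Qed.

Lemma twist_mulS q n M (t : twist q M) (s : tpow n M) (x : M) :
  twist_mul (n := n.+1) t (tens s x) = twist_succ (twist_mul t s) x.
Proof.
rewrite /= tens_liftM // => [u|y] c a b /=; first by rewrite twist_succ_lin2.
rewrite -[LHS]/(twist_succ (twist_mul t (c *: a + b)) y).
by rewrite -[RHS]/(c *: twist_succ (twist_mul t a) y + twist_succ (twist_mul t b) y) twist_mul_lin2 twist_succ_lin1.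
Qed.

Lemma twist_mul_lin1 q n M (s : tpow n M) : linear (fun t : twist q M => twist_mul t s).
Proof.
move=> c t t'; elim: n s => [|n IH] s; first by rewrite /= scalerDr !scalerA mulrC.
move: s; apply: tens_ext => [||s x]; first exact: (twist_mul_lin2 (n := n.+1)).
  move=> d u v; rewrite !(twist_mul_lin2 (n := n.+1)) !scalerDr !scalerA mulrC.
  by rewrite -!addrA; congr (_ + _); rewrite addrCA.
by rewrite !twist_mulS IH twist_succ_lin1.
Qed.

Lemma cast_lin M p p' (e : p = p') : linear (fun t : twist p M => eq_rect p (fun p => twist p M) t p' e).
Proof. by case: p' / e. Qed.

Lemma cast_map M M' (f : M -> M') f' p p' (e : p = p') (t : twist p M) :
  eq_rect p (fun p => twist p M') (twist_map f f' t) p' e =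
  twist_map f f' (eq_rect p (fun p => twist p M) t p' e).
Proof. by case: p' / e. Qed.

Section Equivariance.
Context (M M' : lmodType R) (f : M -> M') (f' : M' -> M).
Hypotheses (fl : linear f) (fl' : linear f') (fK : cancel f f').

Lemma twist_succ_map q (t : twist q M) x :
  twist_succ (twist_map f f' t) (f x) = twist_map f f' (twist_succ t x).
Proof.
have tl k (N N' : lmodType R) (e : N -> N') : linear e -> linear (tpow_map (n := k) e) by exact: tpow_map_linear.
have dl' := dual_map_linear fl'.
have con n (u : tpow n.+1 (dual M)) :
    contract (tpow_map (n := n.+1) (dual_map f') u) (f x) = tpow_map (dual_map f') (contract u x).
  move: u; apply: tens_ext => [||s phi].
  - by apply: (lin_comp (f := fun t => contract t (f x))); [exact: contract_lin1|exact: (tl n.+1)].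
  - by apply: (lin_comp (f := tpow_map (dual_map f'))); [exact: tl|exact: contract_lin1].
  rewrite (tpow_mapS (n := n)) // !contractE dual_mapE // fK.
  by rewrite (linB (tl n _ _ _ dl')).
case: q t => [n|[|n]] t; [|exact: (con 0)|exact: (con n.+1)].
by rewrite [RHS](tpow_mapS (n := n)).
Qed.

Lemma twist_mul_map q n (t : twist q M) (s : tpow n M) :
  twist_mul (twist_map f f' t) (tpow_map f s) = twist_map f f' (twist_mul t s).
Proof.
have tml p := @twist_map_linear R p _ _ _ _ fl fl'.
elim: n s => [|n IH] s; first by rewrite /= (linB (tml q)).
move: s; apply: tens_ext => [||s x].
- by apply: (lin_comp (f := twist_mul (n := n.+1) _)); [exact: twist_mul_lin2|exact: (tpow_map_linear (n := n.+1))].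
- by apply: (lin_comp (f := twist_map f f')); [exact: tml|exact: (twist_mul_lin2 (n := n.+1))].
rewrite (tpow_mapS (n := n)) // !twist_mulS IH.
exact: twist_succ_map.
Qed.

Lemma twist_pair_map q n (t : twist (q - n%:Z) M) (s : tpow n M) :
  twist_pair (twist_map f f' t) (tpow_map f s) = twist_map f f' (twist_pair t s).
Proof.
by rewrite /twist_pair twist_mul_map cast_map.
Qed.

End Equivariance.

Lemma twist_pair_lin1 q n M (s : tpow n M) : linear (fun t : twist (q - n%:Z) M => twist_pair t s).
Proof. by move=> c t t'; rewrite /twist_pair twist_mul_lin1 cast_lin. Qed.
Lemma twist_pair_lin2 q n M (t : twist (q - n%:Z) M) : linear (twist_pair (n := n) t).
Proof. by move=> c s s'; rewrite /twist_pair twist_mul_lin2 cast_lin. Qed.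

(** [M] is free with basis [g]. *)
Definition rank1 M (g : M) := (forall x, exists c : R, x = c *: g) /\ forall c : R, c *: g = 0 -> c = 0.

Lemma rank1_coord M (g : M) : rank1 g -> exists phi : M -> R^o, linear phi /\ phi g = 1.
Proof.
move=> [/choice[k kE] k0]; have uniqk c d : c *: g = d *: g -> c = d.
  by move=> e; apply/eqP; rewrite -subr_eq0; apply/eqP/k0; rewrite scalerBl e subrr.
exists k; split; last by apply: uniqk; rewrite -kE scale1r.
move=> c x y; apply: uniqk; rewrite -kE {1}(kE x) {1}(kE y).
by rewrite scalerA -scalerDl.
Qed.

Lemma rank1_tens M M' (g : M) (g' : M') : rank1 g -> rank1 g' -> rank1 (tens g g').
Proof.
move=> rg rg'; split=> [t|c c0]; last first.
  have [phi [pl p1]] := rank1_coord rg; have [psi [ql q1]] := rank1_coord rg'.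
  pose F := tens_lift (fun x y => (phi x * psi y : R^o)).
  have l1 x : linear (fun y => (phi x * psi y : R^o)).
    by move=> d u v; rewrite ql mulrDr -[d *: psi u]/(d * psi u) mulrCA.
  have l2 y : linear (fun x => (phi x * psi y : R^o)).
    by move=> d u v; rewrite pl mulrDl -[d *: phi u]/(d * phi u) -mulrA.
  have Fl : linear F := tens_lift_linear l1 l2; have := congr1 F c0.
  rewrite !(linB Fl) /F tens_liftM // p1 q1 mulr1.
  by rewrite -[c *: (1 : R^o)]/(c * 1) mulr1.
have [D <-] : exists D, qpi D = t by exists (qrepr t); exact: qreprK.
have /choice[k kE] := rg.1; have /choice[k' kE'] := rg'.1.
exists (fglift (fun u : M * M' => k u.1 * k' u.2 : R^o) D).
apply: (@freeg_lin_ext _ _ _ qpi (fun D => fglift (fun u : M * M' => k u.1 * k' u.2 : R^o) D *: tens g g')).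
- exact: linearP.
- by move=> c u v; rewrite fglift_linear scalerDl scalerA.
move=> [x y]; rewrite liftU -[1 *: _]/(1 * (k x * k' y)) mul1r -[LHS]/(tens x y) {1}(kE x) {1}(kE' y).
by rewrite (linB (tens_linearl _)) (linB (tens_linearr _)) scalerA.
Qed.

Lemma rank1_dual M (g : M) : rank1 g -> exists phi : dual M, rank1 phi /\ dual_app phi g = 1.
Proof.
move=> rg; have [f [fl f1]] := rank1_coord rg; have [phi phiE] := dual_ex fl.
exists phi; split; last by rewrite phiE.
split=> [psi|c c0]; last first.
  have : dual_app (c *: phi) g = 0 by rewrite c0.
  by rewrite dual_appZ phiE f1 mulr1.
exists (dual_app psi g); apply: dual_ext => x; have [c ->] := rg.1 x.
rewrite dual_appZ !(linB (dual_lin _)) phiE f1 -[c *: (1 : R^o)]/(c * 1) mulr1 [RHS]mulrC.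
by [].
Qed.

Fixpoint tgen n M (g : M) : tpow n M := if n is k.+1 then tens (tgen k g) g else (1 : R).

Lemma rank1_tgen n M (g : M) : rank1 g -> rank1 (tgen n g).
Proof.
move=> rg; elim: n => [|n IH]; last exact: rank1_tens.
split=> [x|c]; first by exists x; rewrite -[_ *: _]/(x * 1) mulr1.
by rewrite -[c *: _]/(c * 1) mulr1.
Qed.

Definition twgen q M (g : M) (phi : dual M) : twist q M :=
  match q with Posz n => tgen n g | Negz n => tgen n.+1 phi end.

Lemma twist_succ_gen q M (g : M) (phi : dual M) : dual_app phi g = 1 ->
  twist_succ (twgen q g phi) g = twgen (succz q) g phi.
Proof.
move=> p1; case: q => [n|[|n]] //.
  by rewrite [LHS](contractE (n := 0)) p1 scale1r.
by rewrite [LHS](contractE (n := n.+1)) p1 scale1r.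
Qed.

Lemma twist_pair_gen q n M (g : M) (phi : dual M) : dual_app phi g = 1 ->
  twist_pair (twgen (q - n%:Z) g phi) (tgen n g) = twgen q g phi.
Proof.
move=> p1; have E p : twist_mul (twgen p g phi) (tgen n g) = twgen (iter n succz p) g phi.
  elim: (n) => [|k IH]; first by rewrite /= scale1r.
  by rewrite [LHS]twist_mulS IH /= twist_succ_gen.
have cast p p' (e : p = p') : eq_rect p (fun p => twist p M) (twgen p g phi) p' e = twgen p' g phi.
  by case: p' / e.
by rewrite /twist_pair E cast.
Qed.

(** All twists of a free module of rank one are free of rank one, with generators [twgen], and the
    pairing sends generator to generator. *)
Lemma twist_pair_bij q n M (g : M) : rank1 g -> bijective (fun t : twist (q - n%:Z) M => twist_pair t (tgen n g)).
Proof.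
move=> rg; have [phi [rp p1]] := rank1_dual rg.
have rt p : rank1 (twgen p g phi) by case: p => k; exact: rank1_tgen.
have /choice[k kE] := (rt q).1.
have PE c : twist_pair (c *: twgen (q - n%:Z) g phi) (tgen n g) = c *: twgen q g phi.
  by rewrite (linB (twist_pair_lin1 _)) twist_pair_gen.
have uk c d : c *: twgen q g phi = d *: twgen q g phi -> c = d.
  by move=> e; apply/eqP; rewrite -subr_eq0; apply/eqP/(rt q).2; rewrite scalerBl e subrr.
exists (fun t => k t *: twgen (q - n%:Z) g phi) => t; last by rewrite PE -kE.
by have [c ->] := (rt (q - n%:Z)).1 t; rewrite PE; congr (_ *: _); apply: uk; rewrite -kE.
Qed.

End Twist.

Lemma mspan_in (R : pzRingType) (V : lmodType R) (P : set V) x : P x -> x \in mspan P.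
Proof. by move=> Px; apply: asboolT => S; exact. Qed.

Lemma mspanP (R : pzRingType) (V : lmodType R) (P : set V) (S : V -> Prop) x :
  S 0 -> (forall c u v, S u -> S v -> S (c *: u + v)) -> (forall y, P y -> S y) -> x \in mspan P -> S x.
Proof.
move=> S0 SL PS xP; pose K : {pred V} := [pred y | `[< S y >]].
have Kc : subsemimod_closed K.
  apply: GRing.submod_closed_semi; split=> [|c u v]; first exact: asboolT.
  by move=> /asboolW hu /asboolW hv; apply: asboolT; exact: SL.
pose Km := GRing.isSubmodClosed.Build _ _ _ Kc.
pose KS : submodClosed V := HB.pack K Km.
have /asboolW/(_ KS) h := xP; have : x \in KS by apply: h => y /PS Sy; exact: asboolT.
by move/asboolW.
Qed.

Section QuotientLift.
Context (R : pzRingType) (V W : lmodType R) (P : set V) (f : V -> W).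
Hypotheses (fl : linear f) (fP : forall y, P y -> f y = 0).

Definition qlift (u : quotm (mspan P)) : W := f (qrepr u).

Lemma qliftE x : qlift (qpi x) = f x.
Proof.
apply/eqP; rewrite /qlift -subr_eq0 -(linB fl); apply/eqP.
apply: (@mspanP _ _ P (fun y => f y = 0)) => [|c u v fu fv||]; first by rewrite (linB fl).
- by rewrite fl fu fv scaler0 addr0.
- exact: fP.
by rewrite -qpi_eq qreprK.
Qed.

Lemma qlift_linear : linear qlift.
Proof. by move=> c u v; rewrite -[u]qreprK -[v]qreprK -linearP !qliftE fl. Qed.

End QuotientLift.

(** Two modules whose elements are determined by coordinates, with the same families of coordinates
    occurring in both, are isomorphic. The map and its inverse need not be written down. *)
Lemma lin_transfer (R : pzRingType) (U W X : lmodType R) (I : Type) (f : I -> U -> X) (g : I -> W -> X) :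
  (forall i, linear (f i)) -> (forall i, linear (g i)) ->
  (forall u, (forall i, f i u = 0) -> u = 0) -> (forall w, (forall i, g i w = 0) -> w = 0) ->
  (forall u, exists w, forall i, g i w = f i u) -> (forall w, exists u, forall i, f i u = g i w) ->
  exists2 phi : U -> W, linear phi & bijective phi.
Proof.
move=> fl gl f0 g0 /choice[phi phiE] /choice[psi psiE].
have ginj w w' : (forall i, g i w = g i w') -> w = w'.
  by move=> h; apply/eqP; rewrite -subr_eq0; apply/eqP/g0 => i; rewrite (linB (gl i)) h subrr.
have finj u u' : (forall i, f i u = f i u') -> u = u'.
  by move=> h; apply/eqP; rewrite -subr_eq0; apply/eqP/f0 => i; rewrite (linB (fl i)) h subrr.
exists phi; first by move=> c u v; apply: ginj => i; rewrite gl !phiE fl.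
by exists psi => x; [apply: finj|apply: ginj] => i; rewrite ?psiE ?phiE ?psiE.
Qed.

Lemma big_uniq_extend (M : zmodType) (I : choiceType) (s u : seq I) (F : I -> M) : uniq s -> uniq u ->
  {subset s <= u} -> (forall i, i \notin s -> F i = 0) -> \sum_(i <- u) F i = \sum_(i <- s) F i.
Proof.
move=> us uu su F0; rewrite (bigID (mem s)) /= [X in _ + X]big1 ?addr0 => [|i]; last exact: F0.
rewrite -big_filter; apply: perm_big; apply: uniq_perm; rewrite ?filter_uniq // => i.
by rewrite mem_filter; case: (boolP (i \in s)) => //= /su ->.
Qed.

Section BasisCoordinates.
Context (R : comNzRingType) (M : lmodType R) (B : choiceType) (e : B -> M) (be : is_basis e).

Lemma basis_coord : exists k : B -> M -> R^o, (forall b, linear (k b)) /\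
  forall b b', k b (e b') = (b' == b)%:R.
Proof.
pose rep x s (c : B -> R) := [/\ uniq s, x = \sum_(b <- s) c b *: e b & forall b, b \notin s -> c b = 0].
have ex x : exists sc, rep x sc.1 sc.2.
  have [s [c ->]] := be.2 x; exists (undup s, fun b => c b *+ count_mem b s); split=> /=.
  - exact: undup_uniq.
  - rewrite -big_undup_iterop_count; apply: eq_bigr => b _.
    by rewrite Monoid.iteropE iter_addr_0 scalerMnl.
  - by move=> b; rewrite mem_undup => /count_memPn ->; rewrite mulr0n.
have un x s c s' c' : rep x s c -> rep x s' c' -> c =1 c'.
  move=> [us xs c0] [us' xs' c0'] b; pose u := undup (s ++ s').
  have su : {subset s <= u} by move=> z zs; rewrite mem_undup mem_cat zs.
  have su' : {subset s' <= u} by move=> z zs; rewrite mem_undup mem_cat zs orbT.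
  have z0 : \sum_(b <- u) (c b - c' b) *: e b = 0.
    rewrite (eq_bigr (fun b => c b *: e b - c' b *: e b)) => [|z _]; last by rewrite scalerBl.
    rewrite sumrB (big_uniq_extend us (undup_uniq _) su); last by move=> z /c0 ->; rewrite scale0r.
    rewrite (big_uniq_extend us' (undup_uniq _) su'); last by move=> z /c0' ->; rewrite scale0r.
    by rewrite -xs -xs' subrr.
  have [bu|bu] := boolP (b \in u).
    by apply/eqP; rewrite -subr_eq0; apply/eqP/(be.1 _ _ (undup_uniq _) z0).
  rewrite c0 ?c0' //; first by apply: contra bu => /su'.
  by apply: contra bu => /su.
have /choice[sc scE] := ex.
exists (fun b x => (sc x).2 b); split=> [b c x y|b b'].
  have [us xs c0] := scE x; have [us' xs' c0'] := scE y.
  pose u := undup ((sc x).1 ++ (sc y).1).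
  have su : {subset (sc x).1 <= u} by move=> z zs; rewrite mem_undup mem_cat zs.
  have su' : {subset (sc y).1 <= u} by move=> z zs; rewrite mem_undup mem_cat zs orbT.
  apply: (un (c *: x + y) _ _ u (fun b => c * (sc x).2 b + (sc y).2 b) (scE _)); split.
  - exact: undup_uniq.
  - rewrite [in LHS]xs [in LHS]xs' -(big_uniq_extend us (undup_uniq _) su); last by move=> z /c0 ->; rewrite scale0r.
    rewrite -(big_uniq_extend us' (undup_uniq _) su'); last by move=> z /c0' ->; rewrite scale0r.
    by rewrite scaler_sumr -big_split; apply: eq_bigr => z _; rewrite scalerDl scalerA.
  - by move=> z zu; rewrite c0 ?c0' ?mulr0 ?addr0 //;
    apply: contra zu => h; rewrite mem_undup mem_cat h ?orbT.
apply: (un (e b') _ _ [:: b'] (fun b => (b' == b)%:R) (scE _)); split=> //.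
  by rewrite big_seq1 eqxx scale1r.
by move=> z; rewrite inE eq_sym => /negPf ->.
Qed.

End BasisCoordinates.

Section ExteriorPower.
Context (R : comNzRingType) (M : lmodType R) (B : choiceType) (e : B -> M) (be : is_basis e) (r : nat).
Implicit Types x : {ffun 'I_r -> M}.

Definition wedge x : extpow r M := qpi << x >>.

Lemma wedge_lin x i : linear (fun y => wedge (ffset x i y)).
Proof.
move=> c y z; apply/eqP; rewrite -linearP qpi_eq; apply: mspan_in; left.
by exists x, i, c, y, z; rewrite opprD addrA.
Qed.

Lemma ffset_id x i : ffset x i (x i) = x.
Proof. by apply/ffunP => j; rewrite ffunE; case: eqP => [->|]. Qed.

Lemma wedge_alt x i j : i != j -> x i = x j -> wedge x = 0.
Proof.
move=> ij xij; apply/eqP; rewrite -[0](linear0 qpi) qpi_eq subr0; apply: mspan_in; right.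
by exists x, i, j.
Qed.

Lemma wedge_tperm x i j : i != j -> wedge [ffun k => x (tperm i j k)] = - wedge x.
Proof.
move=> ij; pose F u v := wedge (ffset (ffset x i u) j v).
have ji : (j == i) = false by rewrite eq_sym (negPf ij).
have FE u v u' : ffset (ffset (ffset x i u) j v) i u' = ffset (ffset x i u') j v.
  by apply/ffunP => k; rewrite !ffunE; case: (eqVneq k i) => [->|//]; rewrite (negPf ij).
have F1 v : linear (F^~ v) by move=> c u u'; rewrite /F -(FE 0 v (c *: u + u')) -(FE 0 v u) -(FE 0 v u') wedge_lin.
have F2 u : linear (F u) by exact: wedge_lin.
have F0 u : F u u = 0 by apply: (wedge_alt ij); rewrite !ffunE eqxx (negPf ij) eqxx.
have -> : wedge x = F (x i) (x j).
  by rewrite /F ffset_id -[x j](_ : ffset x i (x i) j = _) ?ffset_id.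
have -> : wedge [ffun k => x (tperm i j k)] = F (x j) (x i).
  congr wedge; apply/ffunP => k; rewrite !ffunE; case: tpermP => [->|->|/eqP ki /eqP kj].
  - by rewrite (negPf ij) eqxx.
  - by rewrite eqxx.
  - by rewrite (negPf ki) (negPf kj).
apply/eqP; rewrite -subr_eq0 opprK; apply/eqP.
have := F0 (x i + x j); rewrite (linB (F1 _)) !(linB (F2 _)) !F0 addr0 add0r addrC.
by [].
Qed.

Lemma wedge_perm x (s : 'S_r) : exists b : bool, wedge [ffun k => x (s k)] = (-1) ^+ b *: wedge x.
Proof.
have [ts -> dts] := prod_tpermP s; elim: ts x dts => [|[i j] ts IH] x /=.
  by move=> _; exists false; rewrite big_nil scale1r; congr wedge; apply/ffunP => k; rewrite ffunE perm1.
move=> /andP[ij /IH h]; rewrite big_cons /=; have [b bE] := h x.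
exists (~~ b); have -> : [ffun k => x ((tperm i j * \prod_(t <- ts) tperm t.1 t.2)%g k)] =
    [ffun k => [ffun k => x ((\prod_(t <- ts) tperm t.1 t.2)%g k)] (tperm i j k)].
  by apply/ffunP => k; rewrite !ffunE permM.
rewrite wedge_tperm // bE -scaleN1r scalerA; congr (_ *: _).
by case: (b); rewrite ?expr1 ?expr0 ?mulr1 ?mulrN1 ?opprK.
Qed.

Context (I : choiceType) (tup : I -> r.-tuple B).
Hypothesis tup_uniq : forall J, uniq (tup J).
Hypothesis tup_inj : forall J J', tup J =i tup J' -> J = J'.
Hypothesis tup_surj : forall t : r.-tuple B, uniq t -> exists J, perm_eq (tup J) t.

Definition wbasis J : extpow r M := wedge [ffun i => e (tnth (tup J) i)].

(** Slots from [k] on already hold basis vectors; the slot before them is expanded by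
    multilinearity. When all slots are basis vectors, a repetition gives 0, and otherwise the
    vectors are sorted up to sign. *)
Lemma wedge_span x : wedge x \in mspan [set wbasis J | J in [set: I]]%classic.
Proof.
set S := mspan _; suff H k : (k <= r)%N -> forall x, (forall i : 'I_r, (k <= i)%N -> exists b, x i = e b) -> wedge x \in S.
  by apply: (H r) => // i; rewrite leqNgt ltn_ord.
elim: k => [|k IH] kr {}x xe.
  have /choice[f fE] : forall i, exists b, x i = e b by move=> i; exact: xe.
  pose t := [tuple f i | i < r].
  have [ut|nt] := boolP (uniq t); last first.
    suff [i [j [ij fij]]] : exists i j, i != j /\ f i = f j.
      by rewrite (wedge_alt ij) ?rpred0 // !fE fij.
    apply: contrapT => h; case/negP: nt; rewrite map_inj_uniq ?enum_uniq // => i j fij.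
    by apply: contrapT => /eqP ij; apply: h; exists i, j.
  have [J] := tup_surj ut; rewrite perm_sym => /tuple_permP[p pE].
  have -> : x = [ffun i => [ffun i => e (tnth (tup J) i)] (p i)].
    apply/ffunP => i; rewrite !ffunE fE; congr e.
    have : tnth t i = tnth [tuple tnth (tup J) (p i) | i < r] i by congr tnth; exact: val_inj.
    by rewrite !tnth_mktuple.
  by have [b ->] := wedge_perm [ffun i => e (tnth (tup J) i)] p; rewrite rpredZ //; apply: mspan_in; exists J.
have [s [c sE]] := be.2 (x (Ordinal kr)).
rewrite -(ffset_id x (Ordinal kr)) sE (lin_sum _ _ (wedge_lin x _)); apply: rpred_sum => b _.
rewrite (linB (wedge_lin x _)) rpredZ //; apply: IH; first exact: ltnW.
move=> i ki; rewrite ffunE; case: eqP => [_|ik]; first by exists b.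
by apply: xe; rewrite ltn_neqAle ki andbT; apply/eqP => ki'; apply: ik; exact: val_inj.
Qed.

(** The coordinate along [J] is the minor of the coordinate matrix on the columns in [J]; it kills
    the relations because a determinant is multilinear and alternating. *)
Lemma wedge_coord : exists lam : I -> extpow r M -> R^o, (forall J, linear (lam J)) /\
  forall J J', lam J (wbasis J') = (J' == J)%:R.
Proof.
have [k [kl ke]] := basis_coord be.
pose A J x : 'M[R]_r := \matrix_(i, j) k (tnth (tup J) j) (x i).
pose F J := fglift (fun x => \det (A J x) : R^o).
have Fl J : linear (F J) by exact: fglift_linear.
have FU J x : F J << x >> = \det (A J x) by rewrite /F liftU -[1 *: _]/(1 * _) mul1r.
have F0 J y : extpow_rel y -> F J y = 0.
  case=> [[x [i [c [u [v ->]]]]]|[x [i [j [ij xij ->]]]]].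
    rewrite !(linB (Fl J)) !FU.
    have row'E w : row' i (A J (ffset x i w)) = row' i (A J x).
      by apply/matrixP => a b; rewrite !mxE ffunE eq_sym (negPf (neq_lift _ _)).
    rewrite (determinant_multilinear (A := A J (ffset x i (c *: u + v))) (B := A J (ffset x i u))
      (C := A J (ffset x i v)) (i0 := i) (b := c) (c := 1)) ?row'E //; last first.
      by apply/rowP => b; rewrite !mxE !ffunE eqxx kl mul1r.
    by rewrite mul1r -[c *: \det _]/(c * \det _) addrAC addrK subrr.
  by rewrite FU; apply: (determinant_alternate ij) => b; rewrite !mxE xij.
exists (fun J => qlift (F J)); split=> [J|J J']; first exact: (qlift_linear (Fl J) (F0 J)).
rewrite /wbasis /wedge (qliftE (Fl J) (F0 J)) FU; case: eqP => [->|JJ'].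
  rewrite (_ : A _ _ = 1%:M) ?det1 //; apply/matrixP => i j; rewrite !mxE ffunE ke.
  by rewrite (inj_eq (tuple_uniqP _ (tup_uniq J))).
have [i iJ] : exists i, tnth (tup J') i \notin tup J.
  apply: contrapT => h; apply: JJ'; apply: tup_inj => b.
  have sub : {subset tup J' <= tup J}.
    by move=> z /tnthP[i ->]; apply: contrapT => /negP iJ; apply: h; exists i.
  have [_ eqi] := uniq_min_size (tup_uniq J') sub (eq_leq (etrans (size_tuple _) (esym (size_tuple _)))).
  exact: eqi.
rewrite (expand_det_row _ i) big1 // => j _; rewrite mxE ffunE ke.
by case: eqP => [e0|]; rewrite ?mul0r //; case/negP: iJ; rewrite e0 mem_tnth.
Qed.

Context (X : lmodType R).

(** The tensor product as a direct sum of copies of [X] over [I], stated through coordinates for use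
    with [lin_transfer]. *)
Lemma tensor_coord : exists kap : I -> tensor (extpow r M) X -> X, [/\ forall J, linear (kap J),
  forall J J' z, kap J (tens (wbasis J') z) = (J' == J)%:R *: z &
  forall t, exists s, [/\ uniq s, forall J, J \notin s -> kap J t = 0 &
    t = \sum_(J <- s) tens (wbasis J) (kap J t)]].
Proof.
have [lam [ll le]] := wedge_coord.
have l1 J w : linear (fun z : X => lam J w *: z) by move=> c u v; rewrite scalerDr !scalerA mulrC.
have l2 J z : linear (fun w => lam J w *: (z : X)).
  by move=> c u v; rewrite ll scalerDl scalerA.
pose kap J : tensor (extpow r M) X -> X := tens_lift (fun w z => lam J w *: z).
have kl J : linear (kap J) by exact: tens_lift_linear.
have kE J w z : kap J (tens w z) = lam J w *: z by exact: tens_liftM.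
exists kap; split=> // [J J' z|t]; first by rewrite kE le.
pose S t := exists s, [/\ uniq s, forall J, J \notin s -> kap J t = 0 & t = \sum_(J <- s) tens (wbasis J) (kap J t)].
have S0 : S 0 by exists [::]; split=> // [J _|]; rewrite ?big_nil // (linB (kl J)).
have T2 w := tens_linearr (w : extpow r M) : linear (tens w : X -> _).
have SL c u v : S u -> S v -> S (c *: u + v).
  move=> [s [us s0 uE]] [s' [us' s0' vE]]; pose w := undup (s ++ s').
  have su : {subset s <= w} by move=> z zs; rewrite mem_undup mem_cat zs.
  have su' : {subset s' <= w} by move=> z zs; rewrite mem_undup mem_cat zs orbT.
  exists w; split=> [|J Jw|]; first exact: undup_uniq.
    by rewrite kl s0 ?s0' ?scaler0 ?addr0 //;
      apply: contra Jw => h; rewrite mem_undup mem_cat h ?orbT.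
  rewrite [in LHS]uE [in LHS]vE.
  rewrite -(big_uniq_extend us (undup_uniq _) su); last by move=> z /s0 ->; rewrite (linB (T2 _)).
  rewrite -(big_uniq_extend us' (undup_uniq _) su'); last by move=> z /s0' ->; rewrite (linB (T2 _)).
  by rewrite scaler_sumr -big_split; apply: eq_bigr => J _; rewrite kl T2.
have Sb J z : S (tens (wbasis J) z).
  exists [:: J]; split=> // [J'|]; last by rewrite big_seq1 kE le eqxx scale1r.
  by rewrite inE eq_sym kE le => /negPf ->; rewrite scale0r.
have Sw w z : S (tens w z).
  have wS : w \in mspan [set wbasis J | J in [set: I]]%classic.
    rewrite -[w]qreprK -[qrepr w]freeg_sumE linear_sum; apply: rpred_sum => x _.
    have -> : << coeff x (qrepr w) *g x >> = coeff x (qrepr w) *: << x >>.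
      apply/eqP/freeg_eqP => y.
      by rewrite -[_ *: _]/(fgscale _ _) coeff_fgscale !coeffU mul1r.
    by rewrite linearZ rpredZ //; exact: wedge_span.
  move: wS; apply: (@mspanP _ _ _ (fun w => S (tens w z))) => [|c u v Su Sv|y [J _ <-]].
  - by rewrite (linB (tens_linearl z)).
  - by rewrite tens_linearl; exact: SL.
  - exact: Sb.
rewrite -[t]qreprK -[qrepr t]freeg_sumE linear_sum; elim/big_ind: _ => // [u v Su Sv|[x y] _].
  by rewrite -[u]scale1r; exact: SL.
have -> : << coeff (x, y) (qrepr t) *g (x, y) >> = coeff (x, y) (qrepr t) *: << (x, y) >>.
  apply/eqP/freeg_eqP => z.
  by rewrite -[_ *: _]/(fgscale _ _) coeff_fgscale !coeffU mul1r.
have := SL (coeff (x, y) (qrepr t)) _ _ (Sw x y) S0; rewrite addr0 linearZ; exact.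
Qed.

End ExteriorPower.

(** * Homogeneous cochains as functions on lists *)

Section ListCochains.
Context (R : pzRingType) (G : Type) (U : lmodType R) (x0 : G).

Definition lst n (g : 'I_n -> G) : seq G := [seq g k | k <- enum 'I_n].
Definition fnl n (s : seq G) : 'I_n -> G := fun k => nth x0 s k.
Arguments fnl n s : clear implicits.

Lemma size_lst n (g : 'I_n -> G) : size (lst g) = n.
Proof. by rewrite size_map -cardE card_ord. Qed.
Lemma nth_lst n (g : 'I_n -> G) (k : 'I_n) : nth x0 (lst g) k = g k.
Proof. by rewrite (nth_map k) ?size_enum_ord // nth_ord_enum. Qed.
Lemma lstK n (g : 'I_n -> G) : fnl n (lst g) = g.
Proof. by apply: funext => k; rewrite /fnl nth_lst. Qed.
Lemma fnlK n s : size s = n -> lst (fnl n s) = s.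
Proof.
move=> sn; apply: (@eq_from_nth _ x0); rewrite size_lst // => k kn.
by rewrite -[k]/(nat_of_ord (Ordinal kn)) nth_lst.
Qed.
Lemma eq_lst n (g : 'I_n -> G) s : size s = n -> (forall k : 'I_n, g k = nth x0 s k) -> lst g = s.
Proof. by move=> sn gs; rewrite -[RHS](fnlK sn); congr lst; apply: funext. Qed.

Lemma dl_rem (f : seq G -> U) s :
  dl f s = \sum_(j < size s) (-1) ^+ j *: f (take j s ++ drop j.+1 s).
Proof.
elim: s f => [|x s IH] f; first by rewrite big_ord0.
rewrite big_ord_recl /= expr0 scale1r drop0 IH -sumrN; congr (_ + _).
by apply: eq_bigr => j _; rewrite exprS mulN1r scaleNr.
Qed.

Lemma cobd_dl n (f : seq G -> U) (g : 'I_n.+2 -> G) :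
  cobd (fun g : 'I_n.+1 -> G => f (lst g)) g = dl f (lst g).
Proof.
rewrite dl_rem size_lst; apply: eq_bigr => j _; congr (_ *: f _).
apply: eq_lst; first by rewrite size_cat size_take size_drop size_lst ltn_ord; have := ltn_ord j; lia.
move=> k; rewrite -nth_lst nth_cat size_take size_lst ltn_ord /= /bump.
have [kj|kj] := ltnP k j; first by rewrite add0n nth_take.
by rewrite nth_drop; congr nth; lia.
Qed.

End ListCochains.
Arguments fnl {G} x0 n s _.

Lemma lst_map (G G' : Type) n (phi : G -> G') (g : 'I_n -> G) :
  lst (fun k => phi (g k)) = map phi (lst g).
Proof. by rewrite /lst -map_comp. Qed.

Section LocallyConstant.
Context (F E : fieldType) (i : {rmorphism F -> E}) (sc : separable_closure i).
Local Notation G := (gal_pgrp sc).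
Local Notation e1 := (gal1 i).

Lemma eqvs_nth (v : seq E) (s s' : seq G) : size s = size s' ->
  (forall k, (k < size s)%N -> @pg_eqv G v (nth e1 s k) (nth e1 s' k)) -> @eqvs G v s s'.
Proof.
elim: s s' => [|x s IH] [|y s'] //= [ss] h; split; first exact: (h 0%N).
by apply: IH => // k ks; exact: (h k.+1).
Qed.
Lemma nth_eqvs (v : seq E) (s s' : seq G) k : @eqvs G v s s' -> @pg_eqv G v (nth e1 s k) (nth e1 s' k).
Proof.
elim: s s' k => [|x s IH] [|y s'] k; [by move=> _; rewrite !nth_nil; exact: pg_refl|by []|by []|].
by case: k => [|k] [h1 h2] //; exact: IH.
Qed.

(* By compactness of the Galois group. *)
Lemma loc_const_smooth (T : Type) n (f : ('I_n.+1 -> gal i) -> T) : loc_const f ->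
  @smooth G T n.+1 (fun s => f (fnl e1 n.+1 s)).
Proof.
move=> fc; apply: contrapT => nu.
have /choice[sig sigP] : forall u : seq E, exists g : 'I_n.+1 * bool -> gal i,
    (forall k, {in u, g (k, false) =1 g (k, true)}) /\
    f (fun k => g (k, false)) <> f (fun k => g (k, true)).
  move=> u; apply: contrapT => h; apply: nu; exists u => s s' sn ss'; apply: contrapT => ne; apply: h.
  exists (fun kb => if kb.2 then fnl e1 n.+1 s' kb.1 else fnl e1 n.+1 s kb.1); split=> //= k x xu.
  exact: (nth_eqvs k ss' xu e1).
have [g gE] := gal_limit sc sig.
have gg k : g (k, false) = g (k, true).
  apply: gal_ext => x; have [u [su uE]] := gE [:: x] [:: (k, false, x); (k, true, x)].
  by rewrite -(uE (k, false)) ?mem_head // -(uE (k, true)) ?inE ?eqxx ?orbT // (sigP u).1 // su // mem_head.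
have [s sE] := fc (fun k => g (k, false)).
have [u [_ uE]] := gE [::] [seq (kb, x) | kb <- enum {: 'I_n.+1 * bool}, x <- s].
have agree b k : {in s, sig u (k, b) =1 g (k, false)}.
  move=> x xs; have -> : g (k, false) = g (k, b) by case: b.
  by apply: uE; apply/allpairsP; exists ((k, b), x); rewrite mem_enum.
case: (sigP u) => _; case.
by rewrite (sE _ (agree false)) -(sE _ (agree true)).
Qed.

Lemma smooth_loc_const (T : Type) n (f : seq G -> T) : smooth n.+1 f ->
  loc_const (fun g : 'I_n.+1 -> gal i => f (lst g)).
Proof.
move=> [v fv] g; exists (flatten [seq orb i x | x <- v]) => g' gg'.
apply: fv; rewrite ?size_lst //; apply: eqvs_nth; rewrite ?size_lst // => k kn x xv u.
rewrite -[k]/(nat_of_ord (Ordinal kn)) !nth_lst; apply: gg'.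
by apply/flatten_mapP; exists x => //; exact: (mem_orb sc).
Qed.

End LocallyConstant.

Section ListCohomology.
Context (R : pzRingType) (F E : fieldType) (i : {rmorphism F -> E}) (sc : separable_closure i) (M : galmod R i).
Local Notation G := (gal_pgrp sc).
Local Notation e1 := (gal1 i).
Implicit Types (f h : seq G -> M).

Definition eqvt n f := forall x s, size s = n -> f (map (pg_mul x) s) = gm_act x (f s).
Definition cocl n f := [/\ smooth n.+1 f, eqvt n.+1 f & forall s, size s = n.+2 -> dl f s = 0].
(** The primitive takes lists of length [n]. The condition [h [::] = 0] makes coboundaries of degree
    0 vanish, as in [coboundary]. *)
Definition cobl n f := exists h, [/\ smooth n h, eqvt n h, h [::] = 0 & forall s, size s = n.+1 -> f s = dl h s].
Definition ofl n f : cochain M n := fun g => f (lst g).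
Arguments ofl n f : clear implicits.
Definition tol n (f : cochain M n) : seq G -> M := fun s => if size s == n.+1 then f (fnl e1 n.+1 s) else 0.

Lemma ofl_tol n (f : cochain M n) : ofl n (tol f) = f.
Proof. by apply: funext => g; rewrite /ofl /tol size_lst eqxx lstK. Qed.
Lemma tolE n (f : cochain M n) g : tol f (lst g) = f g.
Proof. by rewrite -[LHS]/(ofl n (tol f) g) ofl_tol. Qed.

Lemma tol_smooth n (f : cochain M n) : loc_const f -> smooth n.+1 (tol f).
Proof.
move=> /(loc_const_smooth sc)[v fv]; exists v => s s' sn ss'.
by rewrite /tol sn -(eqvs_size ss') sn eqxx; exact: fv.
Qed.
Lemma tol_eqvt n (f : cochain M n) : equivariant f -> eqvt n.+1 (tol f).
Proof.
move=> fe x s sn; rewrite /tol size_map sn eqxx -fe; congr f; apply: funext => k.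
by rewrite /fnl (nth_map e1) // sn.
Qed.
Lemma ofl_ccochain n f : smooth n.+1 f -> eqvt n.+1 f -> ofl n f \in ccochain M n.
Proof.
move=> fs fe; apply: asboolT; split; first exact: smooth_loc_const.
by move=> x g; rewrite /ofl -fe ?size_lst // -lst_map.
Qed.

Lemma cocl_cocycle n f : cocl n f -> ofl n f \in cocycle M n.
Proof.
move=> [fs fe fd]; apply: asboolT; split; first exact: ofl_ccochain.
by apply: funext => g; rewrite [LHS](cobd_dl e1) fd ?size_lst.
Qed.

Lemma tol_cocl n (f : cochain M n) : f \in cocycle M n -> cocl n (tol f).
Proof.
move=> /asboolW[/asboolW[fc fe] fd]; split; [exact: tol_smooth|exact: tol_eqvt|].
move=> s sn; rewrite -(fnlK e1 sn) -(cobd_dl e1) -[X in cobd X]/(ofl n (tol f)) ofl_tol fd.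
by [].
Qed.

Lemma eq_ofl n f h : (forall s, size s = n.+1 -> f s = h s) -> ofl n f = ofl n h.
Proof. by move=> fh; apply: funext => g; apply: fh; rewrite size_lst. Qed.

Lemma cobl_coboundary n f : (ofl n f \in coboundary M n) <-> cobl n f.
Proof.
case: n => [|n]; split.
- move=> /asboolW f0; exists (fun=> 0); split=> // [|x s _|[|x [|]] //= _].
  + exact: smooth_cst.
  + have := gm_act_linear x (-1) 0 (0 : M); by rewrite scaler0 addr0 scaleN1r addNr.
  + by rewrite subrr -(fnlK e1 (s := [:: x]) (n := 1)) // -[LHS]/(ofl 0 f _) f0.
- move=> [h [_ _ h0 fh]]; apply: asboolT; apply: funext => g.
  by rewrite /ofl fh ?size_lst //; have := size_lst g; case: (lst g) => [|x [|]] //= _; rewrite h0 subrr.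
- move=> /asboolW[h /asboolW[hc he] fh]; exists (tol h); split=> //; [exact: tol_smooth|exact: tol_eqvt|].
  move=> s sn; rewrite -(fnlK e1 sn) -(cobd_dl e1) -[X in cobd X]/(ofl n (tol h)) ofl_tol -fh.
  by [].
move=> [h [hs he h0 fh]]; apply: asboolT; exists (ofl n h); first exact: ofl_ccochain.
by apply: funext => g; rewrite [RHS](cobd_dl e1) /ofl fh ?size_lst.
Qed.

Lemma coclP n c f h : cocl n f -> cocl n h -> cocl n (fun s => c *: f s + h s).
Proof.
move=> [fs fe fd] [hs he hd]; split=> [|x s sn|s sn].
- apply: (smooth_op2 +%R) => //; exact: smooth_op1.
- by rewrite fe ?he // gm_act_linear.
- rewrite dlD hd // addr0 -(dl_morph (u := fun x => c *: x)) ?fd ?scaler0 // => x y.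
  by rewrite scalerBr.
Qed.

Lemma ccls_eq n (f h : cochain M n) : f \in cocycle M n -> h \in cocycle M n ->
  (ccls f = ccls h) <-> f - h \in coboundary M n.
Proof.
move=> fz hz; rewrite /ccls /scls.
have sb : (insubd 0 f : subm (cocycle M n)) - insubd 0 h \in subq_rel (A := cocycle M n) (coboundary M n) <->
    f - h \in coboundary M n.
  rewrite inE -[val _]/(val (insubd 0 f : subm (cocycle M n)) - val (insubd 0 h : subm (cocycle M n))).
  by rewrite !insubdK.
by split=> [/eqP|h0]; [rewrite qpi_eq => /sb|apply/eqP; rewrite qpi_eq; exact/sb].
Qed.

Lemma ccls_ofl_eq n f h : cocl n f -> cocl n h ->
  ccls (ofl n f) = ccls (ofl n h) <-> cobl n (fun s => f s - h s).
Proof.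
move=> fz hz; rewrite ccls_eq; [|exact: cocl_cocycle|exact: cocl_cocycle].
by rewrite -cobl_coboundary.
Qed.

Lemma ccls_oflP n c f h : cocl n f -> cocl n h ->
  ccls (ofl n (fun s => c *: f s + h s)) = c *: ccls (ofl n f) + ccls (ofl n h).
Proof. by move=> fz hz; rewrite -ccls_linear //; exact: cocl_cocycle. Qed.

Lemma cocl_zero n : cocl n (fun=> 0).
Proof.
split=> [|x s _|s _]; [exact: smooth_cst| |by rewrite dl_zero].
by have := gm_act_linear x (-1) 0 (0 : M); rewrite scaler0 addr0 scaleN1r addNr.
Qed.

Lemma ccls_ofl0 n : ccls (ofl n (fun=> 0)) = 0.
Proof.
have z := cocl_zero n; have e := ccls_oflP (-1) z z.
by rewrite !scaleN1r !addNr in e.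
Qed.

Lemma crep_cocycle n (c : cohom M n) : crep c \in cocycle M n.
Proof. exact: valP (qrepr c). Qed.
Lemma crepK n (c : cohom M n) : ccls (crep c) = c.
Proof.
rewrite /ccls /scls /crep /srep; have -> : insubd 0 (val (qrepr c)) = qrepr c by exact: valKd.
exact: qreprK.
Qed.

Definition rep n (c : cohom M n) : seq G -> M := tol (crep c).
Lemma rep_cocl n (c : cohom M n) : cocl n (rep c). Proof. exact/tol_cocl/crep_cocycle. Qed.
Lemma repK n (c : cohom M n) : ccls (ofl n (rep c)) = c. Proof. by rewrite ofl_tol crepK. Qed.
Lemma rep_size n (c : cohom M n) s : size s != n.+1 -> rep c s = 0.
Proof. by rewrite /rep /tol => /negPf ->. Qed.
Lemma rep_ofl n f : cocl n f -> cobl n (fun s => rep (ccls (ofl n f)) s - f s).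
Proof. by move=> fz; apply/ccls_ofl_eq => //; rewrite ?repK //; exact: rep_cocl. Qed.

End ListCohomology.
Arguments ofl {R F E i sc M} n f _.

Lemma eq_dl_size (G : Type) (M : zmodType) (f h : seq G -> M) n s : size s = n.+1 ->
  (forall u, size u = n -> f u = h u) -> dl f s = dl h s.
Proof. by move=> sn fh; apply: eq_dl => u; rewrite sn => -[un]; exact: fh. Qed.

(** * Cup products *)

Section Cup.
Context (R : pzRingType) (F E : fieldType) (i : {rmorphism F -> E}) (sc : separable_closure i).
Context (M1 M2 M3 : galmod R i) (m : M1 -> M2 -> M3).
Local Notation G := (gal_pgrp sc).
Hypothesis ml : forall y, linear (fun x => m x y).
Hypothesis mr : forall x, linear (m x).
Hypothesis me : forall (s : gal i) x y, m (gm_act s x) (gm_act s y) = gm_act s (m x y).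

Definition cupl p (f : seq G -> M1) (h : seq G -> M2) : seq G -> M3 :=
  fun s => m (f (take p.+1 s)) (h (drop p s)).

Lemma leibniz p f h s : (p < (size s).-1)%N ->
  dl (cupl p f h) s = m (dl f (take p.+2 s)) (h (drop p.+1 s)) +
                      (-1) ^+ p *: m (f (take p.+1 s)) (dl h (drop p s)).
Proof.
elim: p f s => [|p IH] f [|x s] //= ps; last first.
  case: s ps => [|y s] //= ps.
  have := IH (fun u => f (x :: u)) (y :: s) ps; rewrite /cupl /= => ->.
  by rewrite !(linB (ml _)) exprS mulN1r scaleNr; zmod.
case: s ps => [|y s] // _; rewrite /cupl /= !take0 expr0 scale1r subr0 (linB (ml _)) (linB (mr _)).
rewrite -(dl_morph (u := fun z => m (f [:: x]) z)); last by move=> a b; rewrite (linB (mr _)).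
by rewrite /= opprB !(linB (mr _)); zmod.
Qed.

Lemma cupl_smooth p q f h : smooth p.+1 f -> smooth q.+1 h -> smooth (p + q).+1 (cupl p f h).
Proof.
move=> [v fv] [w hw]; have [u uvw] := pg_dir v w; exists u => s s' sn ss'; rewrite /cupl.
have sub k : eqvs u (take k s) (take k s') /\ eqvs u (drop k s) (drop k s').
  elim: s s' k ss' {sn} => [|x s IH] [|y s'] k; [by case: k|by []|by []|].
  by case: k => [|k] [xy ss'] /=; [|have [h1 h2] := IH _ k ss'].
rewrite (fv (take p.+1 s) (take p.+1 s')) ?(hw (drop p s) (drop p s')) ?size_drop ?size_takel ?sn //; try lia.
  by apply: eqvs_sub (sub _).2 => x y /uvw[].
by apply: eqvs_sub (sub _).1 => x y /uvw[].
Qed.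

Lemma cupl_eqvt p q f h : eqvt p.+1 f -> eqvt q.+1 h -> eqvt (p + q).+1 (cupl p f h).
Proof.
move=> fe he x s sn; rewrite /cupl -map_take -map_drop fe ?he ?me //.
  by rewrite size_drop sn; lia.
by rewrite size_takel // sn; lia.
Qed.

Lemma cupl_cocl p q f h : cocl p f -> cocl q h -> cocl (p + q)%N (cupl p f h).
Proof.
move=> [fs fe fd] [hs he hd]; split; [exact: cupl_smooth|exact: cupl_eqvt|].
move=> s sn; rewrite leibniz ?sn /=; last by lia.
rewrite fd ?hd ?size_drop ?size_takel ?sn //; try lia.
by rewrite (linB (ml _)) (linB (mr _)) scaler0 addr0.
Qed.

Lemma cupl_congr p q f f' h h' : cocl p f -> cocl p f' -> cocl q h -> cocl q h' ->
  cobl p (fun s => f s - f' s) -> cobl q (fun s => h s - h' s) ->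
  cobl (p + q)%N (fun s => cupl p f h s - cupl p f' h' s).
Proof.
move=> [fs fe fd] [fs' fe' fd'] [hs he hd] [hs' he' hd'] [u [us ue u0 uE]] [w [ws we w0 wE]].
have act_add x (a b : M3) : gm_act x (a + b) = gm_act x a + gm_act x b by rewrite (linB (gm_act_linear x)).
have act_sc x c (a : M3) : gm_act x (c *: a) = c *: gm_act x a by rewrite (linB (gm_act_linear x)).
(* [A] is a primitive for the change of the first factor and [B], with the Leibniz sign, for that of
   the second. In degree 0 cohomologous cocycles are equal and the primitive is replaced by 0. *)
pose A s := if p is p'.+1 then cupl p' u h s else 0.
pose B s := if q is q'.+1 then (-1) ^+ p *: cupl p f' w s else 0.
have As : smooth (p + q)%N A.
  rewrite /A; case: (p) us => [|p'] us; first exact: smooth_cst.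
  exact: cupl_smooth.
have Bs : smooth (p + q)%N B.
  rewrite /B; case: (q) ws => [|q'] ws; first exact: smooth_cst.
  by rewrite addnS; apply: smooth_op1; exact: cupl_smooth.
have z x : gm_act x (0 : M3) = 0 by rewrite (linB (gm_act_linear x)).
exists (fun s => if s is [::] then 0 else A s + B s); split=> //.
- have [k kE] : smooth (p + q)%N (fun s => A s + B s) by exact: smooth_op2.
  by exists k => -[|x s] [|y s'] sn ss' //; apply: kE.
- move=> x [|y s] sn; first by rewrite z.
  rewrite [map _ _]/= -[pg_mul x y :: _]/(map (pg_mul x) (y :: s)) act_add; congr (_ + _).
    rewrite /A; case: (p) ue sn => [|p'] ue sn; first by rewrite z.
    by apply: (cupl_eqvt (q := q)).
  rewrite /B; case: (q) we sn => [|q'] we sn; first by rewrite z.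
  by rewrite act_sc (cupl_eqvt (q := q')) //; rewrite sn addnS.
move=> s sn.
have AE : dl A s = m (f (take p.+1 s) - f' (take p.+1 s)) (h (drop p s)).
  rewrite uE ?size_takel ?sn ?ltnS ?leq_addr //.
  rewrite /A; case: (p) ue u0 sn uE => [|p'] ue u0 sn uE.
    rewrite dl_zero //; case: (s) sn => [|x s'] //= _; rewrite take0 /= u0 subrr.
    by rewrite (linB (ml _)).
  rewrite leibniz ?sn /=; last by lia.
  rewrite hd ?size_drop ?sn; last by lia.
  by rewrite (linB (mr _)) scaler0 addr0.
have BE : dl B s = m (f' (take p.+1 s)) (h (drop p s) - h' (drop p s)).
  rewrite wE ?size_drop ?sn; last by lia.
  rewrite /B; case: (q) we w0 sn wE => [|q'] we w0 sn wE.
    rewrite dl_zero //; have := size_drop p s; rewrite sn.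
    have -> : ((p + 0).+1 - p = 1)%N by lia.
    by case: (drop p s) => [|x [|]] //= _; rewrite w0 subrr (linB (mr _)).
  rewrite -(dl_morph (u := fun x => (-1) ^+ p *: x)); last by move=> a b; rewrite scalerBr.
  rewrite leibniz ?sn /=; last by lia.
  rewrite fd' ?size_takel ?sn //; last by lia.
  by rewrite (linB (ml _)) add0r scalerA -exprD addnn -mul2n exprM sqrrN expr1n expr1n scale1r.
have -> : dl (fun s => if s is [::] then 0 else A s + B s) s = dl A s + dl B s.
  rewrite -dlD; apply: eq_dl => -[|x t] //; rewrite sn => -[pq].
  have [p0 q0] : p = 0%N /\ q = 0%N by lia.
  by rewrite /A /B p0 q0 addr0.
by rewrite AE BE ((linB (ml _)).1.1.1) ((linB (mr _)).1.1.1) /cupl addrA subrK.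
Qed.

Lemma cup_ofl p q (f : seq G -> M1) (h : seq G -> M2) : cocl p f -> cocl q h ->
  cup (p := p) (q := q) m (p + q)%N (ccls (ofl p f)) (ccls (ofl q h)) = ccls (ofl (p + q)%N (cupl p f h)).
Proof.
move=> fz hz; transitivity (ccls (ofl (p + q)%N (cupl p (rep (sc := sc) (ccls (ofl p f))) (rep (sc := sc) (ccls (ofl q h)))))).
  rewrite /cup; congr ccls; apply: funext => g; rewrite /ofl /cupl /rep; congr m.
    rewrite /tol size_takel ?size_lst ?ltnS ?leq_addr // eqxx; congr (crep _ _); apply: funext => k.
    have kq : (k < (p + q).+1)%N by rewrite (leq_trans (ltn_ord k)) // ltnS leq_addr.
    by rewrite /fnl nth_take // -[in RHS](inordK kq) nth_lst.
  rewrite /tol size_drop size_lst subSn ?leq_addr // addKn eqxx; congr (crep _ _); apply: funext => k.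
  have kq : (p + k < (p + q).+1)%N by rewrite ltnS leq_add2l -ltnS.
  by rewrite /fnl nth_drop -[in RHS](inordK kq) nth_lst.
apply/ccls_ofl_eq; [exact: (cupl_cocl (rep_cocl _ _) (rep_cocl _ _))|exact: cupl_cocl|].
by apply: cupl_congr => //; [exact: rep_cocl|exact: rep_cocl|exact: rep_ofl|exact: rep_ofl].
Qed.

End Cup.

Lemma aw_sum (G Q : Type) (pi : G -> Q) (M : zmodType) (Phi : seq Q -> seq G -> M) s :
  aw pi Phi s = \sum_(k < size s) Phi (map pi (take k.+1 s)) (drop k s).
Proof.
elim: s Phi => [|x s IH] Phi; first by rewrite big_ord0.
by rewrite big_ord_recl /= take0 IH.
Qed.

Lemma awh_sum (G Q : Type) (pi : G -> Q) (R : pzRingType) (M : lmodType R) (Phi : seq Q -> seq G -> M) t s :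
  t <> [::] -> awh pi Phi t s =
  \sum_(k < size s) (-1) ^+ (odd (size t) * k) *: Phi (map pi (take k.+1 s) ++ t) (drop k s).
Proof.
case: t => [//|y t] _; elim: s Phi => [|x s IH] Phi; first by rewrite big_ord0.
rewrite big_ord_recl /= take0 muln0 expr0 scale1r; congr (_ + _).
rewrite IH /sgn /= fun_if -sumrN; case: (odd (size t)) => /=.
  by rewrite -sumrN; apply: eq_bigr => k _; rewrite !mul0n expr0 !scale1r opprK.
by apply: eq_bigr => k _; rewrite !mul1n exprS mulN1r scaleNr.
Qed.

Lemma awh_nilt (G Q : Type) (pi : G -> Q) (M : zmodType) (Phi : seq Q -> seq G -> M) s : awh pi Phi [::] s = 0.
Proof. by case: s. Qed.

(** * The total complex *)

Section TotalComplex.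
Context (V : henselian_valuation_ring) (D : strict_data V) (N : nat).
Local Notation base := (sd_base D).
Context (M : galmod 'Z_N base).
Local Notation G := (gal_pgrp (sd_closure D)).
Local Notation Q := (gal_pgrp (kap_sc D)).
Local Notation pi := (@specialize V D : G -> Q).
Local Notation act := (fun s : G => @gm_act _ _ _ _ M s : M -> M).
Local Notation e1 := (gal1 base).
Local Notation e1k := (gal1 (sd_kap D)).
Local Notation totc := (@totl G Q pi M act).
Implicit Types Phi Psi : seq Q -> seq G -> M.


Lemma gactB (x : gal base) (m m' : M) : gm_act x (m - m') = gm_act x m - gm_act x m'.
Proof. exact: (linB (gm_act_linear x)).1.1.1. Qed.
Lemma gact0 (x : gal base) : gm_act x (0 : M) = 0.
Proof. by rewrite (linB (gm_act_linear x)). Qed.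
Lemma gact_sum (x : gal base) (I : Type) (r : seq I) (F : I -> M) :
  gm_act x (\sum_(k <- r) F k) = \sum_(k <- r) gm_act x (F k).
Proof. exact: lin_sum (gm_act_linear x). Qed.

Lemma eqvs_pi (v : seq (sdks D)) : exists u : seq (sdLs D), forall s s' : seq G,
  @eqvs G u s s' -> @eqvs Q v (map pi s) (map pi s').
Proof.
have [u uv] := spec_cont v; exists u; elim=> [|x s IH] [|y s'] //= [xy ss']; split; first exact: uv.
exact: IH.
Qed.

Lemma eqvs_take_drop (K : pgrp) (v : pg_lev K) (s s' : seq K) k : eqvs v s s' ->
  eqvs v (take k s) (take k s') /\ eqvs v (drop k s) (drop k s').
Proof.
elim: s s' k => [|x s IH] [|y s'] k; [by case: k|by []|by []|].
by case: k => [|k] [xy ss'] /=; [|have [h1 h2] := IH _ k ss'].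
Qed.

Lemma smooth_sum (I : Type) (r : seq I) n (F : I -> seq G -> M) : (forall k, smooth n (F k)) ->
  smooth n (fun s => \sum_(k <- r) F k s).
Proof.
move=> h; elim: r => [|k r IH].
  by apply: (@eq_smooth G M n (fun=> 0)) => [s _|]; [rewrite big_nil|exact: smooth_cst].
apply: (@eq_smooth G M n (fun s => F k s + \sum_(j <- r) F j s)) => [s _|]; first by rewrite big_cons.
exact: smooth_op2.
Qed.

Lemma jsmooth_sum (I : Type) (r : seq I) p q (F : I -> seq Q -> seq G -> M) : (forall k, jsmooth p q (F k)) ->
  jsmooth p q (fun t s => \sum_(k <- r) F k t s).
Proof.
move=> h; elim: r => [|k r IH].
  by apply: (@eq_jsmooth G Q M p q (fun _ _ => 0)) => [t s _ _|]; [rewrite big_nil|exact: jsmooth_cst].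
apply: (@eq_jsmooth G Q M p q (fun t s => F k t s + \sum_(j <- r) F j t s)) => [t s _ _|]; first by rewrite big_cons.
exact: jsmooth_op2.
Qed.

Lemma aw_term_smooth n k Phi : (forall p q, jsmooth p q Phi) -> (k < n)%N ->
  smooth n (fun s : seq G => Phi (map pi (take k.+1 s)) (drop k s)).
Proof.
move=> Ps kn; have [u [v uv]] := Ps k.+1 (n - k)%N; have [u' u'u] := eqvs_pi u.
have [w wuv] := @pg_dir G u' v; exists w => s s' sn ss'.
have [h1 _] := eqvs_take_drop k.+1 ss'; have [_ h2] := eqvs_take_drop k ss'.
apply: uv; rewrite ?size_map ?size_takel ?size_drop ?sn //.
  by apply: u'u; apply: eqvs_sub h1 => x y /wuv[].
by apply: eqvs_sub h2 => x y /wuv[].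
Qed.

Lemma aw_smooth n Phi : totc n.+1 Phi -> smooth n (aw pi Phi).
Proof.
move=> [_ Ps _]; apply: (@eq_smooth G M n (fun s => \sum_(k < n) Phi (map pi (take k.+1 s)) (drop k s))).
  by move=> s sn; rewrite aw_sum sn.
by apply: smooth_sum => k; exact: aw_term_smooth.
Qed.

Lemma aw_eqvt n m Phi : totc n Phi -> eqvt m (aw pi Phi).
Proof.
move=> [_ _ Pe] x s _; rewrite !aw_sum size_map gact_sum; apply: eq_bigr => k _.
rewrite -(Pe x) -map_take -map_drop -!map_comp; congr (Phi _ _).
by apply: eq_map => y; exact: specM.
Qed.

Lemma aw_cocl a Phi : totc a.+2 Phi -> (forall t s, t <> [::] -> s <> [::] -> dtot Phi t s = 0) ->
  cocl a (aw pi Phi).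
Proof.
move=> T d; have [n1 n2] := tot_nil T; split; [exact: aw_smooth|exact: aw_eqvt T|].
move=> s sn; rewrite dl_aw // n2 subr0 aw_sum big1 // => k _; apply: d.
  by move=> /(congr1 size); rewrite size_map size_takel.
by move=> /(congr1 size)/eqP; rewrite size_drop subn_eq0 leqNgt ltn_ord.
Qed.

Lemma awh_tot n Phi : (0 < n)%N -> totc n Phi -> totc n.-1 (awh pi Phi).
Proof.
move=> n0 [P Ps Pe]; split=> [t s h|p q|x t s].
- have [->|t0] := pselect (t = [::]); first exact: awh_nilt.
  rewrite awh_sum //; apply: big1 => k _; rewrite P ?scaler0 //; apply: contra h => /and3P[_ _ /eqP e].
  have ks := ltn_ord k; rewrite size_cat size_map size_takel // size_drop in e.
  have e2 : (size t + size s)%N = n.-1.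
    by rewrite -e !addSn /= [(k + _)%N]addnC -addnA subnKC // ltnW.
  apply/and3P; split; [exact/eqP| |exact/eqP].
  by apply: contraTneq (leq_ltn_trans (leq0n _) ks) => ->.
- case: p => [|p].
    by apply: (@eq_jsmooth G Q M 0 q (fun _ _ => 0)) => [[]// s _ _|]; [rewrite awh_nilt|exact: jsmooth_cst].
  apply: (@eq_jsmooth G Q M p.+1 q (fun t s => \sum_(k < q) (-1) ^+ (odd p.+1 * k) *: Phi (map pi (take k.+1 s) ++ t) (drop k s))).
    by move=> t s tp sq; rewrite awh_sum ?tp ?sq // => t0; rewrite t0 in tp.
  apply: jsmooth_sum => k; apply: jsmooth_op1.
  have [u [v uv]] := Ps (k.+1 + p.+1)%N (q - k)%N; have [u' u'u] := eqvs_pi u.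
  have [w wuv] := @pg_dir G u' v; exists u, w => t t' s s' tn sn tt' ss'.
  have [h1 _] := eqvs_take_drop k.+1 ss'; have [_ h2] := eqvs_take_drop k ss'.
  apply: uv; rewrite ?size_cat ?size_map ?size_takel ?size_drop ?sn ?tn //.
    by apply: eqvs_cat => //; apply: u'u; apply: eqvs_sub h1 => y z /wuv[].
  by apply: eqvs_sub h2 => y z /wuv[].
have [->|t0] := pselect (t = [::]); first by rewrite /= !awh_nilt gact0.
rewrite !awh_sum //; last by case: (t) t0.
rewrite !size_map gact_sum; apply: eq_bigr => k _; rewrite (linB (gm_act_linear x)); congr (_ *: _).
rewrite -(Pe x) map_cat -map_take -map_drop -!map_comp; congr (Phi (_ ++ _) _).
by apply: eq_map => y; exact: specM.
Qed.

Lemma awh_zero Phi t s : (forall t s, dtot Phi t s = 0) -> awh pi (dtot Phi) t s = 0.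
Proof.
move=> d; case: t => [|y t]; first exact: awh_nilt.
rewrite awh_sum //; apply: big1 => k _.
by rewrite d scaler0.
Qed.

Lemma dtot_full n Phi : totc n Phi -> (forall t s, t <> [::] -> s <> [::] -> dtot Phi t s = 0) ->
  forall t s, dtot Phi t s = 0.
Proof.
move=> T d t s; have [n1 n2] := tot_nil T.
case: t => [|y t].
  by rewrite /dtot /= add0r (eq_dl (h := fun=> 0)) ?dl_zero ?sgn0.
case: s => [|x s]; last exact: d.
by rewrite /dtot /= sgn0 addr0 n1 dl_zero ?subrr // => u _; rewrite n1.
Qed.

(** Degree [(p, j)] corresponds to lists of [p + 1] and [j + 1] entries; pairs with an empty list
    get the value 0, as [totl] demands. *)
Definition toB (Phi : bicochain M) : seq Q -> seq G -> M := fun t s =>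
  if (t != [::]) && (s != [::]) then Phi (size t).-1 (size s).-1 (fnl e1k (size t).-1.+1 t) (fnl e1 (size s).-1.+1 s) else 0.
Definition ofB Phi : bicochain M := fun p j t g => Phi (lst t) (lst g).
Arguments ofB Phi p j t g : clear implicits.
Local Notation totd Phi p j t g := (@tot_d V D N M Phi p j t g).

Lemma toBE (Phi : bicochain M) p j t s : size t = p.+1 -> size s = j.+1 -> toB Phi t s = Phi p j (fnl e1k p.+1 t) (fnl e1 j.+1 s).
Proof. by case: t => [//|y t] [<-]; case: s => [//|x s] [<-]. Qed.

Lemma toB_lst (Phi : bicochain M) p j (t : 'I_p.+1 -> gal (sd_kap D)) (g : 'I_j.+1 -> gal base) : toB Phi (lst t) (lst g) = Phi p j t g.
Proof. by rewrite (@toBE Phi p j) ?size_lst // !lstK. Qed.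

Lemma tot_d_ofB Phi p j t g : (forall t, Phi t [::] = 0) -> (forall s, Phi [::] s = 0) ->
  totd (ofB Phi) p j t g = dtot Phi (lst t) (lst g).
Proof.
move=> n1 n2; rewrite /tot_d /dtot size_lst; congr (_ + _).
  case: p t => [|p] t.
    by have := size_lst t; case: (lst t) => [|y [|]] //= _; rewrite n2 subrr.
  transitivity ((cobd (fun t' : 'I_p.+1 -> gal (sd_kap D) => ofB Phi p j t') t) g); first by [].
  have -> : cobd (ofB Phi p j) t g = cobd (fun t' : 'I_p.+1 -> gal (sd_kap D) => (Phi (lst t') (lst g) : M)) t.
    rewrite /cobd; have E (I : Type) (r : seq I) (F : I -> cochain M j) : (\sum_(k <- r) F k) g = \sum_(k <- r) F k g.
      by elim: r => [|k r IH]; rewrite ?big_nil // !big_cons -IH.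
    by rewrite E; apply: eq_bigr => k _.
  exact: (cobd_dl e1k (fun t' => Phi t' (lst g))).
have sg x : (-1) ^+ p *: x = sgn p.+1 x :> M.
  by rewrite /sgn /= -signr_odd; case: (odd p); rewrite ?expr1 ?expr0 ?scaleN1r ?scale1r.
case: j g => [|j] g.
  have := size_lst g; case: (lst g) => [|y [|]] //= _; rewrite n1 subrr sgn0.
  by [].
by rewrite -[LHS]/((-1) ^+ p *: (cobd (fun g' => (Phi (lst t) (lst g') : M)) g)) (cobd_dl e1) sg.
Qed.

Lemma tot_d_toB (Phi : bicochain M) t s : t <> [::] -> s <> [::] ->
  dtot (toB Phi) t s = totd Phi (size t).-1 (size s).-1 (fnl e1k (size t).-1.+1 t) (fnl e1 (size s).-1.+1 s).
Proof.
move=> t0 s0; have E : ofB (toB Phi) = Phi.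
  apply: functional_extensionality_dep => p; apply: functional_extensionality_dep => j.
  by apply: funext => u; apply: funext => g; exact: toB_lst.
rewrite -[in RHS]E tot_d_ofB; last by []; last by move=> u; rewrite /toB andbF.
by rewrite !fnlK //; [case: (s) s0|case: (t) t0].
Qed.

Lemma totB (K : forall j, cochain M j -> Prop) (n : int) (a : nat) (Phi : bicochain M) :
  (forall j f, K j f -> inert_cochain f) -> (forall p j : nat, (p + j)%:Z = n -> (p + j).+2 = a) ->
  tot K n Phi -> totc a (toB Phi).
Proof.
move=> KI na [Pd PK Pl Pe]; split=> [t s h|p q|x t s].
- rewrite /toB; case: ifP => // /andP[t0 s0]; rewrite Pd //; apply: contra h => /eqP/na e.
  rewrite t0 s0 /= -e; case: (t) t0 => // y t' _; case: (s) s0 => // z s' _ /=.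
  by rewrite addnS.
- case: p => [|p]; first by apply: (@eq_jsmooth G Q M 0 q (fun _ _ => 0)) => [[]//|]; exact: jsmooth_cst.
  case: q => [|q].
    by apply: (@eq_jsmooth G Q M p.+1 0 (fun _ _ => 0)) => [t []// _ _|]; [rewrite /toB andbF|exact: jsmooth_cst].
  have [u uE] := loc_const_smooth (kap_sc D) (Pl p q).
  have [L LE] := @eqvs_fin Q u p.+1.
  (* Local constancy in the second variable is given for each [t] separately; finitely many [t] at
     level [u] make it uniform. *)
  have [v vE] : exists v : seq (sdLs D), forall t, t \in L -> forall s s' : seq G, size s = q.+1 -> @eqvs G v s s' ->
      Phi p q (fnl e1k p.+1 t) (fnl e1 q.+1 s) = Phi p q (fnl e1k p.+1 t) (fnl e1 q.+1 s').
    elim: (L) => [|t L' [v vE]]; first by exists [::].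
    have [w wE] := loc_const_smooth (sd_closure D) (KI _ _ (PK p q (fnl e1k p.+1 t))).1.
    have [z zvw] := @pg_dir G v w; exists z => t' /predU1P[->|t'L] s s' sq ss'.
      by apply: wE => //; apply: eqvs_sub ss' => x y /zvw[].
    by apply: vE => //; apply: eqvs_sub ss' => x y /zvw[].
  exists u, v => t t' s s' tp sq tt' ss'.
  rewrite !(@toBE Phi p q) -?(eqvs_size tt') -?(eqvs_size ss') //.
  have [t1 t1L tt1] := LE t tp; rewrite -(uE t t') // (uE t t1) //; exact: vE.
- rewrite /toB; have -> : (map (pg_mul (pi x)) t != [::]) = (t != [::]) by case: (t).
  have -> : (map (pg_mul x) s != [::]) = (s != [::]) by case: (s).
  case: ifP => [/andP[t0 s0]|_]; last by rewrite gact0.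
  rewrite !size_map -Pe; congr (Phi _ _ _ _); apply: funext => k; rewrite /fnl.
  + by rewrite (nth_map e1k) //; apply: leq_trans (ltn_ord k) _; case: (t) t0.
  + by rewrite (nth_map e1) //; apply: leq_trans (ltn_ord k) _; case: (s) s0.
Qed.

Lemma ofB_tot (K : forall j, cochain M j -> Prop) (n : int) (a : nat) Phi :
  (forall p j : nat, (p + j).+2 = a -> (p + j)%:Z = n) -> totc a Phi ->
  (forall p j (t : 'I_p.+1 -> gal (sd_kap D)), K j (ofB Phi p j t)) ->
  tot K n (ofB Phi).
Proof.
move=> an [P Ps Pe] KP; split=> [p j t pj|//|p j|p j s t g].
- apply: funext => g; apply: P; rewrite !size_lst; apply: contra pj => /and3P[_ _ /eqP e].
  by apply/eqP/an; rewrite -e addnS.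
- have [u [v uv]] := Ps p.+1 j.+1.
  apply: (@smooth_loc_const _ _ _ (kap_sc D) _ p (fun t => (fun g : 'I_j.+1 -> gal base => Phi t (lst g)) : cochain M j)).
  exists u => t t' tp tt'; apply: funext => g; apply: uv => //; [exact: size_lst|exact: eqvs_refl].
- by rewrite /ofB -(Pe s) -!lst_map.
Qed.

Lemma ofB_inert a Phi p j (t : 'I_p.+1 -> gal (sd_kap D)) : totc a Phi -> inert_cochain (ofB Phi p j t).
Proof.
move=> [P Ps Pe]; split.
  have [u [v uv]] := Ps p.+1 j.+1; apply: (@smooth_loc_const _ _ _ (sd_closure D) _ j (Phi (lst t))).
  by exists v => s s' sj ss'; apply: uv => //; [exact: size_lst|exact: eqvs_refl].
move=> s g; rewrite /ofB; have si : pi (inertia_incl s) = e1k by apply/spec_ker; exists s.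
have := Pe (inertia_incl s) (lst t) (lst g); rewrite si => <-; congr (Phi _ _); last exact: lst_map.
by rewrite -[LHS]map_id; apply: eq_map => y; rewrite -[pg_mul _ _]/(galM _ _) gal1M.
Qed.

(** Applying [aw] to the equation between [augment z], [Phi] and the boundary of [Psi] gives back
    [z] on the left, so [z] and [aw Phi] differ by the coboundary of [aw Psi]. *)
Lemma FHS_aw a r c : c \in FHS (M := M) a r -> exists Phi, [/\ totc a.+2 Phi, truncl r.+1 Phi,
  forall t s, t <> [::] -> s <> [::] -> dtot Phi t s = 0 & c = ccls (ofl a (aw pi Phi))].
Proof.
move=> /asboolW[z [Phi [zz -> PT Pd [Psi QT QE]]]].
have PTl : totc a.+2 (toB Phi).
  by apply: (totB (K := trunc_cochain (M := M) r) (n := a)) PT => [j f []//|p j [->]].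
have QTl : totc a.+1 (toB Psi).
  apply: (totB (K := inert_cochain (M := M)) (n := a%:Z - 1)) QT => [//|p j e]; have : ((p + j).+1)%:Z = a%:Z by rewrite -addn1 PoszD e subrK.
  by move=> [->].
have cyc t s : t <> [::] -> s <> [::] -> dtot (toB Phi) t s = 0.
  by move=> t0 s0; rewrite tot_d_toB // Pd.
exists (toB Phi); split=> //.
  split=> [t s rs|t s sr].
    rewrite /toB; case: ifP => // /andP[t0 s0]; have [_ PK _ _] := PT.
    have [_ [h|[h _]|->//]] := PK (size t).-1 (size s).-1 (fnl e1k (size t).-1.+1 t).
      by move: rs h s0; case: (s) => //= x s' h1 h2; lia.
    by move: rs h s0; case: (s) => //= x s' h1 h2; lia.
  case: t => [|y t]; first by apply: dl_zero.
  have [_ PK _ _] := PT; pose f := Phi (size t) r (fnl e1k (size t).+1 (y :: t)).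
  have -> : dl (toB Phi (y :: t)) s = dl (fun s' => f (fnl e1 r.+1 s')) s.
    apply: (eq_dl_size sr) => s' s'r; exact: (@toBE Phi (size t) r).
  have fd : cobd f = 0.
    have [_ [h|[_ h]|h]] := PK (size t) r (fnl e1k (size t).+1 (y :: t)); first by rewrite ltnn in h.
      exact: h.
    rewrite /f h; have := cobd_linear (-1) 0 (0 : cochain M r).
    by rewrite scaler0 addr0 scaleN1r addNr.
  rewrite -(fnlK e1 sr) -(cobd_dl e1) -[RHS](congr1 (fun F => F (fnl e1 r.+2 s)) fd).
  by congr (cobd _ _); apply: funext => g; rewrite lstK.
have zc := @tol_cocl _ _ _ _ (sd_closure D) M _ _ zz.
have -> : ccls z = ccls (ofl a (@tol _ _ _ _ (sd_closure D) M _ z)) by rewrite ofl_tol.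
apply/ccls_ofl_eq => //; first exact: aw_cocl.
have [n1 n2] := tot_nil QTl.
exists (aw pi (toB Psi)); split=> //; [exact: aw_smooth|exact: aw_eqvt QTl|].
move=> s sa; have key t s' : t <> [::] -> s' <> [::] ->
    augl (@tol _ _ _ _ (sd_closure D) M _ z) t s' = toB Phi t s' + dtot (toB Psi) t s'.
  move=> t0 s0; have := QE (size t).-1 (size s').-1 (fnl e1k (size t).-1.+1 t) (fnl e1 (size s').-1.+1 s').
  rewrite tot_d_toB // [toB Phi t s']/toB; move/eqP: (t0) => ->; move/eqP: (s0) => -> /= <-.
  rewrite /augl /augment /tol; case: (t) t0 => // y [|//] _ /=; case: (s') s0 => // x s'' _ /=.
  rewrite eqSS; case: eqP => [e|//]; congr z; apply: funext => k; rewrite /fnl.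
  by rewrite inordK // e; exact: ltn_ord.
have awE : aw pi (augl (@tol _ _ _ _ (sd_closure D) M _ z)) s = aw pi (fun t s => toB Phi t s + dtot (toB Psi) t s) s.
  by apply: eq_aw => t v t0 v0 _; exact: key.
rewrite aw_augl // awD in awE; rewrite awE addrC addKr dl_aw //.
by rewrite n2 subr0.
Qed.

(** With [Psi] equal to [- awh Phi], the homotopy formula [awhE] for a total cocycle reads: the
    augmentation of [aw Phi] is [Phi] plus the total boundary of [Psi]. *)
Lemma aw_FHS a r Phi : totc a.+2 Phi -> truncl r.+1 Phi ->
  (forall t s, t <> [::] -> s <> [::] -> dtot Phi t s = 0) -> ccls (ofl a (aw pi Phi)) \in FHS (M := M) a r.
Proof.
move=> T [tr1 tr2] d; have [n1 n2] := tot_nil T; have dz := dtot_full T d.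
have Tn : totc a.+1 (fun t s => - awh pi Phi t s).
  have [h1 h2 h3] := awh_tot (ltn0Sn _) T; split=> [t s ts|p q|x t s]; first by rewrite h1 ?oppr0.
    by apply: jsmooth_op1.
  by rewrite h3 -!scaleN1r (linB (gm_act_linear x)).
apply: asboolT; exists (ofl a (aw pi Phi)), (ofB Phi); split.
- exact/cocl_cocycle/aw_cocl.
- by [].
- apply: (ofB_tot (a := a.+2) _ T) => [p j [->]//|p j t]; split; first exact: ofB_inert T.
  have [jr|rj] := ltnP j r; first by constructor 1.
  have [jr|rj'] := eqVneq j r; last first.
    constructor 3; apply: funext => g; apply: tr1; rewrite size_lst ltnS.
    by rewrite ltn_neqAle eq_sym rj'.
  constructor 2; split=> //; apply: funext => g; rewrite [LHS](cobd_dl e1 (Phi (lst t))) tr2 // size_lst jr.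
  by [].
- by move=> p j t g; rewrite tot_d_ofB // dz.
exists (ofB (fun t s => - awh pi Phi t s)).
  apply: (ofB_tot (a := a.+1) _ Tn) => [p j e|p j t]; last exact: ofB_inert Tn.
  by move: e => [<-]; rewrite intS addrC addKr.
have [m1 m2] := tot_nil Tn.
move=> p j t g; rewrite tot_d_ofB // dtotN.
have t0 : lst t <> [::] by move=> /(congr1 size); rewrite size_lst.
have := awhE pi (Phi := Phi) (t := lst t) (lst g) t0 n1; rewrite awh_zero // addr0 => ->.
rewrite opprB addrC subrK /augment /augl size_lst eqSS; case: (p == 0%N) => //=.
case: eqP => [e|ja]; last first.
  rewrite aw_sum big1 // => k _; have [P _ _] := T; apply: P; have kj := ltn_ord k.
  have kj' : (k < j.+1)%N := leq_trans kj (eq_leq (size_lst g)).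
  move: (nat_of_ord k) kj kj' => k' kj kj'.
  rewrite size_map size_takel // size_drop size_lst.
  by apply/negP => /and3P[_ _ /eqP]; lia.
move: g; rewrite e => g; rewrite /ofl; congr aw; congr lst; apply: funext => k.
by rewrite inord_val.
Qed.

End TotalComplex.

(** * Cocycles of a frame *)

Section RootsOfUnity.
Context (V : henselian_valuation_ring) (D : strict_data V).
Context (l : nat) (l_pr : prime l) (lW : (l%:R : hvW V) \is a GRing.unit) (nu : nat) (nu0 : (0 < nu)%N).
Local Notation N := (l ^ nu)%N.
Local Notation base := (sd_base D).
Local Notation GL := (gal base).
Local Notation muL := (mumod N base).
Local Notation muk := (mumod N (sd_kap D)).
Local Notation lift := (@mu_lift V D N).
Local Notation red := (@mu_red V D N).

Lemma mu_valZ (E : fieldType) (c : 'Z_N) (x : mu N E) : c *: x = x *+ c. Proof. by []. Qed.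

Lemma mu_expN (E : fieldType) (x : mu N E) : val x ^+ N = 1.
Proof. by rewrite -[X in _ ^+ X](card_ZN l_pr nu0) muP. Qed.

Lemma mu_gen_ex (E : fieldType) (g : mu N E) (x : mu N E) : N.-primitive_root (val g) -> exists k : nat, x = g *+ k.
Proof.
by move=> gp; have [k e] := prim_rootP gp (mu_expN x); exists k; apply: val_inj; rewrite mu_valMn.
Qed.

Lemma mu_gen_eq (E : fieldType) (g : mu N E) i j : N.-primitive_root (val g) ->
  g *+ i = g *+ j <-> i = j %[mod N].
Proof.
move=> gp; split=> [/(congr1 val)|e].
  by rewrite !mu_valMn => /eqP; rewrite (eq_prim_root_expr gp) => /eqP.
by apply: val_inj; rewrite !mu_valMn; apply/eqP; rewrite (eq_prim_root_expr gp); exact/eqP.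
Qed.

Lemma mu_rank1 (E : fieldType) (g : mu N E) : N.-primitive_root (val g) -> rank1 g.
Proof.
move=> gp; split=> [x|c].
  by have [k ->] := mu_gen_ex x gp; exists k%:R; rewrite scaler_nat.
have cN : (c < N)%N.
  by apply: leq_trans (ltn_ord c) _; rewrite -[X in (X <= _)%N]card_ord (card_ZN l_pr nu0).
rewrite mu_valZ -[0](mulr0n g) => /(mu_gen_eq _ _ gp); rewrite mod0n => h; apply: val_inj => /=.
by rewrite modn_small in h.
Qed.

Lemma mu_mk (E : fieldType) (z : E) : N.-primitive_root z -> exists g : mu N E, val g = z.
Proof.
move=> zp; have h : z ^+ #|'Z_N| == 1 by rewrite (card_ZN l_pr nu0) prim_expr_order.
by exists (Mu h).
Qed.

Definition compatible (g : mu N (sdLs D)) (g' : mu N (sdks D)) := exists2 z : sdW D,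
  sd_iota D z = val g & sd_res D z = val g'.

Lemma mu_gens : exists (g : mu N (sdLs D)) (g' : mu N (sdks D)),
  [/\ N.-primitive_root (val g), N.-primitive_root (val g') & compatible g g'].
Proof.
have [z [zp zp']] := wsh_prim D l_pr lW nu; have [g gE] := mu_mk zp; have [g' gE'] := mu_mk zp'.
by exists g, g'; split; [rewrite gE|rewrite gE'|exists z].
Qed.

Context (g : mu N (sdLs D)) (g' : mu N (sdks D)).
Hypotheses (gp : N.-primitive_root (val g)) (gp' : N.-primitive_root (val g')) (gg : compatible g g').

Lemma mu_reducesP x y : mu_reduces x y <-> exists k : nat, x = g *+ k /\ y = g' *+ k.
Proof.
have [z zg zg'] := gg; split=> [[u ux uy]|[k [-> ->]]]; last first.
  by exists (z ^+ k); rewrite mu_valMn -?zg -?zg' /= !rmorphXn.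
have [k xk] := mu_gen_ex x gp; exists k; split=> //; apply: val_inj; rewrite mu_valMn -zg' -uy -rmorphXn; congr (sd_res D _).
apply: (sd_incl_inj (s := D)); apply: (fmorph_inj (sd_sep D)); rewrite ux xk mu_valMn -zg /sd_iota /=.
by rewrite !rmorphXn.
Qed.

Lemma mu_liftE k : lift (g' *+ k) = g *+ k.
Proof.
have : mu_reduces (lift (g' *+ k)) (g' *+ k).
  by apply: (xgetPex 0 (P := [set x | mu_reduces x (g' *+ k)])); exists (g *+ k); apply/mu_reducesP; exists k.
move=> /mu_reducesP[j [-> /(mu_gen_eq _ _ gp') e]].
by apply/mu_gen_eq.
Qed.

Lemma mu_redE k : red (g *+ k) = g' *+ k.
Proof.
have : mu_reduces (g *+ k) (red (g *+ k)).
  by apply: (xgetPex 0 (P := [set y | mu_reduces (g *+ k) y])); exists (g' *+ k); apply/mu_reducesP; exists k.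
move=> /mu_reducesP[j [/(mu_gen_eq _ _ gp) e ->]].
by apply/mu_gen_eq.
Qed.

Lemma mu_liftK : cancel lift red.
Proof. by move=> y; have [k ->] := mu_gen_ex y gp'; rewrite mu_liftE mu_redE. Qed.
Lemma mu_redK : cancel red lift.
Proof. by move=> y; have [k ->] := mu_gen_ex y gp; rewrite mu_redE mu_liftE. Qed.

Lemma mu_lift_lin : linear lift.
Proof.
move=> c x y; have [i ->] := mu_gen_ex x gp'; have [j ->] := mu_gen_ex y gp'.
transitivity (lift (g' *+ (i * c + j))); first by congr lift; rewrite mulrnDr mulrnA.
by rewrite mu_liftE mulrnDr mulrnA -(mu_liftE i) -(mu_liftE j).
Qed.
Lemma mu_red_lin : linear red.
Proof.
move=> c x y; have [i ->] := mu_gen_ex x gp; have [j ->] := mu_gen_ex y gp.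
transitivity (red (g *+ (i * c + j))); first by congr red; rewrite mulrnDr mulrnA.
by rewrite mu_redE mulrnDr mulrnA -(mu_redE i) -(mu_redE j).
Qed.

Lemma mu_actMn (F E : fieldType) (i : {rmorphism F -> E}) (s : gal i) (x : mu N E) k : mu_act s (x *+ k) = mu_act s x *+ k.
Proof. by apply: val_inj; rewrite mu_valMn /= mu_valMn rmorphXn. Qed.

Lemma mu_lift_act (s : GL) y : mu_act s (lift y) = lift (mu_act (specialize s) y).
Proof.
have [k ->] := mu_gen_ex y gp'; have [j e] := mu_gen_ex (mu_act s g) gp; have [z zg zg'] := gg.
rewrite mu_liftE !mu_actMn e; have -> : mu_act (specialize s) g' = g' *+ j.
  apply: val_inj; rewrite mu_valMn /= -zg' -rmorphXn; apply: spec_res; rewrite zg.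
  have -> : sd_iota D (z ^+ j) = val g ^+ j by rewrite -zg; exact: rmorphXn.
  by have := congr1 val e; rewrite mu_valMn.
by rewrite -!mulrnA mu_liftE.
Qed.

Lemma mu_red_act (s : GL) y : red (mu_act s y) = mu_act (specialize s) (red y).
Proof. by apply: (can_inj mu_liftK); rewrite mu_redK -mu_lift_act mu_redK. Qed.

Lemma mu_actK (F E : fieldType) (i : {rmorphism F -> E}) (s : gal i) : cancel (@mu_act N _ _ _ s) (mu_act (galV s)).
Proof. by move=> x; apply: val_inj; exact: gal_funK. Qed.

Section Tate.
Context (F E : fieldType) (i : {rmorphism F -> E}).
Lemma tate_actM q (x y : gal i) (m : tate N i q) : gm_act (galM x y) m = gm_act x (gm_act y m).
Proof.
by apply: (twist_map_comp (q := q)); try exact: mu_act_linear; move=> u; apply: val_inj.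
Qed.
Lemma tate_act_id q (x : gal i) (m : tate N i q) : (forall u, mu_act x u = u :> mu N E) -> gm_act x m = m.
Proof. by move=> xu; apply: (twist_map_id (q := q)) => // u; rewrite -{1}(xu u) mu_actK. Qed.
End Tate.

Lemma inertia_tate q (s : GL) (m : tate N base q) : specialize s = gal1 _ -> gm_act s m = m.
Proof.
move=> s1; apply: tate_act_id => u; apply: val_inj => /=; apply: (unity_fix l_pr lW s1 (m := nu)).
exact: mu_expN.
Qed.

Lemma tate_smooth q : exists v : seq (sdLs D), forall (x : GL) (m : tate N base q),
  gal_lev_eqv v x (gal1 base) -> gm_act x m = m.
Proof.
exists [:: val g] => x m xg; apply: tate_act_id => u; have [k ->] := mu_gen_ex u gp.
rewrite mu_actMn; congr (_ *+ k); apply: val_inj => /=.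
by rewrite (xg _ (mem_head _ _) (gal1 base)).
Qed.

Definition tlift q : twist q muk -> twist q muL := @twist_map _ q _ _ lift red.

Lemma tlift_lin q : linear (@tlift q). Proof. exact: twist_map_linear mu_lift_lin mu_red_lin. Qed.
Lemma tlift_act q (s : GL) (m : tate N (sd_kap D) q) :
  gm_act s (tlift m : tate N base q) = tlift (gm_act (specialize s) m).
Proof.
rewrite -[RHS](twist_map_comp (h := fun y => lift (mu_act (specialize s) y)) (h' := fun x => mu_act (galV (specialize s)) (red x))) //;
  try exact: mu_act_linear; try exact: mu_lift_lin; try exact: mu_red_lin.
rewrite -[LHS](twist_map_comp (h := fun y => lift (mu_act (specialize s) y)) (h' := fun x => mu_act (galV (specialize s)) (red x))) //;
  try exact: mu_act_linear; try exact: mu_lift_lin; try exact: mu_red_lin.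
  by move=> y /=; rewrite mu_lift_act.
by move=> y /=; rewrite mu_red_act specV.
Qed.

Lemma tlift_bij q : bijective (@tlift q).
Proof.
exists (@twist_map _ q _ _ red lift) => t.
  rewrite /tlift -(twist_map_comp (h := id) (h' := id)) ?twist_map_id //; try exact: mu_lift_lin; try exact: mu_red_lin.
    by move=> u; rewrite /= mu_liftK.
  by move=> u; rewrite /= mu_liftK.
rewrite /tlift -(twist_map_comp (h := id) (h' := id)) ?twist_map_id //; try exact: mu_lift_lin; try exact: mu_red_lin.
  by move=> u; rewrite /= mu_redK.
by move=> u; rewrite /= mu_redK.
Qed.

(** Translates a coefficient of [w_J], an element of the twist by [q - n] over [ks], into the
    coefficient of the integer-valued product [wl] once each factor [mu_N] is trivialized by [g]. *)
Definition pairing_map q n (c : twist (q - n%:Z) muk) : twist q muL := twist_pair (tlift c) (tgen n (g : muL)).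

Lemma pairing_map_lin q n : linear (@pairing_map q n).
Proof. by move=> c x y; rewrite /pairing_map tlift_lin twist_pair_lin1. Qed.

Lemma pairing_map_bij q n : bijective (@pairing_map q n).
Proof.
apply: (@bij_comp _ _ _ (fun t : twist (q - n%:Z) muL => twist_pair t (tgen n (g : muL)))) (tlift_bij _).
exact: twist_pair_bij (mu_rank1 gp).
Qed.

Lemma tpow_torsion q (x : tate N base q) : x *+ N = 0.
Proof.
rewrite -scaler_nat; have -> : (N%:R : 'Z_N) = 0; last exact: scale0r.
by apply: val_inj; rewrite /= Zp_nat; have := lX_gt1 l_pr nu0; case: (N) => [|[|n]] // _; exact: modnn.
Qed.

End RootsOfUnity.

Section FrameCocycles.
Context (V : henselian_valuation_ring) (D : strict_data V).
Context (l : nat) (l_pr : prime l) (lW : (l%:R : hvW V) \is a GRing.unit) (nu : nat) (nu0 : (0 < nu)%N).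
Local Notation N := (l ^ nu)%N.
Local Notation base := (sd_base D).
Local Notation GL := (gal base).
Local Notation GI := (gal (sd_sep D)).
Local Notation muL := (mumod N base).
Local Notation muI := (mumod N (sd_sep D)).
Local Notation G := (gal_pgrp (sd_closure D)).
Local Notation GIp := (gal_pgrp (sep_closure D)).
Local Notation e1 := (gal1 base).
Local Notation inI := (fun s : GL => specialize s = gal1 (sd_kap D)).
Context (g : mu N (sdLs D)) (gp : N.-primitive_root (val g)).
Context (fr : frame D N).
Local Notation B := (fr_B fr).

Definition fw (b : B) : seq G -> muL := rep (sc := sd_closure D) (fr_w b).
Definition fwY (b : B) (s : GL) : nat := proj1_sig (cid (mu_gen_ex l_pr nu0 (fw b [:: e1; s]) gp)).

Lemma fwYE b s : fw b [:: e1; s] = g *+ fwY b s.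
Proof. by rewrite /fwY; case: cid. Qed.

Lemma fw_cocl b : cocl 1 (fw b). Proof. exact: rep_cocl. Qed.

Lemma fw_chain b (x y z : GL) : fw b [:: x; z] = fw b [:: x; y] + fw b [:: y; z].
Proof.
have [_ _ /(_ [:: x; y; z] erefl)] := fw_cocl b.
by rewrite /= !subr0 => /eqP; rewrite subr_eq0 eq_sym subr_eq addrC => /eqP.
Qed.

Lemma fw_pair b (x y : GL) : fw b [:: x; y] = g *+ fwY b y - g *+ fwY b x.
Proof. by rewrite -!fwYE (fw_chain b e1 x y) addrC addKr. Qed.

Lemma mu_act_inertia (s : GL) (u : mu N (sdLs D)) : inI s -> mu_act s u = u.
Proof. by move=> s1; apply: val_inj => /=; apply: (unity_fix l_pr lW s1 (m := nu)); exact: mu_expN. Qed.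

(** Additivity needs the left factor in inertia, which acts trivially on [mu_N]; on all of [G_L] the
    exponents are only a crossed homomorphism. *)
Lemma fwY_M b (i s : GL) : inI i -> fwY b (galM i s) = fwY b i + fwY b s %[mod N].
Proof.
move=> iI; apply/(mu_gen_eq _ _ gp); rewrite mulrnDr -!fwYE (fw_chain b e1 i); congr (_ + _).
have [_ fe _] := fw_cocl b.
have e : fw b [:: galM i e1; galM i s] = mu_act i (fw b [:: e1; s]) := fe i [:: e1; s] erefl.
have i1 : galM i e1 = i by exact: gal_ext.
by rewrite i1 in e; rewrite e mu_act_inertia.
Qed.

Lemma fwY_smooth b : exists v : seq (sdLs D), forall x y : GL, gal_lev_eqv v x y -> fwY b x = fwY b y %[mod N].
Proof.
have [[v vE] _ _] := fw_cocl b; exists v => x y xy; apply/(mu_gen_eq _ _ gp); rewrite -!fwYE.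
by apply: vE => //; split=> //; exact: (@pg_refl G v).
Qed.

Lemma restriction_rep (w : cohom muL 1) : restriction1 w = ccls (ofl (sc := sep_closure D) (M := muI) 1
  (fun s : seq GIp => rep (sc := sd_closure D) w (map (@inertia_incl V D) s))).
Proof.
rewrite /restriction1 /pullback; congr ccls; apply: funext => u; rewrite /ofl -lst_map.
by rewrite /rep tolE.
Qed.

Lemma restriction_cocl (w : cohom muL 1) : cocl (sc := sep_closure D) (M := muI) 1
  (fun s : seq GIp => rep (sc := sd_closure D) w (map (@inertia_incl V D) s)).
Proof.
have [[v vE] fe fd] := rep_cocl (sd_closure D) w; split.
- exists (flatten [seq orb base z | z <- v]) => s s' s2 ss'; apply: vE; first by rewrite size_map.
  elim: s s' {s2} ss' => [|x s IH] [|y s'] //= [xy ss']; split; last exact: IH.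
  move=> z zv u; apply: (xy (u z) _ (gal1 _)).
  by apply/flattenP; exists (orb base z); [exact: map_f|exact: mem_orb (sd_closure D) u z].
- move=> x s s2; have := fe (inertia_incl x) (map (@inertia_incl V D) s); rewrite size_map => /(_ s2) e.
  have lE : map (@inertia_incl V D) (map (@pg_mul GIp x) s) = map (@pg_mul G (inertia_incl x)) (map (@inertia_incl V D) s).
    by rewrite -!map_comp; apply: eq_map => y; exact: gal_ext.
  by rewrite lE; apply: val_inj; exact: (congr1 val e).
- by move=> s s3; rewrite -dl_map fd // size_map.
Qed.

Lemma kummer_cochain (z : sdLur D) c : kummer (N := N) z c -> exists (y : sdLs D) (K : GI -> mu N (sdLs D)),
  [/\ y != 0, y ^+ N = sd_sep D z, forall s, val (K s) = s y / y &
    c = ccls (ofl (sc := sep_closure D) (M := muI) 1 (fun s : seq GIp => K (nth (gal1 _) s 1) - K (nth (gal1 _) s 0)))].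
Proof.
move=> [y [y0 yN [f fE ->]]]; rewrite (card_ZN l_pr nu0) in yN.
have Kx (s : GI) : (s y / y) ^+ #|'Z_N| == 1.
  by rewrite (card_ZN l_pr nu0) exprMn exprVn -rmorphXn yN gal_fix divff // -yN expf_neq0.
exists y, (fun s => Mu (Kx s)); split=> //; congr ccls; apply: funext => u; apply: val_inj.
rewrite fE /ofl; have E k : nth (gal1 (sd_sep D)) (lst u) (nat_of_ord (k : 'I_2)) = u k := nth_lst _ u k.
have := E (inord 0); have := E (inord 1); rewrite !inordK // => -> ->.
rewrite -[RHS]/((u (inord 1) y / y) / (u (inord 0) y / y)).
by rewrite invf_div mulrA mulfVK.
Qed.

Lemma kummer_cocl (y : sdLs D) (K : GI -> mu N (sdLs D)) : y != 0 -> (forall s, val (K s) = s y / y) ->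
  (forall s t : GI, K (galM s t) = K s + K t) ->
  cocl (sc := sep_closure D) (M := muI) 1 (fun s : seq GIp => K (nth (gal1 _) s 1) - K (nth (gal1 _) s 0)).
Proof.
move=> y0 KE KM; split.
- have E (x x' : GI) : gal_lev_eqv [:: y] x x' -> K x = K x'.
    by move=> h; apply: val_inj; rewrite !KE; have /= -> := h y (mem_head _ _) (gal1 _).
  exists [:: y] => s s' s2 ss'; have := eqvs_size ss'; move: s s' s2 ss'.
  move=> [|a [|b [|? ?]]] // [|a' [|b' [|? ?]]] // _ [ha [hb _]] _ /=.
  by rewrite (E _ _ ha) (E _ _ hb).
- move=> x [|a [|b [|]]] // _; rewrite -[nth _ _ 1]/(galM x b) -[nth _ _ 0]/(galM x a) !KM [K x + K b]addrC addrKA /=.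
  apply: val_inj; have := mu_act_inertia (s := inertia_incl x) (K b - K a).
  by move=> h; rewrite -[LHS](congr1 val (h _)) //; apply/spec_ker; exists x.
- move=> [|a [|b [|c [|]]]] // _ /=.
  by zmod.
Qed.

(** Inertia acts trivially on [mu_N], so the primitive [h] is constant and the two cohomologous
    cocycles coincide there. The elements [z] and [xx] differ by a unit of [Wsh], which is an [N]-th
    power, so they have the same character. *)
Lemma kummer_root (b : B) (xx : hvL V) (z : sdLur D) (u : sdW D) : xx != 0 -> u \is a GRing.unit ->
  z = sd_incl D u * sd_ur D xx -> kummer (N := N) z (restriction1 (fr_w b)) ->
  forall (i : GL) r, inI i -> r ^+ N = base xx -> i r = val g ^+ fwY b i * r.
Proof.
move=> xx0 uu zE /kummer_cochain[y [K [y0 yN KE Kc]]] i r iI rN.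
have [u' u'i] := (spec_ker i).1 iI; have r0 : r != 0.
  apply/eqP => r0; move: rN; rewrite r0 expr0n expn_eq0 -leqn0 leqNgt prime_gt0 //= => /esym/eqP.
  by rewrite !fmorph_eq0 (negPf xx0).
have KM (s t : GI) : K (galM s t) = K s + K t.
  apply: val_inj; rewrite -[RHS]/(val (K s) * val (K t)) !KE.
  have := congr1 val (mu_act_inertia (s := inertia_incl s) (K t) _); rewrite /= KE fmorph_div /= => <-.
    by rewrite [RHS]mulrC mulrA mulfVK ?fmorph_eq0.
  by apply/spec_ker; exists s.
have Y : fw b [:: e1; i] = K u'.
  rewrite restriction_rep in Kc; have [h [_ he _ hE]] := (ccls_ofl_eq (restriction_cocl _) (kummer_cocl y0 KE KM)).1 Kc.
  have hc (s : GI) : h [:: s] = h [:: gal1 (sd_sep D)].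
    have e : h [:: galM s (gal1 _)] = mu_act s (h [:: gal1 _]) := he s [:: gal1 (sd_sep D)] erefl.
    have s1 : galM s (gal1 (sd_sep D)) = s by exact: gal_ext.
    have si : specialize (inertia_incl s) = gal1 (sd_kap D) by apply/spec_ker; exists s.
    rewrite -{1}s1 e; apply: val_inj; exact: (congr1 val (mu_act_inertia (h [:: gal1 _]) si)).
  have /eqP := hE [:: gal1 _; u'] erefl; rewrite /= !subr0 (hc u') subrr subr_eq0.
  have -> : K (gal1 _) = 0 by apply: (addrI (K (gal1 _))); rewrite -KM addr0 gal1M.
  rewrite subr0 => /eqP <-; rewrite -u'i.
  have -> : e1 = inertia_incl (gal1 _) by exact: gal_ext.
  reflexivity.
have iy : i y = val g ^+ fwY b i * y.
  by rewrite -mu_valMn -fwYE Y KE mulfVK // -u'i.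
have [ru _] := sd_res_map D; have u0 : sd_res D u != 0 by have [_ ->] := sd_res_map D.
have [x xN] := ks_root l_pr lW nu u0; have [t [tN _]] := wsh_root l_pr lW u0 xN.
have tE : sd_iota D t ^+ N = (y / r) ^+ N.
  rewrite exprMn exprVn yN rN zE rmorphM -tN /sd_iota /= !rmorphXn mulfK //.
  by rewrite !fmorph_eq0.
have t0 : sd_iota D t != 0.
  have : (y / r) ^+ N != 0 by rewrite expf_neq0 // mulf_neq0 // invr_eq0.
  by rewrite -tE; apply: contraNneq => ->; rewrite expf_eq0 eqxx andbT expn_gt0 prime_gt0.
have yr : i (y / r) = y / r.
  have w1 : ((y / r) / sd_iota D t) ^+ N = 1 by rewrite [LHS]exprMn exprVn -tE divff ?expf_neq0.
  have := unity_fix l_pr lW iI w1; rewrite fmorph_div.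
  have -> : i (sd_iota D t) = sd_iota D t by exact: (inertia_fix _ iI).
  by move=> /(mulIf _) -> //; rewrite invr_eq0.
have -> : r = y / (y / r) by rewrite invf_div mulrCA mulfV // mulr1.
by rewrite fmorph_div yr iy mulrA.
Qed.

Lemma frame_roots : exists xb : B -> hvL V, [/\ forall b, xb b != 0, is_basis (fun b => modN_pi N (hv_val (xb b)))
  & forall b (i : GL) r, inI i -> r ^+ N = base (xb b) -> i r = val g ^+ fwY b i * r].
Proof.
have /choice[xb xbE] : forall b : B, exists x, [/\ x != 0, modN_pi N (hv_val x) = fr_e b &
    forall (i : GL) r, inI i -> r ^+ N = base x -> i r = val g ^+ fwY b i * r].
  move=> b; have [z [d [kz [u [x [uu x0 zE xd]]] be]]] := fr_restr b.
  by exists x; split; [|rewrite xd be|exact: (kummer_root x0 uu zE kz)].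
exists xb; split=> [b||b]; [by have [] := xbE b| |by have [] := xbE b].
have -> : (fun b => modN_pi N (hv_val (xb b))) = @fr_e _ _ _ fr; last exact: fr_basis.
by apply: funext => b; have [] := xbE b.
Qed.

Lemma inIV (i : GL) : inI i -> inI (galV i).
Proof. by move=> /= i1; rewrite specV i1; apply: gal_ext. Qed.

Section InertiaCohomology.
Context (q : int).
Local Notation M := (tate N base q).

Lemma frame_H_ex r (f : seq G -> M) : Ki (G := G) inI r.+1 f -> (forall s, size s = r.+2 -> dl f s = 0) ->
  exists S0 : seq B, forall T, uniq T -> {subset S0 <= T} -> exists (c : seq B -> M) (h : seq G -> M),
  Ki (G := G) inI r h /\ forall s, size s = r.+1 -> f s = \sum_(J <- subs T r) wl (c J) J (map (YV (G := G) fwY) s) + dl h s.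
Proof.
have [xb [xb0 xbas xY]] := frame_roots.
have co := coordinates_ex l_pr lW nu0 xb0 xbas gp fwY_M xY fwY_smooth.
have pl := prime_to_l l_pr lW nu0 xb0 xbas (D := D).
exact: (@inertia_H_ex G inI M B l nu fwY (fix_roots l xb) l_pr (tpow_torsion l_pr nu0 (q := q)) (@inIM V D) inIV co pl).
Qed.

Lemma frame_H_un T r (c : seq B -> M) (h : seq G -> M) : uniq T -> Ki (G := G) inI r h ->
  (forall s, size s = r.+1 -> \sum_(J <- subs T r) wl (c J) J (map (YV (G := G) fwY) s) = dl h s) ->
  {in subs T r, forall J, c J = 0}.
Proof.
have [xb [xb0 xbas xY]] := frame_roots.
have co := coordinates_ex l_pr lW nu0 xb0 xbas gp fwY_M xY fwY_smooth.
have pl := prime_to_l l_pr lW nu0 xb0 xbas (D := D).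
exact: (@inertia_H_un G inI M B l nu fwY (fix_roots l xb) l_pr (tpow_torsion l_pr nu0 (q := q)) (@inIM V D) inIV co pl).
Qed.

End InertiaCohomology.
End FrameCocycles.

(** * Direct sums and sorted subsets *)

Section DirectSums.
Context (R : pzRingType) (I : choiceType) (X : I -> lmodType R).

Lemma dsum_ext (f h : dsum X) : (forall i, dcoord f i = dcoord h i) -> f = h.
Proof. by move=> fh; apply: val_inj; exact: functional_extensionality_dep. Qed.

Lemma dsum_supp (f : dsum X) : exists2 s, uniq s & forall i, i \notin s -> dcoord f i = 0.
Proof.
have /asboolW/finite_seqP[s sE] := valP f; exists (undup s); first exact: undup_uniq.
move=> i; rewrite mem_undup => /negP si; apply: contrapT => /eqP fi; apply: si.
by have : [set i | (val f : dprod X) i != 0]%classic i by []; rewrite sE.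
Qed.

Definition dmk (c : forall i, X i) : dsum X := insubd (0 : dsum X) (c : dprod X).

Lemma dmkE (c : forall i, X i) (s : seq I) i : (forall j, j \notin s -> c j = 0) -> dcoord (dmk c) i = c i.
Proof.
move=> cs; rewrite /dcoord insubdK //; apply: asboolT; apply: (sub_finite_set _ (finite_seq s)) => j /=.
by apply: contraNT => /cs ->.
Qed.

Lemma dcoordP c (f h : dsum X) i : dcoord (c *: f + h) i = c *: dcoord f i + dcoord h i. Proof. by []. Qed.
Lemma dcoordB (f h : dsum X) i : dcoord (f - h) i = dcoord f i - dcoord h i. Proof. by []. Qed.
Lemma dcoord0 i : dcoord (0 : dsum X) i = 0. Proof. by []. Qed.

End DirectSums.

Lemma fsum_seq (I : choiceType) (M : zmodType) (s : seq I) (F : I -> M) : uniq s ->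
  (forall i, i \notin s -> F i = 0) -> \sum_(i \in [set: I]) F i = \sum_(i <- s) F i.
Proof.
move=> us Fs; rewrite (fsbigE s) //; first by apply: eq_bigl => i; rewrite in_setT.
by move=> i _; exact: Fs.
Qed.

Section Sublists.
Context (B : eqType).
Implicit Types (T J : seq B).

Lemma subs_subseq T r J : J \in subs T r -> subseq J T.
Proof.
elim: T r J => [|b T IH] [|r] J //=; try by rewrite inE => /eqP ->; rewrite ?sub0seq.
rewrite mem_cat => /orP[/mapP[J' /IH J'T ->]|/IH JT]; first by rewrite /= eqxx.
exact: subseq_trans JT (subseq_cons _ _).
Qed.

Lemma mem_subs T J : subseq J T -> J \in subs T (size J).
Proof.
elim: T J => [|b T IH] [|c J] //=; rewrite mem_cat; case: eqP => [->|_] /IH h.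
  by rewrite map_f.
by rewrite h orbT.
Qed.

Lemma subs_uniq T r : uniq T -> uniq (subs T r).
Proof.
elim: T r => [|b T IH] [|r] //= /andP[bT uT]; rewrite cat_uniq map_inj_uniq ?IH //; last by move=> x y [].
rewrite andbT; apply/hasPn => J /subs_subseq/mem_subseq JT; apply/negP => /mapP[J' _ JE].
by have := JT b; rewrite JE mem_head => /(_ isT); rewrite (negPf bT).
Qed.
End Sublists.

Section WLmorph.
Context (B : eqType) (M M' : zmodType).

Lemma wl_morph (u : M -> M') c (J : seq B) s : {morph u : x y / x - y} -> u (wl c J s) = wl (u c) J s.
Proof.
move=> uB; have u0 : u 0 = 0 by rewrite -{1}(subrr 0) uB subrr.
have uN x : u (- x) = - u x by rewrite -sub0r uB u0 sub0r.
have uM x k : u (x *+ k) = u x *+ k.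
  by elim: k => [|k IH]; rewrite ?mulr0n // !mulrS -{1}(opprK (x *+ k)) uB uN opprK IH.
elim: J s => [|b J IH] [|x [|y s]] //=; by rewrite uB !uM IH.
Qed.

(** [wl] consumes [J] from the front, while the cup products [wprod] append factors at the end; here
    the last difference moves into the coefficient. *)
Lemma wl_rcons (y0 : B -> nat) (c : M) (J : seq B) b s : size s = (size J).+2 ->
  wl c (rcons J b) s = wl (c *+ nth y0 s (size J).+1 b - c *+ nth y0 s (size J) b) J (take (size J).+1 s).
Proof.
elim: J s => [|b' J IH] [|x [|y s]] //=; first by case: s.
by move=> [sn]; rewrite IH //= sn.
Qed.
End WLmorph.

Section SortedSubsets.
Context (disp : Order.disp_t) (B : orderType disp).
Local Open Scope fset_scope.

Definition fsubset r : choiceType := {J : {fset B} | #|` J| == r}.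

Definition fsv r (J : fsubset r) : {fset B} := val J.

Lemma sort_fset_sorted (J : {fset B}) : sorted <%O (sort <=%O J).
Proof. by rewrite sort_lt_sorted fset_uniq. Qed.

Lemma sort_fsetK (l : seq B) : sorted <%O l -> sort <=%O [fset x in l] = l.
Proof. by move=> ls; apply: lt_sorted_eq => // [|x]; [exact: sort_fset_sorted|rewrite mem_sort !inE]. Qed.

Lemma fset_sortK (J : {fset B}) : [fset x in sort <=%O J] = J.
Proof. by apply/fsetP => x; rewrite !inE mem_sort. Qed.

(** Matches the sublists of the periodic computation with the finite sets that index [theta]. Taking
    [T] sorted makes each sublist the sorted list of its set. *)
Lemma fsubsets (S0 : seq B) r : exists2 T : seq B, uniq T /\ {subset S0 <= T} &
  exists S : seq (fsubset r), [/\ uniq S, [seq sort <=%O (fsv J) | J <- S] = subs T r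
    & forall J : fsubset r, {subset (fsv J) <= T} -> J \in S].
Proof.
pose T := sort <=%O (undup S0); have Ts : sorted <%O T by rewrite sort_lt_sorted undup_uniq.
have uT : uniq T by rewrite sort_uniq undup_uniq.
exists T; first by split=> // x; rewrite mem_sort mem_undup.
pose L := [seq [fset x in l] | l <- subs T r].
have subs_sorted l : l \in subs T r -> sorted <%O l by move=> /subs_subseq lT; exact: (subseq_sorted lt_trans lT).
have LE : [seq fsv J | J <- pmap (insub : {fset B} -> option (fsubset r)) L] = L.
  rewrite (pmap_filter (@insubK _ _ _)); apply/all_filterP/allP => K /mapP[l lT ->].
  rewrite isSome_insub; have [lr _] := subs_mem lT; have ls := subs_sorted _ lT.
  by rewrite -lr; apply/eqP; rewrite -[in RHS](sort_fsetK ls) size_sort.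
exists (pmap (insub : {fset B} -> option (fsubset r)) L).
have SE : [seq sort <=%O (fsv J) | J <- pmap (insub : {fset B} -> option (fsubset r)) L] = subs T r.
  rewrite (map_comp (fun J : {fset B} => sort <=%O J) (@fsv r)) LE -map_comp -[RHS]map_id; apply/eq_in_map => l lT /=.
  exact/sort_fsetK/subs_sorted.
split=> //; first by apply: (@map_uniq _ _ (fun J : fsubset r => sort <=%O (fsv J))); rewrite SE subs_uniq.
move=> J JT; have Jr : size (sort <=%O (fsv J)) = r by rewrite size_sort; exact/eqP/(valP J).
have JL : fsv J \in L.
  rewrite -(fset_sortK (fsv J)); apply: map_f.
  suff : subseq (sort <=%O (fsv J)) T by move=> /mem_subs; rewrite Jr.
  have -> : sort <=%O (fsv J) = [seq x <- T | x \in fsv J].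
    apply: lt_sorted_eq; [exact: sort_fset_sorted|exact: (subseq_sorted lt_trans (filter_subseq _ _))|].
    by move=> x; rewrite mem_sort mem_filter; case: (boolP (x \in _)) => // /JT ->.
  exact: filter_subseq.
by rewrite -LE in JL; move/mapP: JL => [K KS /val_inj ->].
Qed.

End SortedSubsets.

(** * The classes [w_J] as a basis over inertia *)

Section CupProductOfFrame.
Context (V : henselian_valuation_ring) (D : strict_data V).
Context (l : nat) (l_pr : prime l) (lW : (l%:R : hvW V) \is a GRing.unit) (nu : nat) (nu0 : (0 < nu)%N).
Local Notation N := (l ^ nu)%N.
Local Notation base := (sd_base D).
Local Notation GL := (gal base).
Local Notation muL := (mumod N base).
Local Notation muk := (mumod N (sd_kap D)).
Local Notation G := (gal_pgrp (sd_closure D)).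
Local Notation Q := (gal_pgrp (kap_sc D)).
Local Notation pi := (@specialize V D : G -> Q).
Context (g : mu N (sdLs D)) (g' : mu N (sdks D)).
Hypotheses (gp : N.-primitive_root (val g)) (gp' : N.-primitive_root (val g')) (gg : compatible g g').

Fixpoint wcup n : ('I_n -> cohom muL 1) -> seq G -> tpow n muL :=
  match n with
  | 0 => fun _ _ => (1 : 'Z_N)
  | m.+1 => fun w => @cupl _ _ _ _ (sd_closure D) (tate N base m%:Z) muL (tate N base m.+1%:Z) (@tens _ _ _) m
      (wcup (fun i => w (widen_ord (leqnSn m) i))) (rep (sc := sd_closure D) (w ord_max))
  end.

Lemma tens_equiv n (s : GL) (x : tate N base n%:Z) (y : muL) :
  tens (gm_act s x : tpow n muL) (gm_act s y) = gm_act s (tens (x : tpow n muL) y : tate N base n.+1%:Z).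
Proof. exact: (esym (tens_mapE _ _ (tpow_map_linear (mu_act_linear s)) (mu_act_linear s))). Qed.

Lemma wcup_cocl n (w : 'I_n -> cohom muL 1) : cocl (sc := sd_closure D) (M := tate N base n%:Z) n (wcup w).
Proof.
elim: n w => [|n IH] w.
  split=> [|//|s]; first exact: smooth_cst.
  by case: s => [|x [|y [|]]] //= _; rewrite subr0 subrr.
have h := @cupl_cocl _ _ _ _ (sd_closure D) (tate N base n%:Z) muL (tate N base n.+1%:Z) (@tens _ _ _)
  (@tens_linl _ _ _) (@tens_linr _ _ _) (@tens_equiv n) n 1 _ _ (IH (fun i => w (widen_ord (leqnSn n) i))) (rep_cocl _ (w ord_max)).
by rewrite addn1 in h.
Qed.

Lemma cup_oflE (M1 M2 M3 : galmod 'Z_N base) (m : M1 -> M2 -> M3) p q n (f : seq G -> M1) (h : seq G -> M2) :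
  (forall y, linear (fun x => m x y)) -> (forall x, linear (m x)) ->
  (forall (s : GL) x y, m (gm_act s x) (gm_act s y) = gm_act s (m x y)) -> (p + q)%N = n ->
  cocl p f -> cocl q h -> cup m n (ccls (ofl p f)) (ccls (ofl q h)) = ccls (ofl n (cupl m p f h)).
Proof. by move=> ml mr me <-; exact: cup_ofl. Qed.

Lemma wprodE n (w : 'I_n -> cohom muL 1) :
  wprod w = ccls (ofl (sc := sd_closure D) (M := tate N base n%:Z) n (wcup w)).
Proof.
elim: n w => [|n IH] w; first by [].
have e := @cup_oflE (tate N base n%:Z) muL (tate N base n.+1%:Z) (@tens _ _ _) n 1 n.+1
  (wcup (fun i => w (widen_ord (leqnSn n) i))) (rep (sc := sd_closure D) (w ord_max))
  (@tens_linl _ _ _) (@tens_linr _ _ _) (@tens_equiv n) (addn1 n) (wcup_cocl _) (rep_cocl _ _).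
by rewrite -IH repK in e; exact: e.
Qed.

Context (fr : frame D N).
Local Notation B := (fr_B fr).
Local Notation fwY := (@fwY V D l l_pr nu nu0 g gp fr).

Lemma tensB (n : nat) (x : tpow n muL) (y z : muL) : tens x (y - z) = tens x y - tens x z.
Proof. exact: (linB (tens_linr x)).1.1.1. Qed.

Lemma wcup_wl n (bs : 'I_n -> B) s : size s = n.+1 ->
  wcup (fun i => fr_w (bs i)) s = wl (tgen n (g : muL)) (lst bs) (map (YV (G := G) fwY) s).
Proof.
elim: n bs s => [|n IH] bs s sn.
  have -> : lst bs = [::] by apply: size0nil; rewrite size_lst.
  by case: s sn => [|x [|]].
have -> : lst bs = rcons (lst (fun i => bs (widen_ord (leqnSn n) i))) (bs ord_max).
  by rewrite /lst enum_ordSr map_rcons -map_comp.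
have sz := size_lst (fun i : 'I_n => bs (widen_ord (leqnSn n) i)).
rewrite (wl_rcons (YV (G := G) fwY (gal1 base))) ?sz ?size_map // -map_take.
rewrite !(nth_map (gal1 base)) ?sn // /cupl /= /cupl IH; last by rewrite size_takel // sn.
have [x [y dE]] : exists x y, drop n s = [:: x; y].
  have : size (drop n s) = 2%N by rewrite size_drop sn -addn2 addKn.
  by case: (drop n s) => [|x [|y [|]]] //; exists x, y.
have nE k : nth (gal1 base) s (n + k) = nth (gal1 base) [:: x; y] k by rewrite -nth_drop dE.
have := nE 0%N; have := nE 1%N; rewrite addn0 addn1 /= => -> ->.
rewrite dE -[rep _ _]/(fw (bs ord_max) [:: x; y]) (fw_pair l_pr nu0 gp).
rewrite (wl_morph (u := fun c => tens c (g *+ _ - g *+ _))); last first.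
  by move=> u v; exact: (linB (tens_linl _)).1.1.1.
congr wl; rewrite [LHS]tensB; congr (_ - _).
  by rewrite -[g *+ _]scaler_nat (linB (tens_linr _)) scaler_nat.
by rewrite -[g *+ _]scaler_nat (linB (tens_linr _)) scaler_nat.
Qed.

Context (q : int).
Local Notation M := (tate N base q).
Local Notation X J := (twist (q - #|` J|%:Z) muk).

Definition Wt (J : {fset B}) (x : X J) (s : seq G) : M :=
  twist_pair (tlift x) (wcup (fun i => fr_w (fset_nth (J := J) i)) s).

Lemma Wt_lin J s : linear (fun x : X J => Wt x s).
Proof. by move=> c x y; rewrite /Wt (tlift_lin l_pr nu0 gp gp' gg) twist_pair_lin1. Qed.

Lemma Wt_wl J (x : X J) s : size s = #|` J|.+1 ->
  Wt x s = wl (pairing_map g x : M) (sort <=%O J) (map (YV (G := G) fwY) s).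
Proof.
move=> sJ; rewrite /Wt wcup_wl // (wl_morph (u := fun t => twist_pair (tlift x) t)); last first.
  by move=> u v; exact: (linB (twist_pair_lin2 _)).1.1.1.
by congr wl; exact: map_tnth_enum.
Qed.

Lemma Wt_smooth J (x : X J) : smooth #|` J|.+1 (Wt x).
Proof. by have [h _ _] := wcup_cocl (fun i => fr_w (fset_nth (J := J) i)); exact: smooth_op1. Qed.

Lemma twist_pair_equiv n (s : GL) (x : tate N base (q - n%:Z)) (y : tate N base n%:Z) :
  twist_pair (gm_act s x : twist _ muL) (gm_act s y : tpow n muL) = gm_act s (twist_pair (x : twist _ muL) (y : tpow n muL) : M).
Proof. exact: (twist_pair_map (mu_act_linear s) (mu_act_linear (galV s)) (@mu_actK _ _ _ _ _ s)). Qed.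

Lemma Wt_equiv J (x : X J) (s : GL) u : size u = #|` J|.+1 ->
  Wt (gm_act (specialize s) (x : tate N (sd_kap D) _) : X J) (map (@pg_mul G s) u) = gm_act s (Wt x u).
Proof.
move=> uJ; have [_ h _] := wcup_cocl (fun i => fr_w (fset_nth (J := J) i)).
rewrite /Wt -(tlift_act l_pr nu0 gp gp' gg) -twist_pair_equiv; congr twist_pair.
exact: h.
Qed.

Lemma Wt_closed J (x : X J) s : size s = #|` J|.+2 -> dl (Wt x) s = 0.
Proof.
move=> sJ; have [_ _ h] := wcup_cocl (fun i => fr_w (fset_nth (J := J) i)).
rewrite -(dl_morph (u := fun t => twist_pair (tlift x) t)); last first.
  by move=> u v; exact: (linB (twist_pair_lin2 _)).1.1.1.
by rewrite h // (linB (twist_pair_lin2 _)).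
Qed.

(** The coefficient module of the Leray-Hirsch argument, that is, the cohomology of inertia in
    degree [r] with the action of [G_k] through the twists. *)
Definition Ar r : lmodType 'Z_N := dsum (fun J : fsubset B r => X (fsv J)).

Definition actAr r (y : Q) (a : Ar r) : Ar r :=
  dmk (fun J => gm_act (y : gal (sd_kap D)) (dcoord a J : tate N (sd_kap D) _)).

Lemma actArE r y (a : Ar r) J : dcoord (actAr y a) J = gm_act (y : gal (sd_kap D)) (dcoord a J : tate N (sd_kap D) _).
Proof.
have [s _ sE] := dsum_supp a; apply: (dmkE (s := s)) => K /sE ->.
by rewrite (linB (gm_act_linear y)).
Qed.

Definition Wr r (a : Ar r) (s : seq G) : M := \sum_(J \in [set: fsubset B r]) Wt (dcoord a J) s.

Lemma Wt0 J s : Wt (0 : X J) s = 0. Proof. by rewrite (linB (@Wt_lin J s)). Qed.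

Lemma WrE r (a : Ar r) S s : uniq S -> (forall J, J \notin S -> dcoord a J = 0) ->
  Wr a s = \sum_(J <- S) Wt (dcoord a J) s.
Proof. by move=> uS aS; apply: fsum_seq => // J /aS ->; rewrite Wt0. Qed.

Lemma dsum_supp2 r (a b : Ar r) : exists S, [/\ uniq S, forall J, J \notin S -> dcoord a J = 0
  & forall J, J \notin S -> dcoord b J = 0].
Proof.
have [s _ sE] := dsum_supp a; have [t _ tE] := dsum_supp b; exists (undup (s ++ t)); split.
- exact: undup_uniq.
- by move=> J; rewrite mem_undup mem_cat => /norP[/sE].
- by move=> J; rewrite mem_undup mem_cat => /norP[_ /tE].
Qed.

Lemma Wr_sub r (a b : Ar r) s : Wr (a - b) s = Wr a s - Wr b s.
Proof.
have [S [uS aS bS]] := dsum_supp2 a b; rewrite !(WrE _ uS) //; last by move=> J JS; rewrite dcoordB aS // bS // subrr.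
by rewrite -sumrB; apply: eq_bigr => J _; rewrite dcoordB (linB (@Wt_lin _ s)).
Qed.

Lemma card_fsv r (J : fsubset B r) : #|` fsv J| = r. Proof. exact/eqP/(valP J). Qed.

Lemma Wr_smooth r (a : Ar r) : smooth r.+1 (Wr a).
Proof.
have [S uS aS] := dsum_supp a.
apply: (@eq_smooth G M r.+1 (fun s => \sum_(J <- S) Wt (dcoord a J) s)) => [s _|]; first by rewrite (WrE _ uS).
by apply: smooth_sum => J; have := Wt_smooth (dcoord a J); rewrite card_fsv.
Qed.

Lemma Wr_equiv r (a : Ar r) (s : GL) u : size u = r.+1 ->
  Wr (actAr (specialize s) a) (map (@pg_mul G s) u) = gm_act s (Wr a u).
Proof.
move=> ur; have [S [uS aS bS]] := dsum_supp2 a (actAr (specialize s) a).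
rewrite !(WrE _ uS) // gact_sum; apply: eq_bigr => J _.
by rewrite actArE Wt_equiv // card_fsv.
Qed.

Lemma Wr_closed r (a : Ar r) s : size s = r.+2 -> dl (Wr a) s = 0.
Proof.
move=> sr; have [S uS aS] := dsum_supp a.
rewrite (eq_dl (h := fun s => \sum_(J <- S) Wt (dcoord a J) s)) => [|u _]; last by rewrite (WrE _ uS).
by rewrite dl_sum big1 // => J _; apply: Wt_closed; rewrite card_fsv.
Qed.

Lemma Wr_wl r (a : Ar r) S s : uniq S -> (forall J, J \notin S -> dcoord a J = 0) -> size s = r.+1 ->
  Wr a s = \sum_(J <- S) wl (pairing_map g (dcoord a J) : M) (sort <=%O (fsv J)) (map (YV (G := G) fwY) s).
Proof.
by move=> uS aS sr; rewrite (WrE _ uS) //; apply: eq_bigr => J _; rewrite Wt_wl // card_fsv.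
Qed.

Local Notation actM := (fun s : G => @gm_act _ _ _ _ M s : M -> M).
Local Notation Kcc := (@Kc G Q pi M actM).
Local Notation inI := (fun s : GL => specialize s = gal1 (sd_kap D)).

Lemma Kc_Ki n (f : seq G -> M) : Kcc n f <-> Ki (G := G) inI n f.
Proof.
split=> -[f1 f2 f3]; split=> // i s ii sn; rewrite f2 // (inertia_tate l_pr lW nu0) //.
Qed.

Lemma Wr_H_ex r (f : seq G -> M) : Kcc r.+1 f -> (forall s, size s = r.+2 -> dl f s = 0) ->
  exists c : Ar r, exists2 h, Kcc r h & forall s, size s = r.+1 -> f s = Wr c s + dl h s.
Proof.
move=> /Kc_Ki fK fd; have [S0 S0P] := frame_H_ex l_pr lW nu0 gp fr fK fd.
have [T [uT S0T] [S [uS SE _]]] := fsubsets S0 r; have [c [h [hK fE]]] := S0P T uT S0T.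
have pe (J : fsubset B r) : exists x : X (fsv J), pairing_map g x = c (sort <=%O (fsv J)).
  have [k _ kK] := pairing_map_bij l_pr nu0 gp gp' gg q #|` fsv J|; exists (k (c (sort <=%O (fsv J)))).
  exact: kK.
pose a : Ar r := dmk (fun J : fsubset B r => if J \in S then proj1_sig (cid (pe J)) else 0).
have aE J : dcoord a J = if J \in S then proj1_sig (cid (pe J)) else 0.
  by apply: (dmkE (s := S)) => K /negPf ->.
exists a, h; first exact/Kc_Ki.
move=> s sr; rewrite fE // (Wr_wl (S := S)) //; last by move=> J /negPf JS; rewrite aE JS.
congr (_ + _); rewrite -SE big_map big_seq [RHS]big_seq; apply: eq_bigr => J JS.
by rewrite aE JS; case: cid => x /= ->.
Qed.

Lemma Wr_H_un r (c : Ar r) h : Kcc r h -> (forall s, size s = r.+1 -> Wr c s = dl h s) -> c = 0.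
Proof.
move=> /Kc_Ki hK cE; have [S0 uS0 cS0] := dsum_supp c.
have [T [uT S0T] [S [uS SE Sin]]] := fsubsets (flatten [seq (fsv J : seq B) | J <- S0]) r.
have S0S J : J \in S0 -> J \in S.
  by move=> JS0; apply: Sin => b bJ; apply: S0T; apply/flattenP; exists (fsv J : seq B) => //; exact: map_f.
have cS J : J \notin S -> dcoord c J = 0 by move=> JS; apply: cS0; apply: contra JS; exact: S0S.
(* The uniqueness statement takes coefficients indexed by lists; [cc] transports those of [c] along
   sorting, which is injective on sets. *)
pose cc (k : seq B) : M := \sum_(J <- S | sort <=%O (fsv J) == k) pairing_map g (dcoord c J).
have sinj : {in S &, injective (fun J : fsubset B r => sort <=%O (fsv J))}.
  move=> J J' _ _ e; have e' : sort <=%O (fsv J) = sort <=%O (fsv J') := e.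
  by apply: val_inj; rewrite -[LHS]/(fsv J) -[RHS]/(fsv J') -(fset_sortK (fsv J)) e' fset_sortK.
have ccE J : J \in S -> cc (sort <=%O (fsv J)) = pairing_map g (dcoord c J).
  move=> JS; rewrite /cc -big_filter; have -> : [seq K <- S | sort <=%O (fsv K) == sort <=%O (fsv J)] = [:: J].
    rewrite (eq_in_filter (a2 := pred1 J)); last by move=> K KS; apply/eqP/eqP => [/sinj ->|->].
    by rewrite filter_pred1_uniq.
  by rewrite big_seq1.
have cc0 : {in subs T r, forall J, cc J = 0}.
  apply: (@frame_H_un V D l l_pr lW nu nu0 g gp fr q T r cc h uT hK) => s sr; rewrite -cE // (Wr_wl (S := S)) // -SE big_map.
  by rewrite big_seq [RHS]big_seq; apply: eq_bigr => J JS; rewrite ccE.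
apply: dsum_ext => J; rewrite dcoord0; have [JS|/cS//] := boolP (J \in S).
have [k kK _] := pairing_map_bij l_pr nu0 gp gp' gg q #|` fsv J|; apply: (can_inj kK).
have Jsub : sort <=%O (fsv J) \in subs T r.
  by rewrite -SE; exact: (map_f (fun J : fsubset B r => sort <=%O (fsv J)) JS).
rewrite -ccE // cc0 //.
by rewrite (linB (pairing_map_lin l_pr nu0 gp gp' gg (q := q) (n := _))).
Qed.

Lemma actAr_sub r y (a b : Ar r) : actAr y (a - b) = actAr y a - actAr y b.
Proof.
by apply: dsum_ext => J; rewrite dcoordB !actArE dcoordB (linB (gm_act_linear y)).
Qed.

End CupProductOfFrame.

(** * The isomorphism and the filtration *)

Section ThetaCochains.
Context (V : henselian_valuation_ring) (D : strict_data V).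
Context (l : nat) (l_pr : prime l) (lW : (l%:R : hvW V) \is a GRing.unit) (nu : nat) (nu0 : (0 < nu)%N).
Local Notation N := (l ^ nu)%N.
Local Notation base := (sd_base D).
Local Notation muL := (mumod N base).
Local Notation G := (gal_pgrp (sd_closure D)).
Local Notation Q := (gal_pgrp (kap_sc D)).
Local Notation pi := (@specialize V D : G -> Q).
Context (g : mu N (sdLs D)) (g' : mu N (sdks D)).
Hypotheses (gp : N.-primitive_root (val g)) (gp' : N.-primitive_root (val g')) (gg : compatible g g').

Section Inflation.
Context (q : int).
Local Notation Mk := (tate N (sd_kap D) q).
Local Notation ML := (tate N base q).

Lemma tliftB (x y : Mk) : tlift (x - y) = tlift x - tlift y :> ML.
Proof. exact: (linB (tlift_lin l_pr nu0 gp gp' gg (q := q))).1.1.1. Qed.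
Lemma tlift0 : tlift (0 : Mk) = 0 :> ML. Proof. by rewrite -(subrr (0 : Mk)) tliftB subrr. Qed.

Lemma pull_smooth (T : Type) n (f : seq Q -> T) : smooth n f -> smooth n (fun s : seq G => f (map pi s)).
Proof.
by move=> [v vE]; have [u uv] := eqvs_pi v; exists u => s s' sn ss'; apply: vE; [rewrite size_map|exact: uv].
Qed.

Lemma pull_eqvt n (f : seq Q -> Mk) : eqvt n f -> eqvt n (fun s : seq G => tlift (f (map pi s)) : ML).
Proof.
move=> fe x s sn; rewrite (tlift_act l_pr nu0 gp gp' gg); have := fe (pi x) (map pi s); rewrite size_map => /(_ sn) <-.
by rewrite -!map_comp; congr (tlift (f _)); apply: eq_map => y; exact: specM.
Qed.

Lemma pull_dl (f : seq Q -> Mk) s : dl (fun s : seq G => tlift (f (map pi s)) : ML) s = tlift (dl f (map pi s)).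
Proof. by rewrite (dl_morph (u := fun x : Mk => tlift x : ML)) ?dl_map //; exact: tliftB. Qed.

Lemma pull_cocl n (f : seq Q -> Mk) : cocl n f -> cocl n (fun s : seq G => tlift (f (map pi s)) : ML).
Proof.
move=> [fs fe fd]; split; [|exact: pull_eqvt|by move=> s sn; rewrite pull_dl fd ?size_map // tlift0].
by apply: (@pull_smooth _ n.+1 (fun t => tlift (f t) : ML)); exact: smooth_op1.
Qed.

Lemma inflation_ofl n (f : seq Q -> Mk) : cocl n f ->
  inflation (ccls (ofl n f)) = ccls (ofl (sc := sd_closure D) n (fun s => tlift (f (map pi s)) : ML)).
Proof.
move=> fz; set c := ccls _.
have -> : inflation c = ccls (ofl (sc := sd_closure D) n (fun s => tlift (rep (sc := kap_sc D) c (map pi s)) : ML)).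
  by congr ccls; apply: funext => u; rewrite /ofl -lst_map /rep tolE.
apply/ccls_ofl_eq; [exact/pull_cocl/rep_cocl|exact: pull_cocl|].
have [h [hs he h0 hE]] := rep_ofl fz; exists (fun s => tlift (h (map pi s)) : ML); split.
- by apply: (@pull_smooth _ n (fun t => tlift (h t) : ML)); exact: smooth_op1.
- exact: pull_eqvt.
- by rewrite h0 tlift0.
- by move=> s sn; rewrite -tliftB hE ?size_map // pull_dl.
Qed.

End Inflation.

Lemma ccls_ofl_sum (M : galmod 'Z_N base) n (I : Type) (S : seq I) (F : I -> seq G -> M) : (forall i, cocl n (F i)) ->
  cocl n (fun s => \sum_(i <- S) F i s) /\
  \sum_(i <- S) ccls (ofl n (F i)) = ccls (ofl n (fun s => \sum_(i <- S) F i s)).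
Proof.
move=> Fz; elim: S => [|i S [IHz IH]].
  have E : (fun s : seq G => \sum_(i <- [::]) F i s) = fun=> 0 by apply: funext => s; rewrite big_nil.
  by rewrite E big_nil ccls_ofl0; split=> //; exact: cocl_zero.
have E : (fun s => \sum_(j <- i :: S) F j s) = fun s => 1 *: F i s + \sum_(j <- S) F j s.
  by apply: funext => s; rewrite big_cons scale1r.
rewrite E big_cons IH; split; first exact: coclP.
by have e := ccls_oflP 1 (Fz i) IHz; rewrite e scale1r.
Qed.

Context (fr : frame D N) (q : int) (a : nat).
Local Notation B := (fr_B fr).
Local Notation M := (tate N base q).
Local Notation X J := (tate N (sd_kap D) (q - #|` J|%:Z)).
Local Notation Th := (theta_idx fr a).
Local Notation Wt := (@Wt V D l nu fr q).

Definition TJ (J : {fset B}) (f : seq Q -> X J) (t : seq Q) (s : seq G) : M :=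
  if size s == #|` J|.+1 then Wt (f t) s else 0.

(** [TJ f] lives in a single inertia degree, so one term of the Alexander-Whitney sum remains, the
    cup product with front face of degree [a - #|J|]. *)
Lemma aw_TJ (J : {fset B}) (f : seq Q -> X J) s : (#|` J| <= a)%N -> size s = a.+1 ->
  aw pi (TJ f) s = Wt (f (map pi (take (a - #|` J|).+1 s))) (drop (a - #|` J|) s).
Proof.
move=> Ja sa; rewrite aw_sum sa (bigD1 (inord (a - #|` J|))) //= inordK ?ltnS ?leq_subr // big1 ?addr0.
  by rewrite /TJ size_drop sa subSn ?leq_subr // subKn // eqxx.
move=> k /eqP kn; rewrite /TJ size_drop sa subSn -1?ltnS // eqSS; case: eqP => // e; case: kn.
by apply: val_inj; rewrite /= inordK ?ltnS ?leq_subr // -e subKn // -ltnS.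
Qed.

Lemma theta_term_ofl (J : Th) (f : seq Q -> X (val J)) : cocl (a - #|` val J|) f ->
  theta_term (ccls (ofl (a - #|` val J|) f)) = ccls (ofl a (aw pi (TJ f)) : cochain M a) /\ cocl a (aw pi (TJ f) : seq G -> M).
Proof.
move=> fz; have Ja := valP J.
have e := @cup_oflE V D l nu (tate N base (q - #|` val J|%:Z)) (tate N base #|` val J|%:Z) M
  (@twist_pair _ q #|` val J| muL) (a - #|` val J|) #|` val J| a _ _
  (@twist_pair_lin1 _ _ _ _) (@twist_pair_lin2 _ _ _ _) (@twist_pair_equiv V D l nu q _) (subnK Ja)
  (pull_cocl fz) (wcup_cocl (fun i => fr_w (fset_nth (J := val J) i))).
have z := @cupl_cocl _ _ _ _ (sd_closure D) (tate N base (q - #|` val J|%:Z)) (tate N base #|` val J|%:Z) M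
  (@twist_pair _ q #|` val J| muL) (@twist_pair_lin1 _ _ _ _) (@twist_pair_lin2 _ _ _ _) (@twist_pair_equiv V D l nu q _)
  _ _ _ _ (pull_cocl fz) (wcup_cocl (fun i => fr_w (fset_nth (J := val J) i))).
rewrite (subnK Ja) in z.
have E s : size s = a.+1 -> aw pi (TJ f) s = cupl (@twist_pair _ q #|` val J| muL : tate N base (q - #|` val J|%:Z) -> tate N base #|` val J|%:Z -> M) (a - #|` val J|)
    (fun s : seq G => tlift (f (map pi s))) (wcup (fun i => fr_w (fset_nth (J := val J) i))) s.
  by move=> sa; rewrite aw_TJ.
split; first by rewrite /theta_term inflation_ofl // /wJ wprodE e; congr ccls; apply: eq_ofl => s /E.
case: z => [zs ze zd]; split.
- by apply: eq_smooth zs => s /E.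
- by move=> x s sa; rewrite E ?size_map // E // ze.
- by move=> s sa; rewrite (eq_dl_size sa E) zd.
Qed.

Lemma theta_ofl (al : theta_dom fr q a) (f : forall J : {fset B}, seq Q -> X J) (S : seq Th) : uniq S ->
  (forall J : Th, cocl (a - #|` val J|) (f (val J))) ->
  (forall J : Th, dcoord al J = ccls (ofl (a - #|` val J|) (f (val J)))) ->
  (forall J : Th, J \notin S -> forall t, f (val J) t = 0) ->
  theta fr q a al = ccls (ofl a (aw pi (fun t s => \sum_(J <- map val S) TJ (f J) t s)) : cochain M a).
Proof.
move=> uS fz fal fS; rewrite /theta (fsum_seq (s := S)) //; last first.
  move=> J JS; rewrite fal; have [-> _] := theta_term_ofl (fz J).
  rewrite -[RHS](ccls_ofl0 (sd_closure D) M a); congr ccls; apply: eq_ofl => s sa.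
  by rewrite aw_TJ ?(valP J) // fS // (Wt0 l_pr nu0 gp gp' gg).
have [_ E] := ccls_ofl_sum S (fun J => (theta_term_ofl (fz J)).2).
have -> : \sum_(J <- S) theta_term (dcoord al J) = \sum_(J <- S) ccls (ofl a (aw pi (TJ (f (val J)))) : cochain M a).
  by apply: eq_bigr => J _; rewrite fal; have [-> _] := theta_term_ofl (fz J).
rewrite E; congr ccls; apply: eq_ofl => s sa; rewrite aw_sum.
under eq_bigr => J _ do rewrite aw_sum.
by rewrite exchange_big /=; apply: eq_bigr => k _; rewrite big_map.
Qed.

End ThetaCochains.

Section ThetaFiltration.
Context (V : henselian_valuation_ring) (D : strict_data V).
Context (l : nat) (l_pr : prime l) (lW : (l%:R : hvW V) \is a GRing.unit) (nu : nat) (nu0 : (0 < nu)%N).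
Local Notation N := (l ^ nu)%N.
Local Notation base := (sd_base D).
Local Notation G := (gal_pgrp (sd_closure D)).
Local Notation Q := (gal_pgrp (kap_sc D)).
Local Notation pi := (@specialize V D : G -> Q).
Context (g : mu N (sdLs D)) (g' : mu N (sdks D)).
Hypotheses (gp : N.-primitive_root (val g)) (gp' : N.-primitive_root (val g')) (gg : compatible g g').
Context (fr : frame D N) (q : int) (a : nat).
Local Notation B := (fr_B fr).
Local Notation M := (tate N base q).
Local Notation X J := (tate N (sd_kap D) (q - #|` J|%:Z)).
Local Notation Th := (theta_idx fr a).
Local Notation act := (fun s : G => @gm_act _ _ _ _ M s : M -> M).
Local Notation Ar := (@Ar V D l nu fr q).
Local Notation actAr := (@actAr V D l nu fr q).
Local Notation Wr := (@Wr V D l nu fr q).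
Local Notation cocAr := (@cocA G Q pi Ar actAr).
Local Notation cochAr := (@cochA G Q pi Ar actAr).
Local Notation totc := (@totl G Q pi M act).
Local Notation TTr := (@TT G Q M Ar Wr).
Local Notation TJr := (@TJ V D l nu fr q).
Implicit Types (f : forall J : {fset B}, seq Q -> X J) (S : seq {fset B}).

Lemma piM (x y : G) : pi (pg_mul x y) = pg_mul (pi x) (pi y). Proof. exact: specM. Qed.

Lemma Wsub r (x y : Ar r) s : Wr (x - y) s = Wr x s - Wr y s.
Proof. exact: (Wr_sub l_pr nu0 gp gp' gg (q := q)). Qed.
Lemma Wclosed r (x : Ar r) s : size s = r.+2 -> dl (Wr x) s = 0.
Proof. exact: (@Wr_closed V D l l_pr nu nu0 g g' gp gp' gg fr q r x s). Qed.

Lemma total_decomposition R n (Phi : seq Q -> seq G -> M) : (1 < n)%N -> totc n Phi -> truncl R Phi ->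
  (forall t s, t <> [::] -> s <> [::] -> dtot Phi t s = 0) ->
  exists F Psi, [/\ Tspan pi actAr Wr R n F, totc n.-1 Psi
    & forall t s, t <> [::] -> s <> [::] -> Phi t s = F t s + dtot Psi t s].
Proof.
exact: (@total_cocycle_decomposition G Q pi M act Ar actAr Wr piM (@spec_surj V D) (@spec_open V D)
  (@gactB V D N M) (@tate_actM _ _ _ _ base q) (tate_smooth l_pr nu0 gp q)
  (@actAr_sub V D l nu fr q) (Wr_sub l_pr nu0 gp gp' gg (q := q))
  (@Wr_smooth V D l l_pr nu nu0 g g' gp gp' gg fr q) (@Wr_equiv V D l l_pr nu nu0 g g' gp gp' gg fr q)
  (@Wr_closed V D l l_pr nu nu0 g g' gp gp' gg fr q)
  (@Wr_H_ex V D l l_pr lW nu nu0 g g' gp gp' gg fr q) (@Wr_H_un V D l l_pr lW nu nu0 g g' gp gp' gg fr q)).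
Qed.

Lemma components_trivial R n (Psi : seq Q -> seq G -> M) (alpha : forall r, seq Q -> Ar r) : (1 < n)%N ->
  totc n.-1 Psi -> truncl R Psi -> (forall r, (r < R)%N -> cocAr (n - r.+1)%N (alpha r)) ->
  (forall t s, t <> [::] -> s <> [::] -> \sum_(r < R) TTr (alpha r) t s = dtot Psi t s) ->
  forall r, (r < R)%N -> exists2 beta : seq Q -> Ar r, cochAr (n - r.+1).-1 beta &
    forall t, size t = (n - r.+1)%N -> alpha r t = dl beta t.
Proof.
exact: (@coboundary_components G Q pi M act Ar actAr Wr piM (@spec_surj V D) (@spec_open V D)
  (@gactB V D N M) (@tate_actM _ _ _ _ base q) (tate_smooth l_pr nu0 gp q)
  (@actAr_sub V D l nu fr q) (Wr_sub l_pr nu0 gp gp' gg (q := q))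
  (@Wr_smooth V D l l_pr nu nu0 g g' gp gp' gg fr q) (@Wr_equiv V D l l_pr nu nu0 g g' gp gp' gg fr q)
  (@Wr_closed V D l l_pr nu nu0 g g' gp gp' gg fr q)
  (@Wr_H_ex V D l l_pr lW nu nu0 g g' gp gp' gg fr q) (@Wr_H_un V D l l_pr lW nu nu0 g g' gp gp' gg fr q)).
Qed.

(** Regroups the cocycles [f J] by the cardinality of [J], the inertia degree. *)
Definition family f r (t : seq Q) : Ar r := dmk (fun J : fsubset B r => f (fsv J) t).

Definition finite_family R S f := [/\ uniq S, forall J, J \in S -> (#|` J| < R)%N,
  forall J, J \notin S -> forall t, f J t = 0 & forall J t, size t != (a - #|` J|).+1 -> f J t = 0].

Lemma familyE R S f r t (J : fsubset B r) : finite_family R S f -> dcoord (family f r t) J = f (fsv J) t.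
Proof.
move=> [_ _ fS _]; apply: (dmkE (s := pmap (insub : {fset B} -> option (fsubset B r)) S)) => K KS.
apply: fS; apply: contra KS => KS; rewrite mem_pmap; apply/mapP; exists (fsv K) => //.
by rewrite valK.
Qed.

Lemma sum_TT R S f t s : finite_family R S f -> \sum_(r < R) TTr (family f r) t s = \sum_(J <- S) TJr (f J) t s.
Proof.
move=> fam; have [uS SR fS fsz] := fam.
case: s => [|x s]; first by rewrite !big1.
have TTE r : TTr (family f r) t (x :: s) = if size s == r then \sum_(J <- S | #|` J| == r) Wt (f J t) (x :: s) else 0.
  rewrite /TT eqSS; case: eqP => // _.
  rewrite (WrE l_pr nu0 gp gp' gg (S := pmap (insub : {fset B} -> option (fsubset B r)) S)).
  - under eq_bigr => J _ do rewrite (familyE t J fam).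
    rewrite -(big_map (@fsv _ B r) xpredT (fun J => Wt (f J t) (x :: s))) (pmap_filter (@insubK _ _ _)) big_filter.
    by apply: eq_bigl => J; rewrite isSome_insub.
  - exact: pmap_sub_uniq.
  - move=> J JS; rewrite (familyE t J fam); apply: fS; apply: contra JS => JS; rewrite mem_pmap; apply/mapP.
    by exists (fsv J) => //; rewrite valK.
under eq_bigr => r _ do rewrite TTE.
have -> : \sum_(J <- S) TJr (f J) t (x :: s) = \sum_(J <- S | #|` J| == size s) Wt (f J t) (x :: s).
  by rewrite [RHS]big_mkcond; apply: eq_bigr => J _; rewrite /TJ /= eqSS eq_sym.
have [sR|Rs] := ltnP (size s) R; last first.
  rewrite big1 => [|r _]; last first.
    by case: (size s =P nat_of_ord r) => // sr; have := ltn_ord r; rewrite -sr ltnNge Rs.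
  by rewrite big_seq_cond big1 // => J /andP[/SR JR /eqP e]; rewrite -e leqNgt JR in Rs.
rewrite (bigD1 (Ordinal sR)) //= eqxx [Z in _ + Z]big1 ?addr0 //.
by move=> r /eqP rs; case: (size s =P nat_of_ord r) => // e; case: rs; exact: val_inj.
Qed.

Lemma family_smooth R S f r : finite_family R S f -> (forall J, (#|` J| <= a)%N -> cocl (a - #|` J|) (f J)) -> (r <= a)%N ->
  smooth (a - r).+1 (family f r).
Proof.
move=> fam fz ra; have [uS SR fS fsz] := fam.
have [u uE] : exists u : seq (sdks D), forall J, J \in S -> #|` J| = r -> forall t t', size t = (a - r).+1 ->
    @eqvs Q u t t' -> f J t = f J t'.
  elim: (S) => [|K S' [u uE]]; first by exists [::].
  have [Kr|Kr] := eqVneq #|` K| r; last first.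
    by exists u => J /predU1P[->|/uE//] e; rewrite e eqxx in Kr.
  have [[v vE] _ _] : cocl (a - #|` K|) (f K) by apply: fz; rewrite Kr.
  have [w wuv] := @pg_dir Q u v; exists w => J /predU1P[->|JS'] Jr t t' ta tt'.
    by apply: vE; [rewrite Kr|apply: eqvs_sub tt' => y z /wuv[]].
  by apply: uE => //; apply: eqvs_sub tt' => y z /wuv[].
exists u => t t' ta tt'; apply: dsum_ext => J; rewrite !(familyE _ _ fam).
have [JS|JS] := boolP (fsv J \in S); last by rewrite !fS.
by apply: uE => //; exact: card_fsv.
Qed.

Lemma family_cocA R S f r : finite_family R S f -> (forall J, (#|` J| <= a)%N -> cocl (a - #|` J|) (f J)) -> (r <= a)%N ->
  cocAr (a.+2 - r.+1)%N (family f r).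
Proof.
move=> fam fz ra; have [uS SR fS fsz] := fam; have aE : (a.+2 - r.+1)%N = (a - r).+1 by rewrite subSS subSn.
rewrite aE; split; first split.
- by move=> t ta; apply: dsum_ext => J; rewrite (familyE _ _ fam) fsz // card_fsv.
- exact: family_smooth fam fz ra.
- by apply: dsum_ext => J; rewrite (familyE _ _ fam) fsz.
- move=> x t; apply: dsum_ext => J; rewrite actArE !(familyE _ _ fam).
  have [ta|ta] := eqVneq (size t) (a - #|` fsv J|).+1; last first.
    by rewrite !fsz ?size_map // (linB (gm_act_linear _)).
  have Ja : (#|` fsv J| <= a)%N by rewrite card_fsv.
  by have [_ h _] := fz _ Ja; exact: h.
- move=> t ta; apply: dsum_ext => J; rewrite (dl_morph (u := fun b : Ar r => dcoord b J)) //.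
  rewrite (eq_dl (h := f (fsv J))) => [|u _]; last exact: familyE fam.
  have Ja : (#|` fsv J| <= a)%N by rewrite card_fsv.
  by have [_ _ h] := fz _ Ja; apply: h; rewrite card_fsv.
Qed.

Lemma TT_tot R (alpha : forall r, seq Q -> Ar r) : (forall r, (r < R)%N -> cocAr (a.+2 - r.+1)%N (alpha r)) ->
  totc a.+2 (fun t s => \sum_(r < R) TTr (alpha r) t s) /\
  forall t s, t <> [::] -> s <> [::] -> dtot (fun t s => \sum_(r < R) TTr (alpha r) t s) t s = 0.
Proof.
elim: R => [|R IH] az.
  have -> : (fun t s => \sum_(r < 0) TTr (alpha r) t s) = fun _ _ => 0.
    by apply: funext => t; apply: funext => s; rewrite big_ord0.
  split=> [|t s _ _]; first by apply: tot_zero; exact: (@gactB V D N M).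
  by rewrite /dtot !dl_zero // sgn0 addr0.
have [T d] := IH (fun r rR => az r (ltnW rR)).
have -> : (fun t s => \sum_(r < R.+1) TTr (alpha r) t s) = fun t s => \sum_(r < R) TTr (alpha r) t s + TTr (alpha R) t s.
  by apply: funext => t; apply: funext => s; rewrite big_ord_recr.
have [ch dc] := az R (ltnSn R).
have TR : totc a.+2 (TTr (alpha R)).
  apply: tot_TT_sub ch; do ?[exact: (@gactB V D N M)|exact: (Wr_sub l_pr nu0 gp gp' gg (q := q))
    |exact: (@Wr_smooth V D l l_pr nu nu0 g g' gp gp' gg fr q)|exact: (@Wr_equiv V D l l_pr nu nu0 g g' gp gp' gg fr q)].
split=> [|t s t0 s0]; first by apply: tot_add => //; exact: (@gactB V D N M).
rewrite dtotD d // add0r (dtot_TT Wsub Wclosed s ch t0) /TT; case: ifP => // _.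
have [ta|ta] := eqVneq (size t) (a.+2 - R.+1).+1; first by rewrite dc // (W0 Wsub).
by rewrite (dl_support ch) // (W0 Wsub).
Qed.

Lemma Tspan_family R n F : Tspan pi actAr Wr R n F -> exists alpha : forall r, seq Q -> Ar r,
  (forall r, (r < R)%N -> cocAr (n - r.+1)%N (alpha r)) /\ forall t s, F t s = \sum_(r < R) TTr (alpha r) t s.
Proof.
elim: R F => [|R IH] F /=.
  by move=> F0; exists (fun r _ => 0); split=> // t s; rewrite F0 big_ord0.
move=> [al [F' [az /IH[beta [bz bE]] FE]]].
(* The components have types depending on [r], so the new one is inserted by transport along
   [R = r]. *)
pose alpha r : seq Q -> Ar r :=
  match @eqP _ R r with ReflectT e => eq_rect R (fun r => seq Q -> Ar r) al r e | ReflectF _ => beta r end.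
have alR : alpha R = al by rewrite /alpha; case: eqP => // e; rewrite (eq_irrelevance e erefl).
have alN r : R <> r -> alpha r = beta r by rewrite /alpha; case: eqP.
exists alpha; split=> [r|t s].
  rewrite ltnS leq_eqVlt => /orP[/eqP ->|rR]; first by rewrite alR.
  by rewrite alN; [exact: bz|move=> e; rewrite e ltnn in rR].
rewrite big_ord_recr /= alR FE addrC bE; congr (_ + _); apply: eq_bigr => r _.
by rewrite alN // => e; have := ltn_ord r; rewrite -e ltnn.
Qed.

(** A smooth cochain takes finitely many values, and each value has finite support. *)
Lemma component_supp r P (al : seq Q -> Ar r) : cochAr P al ->
  exists S, forall t (J : fsubset B r), fsv J \notin S -> dcoord (al t) J = 0.
Proof.
move=> [a0 [u uE] _ _]; have [L LE] := @eqvs_fin Q u P.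
have /choice[sp spE] : forall t, exists s : seq (fsubset B r), forall J, J \notin s -> dcoord (al t) J = 0.
  by move=> t; have [s _ sE] := dsum_supp (al t); exists s.
exists (map (@fsv _ B r) (flatten (map sp L))) => t J JS.
have [tP|tP] := eqVneq (size t) P; last by rewrite a0.
have [t' t'L tt'] := LE t tP; rewrite (uE t t') //; apply: spE; apply: contra JS => JS.
by apply: map_f; apply/flattenP; exists (sp t') => //; exact: map_f.
Qed.

Definition cochain_family f := forall J, (#|` J| <= a)%N -> cocl (a - #|` J|) (f J).
Definition represents f (al : theta_dom fr q a) := forall J : Th, dcoord al J = ccls (ofl (a - #|` val J|) (f (val J))).

Lemma map_val_pmap R S f : finite_family R S f -> (R <= a.+1)%N ->
  map val (pmap (insub : {fset B} -> option Th) S) = S.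
Proof.
move=> [_ SR _ _] Ra; rewrite (pmap_filter (@insubK _ _ _)); apply/all_filterP/allP => J /SR JR.
by rewrite isSome_insub -ltnS (leq_trans JR).
Qed.

Lemma theta_family R S f al : finite_family R S f -> (R <= a.+1)%N -> cochain_family f -> represents f al ->
  theta fr q a al = ccls (ofl a (aw pi (fun t s => \sum_(r < R) TTr (family f r) t s)) : cochain M a).
Proof.
move=> fam Ra fz fal; have [uS SR fS fsz] := fam.
rewrite (theta_ofl l_pr nu0 gp gp' gg (f := f) (S := pmap (insub : {fset B} -> option Th) S)) //.
- rewrite (map_val_pmap fam Ra); congr ccls; apply: eq_ofl => s _; rewrite !aw_sum; apply: eq_bigr => k _.
  by rewrite (sum_TT _ _ fam).
- exact: pmap_sub_uniq.
- by move=> J; apply: fz; exact: (valP J).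
- move=> J JS t; apply: fS; apply: contra JS => JS; rewrite mem_pmap; apply/mapP; exists (val J) => //.
  by rewrite valK.
Qed.

(** A zero class is represented by the zero cocycle, not by the one that [rep] would choose, to keep
    the family finite. *)
Lemma rep_family r (al : theta_dom fr q a) : theta_dom_le fr q a r al -> (r <= a)%N ->
  exists f S, [/\ finite_family r.+1 S f, cochain_family f & represents f al].
Proof.
move=> alr ra; have [S0 uS0 S0E] := dsum_supp al.
pose f J : seq Q -> X J := match pselect (#|` J| <= a)%N with
  | left h => if dcoord al (exist _ J h : Th) == 0 then fun=> 0 else rep (sc := kap_sc D) (dcoord al (exist _ J h : Th))
  | right _ => fun=> 0 end.
have fE (J : Th) : f (val J) = if dcoord al J == 0 then fun=> 0 else rep (sc := kap_sc D) (dcoord al J).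
  by case: J => J h; rewrite /f /=; case: pselect => // h'; rewrite (bool_irrelevance h' h).
have fN J : ~~ (#|` J| <= a)%N -> f J = fun=> 0 by rewrite /f; case: pselect => // h; rewrite h.
have dS (J : Th) : dcoord al J != 0 -> val J \in map val [seq J <- S0 | dcoord al J != 0].
  move=> J0; apply: map_f; rewrite mem_filter J0 /=; apply: contraR J0 => /S0E ->.
  by rewrite eqxx.
exists f, (map val [seq J <- S0 | dcoord al J != 0]); split; first split.
- by rewrite map_inj_uniq ?filter_uniq //; exact: val_inj.
- move=> J1 /mapP[K]; rewrite mem_filter => /andP[K0 _] ->; rewrite ltnS leqNgt; apply: contra K0 => rK.
  by rewrite alr.
- move=> J JS t; have [Ja|/fN ->//] := boolP (#|` J| <= a)%N.
  rewrite -[J]/(val (exist _ J Ja : Th)) fE; case: eqP => // /eqP /dS JS'.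
  by rewrite JS' in JS.
- move=> J t ta; have [Ja|/fN ->//] := boolP (#|` J| <= a)%N.
  by rewrite -[J]/(val (exist _ J Ja : Th)) fE; case: eqP => // _; exact: rep_size.
- move=> J Ja; rewrite -[J]/(val (exist _ J Ja : Th)) fE; case: eqP => _; [exact: cocl_zero|exact: rep_cocl].
- by move=> J; rewrite fE; case: eqP => [->|_]; rewrite ?ccls_ofl0 ?repK.
Qed.

Lemma theta_FHS r (al : theta_dom fr q a) : (r <= a)%N -> theta_dom_le fr q a r al ->
  theta fr q a al \in FHS (M := M) a r.
Proof.
move=> ra /rep_family/(_ ra)[f [S [fam fz fal]]]; rewrite (theta_family fam _ fz fal) //.
have [T d] := TT_tot (fun r' (r'r : (r' < r.+1)%N) => family_cocA fam fz (leq_trans (r'r : (r' <= r)%N) ra)).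
apply: aw_FHS => //; split=> t s sr.
  rewrite big1 // => k _; rewrite /TT; case: eqP => // e; rewrite e ltnS in sr.
  by have := leq_trans (ltn_ord k) sr; rewrite ltnn.
rewrite (eq_dl (h := Wr (family f r t))); first exact: Wclosed.
move=> u; rewrite sr => -[ur]; rewrite big_ord_recr /= {2}/TT ur eqxx big1 ?add0r // => k _.
by rewrite /TT ur eqSS; case: eqP => // e; have := ltn_ord k; rewrite -e ltnn.
Qed.

(** The total cocycle behind [c] decomposes into products with [W] up to a boundary, which [aw]
    turns into a coboundary. The components of the coefficients are the cocycles whose classes make
    up [al]. *)
Lemma FHS_theta r (c : HL D N q a) : (r <= a)%N -> c \in FHS (M := M) a r ->
  exists2 al, theta_dom_le fr q a r al & theta fr q a al = c.
Proof.
move=> ra /FHS_aw[Phi [T tr d ->]].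
have [F [Psi [FS PsiT PhiE]]] := total_decomposition (n := a.+2) isT T tr d.
have [alpha [az FE]] := Tspan_family FS.
pose f J : seq Q -> X J := fun t => if (#|` J| <= r)%N then dcoord (alpha #|` J| t) (exist _ J (eqxx _) : fsubset B #|` J|) else 0.
have fE r' (J : fsubset B r') t : (r' <= r)%N -> f (fsv J) t = dcoord (alpha r' t) J.
  case: J => J p; have e := eqP p; move: p; rewrite -e => p Jr; rewrite /f /fsv /= Jr.
  by rewrite (bool_irrelevance p (eqxx _)).
have /choice[Sp SpE] : forall r', exists S, (r' <= r)%N -> forall t (J : fsubset B r'), fsv J \notin S -> dcoord (alpha r' t) J = 0.
  move=> r'; have [r'r|] := leqP r' r; last by exists [::].
  by have [ch _] := az r' r'r; have [S SE] := component_supp ch; exists S.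
pose S := [seq J <- undup (flatten [seq Sp r' | r' <- iota 0 r.+1]) | (#|` J| <= r)%N].
have aE J : (#|` J| <= r)%N -> (a.+2 - #|` J|.+1)%N = (a - #|` J|).+1.
  by move=> Jr; rewrite subSS subSn // (leq_trans Jr).
have fam : finite_family r.+1 S f.
  split=> [|J|J JS t|J t ta].
  - by rewrite filter_uniq ?undup_uniq.
  - by rewrite mem_filter => /andP[].
  - rewrite /f; case: ifP => // Jr; apply: (SpE #|` J| Jr t (exist _ J (eqxx _) : fsubset B #|` J|)); apply: contra JS => JS.
    rewrite mem_filter Jr mem_undup; apply/flattenP; exists (Sp #|` J|) => //.
    by apply: map_f; rewrite mem_iota.
  - rewrite /f; case: ifP => // Jr; have [[a0 _ _ _] _] := az #|` J| Jr.
    by rewrite a0 ?aE.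
have fz : cochain_family f.
  move=> J Ja; have [Jr|Jr] := boolP (#|` J| <= r)%N; last first.
    by have -> : f J = fun=> 0 by [apply: funext => t; rewrite /f (negPf Jr)]; exact: cocl_zero.
  have [[a0 as_ an ae] ad] := az #|` J| Jr; rewrite aE // in as_ ad.
  pose JJ : fsubset B #|` J| := exist _ J (eqxx _).
  have E : f J = fun t => dcoord (alpha #|` J| t) JJ by apply: funext => t; rewrite /f Jr.
  rewrite E; split.
  + exact: (smooth_op1 (fun b : Ar #|` J| => dcoord b JJ)).
  + move=> y t _; have [x <-] := spec_surj y.
    transitivity (dcoord (actAr (pi x) (alpha #|` J| t)) JJ); [by congr (dcoord _ JJ); exact: ae|exact: (@actArE V D l nu fr q #|` J| (pi x) (alpha #|` J| t) JJ)].
  + by move=> t ta; rewrite -(dl_morph (u := fun b : Ar #|` J| => dcoord b JJ)) // ad.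
pose al : theta_dom fr q a := dmk (fun J : Th => ccls (ofl (sc := kap_sc D) (a - #|` val J|) (f (val J)))).
have [_ _ fS _] := fam.
have f0 (J : Th) : (forall t, f (val J) t = 0) -> ccls (ofl (sc := kap_sc D) (a - #|` val J|) (f (val J))) = 0.
  move=> fJ; have -> : f (val J) = fun=> 0 by exact: funext.
  exact: ccls_ofl0.
have alE : represents f al.
  move=> J; apply: (dmkE (s := pmap (insub : {fset B} -> option Th) S)) => K KS; apply: f0; apply: fS.
  by apply: contra KS => KS; rewrite mem_pmap; apply/mapP; exists (val K) => //; rewrite valK.
exists al.
  move=> J rJ; rewrite alE; apply: f0; apply: fS; rewrite mem_filter.
  by rewrite leqNgt rJ.
rewrite (theta_family fam _ fz alE) //.
have FfE : (fun t s => \sum_(r' < r.+1) TTr (family f r') t s) = fun t s => \sum_(r' < r.+1) TTr (alpha r') t s.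
  apply: funext => t; apply: funext => s; apply: eq_bigr => k _; rewrite /TT; case: ifP => // _; congr (Wr _ s).
  by apply: dsum_ext => J; rewrite (familyE _ _ fam) fE // -ltnS.
have [FT Fd] := TT_tot az; rewrite FfE; apply/ccls_ofl_eq; [exact: aw_cocl|exact: aw_cocl|].
have PsiN : totc a.+1 (fun t s => 0 - Psi t s).
  by apply: tot_sub => //; [exact: (@gactB V D N M)|apply: tot_zero; exact: (@gactB V D N M)].
have [n1 n2] := tot_nil PsiN.
exists (aw pi (fun t s => 0 - Psi t s)); split=> //; [exact: aw_smooth|exact: aw_eqvt PsiN|].
move=> s sa; rewrite dl_aw // n2 subr0 -awB; apply: eq_aw => t v t0 v0 _.
rewrite PhiE // FE dtotB opprD addrA subrr add0r.
have -> : dtot (fun _ _ => 0 : M) t v = 0 by rewrite /dtot !dl_zero // sgn0 addr0.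
by rewrite sub0r.
Qed.

End ThetaFiltration.

Section ThetaIsomorphism.
Context (V : henselian_valuation_ring) (D : strict_data V).
Context (l : nat) (l_pr : prime l) (lW : (l%:R : hvW V) \is a GRing.unit) (nu : nat) (nu0 : (0 < nu)%N).
Local Notation N := (l ^ nu)%N.
Local Notation base := (sd_base D).
Local Notation G := (gal_pgrp (sd_closure D)).
Local Notation Q := (gal_pgrp (kap_sc D)).
Local Notation pi := (@specialize V D : G -> Q).
Context (g : mu N (sdLs D)) (g' : mu N (sdks D)).
Hypotheses (gp : N.-primitive_root (val g)) (gp' : N.-primitive_root (val g')) (gg : compatible g g').
Context (fr : frame D N) (q : int) (a : nat).
Local Notation B := (fr_B fr).
Local Notation M := (tate N base q).
Local Notation X J := (tate N (sd_kap D) (q - #|` J|%:Z)).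
Local Notation Th := (theta_idx fr a).
Local Notation act := (fun s : G => @gm_act _ _ _ _ M s : M -> M).
Local Notation Ar := (@Ar V D l nu fr q).
Local Notation actAr := (@actAr V D l nu fr q).
Local Notation totc := (@totl G Q pi M act).
Implicit Types (f : forall J : {fset B}, seq Q -> X J) (S : seq {fset B}).

Lemma dtot_augl (h : seq G -> M) t s : t <> [::] -> dtot (augl h : seq Q -> seq G -> M) t s = augl (dl h) t s.
Proof.
case: t => [//|x t] _; rewrite /dtot.
have -> : dl (fun u => augl h u s) (x :: t) = 0.
  case: t => [|y [|z t]] /=; rewrite /augl /= ?subr0 ?subrr //.
  by rewrite dl_zero // !subr0.
case: t => [|y t]; first by rewrite add0r.
by rewrite [Z in sgn _ Z]dl_zero // sgn0 addr0.
Qed.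

Lemma augl_tot n (h : seq G -> M) : smooth n h -> eqvt n h -> (forall s, size s != n -> h s = 0) -> h [::] = 0 ->
  totc n.+1 (augl h).
Proof.
move=> hs he hz h0; split=> [t s ts|p m|x t s].
- rewrite /augl; case: eqP => // t1; have [sn|/hz//] := eqVneq (size s) n.
  move: ts; rewrite t1 sn eqxx andbT; case: (t) t1 => //= _ _ _; rewrite negbK => /eqP ->.
  exact: h0.
- have [p1|p1] := eqVneq p 1%N; last first.
    apply: (@eq_jsmooth G Q M p m (fun _ _ => 0)); last exact: jsmooth_cst.
    by move=> t s tp _; rewrite /augl tp (negPf p1).
  have [mn|mn] := eqVneq m n; last first.
    apply: (@eq_jsmooth G Q M p m (fun _ _ => 0)); last exact: jsmooth_cst.
    by move=> t s _ sm; rewrite /augl hz ?sm // if_same.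
  have [v vE] := hs; exists (pg_lev0 Q), v => t t' s s' tp sm tt' ss'.
  by rewrite /augl -(eqvs_size tt') tp p1 eqxx (vE s s') // sm.
- rewrite /augl size_map; case: eqP => _; last by rewrite (linB (gm_act_linear x)).
  have [sn|sn] := eqVneq (size s) n; first exact: he.
  by rewrite !hz ?size_map // (linB (gm_act_linear x)).
Qed.

Lemma aw_size n (Phi : seq Q -> seq G -> M) s : totc n.+1 Phi -> size s != n -> aw pi Phi s = 0.
Proof.
move=> [P _ _] sn; rewrite aw_sum big1 // => k _; apply: P; have ks := ltn_ord k.
rewrite size_map size_takel // size_drop; apply: contra sn => /and3P[_ _ /eqP e].
by rewrite addSn subnKC in e; [case: e => ->|exact: ltnW].
Qed.

(** In total degree [a] the inertia degree is at most [a], so truncating there loses nothing: the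
    augmentation of a cocycle is already a truncated total cocycle. *)
Lemma FHS_top (c : HL D N q a) : c \in FHS (M := M) a a.
Proof.
have [fs fe fd] := rep_cocl (sd_closure D) c; set f := rep c in fs fe fd.
have T : totc a.+2 (augl f) by apply: augl_tot => // s; exact: rep_size.
have -> : c = ccls (ofl a (aw pi (augl f)) : cochain M a).
  by rewrite -{1}(repK (sd_closure D) c); congr ccls; apply: eq_ofl => s _; rewrite aw_augl.
have fd0 s : dl f s = 0.
  have [sa|sa] := eqVneq (size s) a.+2; first exact: fd.
  by apply: dl_zero => u us; apply: rep_size; apply: contra sa; rewrite -us eqSS.
apply: aw_FHS T _ _; last by move=> t s t0 _; rewrite dtot_augl // /augl fd0 if_same.
split=> t s sa; rewrite /augl; case: (size t == 1%N) => //; last by rewrite dl_zero.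
by apply: rep_size; rewrite neq_ltn sa orbT.
Qed.

Lemma dom_le_top (al : theta_dom fr q a) : theta_dom_le fr q a a al.
Proof. by move=> J; rewrite ltnNge (valP J). Qed.

(** If [aw F] is the coboundary of [h], then [F] is the total boundary of [awh F] plus the
    augmentation of [h]. Uniqueness of components then makes each coefficient cocycle a
    coboundary. *)
Lemma theta_inj0 (al : theta_dom fr q a) : theta fr q a al = 0 -> al = 0.
Proof.
have [f [S [fam fz fal]]] := rep_family (dom_le_top al) (leqnn a).
rewrite (theta_family l_pr nu0 gp gp' gg fam _ fz fal) //; set F := fun t s => _.
have cz (r : nat) (ra : (r < a.+1)%N) := family_cocA fam fz (ra : (r <= a)%N).
have [T d] := TT_tot l_pr nu0 gp gp' gg cz.
rewrite -(ccls_ofl0 (sd_closure D) M a) => /(ccls_ofl_eq (aw_cocl T d) (cocl_zero _ _ _)) [h [hs he h0 hE]].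
pose h' s := if size s == a then h s else 0.
have hT : totc a.+1 (augl h').
  apply: augl_tot => [|x s sa|s sa|].
  - by apply: eq_smooth hs => s sa; rewrite /h' sa eqxx.
  - by rewrite /h' size_map sa eqxx; exact: he.
  - by rewrite /h' (negPf sa).
  - by rewrite /h' h0 if_same.
have [n1 n2] := tot_nil T; have dz := dtot_full T d.
pose Psi t s := awh pi F t s + augl h' t s.
have PT : totc a.+1 Psi by apply: tot_add => //; [exact: (@gactB V D N M)|exact: (awh_tot (n := a.+2))].
have [P _ _] := PT.
have Ptr : truncl a.+1 Psi.
  split=> t s sa.
    by apply: P; apply/negP => /and3P[_ _ /eqP e]; move: sa; rewrite -e ltnNge leq_addl.
  apply: dl_zero => u; rewrite sa => -[ua]; apply: P; rewrite ua; apply/negP => /and3P[t0 _].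
  by rewrite -[Z in _ == Z]add0n eqn_add2r size_eq0 (negPf t0).
have FP t s : t <> [::] -> s <> [::] -> F t s = dtot Psi t s.
  move=> t0 s0; rewrite /Psi dtotD dtot_augl //.
  have := awhE pi (Phi := F) (t := t) s t0 n1; rewrite awh_zero // addr0 => ->.
  suff -> : augl (dl h') t s = augl (aw pi F) t s by rewrite subrK.
  rewrite /augl; case: ifP => // _; have [sa|sa] := eqVneq (size s) a.+1.
    by rewrite -[RHS]subr0 hE //; apply: (eq_dl_size sa) => u ua; rewrite /h' ua eqxx.
  rewrite (aw_size T) //; apply: dl_zero => u us; rewrite /h'; case: eqP => // ua.
  by rewrite -us ua eqxx in sa.
have comp := components_trivial l_pr lW nu0 gp gp' gg (n := a.+2) isT PT Ptr cz FP.
apply: dsum_ext => J; rewrite dcoord0 fal; have Ja := valP J.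
have [beta [_ bs b0 be] bE] := comp #|` val J| Ja.
pose JJ : fsubset B #|` val J| := exist _ (val J) (eqxx _).
have aE : (a.+2 - #|` val J|.+1)%N = (a - #|` val J|).+1 by rewrite subSS subSn.
rewrite aE /= in bs bE; rewrite -[RHS](ccls_ofl0 (kap_sc D)).
apply/ccls_ofl_eq; [by apply: fz|exact: cocl_zero|].
exists (fun t => dcoord (beta t) JJ); split.
- exact: (smooth_op1 (fun b : Ar #|` val J| => dcoord b JJ)).
- move=> y t _; have [x <-] := spec_surj y.
  transitivity (dcoord (actAr (pi x) (beta t)) JJ); [by congr (dcoord _ JJ); exact: be|].
  exact: (@actArE V D l nu fr q #|` val J| (pi x) (beta t) JJ).
- by rewrite b0.
- move=> t ta; rewrite subr0 -(dl_morph (u := fun b : Ar #|` val J| => dcoord b JJ)) // -bE //.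
  by rewrite (familyE _ _ fam).
Qed.

Lemma theta_term_lin (J : Th) : linear (@theta_term V D N fr q a J).
Proof.
move=> c x y; have Ja := valP J.
have xz := rep_cocl (kap_sc D) x; have yz := rep_cocl (kap_sc D) y.
rewrite -{1}(repK (kap_sc D) x) -{1}(repK (kap_sc D) y) -ccls_oflP //.
have [-> _] := theta_term_ofl l_pr nu0 gp gp' gg (coclP c xz yz).
rewrite -{2}(repK (kap_sc D) x) -{2}(repK (kap_sc D) y).
have [-> xz'] := theta_term_ofl l_pr nu0 gp gp' gg xz; have [-> yz'] := theta_term_ofl l_pr nu0 gp gp' gg yz.
rewrite -ccls_oflP //; congr ccls; apply: eq_ofl => s sa; rewrite !(aw_TJ (a := a)) //.
exact: (Wt_lin l_pr nu0 gp gp' gg).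
Qed.

Lemma theta_lin : linear (theta fr q a).
Proof.
move=> c x y; have [s _ sE] := dsum_supp x; have [t _ tE] := dsum_supp y.
pose S := undup (s ++ t); have uS : uniq S by exact: undup_uniq.
have xS J : J \notin S -> dcoord x J = 0 by rewrite mem_undup mem_cat => /norP[/sE].
have yS J : J \notin S -> dcoord y J = 0 by rewrite mem_undup mem_cat => /norP[_ /tE].
have z J : @theta_term V D N fr q a J 0 = 0 by rewrite (linB (@theta_term_lin J)).
have thE (w : theta_dom fr q a) : (forall J, J \notin S -> dcoord w J = 0) ->
    theta fr q a w = \sum_(J <- S) theta_term (dcoord w J).
  by move=> wS; apply: fsum_seq => // J /wS ->.
rewrite !thE //; last by move=> J JS; rewrite dcoordP xS // yS // scaler0 addr0.
by rewrite scaler_sumr -big_split; apply: eq_bigr => J _; rewrite dcoordP theta_term_lin.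
Qed.

Lemma theta_bij : bijective (theta fr q a).
Proof.
have inj : injective (theta fr q a).
  by move=> x y e; apply/eqP; rewrite -subr_eq0; apply/eqP/theta_inj0; rewrite (linB theta_lin).1.1.1 e subrr.
have /choice[k kE] : forall c, exists al, theta fr q a al = c.
  by move=> c; have [al _ alE] := FHS_theta l_pr lW nu0 gp gp' gg fr (leqnn a) (FHS_top c); exists al.
by exists k => [x|c]; [apply: inj; rewrite kE|exact: kE].
Qed.

Lemma theta_image r : (r <= a)%N ->
  (theta fr q a @` theta_dom_le fr q a r = [set c | c \in FHS (M := M) a r])%classic.
Proof.
move=> ra; apply/seteqP; split=> [c [al alr <-]|c cr]; first exact: (theta_FHS l_pr nu0 gp gp' gg ra alr).
by have [al alr alE] := FHS_theta l_pr lW nu0 gp gp' gg fr ra cr; exists al.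
Qed.

Lemma dom_le0 : theta_dom0 fr q a = theta_dom_le fr q a 0.
Proof.
by apply/seteqP; split=> al h J; [rewrite cardfs_gt0|rewrite -cardfs_gt0]; exact: h.
Qed.

End ThetaIsomorphism.

(** * The summand of the empty set and inflation *)

Section Casts.
Context (V : henselian_valuation_ring) (D : strict_data V).
Context (l : nat) (l_pr : prime l) (lW : (l%:R : hvW V) \is a GRing.unit) (nu : nat) (nu0 : (0 < nu)%N).
Local Notation N := (l ^ nu)%N.
Local Notation base := (sd_base D).
Local Notation muL := (mumod N base).
Local Notation G := (gal_pgrp (sd_closure D)).
Local Notation Q := (gal_pgrp (kap_sc D)).
Local Notation pi := (@specialize V D : G -> Q).
Context (g : mu N (sdLs D)) (g' : mu N (sdks D)).
Hypotheses (gp : N.-primitive_root (val g)) (gp' : N.-primitive_root (val g')) (gg : compatible g g').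

Definition cast_Hk p n p' n' (e : p = p') (e' : n = n') (x : Hk D N p n) : Hk D N p' n' :=
  eq_rect _ (fun n => Hk D N p' n) (eq_rect _ (fun p => Hk D N p n) x _ e) _ e'.

Lemma cast_Hk_lin p n p' n' (e : p = p') (e' : n = n') : linear (@cast_Hk p n p' n' e e').
Proof. by case: _ / e; case: _ / e'. Qed.

Lemma cast_HkK p n p' n' (e : p = p') (e' : n = n') : cancel (@cast_Hk p n p' n' e e') (cast_Hk (esym e) (esym e')).
Proof. by case: _ / e; case: _ / e'. Qed.

Lemma cast_HkVK p n p' n' (e : p = p') (e' : n = n') : cancel (cast_Hk (esym e) (esym e')) (@cast_Hk p n p' n' e e').
Proof. by case: _ / e; case: _ / e'. Qed.

Lemma inflation_cast p p' (e : p = p') n (f : seq Q -> tate N (sd_kap D) p) : cocl n f ->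
  inflation (eq_rect _ (fun p => Hk D N p n) (ccls (ofl n f)) _ e) =
  ccls (ofl (sc := sd_closure D) (M := tate N base p') n (fun s => eq_rect _ (fun p => twist p muL) (tlift (f (map pi s))) _ e)).
Proof. by case: _ / e => fz; exact: (inflation_ofl l_pr nu0 gp gp' gg fz). Qed.

(** The degree [n] is a variable with a hypothesis [n = 0], because the cardinal of the empty set
    does not reduce to 0; this lets the dependent casts be eliminated by substitution. *)
Lemma cup_unit q n m a (w : 'I_n -> cohom muL 1) (x : Hk D N (q - n%:Z) m) (eq : q - n%:Z = q) (em : m = a) : n = 0%N ->
  @cup _ _ _ _ (tate N base (q - n%:Z)) (tate N base n%:Z) (tate N base q) (@twist_pair _ q n muL) m n a
    (inflation x) (wprod w) = inflation (cast_Hk eq em x).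
Proof.
move=> n0; subst n; subst a; have xz := rep_cocl (kap_sc D) x; rewrite /cast_Hk /=.
rewrite -{2}(repK (kap_sc D) x) (inflation_cast eq xz) -{1}(repK (kap_sc D) x) (inflation_ofl l_pr nu0 gp gp' gg xz).
have e := @cup_oflE V D l nu (tate N base (q - 0%N%:Z)) (tate N base 0%N%:Z) (tate N base q)
  (@twist_pair _ q 0 muL) m 0 m _ _
  (@twist_pair_lin1 _ _ _ _) (@twist_pair_lin2 _ _ _ _) (@twist_pair_equiv V D l nu q _) (addn0 m)
  (pull_cocl l_pr nu0 gp gp' gg xz) (wcup_cocl w).
apply: (etrans e); congr ccls; apply: eq_ofl => s sm; rewrite /cupl take_oversize ?sm //.
rewrite -[LHS]/(eq_rect _ (fun p => twist p muL) ((1 : 'Z_N) *: _) _ (iter_succz q 0)) scale1r.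
by rewrite (eq_irrelevance (iter_succz q 0) eq).
Qed.

Context (fr : frame D N) (q : int) (a : nat).
Local Notation Th := (theta_idx fr a).

Lemma theta_dom0E (al : theta_dom fr q a) : theta_dom0 fr q a al -> theta fr q a al = inflation (theta_coord0 al).
Proof.
move=> al0; have E : theta fr q a al = theta_term (dcoord al (idx0 fr a)).
  rewrite /theta (fsum_seq (s := [:: idx0 fr a])) ?big_seq1 // => J; rewrite inE => J0.
  by rewrite al0 ?(linB (@theta_term_lin V D l l_pr nu nu0 g g' gp gp' gg fr q a J)).
by rewrite E; apply: cup_unit; exact: cardfs0.
Qed.

Lemma dsum_single (I : choiceType) (X : I -> lmodType 'Z_N) (i : I) (x : X i) :
  exists2 f : dsum X, dcoord f i = x & forall j, j != i -> dcoord f j = 0.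
Proof.
pose c j : X j := match @eqP _ i j with ReflectT e => eq_rect i X x j e | ReflectF _ => 0 end.
have cE j : dcoord (dmk c) j = c j.
  apply: (dmkE (s := [:: i])) => k; rewrite inE /c; case: eqP => // e /eqP h.
  by case: (h (esym e)).
exists (dmk c); first by rewrite cE /c; case: eqP => // e; rewrite (eq_irrelevance e erefl).
by move=> j ji; rewrite cE /c; case: eqP => // e; rewrite e eqxx in ji.
Qed.

Lemma inflation_inj : injective (inflation : Hk D N q a -> HL D N q a).
Proof.
move=> x y xy.
have lift (z : Hk D N q a) : exists2 al, theta_dom0 fr q a al & theta_coord0 al = z.
  have [al alE al0] := @dsum_single Th (@theta_summand V D N fr q a) (idx0 fr a)
    (cast_Hk (esym (idx0_twist fr q a)) (esym (idx0_degree fr a)) z).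
  exists al; first by move=> J J0; apply: al0; apply: contra J0 => /eqP ->.
  by rewrite /theta_coord0 alE; exact: cast_HkVK.
have [al al0 alx] := lift x; have [be be0 bey] := lift y.
rewrite -alx -bey; congr theta_coord0; apply: (bij_inj (theta_bij l_pr lW nu0 gp gp' gg fr q a)).
by rewrite !theta_dom0E // alx bey.
Qed.

End Casts.

(** * Graded pieces *)

Section Graded.
Context (R : pzRingType) (U : lmodType R) (A A' : submodClosed U).

Lemma srep_in (u : subquot A A') : srep u \in A. Proof. exact: valP (qrepr u : subm A). Qed.

Lemma scls_eq x y : x \in A -> y \in A -> scls A A' x = scls A A' y <-> x - y \in A'.
Proof.
move=> xA yA; rewrite /scls; split=> [/eqP|h].
  by rewrite qpi_eq -[_ \in _]/(val (insubd (0 : subm A) x) - val (insubd (0 : subm A) y) \in A') !insubdK.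
by apply/eqP; rewrite qpi_eq -[_ \in _]/(val (insubd (0 : subm A) x) - val (insubd (0 : subm A) y) \in A') !insubdK.
Qed.

Lemma srepK (u : subquot A A') : scls A A' (srep u) = u.
Proof. by rewrite /scls /srep valKd qreprK. Qed.

Lemma scls_lin c x y : x \in A -> y \in A -> scls A A' (c *: x + y) = c *: scls A A' x + scls A A' y.
Proof.
move=> xA yA; rewrite /scls -linearP; congr qpi; apply: val_inj.
have sA : c *: x + y \in A by rewrite rpredD ?rpredZ.
rewrite insubdK // -[RHS]/(c *: val (insubd 0 x : subm A) + val (insubd 0 y : subm A)).
by rewrite !insubdK.
Qed.

Lemma srep_lin c (u v : subquot A A') : srep (c *: u + v) - (c *: srep u + srep v) \in A'.
Proof.
apply/scls_eq; [exact: srep_in|by rewrite rpredD ?rpredZ // srep_in|].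
by rewrite srepK scls_lin ?srep_in // !srepK.
Qed.

Lemma srep_scls x : x \in A -> srep (scls A A' x) - x \in A'.
Proof. by move=> xA; apply/scls_eq => //; [exact: srep_in|exact: srepK]. Qed.

Lemma srep0 (u : subquot A A') : srep u \in A' -> u = 0.
Proof.
move=> u0; rewrite -[u]srepK; have e : scls A A' 0 = 0.
  by have := scls_lin (-1) (rpred0 A) (rpred0 A); rewrite scaler0 addr0 scaleN1r addNr.
by rewrite -e; apply/scls_eq; rewrite ?rpred0 ?srep_in ?subr0.
Qed.

End Graded.

Section GradedPieces.
Context (V : henselian_valuation_ring) (D : strict_data V).
Context (l : nat) (l_pr : prime l) (lW : (l%:R : hvW V) \is a GRing.unit) (nu : nat) (nu0 : (0 < nu)%N).
Local Notation N := (l ^ nu)%N.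
Local Notation base := (sd_base D).
Context (g : mu N (sdLs D)) (g' : mu N (sdks D)).
Hypotheses (gp : N.-primitive_root (val g)) (gp' : N.-primitive_root (val g')) (gg : compatible g g').
Context (fr : frame D N) (q : int) (a r : nat) (ra : (r <= a)%N).
Local Notation B := (fr_B fr).
Local Notation M := (tate N base q).
Local Notation Th := (theta_idx fr a).
Local Notation Idx := (fsubset B r).
Local Notation Xr := (Hk D N (q - r%:Z) (a - r)).
Local Notation A := (FHS (M := M) a r).
Local Notation A' := (@FHSpred V D N M a r).
Local Notation theta := (theta fr q a).

Fact fsv_bound (J : Idx) : (#|` fsv J| <= a)%N. Proof. by rewrite card_fsv. Qed.
Definition idx_of (J : Idx) : Th := exist _ (fsv J) (fsv_bound J).

Fact twist_index n : n = r -> q - n%:Z = q - r%:Z. Proof. by move=> ->. Qed.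
Fact degree_index n : n = r -> (a - n)%N = (a - r)%N. Proof. by move=> ->. Qed.

Definition top_coord (J : Idx) (al : theta_dom fr q a) : Xr :=
  cast_Hk (twist_index (card_fsv J)) (degree_index (card_fsv J)) (dcoord al (idx_of J)).

Lemma top_coord_lin (J : Idx) : linear (top_coord J).
Proof. by move=> c x y; rewrite /top_coord dcoordP; exact: cast_Hk_lin. Qed.

Lemma theta_invP : exists k : HL D N q a -> theta_dom fr q a, [/\ cancel theta k, cancel k theta & linear k].
Proof.
have [k kK Kk] := theta_bij l_pr lW nu0 gp gp' gg fr q a; exists k; split=> // c x y.
by apply: (can_inj kK); rewrite (theta_lin l_pr nu0 gp gp' gg) !Kk.
Qed.

Lemma top_coordP (al : theta_dom fr q a) (K : Th) : #|` val K| = r ->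
  exists J : Idx, K = idx_of J /\ (top_coord J al = 0 -> dcoord al K = 0).
Proof.
move=> Kr; have Kr' : #|` val K| == r by rewrite Kr.
exists (exist _ (val K) Kr' : Idx).
have E : K = idx_of (exist _ (val K) Kr' : Idx) by exact: val_inj.
split=> // h; rewrite E.
apply: (can_inj (cast_HkK (twist_index (card_fsv (exist _ (val K) Kr' : Idx))) (degree_index (card_fsv (exist _ (val K) Kr' : Idx))))).
by rewrite [LHS]h (linB (@cast_Hk_lin V D l nu _ _ _ _ _ _)).
Qed.

Lemma theta_le_in (x : HL D N q a) s : (s <= a)%N -> x \in FHS (M := M) a s ->
  exists2 al, theta_dom_le fr q a s al & theta al = x.
Proof. exact: (FHS_theta l_pr lW nu0 gp gp' gg fr). Qed.

(** In terms of [theta], passing to the previous step of the filtration means losing the summands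
    with exactly [r] elements. The case [r = 0] is separate because the step before it is 0 by
    convention. *)
Lemma FHSpredP (al : theta_dom fr q a) : theta_dom_le fr q a r al ->
  theta al \in A' <-> forall J, top_coord J al = 0.
Proof.
move=> alr; have inj := bij_inj (theta_bij l_pr lW nu0 gp gp' gg fr q a).
have theta0 : theta 0 = 0 by rewrite (linB (@theta_lin V D l l_pr nu nu0 g g' gp gp' gg fr q a)).
have zero be J : (forall K : Th, #|` val K| = r -> dcoord be K = 0) -> top_coord J be = 0.
  by move=> h; rewrite /top_coord h ?(linB (@cast_Hk_lin V D l nu _ _ _ _ _ _)) //; exact: card_fsv.
split=> [|h].
  move=> h J; apply: zero => K Kr; case: (r) Kr ra h => [|s] Ks sa.
    by move=> /eqP; rewrite -theta0 => /inj ->.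
  move=> /(theta_le_in (ltnW sa))[be bes /inj <-]; apply: bes.
  by rewrite Ks.
have hz (K : Th) : #|` val K| = r -> dcoord al K = 0 by move=> /(top_coordP al)[J [_ /(_ (h J))]].
case: (r) ra alr hz => [|s] sa als hz.
  have -> : al = 0.
    apply: dsum_ext => K; have [K0|K0] := posnP #|` val K|; first exact: hz.
    exact: als.
  by rewrite theta0; exact: eqxx.
apply: (theta_FHS l_pr nu0 gp gp' gg (ltnW sa)) => K; rewrite leq_eqVlt => /orP[/eqP e|]; last exact: als.
exact: hz.
Qed.

(** Both sides are determined by coordinates indexed by the [r]-element subsets of the basis, the
    top components under the inverse of [theta] on the left and the coordinates of [tensor_coord] on
    the right, and both realize exactly the families of finite support. *)
Lemma graded_iso : exists2 phi : grHS M a r -> tensor (extpow r (modN N (hvGam V))) Xr, linear phi & bijective phi.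
Proof.
have [k [kK Kk kl]] := theta_invP.
pose tup (J : Idx) : r.-tuple B := tcast (card_fsv J) (Tuple (size_sort_fset (fsv J))).
have tupE J : tval (tup J) = sort <=%O (fsv J) by rewrite val_tcast.
have tup_uniq J : uniq (tup J) by rewrite tupE sort_uniq fset_uniq.
have tup_inj J J' : tup J =i tup J' -> J = J'.
  move=> e; apply: val_inj; apply/fsetP => x; have := e x.
  by rewrite -[x \in tup J]/(x \in tval (tup J)) -[x \in tup J']/(x \in tval (tup J')) !tupE !mem_sort.
have tup_surj (t : r.-tuple B) : uniq t -> exists J, perm_eq (tup J) t.
  move=> ut; pose T : {fset B} := [fset x in tval t]%fset.
  have pt : perm_eq (sort <=%O T) t by rewrite uniq_perm ?sort_uniq ?fset_uniq // => x; rewrite mem_sort !inE.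
  have tr : #|` T| == r by rewrite -(size_sort <=%O) (perm_size pt) size_tuple.
  by exists (exist _ T tr : Idx); rewrite tupE.
have [kap [kapl kapE kapS]] := tensor_coord (@fr_basis V D N fr) tup_uniq tup_inj tup_surj Xr.
have kin (x : HL D N q a) : x \in A -> theta_dom_le fr q a r (k x).
  by move=> /(theta_le_in ra)[al alr <-]; rewrite kK.
have diff (x y : HL D N q a) J : x \in A -> y \in A -> x - y \in A' -> top_coord J (k x) = top_coord J (k y).
  move=> xA yA; have xyA : x - y \in A by rewrite rpredB.
  rewrite -{1}(Kk (x - y)) => /(FHSpredP (kin _ xyA))/(_ J); rewrite (linB kl).1.1.1 (linB (@top_coord_lin J)).1.1.1 => /eqP.
  by rewrite subr_eq0 => /eqP.
apply: (@lin_transfer _ _ _ _ Idx (fun J u => top_coord J (k (srep u))) (fun J w => kap J w)).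
- move=> J c u v; rewrite -top_coord_lin -kl; apply: diff; [exact: srep_in|by rewrite rpredD ?rpredZ ?srep_in|exact: srep_lin].
- exact: kapl.
- move=> u u0; apply: srep0; rewrite -(Kk (srep u)); apply/FHSpredP => //.
  exact/kin/srep_in.
- by move=> w w0; have [s [_ _ ->]] := kapS w; apply: big1 => J _; rewrite w0 (linB (@tens_linr _ _ _ _)).
- move=> u; have [s us sE] := dsum_supp (k (srep u)).
  pose S : seq Idx := pmap (insub : {fset B} -> option Idx) (map val s).
  have uS : uniq S by rewrite pmap_sub_uniq // map_inj_uniq //; exact: val_inj.
  exists (\sum_(J <- S) tens (wbasis (@fr_e V D N fr) tup J) (top_coord J (k (srep u)))) => J.
  rewrite (lin_sum _ _ (kapl J)); under eq_bigr => K _ do rewrite kapE.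
  have [JS|JS] := boolP (J \in S).
    by rewrite (bigD1_seq J) //= eqxx scale1r big1 ?addr0 // => K /negPf ->; rewrite scale0r.
  rewrite big_seq big1 => [|K KS]; last by case: eqP => [e|_]; [rewrite -e KS in JS|rewrite scale0r].
  rewrite /top_coord sE ?(linB (@cast_Hk_lin V D l nu _ _ _ _ _ _)) //.
  apply: contra JS => JS; rewrite mem_pmap; apply/mapP; exists (fsv J); last by rewrite valK.
  exact: (map_f val JS).
move=> w; have [s [us sE _]] := kapS w.
pose c (K : Th) : theta_summand q K := match pselect (#|` val K| = r) with
  | left e => cast_Hk (esym (twist_index e)) (esym (degree_index e)) (kap (exist _ (val K) (introT eqP e) : Idx) w)
  | right _ => 0 end.
have cE (K : Th) : dcoord (dmk c : theta_dom fr q a) K = c K.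
  apply: (dmkE (s := map idx_of s)) => K' Ks; rewrite /c; case: pselect => // e.
  rewrite sE ?(linB (@cast_Hk_lin V D l nu _ _ _ _ _ _)) //; apply: contra Ks => Ks.
  by apply/mapP; exists (exist _ (val K') (introT eqP e) : Idx) => //; exact: val_inj.
have alr : theta_dom_le fr q a r (dmk c).
  by move=> K rK; rewrite cE /c; case: pselect => // e; rewrite e ltnn in rK.
have tA := theta_FHS l_pr nu0 gp gp' gg ra alr.
exists (scls A A' (theta (dmk c))) => J.
rewrite (diff _ (theta (dmk c))) ?srep_in //; last exact: srep_scls.
rewrite kK /top_coord cE /c /=; case: pselect => [e|h]; last by case: h; exact: card_fsv.
rewrite (eq_irrelevance (twist_index (card_fsv J)) (twist_index e)) (eq_irrelevance (degree_index (card_fsv J)) (degree_index e)).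
rewrite cast_HkVK; congr (kap _ w); exact: val_inj.
Qed.

End GradedPieces.

Local Open Scope classical_set_scope.

Theorem theorem4p4 (V : henselian_valuation_ring) (D : strict_data V)
    (l nu N : nat) (hl : prime l) (hnu : (1 <= nu)%N) (hN : N = (l ^ nu)%N)
    (hinv : (N%:R : hvW V) \is a GRing.unit)
    (a : nat) (q : int) (fr : frame D N) :
  [/\ linear (theta fr q a) /\ bijective (theta fr q a),
      forall r, (r <= a)%N ->
        set_bij (theta_dom_le fr q a r)
          [set c | c \in FHS (M := tate N (sd_base D) q) a r] (theta fr q a),
      forall r, (r <= a)%N -> forall fr' : frame D N,
        theta fr q a @` theta_dom_le fr q a r =
        theta fr' q a @` theta_dom_le fr' q a r,
      forall r, (r <= a)%N ->
        exists2 phi : grHS (tate N (sd_base D) q) a r ->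
            tensor (extpow r (modN N (hvGam V))) (Hk D N (q - r%:Z) (a - r)),
          linear phi & bijective phi
    & [/\ theta fr q a @` theta_dom0 fr q a =
            [set c | c \in FHS (M := tate N (sd_base D) q) a 0],
          forall al, theta_dom0 fr q a al -> theta fr q a al = inflation (theta_coord0 al)
        & injective (inflation : Hk D N q a -> HL D N q a)]].
Proof.
subst N; have lW : (l%:R : hvW V) \is a GRing.unit by move: hinv; rewrite natrX unitrX_pos.
have [g [g' [gp gp' gg]]] := mu_gens D hl lW hnu.
have image (fr' : frame D (l ^ nu)) r (ra : (r <= a)%N) := theta_image hl lW hnu gp gp' gg fr' q ra.
have bij := theta_bij hl lW hnu gp gp' gg fr q a.
split.
- by split; [exact: (theta_lin hl hnu gp gp' gg)|exact: bij].
- move=> r ra; have e := image fr r ra; split; first by move=> al alr; rewrite -e; exists al.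
    by move=> x y _ _; exact: bij_inj.
  by move=> c; rewrite -e.
(* Both images are the same step of the filtration, whose definition does not involve a frame. *)
- by move=> r ra fr'; rewrite !image.
- by move=> r ra; exact: (graded_iso hl lW hnu gp gp' gg fr q ra).
split; [by rewrite dom_le0 image|exact: (theta_dom0E hl hnu gp gp' gg)|].
exact: (inflation_inj hl lW hnu gp gp' gg fr).
Qed.
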